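(* Let $\mathcal{F}$ be the singular holomorphic foliation on a neighborhood of $0\in\mathbb{C}^n$ associated to a holomorphic vector field $X$ with an isolated singularity at the origin. Let $\lambda_1,\dots,\lambda_n$ be the eigenvalues of the linear part $DX(0)$. Suppose that: (i) the linear part of $X$ at the origin has determinant different from zero and belongs to the Siegel domain; (ii) the eigenvalues $\lambda_1,\dots,\lambda_n$ are all different from zero and there exists a straight line through the origin in the complex plane separating $\lambda_1$ from the remaining eigenvalues; (iii) up to a change of coordinates, $X=\sum_{i=1}^n\lambda_i x_i(1+f_i(x))\,\partial/\partial x_i$, where $x=(x_1,\dots,x_n)$ and $f_i(0)=0$ for all $i$; (iv) for each separatrix of $\mathcal{F}$, the associated holonomy map $h$ has finite orbits and is such that, for every element $g$ of the cyclic pseudogroup generated by $h$ and every $p$ in the domain of $g$ with $g(p)=p$, either $p$ is an isolated fixed point of $g$ or $g$ coincides with the identity on a neighborhood of $p$. Then $\mathcal{F}$ admits $n-1$ independent holomorphic first integrals.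
   Context: The linear part is in the Siegel domain if $0\in\mathbb{C}$ belongs to the convex hull of $\{\lambda_1,\dots,\lambda_n\}$. A line separates $\lambda_1$ from the others if $\lambda_1$ and the remaining eigenvalues lie in different open half-planes determined by the line. The functions $f_i$ are holomorphic near the origin. A separatrix of $\mathcal{F}$ is an irreducible germ of analytic curve $S$ through the origin invariant by $\mathcal{F}$. The holonomy map associated to $S$ is the germ $h\in\mathrm{Diff}(\mathbb{C}^{n-1},0)$ obtained by lifting to the leaves of $\mathcal{F}$ a loop generating the local fundamental group of $S\setminus\{0\}$, read on a local transverse section (identified with $(\mathbb{C}^{n-1},0)$) at a point of $S\setminus\{0\}$. Here $\mathrm{Diff}(\mathbb{C}^{m},0)$ is the group of germs of holomorphic diffeomorphisms of $\mathbb{C}^m$ fixing $0$. For $h\in\mathrm{Diff}(\mathbb{C}^{m},0)$ and a small open neighborhood $V$ of $0$ on which $h^{\pm1}$ are defined and injective, the cyclic pseudogroup generated by $h$ on $V$ consists of the compositions $F_s\circ\cdots\circ F_1$, $F_i\in\{h,h^{-1}\}$, with domain the set of $x\in V$ with $F_l\circ\cdots\circ F_1(x)\in V$ for all $1\le l<s$. The orbit of $p\in V$ is the set of images in $V$ of $p$ under those elements whose domain contains $p$. The map $h$ has finite orbits if for some such sufficiently small $V$ the orbit of every $p\in V$ is finite. A holomorphic first integral of $\mathcal{F}$ is a holomorphic function $f$ near $0$ with $df(X)=0$; first integrals $f_1,\dots,f_{n-1}$ are independent if $df_1\wedge\cdots\wedge df_{n-1}$ is not identically zero. *)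

(* Defs.v *)
From HB Require Import structures.
From mathcomp Require Import all_boot all_order all_algebra.
From mathcomp Require Import complex.
From mathcomp Require Import all_classical all_reals all_analysis.

Set Implicit Arguments.
Unset Strict Implicit.
Unset Printing Implicit Defensive.

Import Order.TTheory GRing.Theory Num.Theory numFieldNormedType.Exports.

Local Open Scope classical_set_scope.
Local Open Scope ring_scope.

(* The complex numbers over R. Packing R[i] as a numClosedFieldType gives it the
   topology and the normed-module structure that MathComp-Analysis puts on any
   numFieldType; [differentiable], ['d] and ['J] below are then complex
   (C-linear) Frechet differentiability, differential and Jacobian matrix. *)
Definition Cx (R : realType) : numClosedFieldType := R[i].

Section Germs.
Variable R : realType.
Local Notation C := (Cx R).

(* Germs are given by total functions (or sets), of which only the behaviour on
   a neighbourhood of the base point is ever used. *)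
Definition holomorphic_at (V W : normedModType C) (f : V -> W) (p : V) : Prop :=
  \forall x \near p, differentiable f x.

Definition holomorphic_on (V W : normedModType C) (U : set V) (f : V -> W) : Prop :=
  forall x, U x -> differentiable f x.

Definition inverse_germs n (h k : 'rV[C]_n -> 'rV[C]_n) : Prop :=
  [/\ holomorphic_at h 0 /\ h 0 = 0, holomorphic_at k 0 /\ k 0 = 0,
      \forall x \near (0 : 'rV[C]_n), k (h x) = x
    & \forall x \near (0 : 'rV[C]_n), h (k x) = x].

(* membership in Diff(C^n, 0) *)
Definition diffeo_germ n (h : 'rV[C]_n -> 'rV[C]_n) : Prop :=
  exists k, inverse_germs h k.

(* The germ at p of the set S is analytic: near p it is the common zero locus of
   finitely many holomorphic functions, the coordinates of g. *)
Definition analytic_at n (S : set 'rV[C]_n) (p : 'rV[C]_n) : Prop :=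
  exists k (g : 'rV[C]_n -> 'rV[C]_k),
    holomorphic_at g p /\ \forall x \near p, S x <-> g x = 0.

Definition same_germ n (S T : set 'rV[C]_n) (p : 'rV[C]_n) : Prop :=
  \forall x \near p, S x <-> T x.

Definition irreducible_at n (S : set 'rV[C]_n) (p : 'rV[C]_n) : Prop :=
  forall A B, analytic_at A p -> analytic_at B p ->
    same_germ S (A `|` B) p -> same_germ S A p \/ same_germ S B p.

(* g is a submersion at p onto C^m and S = {g = 0} near p: near p, S is a
   complex submanifold of dimension one, with tangent line ker dg(p) at p. *)
Definition smooth_curve_equation m (S : set 'rV[C]_m.+1) (p : 'rV[C]_m.+1)
    (g : 'rV[C]_m.+1 -> 'rV[C]_m) : Prop :=
  [/\ holomorphic_at g p, \rank ('J g p) = m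
    & \forall x \near p, S x <-> g x = 0].

End Germs.

Section Loops.
Variables (R : realType) (T : topologicalType).
Implicit Types (A : set T) (c d : R -> T).

Definition is_loop A c : Prop :=
  [/\ {within `[0, 1], continuous c}, c 0 = c 1
    & forall t : R, t \in `[0, 1] -> A (c t)].

(* homotopy of loops with fixed base point c 0, inside A *)
Definition loop_homotopic A c d : Prop :=
  exists H : R * R -> T,
    [/\ {within `[0, 1] `*` `[0, 1], continuous H},
        (forall s t : R, s \in `[0, 1] -> t \in `[0, 1] -> A (H (s, t))),
        (forall t : R, t \in `[0, 1] -> H (0, t) = c t /\ H (1, t) = d t)
      & (forall s : R, s \in `[0, 1] -> H (s, 0) = c 0 /\ H (s, 1) = c 0)].

(* The loop c run k times (backwards if k < 0): t |-> c(fractional part of k t).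
   It represents the k-th power of the class of c in the fundamental group. *)
Definition loop_power c (k : int) : R -> T :=
  fun t => c (k%:~R * t - (Num.floor (k%:~R * t))%:~R).

(* the class of c generates the fundamental group of A at the base point c 0 *)
Definition generating_loop A c : Prop :=
  is_loop A c /\
  forall d, is_loop A d -> d 0 = c 0 -> exists k, loop_homotopic A d (loop_power c k).

End Loops.

Section Foliation.
Variable R : realType.
Local Notation C := (Cx R).

Definition isolated_singularity n (X : 'rV[C]_n -> 'rV[C]_n) : Prop :=
  X 0 = 0 /\ \forall x \near (0 : 'rV[C]_n)^', X x != 0.

(* 0 is a convex combination of the lambda_i; in C the order relation 0 <= t
   says that t is a nonnegative real. *)
Definition in_Siegel_domain n (lambda : 'I_n -> C) : Prop :=
  exists t : 'I_n -> C,
    [/\ forall i, 0 <= t i, \sum_i t i = 1 & \sum_i t i * lambda i = 0].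

(* The line is R w, and its two sides are given by the sign of Im(z w^* );
   replacing w by - w exchanges them, so fixing the side of lambda_1 is
   harmless. lambda_1 is the entry of index 0. *)
Definition line_separates_first m (lambda : 'I_m.+1 -> C) : Prop :=
  exists w : C, [/\ w != 0, 0 < 'Im (lambda ord0 * w^*)
                  & forall i : 'I_m.+1, i != ord0 -> 'Im (lambda i * w^*) < 0].

(* In the coordinates y = Phi(x), X is sum_i lambda_i y_i (1 + f_i(y)) d/dy_i. *)
Definition normal_form_up_to_coordinates n (X : 'rV[C]_n -> 'rV[C]_n)
    (lambda : 'I_n -> C) : Prop :=
  exists (Phi : 'rV[C]_n -> 'rV[C]_n) (f : 'I_n -> 'rV[C]_n -> C),
    [/\ diffeo_germ Phi,
        forall i, holomorphic_at (f i) 0 /\ f i 0 = 0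
      & \forall x \near (0 : 'rV[C]_n),
          'd Phi x (X x) =
          \row_i (lambda i * Phi x ord0 i * (1 + f i (Phi x)))].

(* S is a representative, closed analytic in the open neighbourhood U of 0, of a
   separatrix of the foliation defined by X: its germ at 0 is irreducible and of
   dimension one (off 0, S is a one-dimensional submanifold accumulating at 0),
   and it is invariant (X is tangent to S). *)
Definition separatrix m (X : 'rV[C]_m.+1 -> 'rV[C]_m.+1)
    (U S : set 'rV[C]_m.+1) : Prop :=
  [/\ [/\ open U, U 0, holomorphic_on U X & forall x, U x -> x != 0 -> X x != 0],
      [/\ S `<=` U, S 0 & forall p, U p -> analytic_at S p],
      irreducible_at S 0 /\ limit_point S 0,
      forall p, S p -> p != 0 -> exists g, smooth_curve_equation S p g
    & forall p g, S p -> p != 0 -> smooth_curve_equation S p g ->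
        'd g p (X p) = 0].

(* S is homeomorphic to the unit disc, by a homeomorphism fixing the origin.
   Every irreducible germ of curve has arbitrarily small such representatives,
   inclusions between them induce isomorphisms on the fundamental groups of the
   sets S \ {0}, and this group is the local fundamental group of S \ {0}. *)
Definition disc_representative m (S : set 'rV[C]_m.+1) : Prop :=
  exists (phi : C -> 'rV[C]_m.+1) (psi : 'rV[C]_m.+1 -> C),
    [/\ {within ball (0 : C) 1, continuous phi}, {within S, continuous psi},
        phi 0 = 0,
        forall z : C, ball (0 : C) 1 z -> S (phi z) /\ psi (phi z) = z
      & forall x, S x -> ball (0 : C) 1 (psi x) /\ phi (psi x) = x].

(* The path delta (on [0, 1]) stays in U and is a continuous path in a leaf, for
   the topology of the leaf: around each time t0 it is u o tau, where u is a
   holomorphic integral curve of X through delta(t0), i.e. a local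
   parametrization of the leaf by complex time, and tau is continuous. *)
Definition leafwise_path n (X : 'rV[C]_n -> 'rV[C]_n) (U : set 'rV[C]_n)
    (delta : R -> 'rV[C]_n) : Prop :=
  forall t0 : R, t0 \in `[0, 1] ->
    exists (r : C) (u : C -> 'rV[C]_n) (e : R) (tau : R -> C),
      [/\ 0 < r /\ 0 < e,
          u 0 = delta t0,
          forall z : C, ball (0 : C) r z -> U (u z) /\ is_derive z (1 : C) u (X (u z)),
          {within `[0, 1] `&` ball t0 e, continuous tau} /\ tau t0 = 0
        & forall t : R, t \in `[0, 1] -> ball t0 e t ->
            ball (0 : C) r (tau t) /\ delta t = u (tau t)].

(* a germ at p of section transverse to the foliation, identified with (C^m, 0)
   through the embedding sigma *)
Definition transverse_section m (X : 'rV[C]_m.+1 -> 'rV[C]_m.+1)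
    (p : 'rV[C]_m.+1) (sigma : 'rV[C]_m -> 'rV[C]_m.+1) : Prop :=
  [/\ holomorphic_at sigma 0, sigma 0 = p,
      injective ('d sigma (0 : 'rV[C]_m)) &
      ~ range ('d sigma (0 : 'rV[C]_m)) (X p)].

(* h in Diff(C^m, 0) is the holonomy along the loop c, read on the section
   sigma: the loop is lifted to a continuous family of leafwise paths, the one
   of parameter z going from sigma(z) to sigma(h(z)). *)
Definition holonomy_along m (X : 'rV[C]_m.+1 -> 'rV[C]_m.+1)
    (U : set 'rV[C]_m.+1) (c : R -> 'rV[C]_m.+1)
    (sigma : 'rV[C]_m -> 'rV[C]_m.+1) (h : 'rV[C]_m -> 'rV[C]_m) : Prop :=
  diffeo_germ h /\
  exists (V : set 'rV[C]_m) (Gamma : R * 'rV[C]_m -> 'rV[C]_m.+1),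
    [/\ open V /\ V 0,
        {within `[0, 1] `*` V, continuous Gamma},
        forall t : R, t \in `[0, 1] -> Gamma (t, 0) = c t,
        forall z, V z -> Gamma (0, z) = sigma z /\ Gamma (1, z) = sigma (h z)
      & forall z, V z -> leafwise_path X U (fun t => Gamma (t, z))].

(* h is the holonomy map of the separatrix S, for some choice of the loop
   generating the local fundamental group and of the transverse section. *)
Definition separatrix_holonomy m (X : 'rV[C]_m.+1 -> 'rV[C]_m.+1)
    (U S : set 'rV[C]_m.+1) (h : 'rV[C]_m -> 'rV[C]_m) : Prop :=
  [/\ separatrix X U S, disc_representative S
    & exists (c : R -> 'rV[C]_m.+1) (sigma : 'rV[C]_m -> 'rV[C]_m.+1),
        [/\ generating_loop (S `\ 0) c,
            transverse_section X (c 0) sigma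
          & holonomy_along X U c sigma h]].

Definition first_integral n (X : 'rV[C]_n -> 'rV[C]_n) (f : 'rV[C]_n -> C) : Prop :=
  holomorphic_at f 0 /\ \forall x \near (0 : 'rV[C]_n), 'd f x (X x) = 0.

(* (df_1 /\ ... /\ df_m)_x (v_1, ..., v_m) *)
Definition wedge_differentials n m (f : 'I_m -> 'rV[C]_n -> C) (x : 'rV[C]_n)
    (v : 'I_m -> 'rV[C]_n) : C :=
  \det (\matrix_(i, j) 'd (f i) x (v j)).

Definition independent_first_integrals n m (X : 'rV[C]_n -> 'rV[C]_n)
    (f : 'I_m -> 'rV[C]_n -> C) : Prop :=
  (forall i, first_integral X (f i)) /\
  ~ (\forall x \near (0 : 'rV[C]_n), forall v, wedge_differentials f x v = 0).

End Foliation.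

Section Pseudogroup.
Variables (R : realType) (m : nat).
Local Notation C := (Cx R).
Implicit Types (h k : 'rV[C]_m -> 'rV[C]_m) (V : set 'rV[C]_m).

(* V is a neighbourhood of 0 on which h and k = h^-1 are both defined and
   injective. *)
Definition pseudogroup_domain h k V : Prop :=
  [/\ open V /\ V 0,
      inverse_germs h k,
      holomorphic_on V h /\ holomorphic_on V k,
      {in V &, injective h} /\ {in V &, injective k}
    & (forall x, V x -> V (h x) -> k (h x) = x) /\
      (forall x, V x -> V (k x) -> h (k x) = x)].

(* The word w = [:: b_1; ...; b_s] stands for F_s o ... o F_1, where F_i is h if
   b_i = true and k = h^-1 otherwise (the empty word is the identity of V). *)
Definition word_map h k (w : seq bool) (x : 'rV[C]_m) : 'rV[C]_m :=
  foldl (fun y b => if b then h y else k y) x w.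

Definition word_dom h k V (w : seq bool) : set 'rV[C]_m :=
  [set x | V x /\ forall l, (1 <= l < size w)%N -> V (word_map h k (take l w) x)].

Definition pseudo_orbit h k V (p : 'rV[C]_m) : set 'rV[C]_m :=
  [set y | V y /\ exists w, word_dom h k V w p /\ y = word_map h k w p].

Definition finite_orbits_on h k V : Prop :=
  forall p, V p -> finite_set (pseudo_orbit h k V p).

Definition isolated_fixed_point h k V (w : seq bool) (p : 'rV[C]_m) : Prop :=
  \forall x \near p, word_dom h k V w x -> word_map h k w x = x -> x = p.

Definition fixed_points_isolated_or_identity_on h k V : Prop :=
  forall w p, word_dom h k V w p -> word_map h k w p = p ->
    isolated_fixed_point h k V w p \/ \forall x \near p, word_map h k w x = x.

(* Both properties pass from V to smaller neighbourhoods of 0, so asking them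
   for one V is the same as asking them for all sufficiently small V. *)
Definition finite_orbits_and_isolated_fixed_points h : Prop :=
  exists k V, [/\ pseudogroup_domain h k V, finite_orbits_on h k V
                & fixed_points_isolated_or_identity_on h k V].

End Pseudogroup.

(* Main.v *)
Require Import Defs.
From HB Require Import structures.
From mathcomp Require Import all_boot all_order all_algebra.
From mathcomp Require Import complex.
From mathcomp Require Import all_classical all_reals all_analysis.
From mathcomp Require Import ring lra zify.
Import Order.TTheory GRing.Theory Num.Theory numFieldNormedType.Exports.
Local Open Scope classical_set_scope.
Local Open Scope ring_scope.

(** Divide X by the factor of its first component: in suitable coordinates the
    foliation is given by a field Y with components a_j y_j (1 + g_j(y)), where
    a_0 = 1 and g_0 = 0. Its flow multiplies the coordinate of index 0 by the
    exponential of time, so the time 2 pi i maps the section y_0 = rho to itself.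

    The axis of y_0 is a separatrix ([curve_separatrix]), the circle of radius
    rho in it generates its fundamental group ([base_generates]), and lifting the
    circle to the leaves shows that its holonomy is the time 2 pi i of the flow on
    the section ([holonomy_realized]). So this return map h has finite orbits, and
    its periodic points are isolated or have a neighbourhood of periodic points
    of the same period. Then h has finite order ([finite_orbits_periodic]): there
    are uncountably many periodic points, they cannot all be isolated, and the
    identity theorem brings the identity h^N = 1 from one of them to the origin.

    A map of finite order that preserves the coordinate hyperplanes is linearized
    by averages psi_k, which are eigenfunctions of composition with h
    ([average_mult]) with the same differentials at 0 as the coordinates
    ([average_der]); their powers with exponents multiple of N are invariant. It remains to extend such an invariant
    function G from the section to a neighbourhood of the origin, constantly along
    the leaves. The line that separates the eigenvalues provides directions of
    complex time in which y_0 expands and all other coordinates contract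
    ([separating_direction]); they form a convex cone. Flow a point along a time nu
    of the cone that leads to the section, and evaluate G there: two such times
    differ by whole turns, between which the cone is convex, so the value is well
    defined by invariance of G ([valid_indep]). The result is holomorphic where
    y_0 is not 0, and constant along the flow. Near y_0 = 0 the time is long and
    the contraction strong: if G vanishes to a high order at 0, the extension is
    O(|y_0|^2) ([integral_bound]), hence holomorphic with zero differential on the
    hyperplane ([integral_zero]).

    The m integrals obtained from the psi_k are independent: on a slice y_0 = q
    they are powers of the psi_k composed with the transport to the section, whose
    differential at 0 is diagonal, and invertible because no coordinate shrinks
    faster than exponentially along the flow ([flow_lower],
    [coordinate_integrals]).

    The analysis behind this is developed from complex differentiability: Cauchy's
    theorem on rectangles gives the mean value inequality [center_le_circle], from
    which follow Cauchy's estimates, second order remainders with uniform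
    constants, Weierstrass' theorem on limits, the passage from complex lines to
    several variables ([gateaux_frechet]) and the identity theorem
    ([identity_connected]). Flows in complex time are limits of Euler polygons,
    whose holomorphy in time and space is immediate ([flow_holo]); all estimates
    of the flow are first proved for the polygons. *)
Set Implicit Arguments.
Unset Strict Implicit.
Unset Printing Implicit Defensive.

(** * The modulus as a real number *)

Section RealModulus.
Variable R : realType.
Local Notation C := (Cx R).

(** The norms of normed modules over C take their values in C. Real parts of
    norms lose nothing, and turn all estimates into inequalities between reals,
    where linear arithmetic applies. *)
Definition nrm (V : normedModType C) (x : V) : R := complex.Re `|x|.

Definition toC (r : R) : C := (r%:C)%C.

Lemma toC_le (a b : R) : (toC a <= toC b) = (a <= b).
Proof. exact: lecR. Qed.

Lemma toC_lt (a b : R) : (toC a < toC b) = (a < b).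
Proof. exact: ltcR. Qed.

Lemma toCD a b : toC (a + b) = toC a + toC b.
Proof. by rewrite /toC; apply/eqP; rewrite eq_complex /= addr0 !eqxx. Qed.

Lemma toCM a b : toC (a * b) = toC a * toC b.
Proof. by apply/eqP; rewrite eq_complex /= !mulr0 !mul0r subr0 addr0 !eqxx. Qed.

Lemma toC_inj : injective toC.
Proof. by move=> a b []. Qed.

Lemma nrmE (V : normedModType C) (x : V) : `|x| = toC (nrm x).
Proof.
have := normr_ge0 x; rewrite /nrm /toC; case: (`|x|) => a b.
by rewrite lecE /= => /andP[/eqP -> _].
Qed.

Lemma pos_toC (e : C) : 0 < e -> exists2 d : R, 0 < d & e = toC d.
Proof.
case: e => a b; rewrite ltcE /= => /andP[/eqP -> a0]; by exists a.
Qed.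

Section NormedModule.
Variable V : normedModType C.
Implicit Types x y : V.

Lemma nrm_ge0 x : 0 <= nrm x.
Proof. by rewrite -toC_le -nrmE normr_ge0. Qed.

Lemma nrm0 : nrm (0 : V) = 0.
Proof. by rewrite /nrm normr0. Qed.

Lemma nrm_eq0 x : (nrm x == 0) = (x == 0).
Proof. by rewrite -[RHS]normr_eq0 nrmE -(inj_eq toC_inj). Qed.

Lemma nrm_gt0 x : (0 < nrm x) = (x != 0).
Proof. by rewrite lt_neqAle nrm_ge0 andbT eq_sym nrm_eq0. Qed.

Lemma nrmN x : nrm (- x) = nrm x.
Proof. by rewrite /nrm normrN. Qed.

Lemma nrmB x y : nrm (x - y) = nrm (y - x).
Proof. by rewrite /nrm distrC. Qed.

Lemma nrm_triD x y : nrm (x + y) <= nrm x + nrm y.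
Proof. by rewrite -toC_le toCD -!nrmE ler_normD. Qed.

Lemma nrm_triB x y : nrm (x - y) <= nrm x + nrm y.
Proof. by rewrite -[nrm y]nrmN; exact: nrm_triD. Qed.

Lemma nrm_tri z x y : nrm (x - y) <= nrm (x - z) + nrm (z - y).
Proof. by have -> : x - y = (x - z) + (z - y); [rewrite addrA subrK | exact: nrm_triD]. Qed.

Lemma nrm_subl x y : nrm x - nrm y <= nrm (x - y).
Proof. by rewrite lerBlDr; have := nrm_triD (x - y) y; rewrite subrK. Qed.

Lemma nrmZ (a : C) x : nrm (a *: x) = nrm a * nrm x.
Proof. by apply: toC_inj; rewrite toCM -!nrmE normrZ. Qed.

Lemma nrm_sum (I : Type) (s : seq I) (P : pred I) (F : I -> V) :
  nrm (\sum_(i <- s | P i) F i) <= \sum_(i <- s | P i) nrm (F i).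
Proof.
elim/big_ind2: _ => [|u u' v v' H1 H2|//]; first by rewrite nrm0.
exact: le_trans (nrm_triD _ _) (lerD H1 H2).
Qed.

(** The quantified radius is a real number, whereas the balls of the topology of
    a module over C have radii in C. *)
Lemma nearP (x : V) (P : V -> Prop) :
  (\forall y \near x, P y) <->
  (exists2 e : R, 0 < e & forall y, nrm (y - x) < e -> P y).
Proof.
split.
  move/nbhs_normP => [e /= e0 H]; have [d d0 ed] := pos_toC e0.
  by exists d => // y yd; apply: H => /=; rewrite distrC nrmE ed toC_lt.
move=> [e e0 H]; apply/nbhs_normP; exists (toC e); first by rewrite /= (_ : 0 = toC 0)// toC_lt.
by move=> y /=; rewrite distrC nrmE toC_lt; exact: H.
Qed.

End NormedModule.

Lemma nrmM (a b : C) : nrm (a * b) = nrm a * nrm b.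
Proof. exact: (@nrmZ C). Qed.

Lemma nrm1 : nrm (1 : C) = 1.
Proof. by rewrite /nrm normr1. Qed.

Lemma nrmV (a : C) : nrm a^-1 = (nrm a)^-1.
Proof.
have [->|a0] := eqVneq a 0; first by rewrite invr0 nrm0 invr0.
have n0 : nrm a != 0 by rewrite nrm_eq0.
by apply: (mulfI n0); rewrite -nrmM divff// divff// nrm1.
Qed.

Lemma nrmX (a : C) n : nrm (a ^+ n) = nrm a ^+ n.
Proof. by elim: n => [|n IH]; rewrite ?expr0 ?nrm1// !exprS nrmM IH. Qed.

Lemma nrm_toC (a : R) : nrm (toC a) = `|a|.
Proof.
apply: toC_inj; rewrite -nrmE /toC normc_def /= expr0n addr0 sqrtr_sqr.
by [].
Qed.

Lemma nrm_sqr (z : C) : nrm z ^+ 2 = complex.Re z ^+ 2 + complex.Im z ^+ 2.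
Proof. by case: z => a b; rewrite /nrm normc_def /= sqr_sqrtr// addr_ge0// sqr_ge0. Qed.

Lemma nrm_Re (z : C) : `|complex.Re z| <= nrm z.
Proof.
rewrite -[nrm z]ger0_norm ?nrm_ge0// -ler_sqr ?nnegrE// !real_normK ?num_real//.
by rewrite nrm_sqr lerDl sqr_ge0.
Qed.

Lemma nrm_Im (z : C) : `|complex.Im z| <= nrm z.
Proof.
rewrite -[nrm z]ger0_norm ?nrm_ge0// -ler_sqr ?nnegrE// !real_normK ?num_real//.
by rewrite nrm_sqr lerDr sqr_ge0.
Qed.

Definition Ci : C := ('i)%C.

Lemma ReIm (z : C) : z = toC (complex.Re z) + Ci * toC (complex.Im z).
Proof. 
by case: z => a b; apply/eqP; rewrite eq_complex /= !mulr0 !mul0r !mul1r subrr addr0 !add0r !eqxx.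
Qed.

Lemma nrm_i : nrm Ci = 1.
Proof. by rewrite /nrm normc_def /= expr0n expr1n add0r sqrtr1. Qed.

Lemma nrm_le_ReIm (z : C) : nrm z <= `|complex.Re z| + `|complex.Im z|.
Proof. by rewrite {1}(ReIm z); apply: le_trans (nrm_triD _ _) _; rewrite nrmM nrm_i mul1r !nrm_toC. Qed.

Lemma nrm_nat n : nrm (n%:R : C) = n%:R.
Proof. by rewrite /nrm normr_nat -raddfMn. Qed.

Lemma nrm_coord m n (x : 'M[C]_(m, n)) i j : nrm (x i j) <= nrm x.
Proof.
rewrite -toC_le -!nrmE [leRHS]mx_normE.
have -> : `|x i j| = (`|x (i, j).1 (i, j).2|%:nng)%:num by [].
exact: (le_bigmax _ (fun k : 'I_m * 'I_n => `|x k.1 k.2|%:nng)).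
Qed.

(** The norm of a row is the largest modulus of its entries. *)
Lemma nrm_row_le n (x : 'rV[C]_n) (e : R) : 0 <= e ->
  (forall i, nrm (x 0 i) <= e) -> nrm x <= e.
Proof.
move=> e0 H; have [/eqP x0|] := eqVneq (mx_norm x) 0.
  by rewrite /nrm [`|x|](eqP x0).
move=> /mx_norm_neq0[[i j] /= xE].
rewrite -toC_le -nrmE [`|x|]xE nrmE toC_le (ord1 i); exact: H.
Qed.

Lemma nrm_row_lt n (x : 'rV[C]_n) (e : R) : 0 < e ->
  (forall i, nrm (x 0 i) < e) -> nrm x < e.
Proof.
move=> e0 H; have [/eqP x0|] := eqVneq (mx_norm x) 0.
  by rewrite /nrm [`|x|](eqP x0).
move=> /mx_norm_neq0[[i j] /= xE].
rewrite -toC_lt -nrmE [`|x|]xE nrmE toC_lt (ord1 i); exact: H.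
Qed.

End RealModulus.

(** * Derivatives and the mean value inequality *)

Lemma subrACA3 (V : zmodType) (a b c d e f : V) :
  a + b - (c + d) - (e + f) = (a - c - e) + (b - d - f).
Proof. by rewrite [in LHS]opprD [in LHS](opprD e f) [a + b + _]addrACA; exact: addrACA. Qed.

Section Cousin.
Variable R : realType.

(** Compactness of a segment as an induction principle: a property of
    subintervals that is transitive and holds near every point holds globally.
    The supremum of the reachable points is reachable and cannot be smaller than
    b. *)
Lemma cousin (P : R -> R -> Prop) (a b : R) : a <= b ->
  (forall x y z, a <= x -> x <= y -> y <= z -> z <= b -> P x y -> P y z -> P x z) ->
  (forall t, a <= t -> t <= b -> exists2 d, 0 < d &
    forall u v, a <= u -> u <= t -> t <= v -> v <= b -> t - u < d -> v - t < d -> P u v) ->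
  P a b.
Proof.
move=> ab Ptr Ploc.
pose S := [set t | [/\ a <= t, t <= b & P a t]].
have Sa : S a.
  have [d d0 Hd] := Ploc a (lexx _) ab.
  by split=> //; apply: Hd => //; rewrite subrr.
have Sup : has_sup S by split; [exists a | exists b => t []].
have [_ Sub] := Sup.
have as_ : a <= sup S by exact: ub_le_sup Sub _ Sa.
have sb : sup S <= b by apply: ge_sup => [|t []//]; exists a.
have [d d0 Hd] := Ploc _ as_ sb.
have [u Su ud] := sup_adherent d0 Sup.
have us := ub_le_sup Sub Su.
case: Su => au ub Pu.
pose v := Num.min b (sup S + d / 2).
have d2 : 0 < d / 2 by rewrite divr_gt0.
have vb : v <= b by rewrite ge_min lexx.
have sv : sup S <= v by rewrite le_min sb lerDl ltW.
have Pv : P a v.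
  apply: (Ptr a u v) => //; first exact: le_trans us sv.
  apply: Hd => //; first by rewrite ltrBlDr addrC -ltrBlDr.
  rewrite ltrBlDr; apply: (@le_lt_trans _ _ (sup S + d / 2)).
    by rewrite ge_min lexx orbT.
  by rewrite addrC ltrD2r ltr_pdivrMr// ltr_pMr// ltr1n.
have : v <= sup S by apply: (ub_le_sup Sub); split=> //; exact: le_trans as_ sv.
rewrite ge_min => /orP[bs|]; last by rewrite gerDl leNgt d2.
by have -> : b = v by apply: le_anti; rewrite vb (le_trans bs sv).
Qed.

End Cousin.

Section Derivatives.
Variable R : realType.
Local Notation C := (Cx R).

(** Derivatives with the remainder estimated in R rather than through limits of
    difference quotients; the increment t is complex in [lder] and real in
    [rder]. Such estimates can be composed and summed directly, and [lderP]
    relates them to derivatives along a vector. *)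
Definition lder (V W : normedModType C) (f : V -> W) (x v : V) (l : W) : Prop :=
  forall e : R, 0 < e -> exists2 d : R, 0 < d &
    forall t : C, nrm t < d -> nrm (f (x + t *: v) - f x - t *: l) <= e * nrm t.

Definition rder (W : normedModType C) (g : R -> W) (t : R) (l : W) : Prop :=
  forall e : R, 0 < e -> exists2 d : R, 0 < d &
    forall s : R, `|s| < d -> nrm (g (t + s) - g t - toC s *: l) <= e * `|s|.

Section Lder.
Variables V W : normedModType C.
Implicit Types (f g : V -> W) (x v : V).

Lemma lderP f x v l : is_derive x v f l <-> lder f x v l.
Proof.
split.
  move=> [fd <-] e e0.
  have : (fun h : C => h^-1 *: (f (h *: v + x) - f x)) @ 0^' --> 'D_v f x by exact: fd.
  move=> /cvgr_dist_le /(_ (toC e)) H.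
  have {}H := H (_ : 0 < toC e).
  have /nearP [d d0 Hd] : \forall h \near (0 : C), h != 0 -> `|'D_v f x - h^-1 *: (f (h *: v + x) - f x)| <= toC e.
    by apply: H; rewrite (_ : 0 = toC 0)// toC_lt.
  exists d => // t td.
  have [->|t0] := eqVneq t 0; first by rewrite !scale0r addr0 subrr subr0 !nrm0 mulr0.
  have := Hd t; rewrite subr0 => /(_ td t0); rewrite nrmE toC_le => H2.
  rewrite -(ler_pM2l (_ : 0 < nrm t^-1)) ?nrm_gt0 ?invr_eq0// mulrCA -nrmM mulVf// nrm1 mulr1.
  by rewrite -nrmZ scalerBr scalerA mulVf// scale1r nrmB [x + _]addrC.
move=> H.
have cv : (fun h : C => h^-1 *: (f (h *: v + x) - f x)) @ 0^' --> l.
  apply/cvgrPdist_le => e /pos_toC[e' e0 ->].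
  have [d d0 Hd] := H _ e0.
  suff H' : \forall h \near (0 : C), h != 0 -> `|l - h^-1 *: (f (h *: v + x) - f x)| <= toC e' by exact: H'.
  apply/nearP; exists d => // t; rewrite subr0 => td t0.
  rewrite nrmE toC_le.
  have := Hd t td; have -> : f (x + t *: v) - f x - t *: l = t *: (t^-1 *: (f (t *: v + x) - f x) - l).
    by rewrite scalerBr scalerA divff// scale1r [x + _]addrC.
  by rewrite nrmZ mulrC ler_pM2r ?nrm_gt0// nrmB.
by split; [apply/cvg_ex; exists l | exact: cvg_lim].
Qed.

Lemma diff_lder f x v : differentiable f x -> lder f x v ('d f x v).
Proof.
by move=> fd; apply/lderP; split; [exact: diff_derivable | rewrite deriveE].
Qed.

Lemma lder_uniq f x v l l' : lder f x v l -> lder f x v l' -> l = l'.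
Proof. by move=> /lderP[_ <-] /lderP[_ <-]. Qed.

Lemma lder_near f g x v l : (\forall y \near x, f y = g y) -> lder f x v l -> lder g x v l.
Proof.
move=> /nearP[r r0 fg] H e e0; have [d d0 Hd] := H e e0.
have n0 : 0 < nrm v + 1 by rewrite ltr_wpDl// nrm_ge0.
exists (Num.min d (r / (nrm v + 1))) => [|t]; first by rewrite lt_min d0 divr_gt0.
rewrite lt_min => /andP[td tr]; rewrite -!fg; first exact: Hd.
  by rewrite subrr nrm0.
rewrite addrC addKr nrmZ (le_lt_trans (_ : _ <= nrm t * (nrm v + 1)))//; last by rewrite -ltr_pdivlMr.
by rewrite ler_wpM2l ?nrm_ge0// lerDl.
Qed.

Lemma lder_line f x v l (t : C) :
  lder f (x + t *: v) v l <-> lder (fun s : C => f (x + s *: v)) t 1 l.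
Proof.
have E (s : C) : x + t *: v + s *: v = x + (t + s *: (1 : C)) *: v.
  by rewrite -addrA -scalerDl [s *: 1]mulr1.
by split=> H e /H[d d0 Hd]; exists d => // s /Hd; rewrite E.
Qed.

Lemma lder_rder f x v l (t : R) :
  lder f (x + toC t *: v) v l -> rder (fun s : R => f (x + toC s *: v)) t l.
Proof.
move=> H e /H[d d0 Hd]; exists d => // s sd.
by have := Hd (toC s); rewrite nrm_toC => /(_ sd); rewrite toCD scalerDl addrA.
Qed.

Lemma lder_cont f x v l : lder f x v l -> forall e, 0 < e -> exists2 d : R, 0 < d &
    forall t : C, nrm t < d -> nrm (f (x + t *: v) - f x) <= e.
Proof.
move=> H e e0; have [d d0 Hd] := H 1 ltr01.
have n0 : 0 < nrm l + 1 by rewrite ltr_wpDl// nrm_ge0.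
exists (Num.min d (e / (nrm l + 1))) => [|t]; first by rewrite lt_min d0 divr_gt0.
rewrite lt_min => /andP[/Hd td]; rewrite ltr_pdivlMr// => tr.
rewrite -(subrK (t *: l) (f (x + t *: v) - f x)).
apply: le_trans (nrm_triD _ _) _; rewrite nrmZ.
by move: td tr; set a := nrm (_ - _); set b := nrm t; set c := nrm l; lra.
Qed.

End Lder.

Section Rder.
Variable W : normedModType C.
Implicit Types g h : R -> W.

Lemma rder_cst (w : W) t : rder (fun _ : R => w) t 0.
Proof.
by move=> e e0; exists 1 => // s _; rewrite subrr scaler0 subr0 nrm0 mulr_ge0// ltW.
Qed.

Lemma rder_lin (w : W) t : rder (fun s : R => toC s *: w) t w.
Proof.
move=> e e0; exists 1 => // s _.
by rewrite toCD scalerDl (addrC (toC t *: w)) addrK subrr nrm0 mulr_ge0// ltW.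
Qed.

Lemma rderD g h t l m : rder g t l -> rder h t m -> rder (fun s => g s + h s) t (l + m).
Proof.
move=> Hg Hh e e0; have e2 : 0 < e / 2 by rewrite divr_gt0.
have [d d0 Hd] := Hg _ e2; have [d' d0' Hd'] := Hh _ e2.
exists (Num.min d d') => [|s]; first by rewrite lt_min d0.
rewrite lt_min => /andP[/Hd H1 /Hd' H2].
have -> : g (t + s) + h (t + s) - (g t + h t) - toC s *: (l + m) =
  (g (t + s) - g t - toC s *: l) + (h (t + s) - h t - toC s *: m).
  by rewrite scalerDr subrACA3.
apply: le_trans (nrm_triD _ _) _; move: H1 H2; set a := nrm _; set b := nrm _; set c := `|s|. lra.
Qed.

Lemma rderZ g t l (a : C) : rder g t l -> rder (fun s => a *: g s) t (a *: l).
Proof.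
move=> Hg e e0; have n0 : 0 < nrm a + 1 by rewrite ltr_wpDl// nrm_ge0.
have [d d0 Hd] := Hg (e / (nrm a + 1)) (divr_gt0 e0 n0).
exists d => // s /Hd H; rewrite scalerA [toC s * a]mulrC -scalerA -!scalerBr nrmZ.
apply: le_trans (ler_wpM2l (nrm_ge0 _) H) _.
rewrite mulrA ler_wpM2r// mulrCA ger_pMr// ler_pdivrMr// mul1r lerDl//.
Qed.

Lemma rderN g t l : rder g t l -> rder (fun s => - g s) t (- l).
Proof.
move=> Hg; rewrite -scaleN1r; have -> : (fun s => - g s) = (fun s => -1 *: g s); last exact: rderZ.
by apply/funext => s; rewrite scaleN1r.
Qed.

Lemma rderB g h t l m : rder g t l -> rder h t m -> rder (fun s => g s - h s) t (l - m).
Proof. by move=> Hg Hh; apply: rderD => //; exact: rderN. Qed.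

(** For functions with values in any normed space: the inequality with a
    slightly larger constant is additive in the interval and holds on small
    ones. *)
Lemma mvi g (a b M : R) : a <= b ->
  (forall t, a <= t -> t <= b -> exists2 l, rder g t l & nrm l <= M) ->
  nrm (g b - g a) <= M * (b - a).
Proof.
move=> ab H; have M0 : 0 <= M by have [l _] := H a (lexx _) ab; apply: le_trans (nrm_ge0 _).
suff HE e : 0 < e -> nrm (g b - g a) <= (M + e) * (b - a).
  have [/eqP|ba] := eqVneq a b.
    by move=> /eqP <-; rewrite !subrr nrm0 mulr0.
  have ba0 : 0 < b - a by rewrite subr_gt0 lt_neqAle ba.
  rewrite -ler_pdivrMr//; apply/ler_addgt0Pr => e e0; rewrite ler_pdivrMr//; exact: HE.
move=> e0; pose P u v := nrm (g v - g u) <= (M + e) * (v - u).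
apply: (@cousin _ P) => // [x y z _ _ _ _ Pxy Pyz|t a_t tb].
  apply: le_trans (nrm_tri (g y) _ _) _.
  by rewrite addrC; apply: le_trans (lerD Pxy Pyz) _; lra.
have [l gl lM] := H t a_t tb; have [d d0 Hd] := gl e e0.
have Q s : `|s| < d -> nrm (g (t + s) - g t) <= (M + e) * `|s|.
  move=> /Hd H1; rewrite -(subrK (toC s *: l) (g (t + s) - g t)).
  apply: le_trans (nrm_triD _ _) _; rewrite nrmZ nrm_toC mulrDl addrC mulrC.
  by apply: lerD => //; rewrite ler_wpM2r.
exists d => // u v _ ut tv _ tu vt; rewrite /P.
apply: le_trans (nrm_tri (g t) _ _) _.
have -> : (M + e) * (v - u) = (M + e) * (v - t) + (M + e) * (t - u) by ring.
apply: lerD.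
  by have := Q (v - t); rewrite (addrC t) subrK ger0_norm ?subr_ge0//; exact.
by have := Q (u - t); rewrite (addrC t) subrK ler0_norm ?subr_le0// opprB [nrm (g u - _)]nrmB; exact.
Qed.

End Rder.
End Derivatives.

(** * The complex exponential and primitives *)

Section RealDerivatives.
Variable R : realType.
Local Notation C := (Cx R).

Lemma realder (g : R -> R) (x l : R) : is_derive x 1 g l ->
  forall e : R, 0 < e -> exists2 d : R, 0 < d &
    forall s : R, `|s| < d -> `|g (x + s) - g x - s * l| <= e * `|s|.
Proof.
move=> [gd <-] e e0.
have H : (fun h : R => h^-1 *: (g (h *: 1 + x) - g x)) @ 0^' --> 'D_1 g x by exact: gd.
move/cvgrPdist_le : H => /(_ _ e0) H.
have /nbhs_normP[d /= d0 Hd] : \forall h \near (0 : R), h != 0 ->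
  `|'D_1 g x - h^-1 *: (g (h *: 1 + x) - g x)| <= e by exact: H.
exists d => // s sd.
have [->|s0] := eqVneq s 0; first by rewrite addr0 mul0r subrr subr0 normr0 mulr0.
have := Hd s; rewrite /= sub0r normrN => /(_ sd s0).
rewrite -(ler_pM2l (_ : 0 < `|s|)) ?normr_gt0// -normrM mulrBr [_ *: 1]mulr1.
by rewrite [_ *: (_ - _)](_ : _ = s^-1 * (g (s + x) - g x))// mulVKf// distrC (addrC s) mulrC [leRHS]mulrC.
Qed.

Lemma realder_rder (g : R -> R) (x l : R) : is_derive x 1 g l ->
  rder (fun t => toC (g t) : C) x (toC l).
Proof.
move=> /realder H e /H[d d0 Hd]; exists d => // s /Hd.
have toCB a b : toC (a - b) = toC a - toC b :> C.
  by rewrite toCD; congr (_ + _); apply/eqP; rewrite eq_complex /= oppr0 !eqxx.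
have -> : toC s *: (toC l : C) = toC (s * l) by rewrite toCM.
by rewrite -!toCB nrm_toC.
Qed.

Lemma realder_cont (g : R -> R) (x l : R) : is_derive x 1 g l ->
  forall e : R, 0 < e -> exists2 d : R, 0 < d &
    forall s : R, `|s| < d -> `|g (x + s) - g x| <= e.
Proof.
move=> /realder H e e0; have [d d0 Hd] := H 1 ltr01.
have n0 : 0 < `|l| + 1 by rewrite ltr_wpDl.
exists (Num.min d (e / (`|l| + 1))) => [|s]; first by rewrite lt_min d0 divr_gt0.
rewrite lt_min => /andP[/Hd H1]; rewrite ltr_pdivlMr// => H2.
rewrite -(subrK (s * l) (g (x + s) - g x)).
apply: le_trans (ler_normD _ _) _; rewrite normrM; lra.
Qed.

Definition cexp (z : C) : C :=
  toC (expR (complex.Re z)) *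
    (toC (cos (complex.Im z)) + Ci R * toC (sin (complex.Im z))).

Lemma ReD (z w : C) : complex.Re (z + w) = complex.Re z + complex.Re w.
Proof. by case: z w => ? ? []. Qed.
Lemma ImD (z w : C) : complex.Im (z + w) = complex.Im z + complex.Im w.
Proof. by case: z w => ? ? []. Qed.
Lemma ReN (z : C) : complex.Re (- z) = - complex.Re z.
Proof. by case: z. Qed.
Lemma ImN (z : C) : complex.Im (- z) = - complex.Im z.
Proof. by case: z. Qed.
Lemma Re_mul (z w : C) :
  complex.Re (z * w) = complex.Re z * complex.Re w - complex.Im z * complex.Im w.
Proof. by case: z w => ? ? []. Qed.
Lemma Im_mul (z w : C) :
  complex.Im (z * w) = complex.Re z * complex.Im w + complex.Im z * complex.Re w.
Proof. by case: z w => ? ? [] a b /=. Qed.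

Lemma complex_eq (z w : C) : complex.Re z = complex.Re w ->
  complex.Im z = complex.Im w -> z = w.
Proof. by case: z w => ? ? [] a b /= -> ->. Qed.

Lemma toCN (a : R) : toC (- a) = - toC a :> C.
Proof. by apply: complex_eq; rewrite /= ?oppr0. Qed.

Lemma toCB (a b : R) : toC (a - b) = toC a - toC b :> C.
Proof. by rewrite toCD toCN. Qed.

Lemma Re_cexp z : complex.Re (cexp z) = expR (complex.Re z) * cos (complex.Im z).
Proof. rewrite /cexp !(Re_mul, ReD, ImD, Im_mul) /=; ring. Qed.

Lemma Im_cexp z : complex.Im (cexp z) = expR (complex.Re z) * sin (complex.Im z).
Proof. rewrite /cexp !(Re_mul, ReD, ImD, Im_mul) /=; ring. Qed.

Opaque cexp.

Lemma cexpD z w : cexp (z + w) = cexp z * cexp w.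
Proof.
apply: complex_eq; rewrite [in RHS]Re_mul || rewrite [in RHS]Im_mul.
  by rewrite !Re_cexp !Im_cexp ReD ImD expRD cosD; ring.
by rewrite !Re_cexp !Im_cexp ReD ImD expRD sinD; ring.
Qed.

Lemma cexp0 : cexp 0 = 1.
Proof. by apply: complex_eq; rewrite ?Re_cexp ?Im_cexp /= ?cos0 ?sin0 expR0; ring. Qed.

Lemma cexp_neq0 z : cexp z != 0.
Proof.
apply/eqP => z0; have := cexpD z (- z).
by rewrite subrr cexp0 z0 mul0r => /eqP; rewrite oner_eq0.
Qed.

Lemma nrm_cexp z : nrm (cexp z) = expR (complex.Re z).
Proof.
apply/eqP; rewrite -(@eqrXn2 _ 2) ?nrm_ge0 ?expR_ge0// nrm_sqr Re_cexp Im_cexp.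
by rewrite !exprMn -mulrDr cos2Dsin2 mulr1.
Qed.

Lemma Re_iC (y : R) : complex.Re (Ci R * toC y) = 0.
Proof. by rewrite Re_mul /= mul0r mulr0 subrr. Qed.

Lemma Im_iC (y : R) : complex.Im (Ci R * toC y) = y.
Proof. by rewrite Im_mul /= mulr0 mul1r add0r. Qed.

Lemma cexp_2pi : cexp (Ci R * toC (pi *+ 2)) = 1.
Proof.
by apply: complex_eq; rewrite ?Re_cexp ?Im_cexp Re_iC Im_iC expR0 mul1r ?cos2pi ?sin2pi.
Qed.

(** The first order expansion at 0, put together from those of the real
    exponential, cosine and sine; the addition formula then carries it to every
    point. *)
Lemma cexp_der0 : forall e : R, 0 < e -> exists2 d : R, 0 < d &
  forall w : C, nrm w < d -> nrm (cexp w - 1 - w) <= e * nrm w.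
Proof.
move=> e e0; have e8 : 0 < e / 8 by rewrite divr_gt0.
have [d1 d10 H1] := realder (is_derive_expR 0) e8.
have [d2 d20 H2] := realder (is_derive_cos 0) e8.
have [d3 d30 H3] := realder (is_derive_sin 0) e8.
have e8' : 0 < Num.min 1 (e / 8) by rewrite lt_min ltr01.
have [d4 d40 H4] := realder_cont (is_derive_expR 0) e8'.
exists (Num.min (Num.min d1 d2) (Num.min d3 d4)) => [|w]; first by rewrite !lt_min d10 d20 d30.
rewrite !lt_min => /andP[/andP[w1 w2] /andP[w3 w4]].
have Rw := nrm_Re w; have Iw := nrm_Im w.
have := H1 _ (le_lt_trans Rw w1); have := H2 _ (le_lt_trans Iw w2).
have := H3 _ (le_lt_trans Iw w3); have := H4 _ (le_lt_trans Rw w4).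
rewrite !add0r expR0 cos0 sin0 !oppr0 mulr0 !mulr1 !subr0 ?addr0.
set x := complex.Re w in Rw *; set y := complex.Im w in Iw *.
rewrite le_min => /andP[E1 E8] S3 C2 E3.
have -> : cexp w - 1 - w = toC (expR x - 1 - x) + (toC (expR x) *
   (toC (cos y - 1) + Ci R * toC (sin y - y)) + Ci R * (toC y * toC (expR x - 1))).
  apply: complex_eq; rewrite !(Re_mul, Im_mul, ReD, ImD, ReN, ImN) ?Re_cexp ?Im_cexp /= -/x -/y; ring.
apply: le_trans (nrm_triD _ _) _; apply: (le_trans (lerD (lexx _) (nrm_triD _ _))).
rewrite !nrmM nrm_i mul1r !nrm_toC.
have B1 := nrm_triD (toC (cos y - 1)) (Ci R * toC (sin y - y)).
rewrite nrmM nrm_i mul1r !nrm_toC in B1.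
have n0 := nrm_ge0 w.
have X2 : `|expR x| <= 2.
  rewrite -(subrK 1 (expR x)); apply: le_trans (ler_normD _ _) _; rewrite normr1; lra.
have P1 : `|expR x| * nrm (toC (cos y - 1) + Ci R * toC (sin y - y)) <=
    2 * (e / 8 * nrm w + e / 8 * nrm w).
  apply: ler_pM => //; first exact: nrm_ge0.
  apply: le_trans B1 _; apply: lerD; [apply: le_trans C2 _ | apply: le_trans S3 _];
    by rewrite ler_wpM2l// ltW.
have P2 : `|y| * `|expR x - 1| <= nrm w * (e / 8) by apply: ler_pM.
have P3 : `|expR x - 1 - x| <= e / 8 * nrm w by apply: le_trans E3 _; rewrite ler_wpM2l// ltW.
have en : 0 <= e * nrm w by rewrite mulr_ge0// ltW.
move: P1 P2 P3 en; lra.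
Qed.

Lemma cexp_der z : lder cexp z 1 (cexp z).
Proof.
move=> e e0; have n0 : 0 < nrm (cexp z) by rewrite nrm_gt0 cexp_neq0.
have [d d0 Hd] := cexp_der0 (divr_gt0 e0 n0).
exists d => // t /Hd H; rewrite [t *: 1]mulr1 cexpD.
have -> : cexp z * cexp t - cexp z - t *: cexp z = cexp z * (cexp t - 1 - t).
  by rewrite [_ *: _]mulrC !mulrBr mulr1.
rewrite nrmM; apply: le_trans (ler_wpM2l (ltW n0) H) _.
by rewrite mulrA mulrCA divff ?mulr1// gt_eqF.
Qed.

Definition rcont (g : R -> C) (t : R) : Prop :=
  forall e : R, 0 < e -> exists2 d : R, 0 < d &
    forall s : R, `|s| < d -> nrm (g (t + s) - g t) <= e.

Lemma rcont_Re g t : rcont g t -> {for t, continuous (fun s => complex.Re (g s))}.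
Proof.
move=> H; apply/cvgrPdist_le => e e0; have [d d0 Hd] := H e e0.
apply/nbhs_normP; exists d => //= s sd.
rewrite distrC.
have := Hd (s - t); rewrite (distrC s t) => /(_ sd); rewrite (addrC t) subrK => H1.
by apply: le_trans H1; rewrite -[_ - _](_ : complex.Re (g s - g t) = _) ?nrm_Re// ReD ReN.
Qed.

Lemma rcont_Im g t : rcont g t -> {for t, continuous (fun s => complex.Im (g s))}.
Proof.
move=> H; apply/cvgrPdist_le => e e0; have [d d0 Hd] := H e e0.
apply/nbhs_normP; exists d => //= s sd; rewrite distrC.
have := Hd (s - t); rewrite (distrC s t) => /(_ sd); rewrite (addrC t) subrK => H1.
by apply: le_trans H1; rewrite -[_ - _](_ : complex.Im (g s - g t) = _) ?nrm_Im// ImD ImN.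
Qed.

Lemma real_primitive (g : R -> R) (a b : R) : a < b ->
  (forall t, a <= t -> t <= b -> {for t, continuous g}) ->
  exists G : R -> R, forall t, a < t -> t < b -> is_derive t 1 G (g t).
Proof.
move=> ab gc.
have gi : lebesgue_measure.-integrable `[a, b] (EFin \o g).
  apply: continuous_compact_integrable; first exact: segment_compact.
  apply: continuous_in_subspaceT => x; rewrite inE /= in_itv /= => /andP[xa xb].
  exact: gc.
exists (fun x => \int[lebesgue_measure]_(t in `[a, x]) g t)%R => t a_t tb.
have [dF FE] := continuous_FTC1_closed tb gi a_t (gc _ (ltW a_t) (ltW tb)).
rewrite derive1E in FE; split; [exact: dF | exact: FE].
Qed.

(** Real and imaginary parts are integrated separately. Integrals of complex
    functions along segments appear below only as increments of such primitives,
    so that the mean value inequality is the only estimate of integrals that is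
    needed. *)
Lemma primitive_ex (g : R -> C) (a b : R) : a < b ->
  (forall t, a <= t -> t <= b -> rcont g t) ->
  exists G : R -> C, forall t, a < t -> t < b -> rder G t (g t).
Proof.
move=> ab gc.
have [G1 H1] := real_primitive ab (fun t ta tb => rcont_Re (gc t ta tb)).
have [G2 H2] := real_primitive ab (fun t ta tb => rcont_Im (gc t ta tb)).
exists (fun t => toC (G1 t) + Ci R *: (toC (G2 t) : C)) => t ta tb.
have E1 := realder_rder (H1 t ta tb).
have E2 := rderZ (Ci R) (realder_rder (H2 t ta tb)).
by rewrite (ReIm (g t)); exact: (rderD E1 E2).
Qed.

End RealDerivatives.

(** * Cauchy's theorem for rectangles *)

Section NestedBoxes.
Variable R : realType.

Lemma nested_intervals (x : nat -> R) (w : nat -> R) : (forall n, 0 <= w n) ->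
  (forall n, x n <= x n.+1 /\ x n.+1 + w n.+1 <= x n + w n) ->
  exists p, forall n, x n <= p /\ p <= x n + w n.
Proof.
move=> w0 H.
have M m n : x n <= x (n + m)%N /\ x (n + m)%N + w (n + m)%N <= x n + w n.
  elim: m => [|m [H1 H2]]; first by rewrite addn0.
  by rewrite addnS; have [H3 H4] := H (n + m)%N; split; [exact: le_trans H3 | exact: le_trans H2].
have B n m : x n <= x m + w m.
  have [nm|mn] := leqP n m.
    have [+ _] := M (m - n)%N n; rewrite subnKC// => xnm.
    by apply: le_trans xnm _; rewrite lerDl.
  have [_] := M (n - m)%N m; rewrite subnKC ?(ltnW mn)// => H1.
  by apply: le_trans H1; rewrite lerDl.
have ub : has_ubound (range x) by exists (x 0%N + w 0%N) => _ [n _ <-].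
exists (sup (range x)) => n; split; first by apply: ub_le_sup => //; exists n.
by apply: ge_sup => [|_ [m _ <-]//]; exists (x 0%N), 0%N.
Qed.

(** A property of boxes that is inherited by some quarter of every box having it
    concentrates at a point (p, q). *)
Lemma nested_boxes (bad : R -> R -> nat -> Prop) (w h : R) : 0 <= w -> 0 <= h ->
  (forall x y n, bad x y n -> exists x' y', [/\ bad x' y' n.+1, x <= x',
      x' + w / 2 ^+ n.+1 <= x + w / 2 ^+ n, y <= y' &
      y' + h / 2 ^+ n.+1 <= y + h / 2 ^+ n]) ->
  forall x0 y0, bad x0 y0 0%N -> exists p q, forall n, exists x y,
    [/\ bad x y n, x <= p, p <= x + w / 2 ^+ n, y <= q & q <= y + h / 2 ^+ n].
Proof.
move=> w0 h0 H x0 y0 bad0.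
have /choice[F HF] (z : R * R * nat) : exists z', bad z.1.1 z.1.2 z.2 ->
    [/\ bad z'.1 z'.2 z.2.+1, z.1.1 <= z'.1,
      z'.1 + w / 2 ^+ z.2.+1 <= z.1.1 + w / 2 ^+ z.2, z.1.2 <= z'.2 &
      z'.2 + h / 2 ^+ z.2.+1 <= z.1.2 + h / 2 ^+ z.2].
  have [/H[x' [y' Hz]]|nb] := pselect (bad z.1.1 z.1.2 z.2); first by exists (x', y').
  by exists (0, 0).
pose s := fix s n : R * R := if n is m.+1 then F (s m, m) else (x0, y0).
have sb n : bad (s n).1 (s n).2 n.
  by elim: n => [//|n IH] /=; have [] := HF (s n, n) IH.
have sS n := HF (s n, n) (sb n).
have wn n : 0 <= w / 2 ^+ n by rewrite divr_ge0// exprn_ge0.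
have hn n : 0 <= h / 2 ^+ n by rewrite divr_ge0// exprn_ge0.
have [p Hp] : exists p, forall n, (s n).1 <= p /\ p <= (s n).1 + w / 2 ^+ n.
  by apply: (nested_intervals wn) => n; have [] := sS n.
have [q Hq] : exists q, forall n, (s n).2 <= q /\ q <= (s n).2 + h / 2 ^+ n.
  by apply: (nested_intervals hn) => n; have [] := sS n.
exists p, q => n; exists (s n).1, (s n).2.
by have [? ?] := Hp n; have [? ?] := Hq n.
Qed.

End NestedBoxes.

Section Goursat.
Variable R : realType.
Local Notation C := (Cx R).

Definition pt (x y : R) : C := toC x + Ci R * toC y.

Lemma scaleC (u v : C) : u *: v = u * v.
Proof. by []. Qed.

Lemma pt_h (x y : R) : pt x y = pt 0 y + toC x *: (1 : C).
Proof. by rewrite /pt scaleC; apply: complex_eq; rewrite !(ReD, ImD, Re_mul, Im_mul) /=; ring. Qed.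

Lemma pt_v (x y : R) : pt x y = pt x 0 + toC y *: Ci R.
Proof. by rewrite /pt scaleC; apply: complex_eq; rewrite !(ReD, ImD, Re_mul, Im_mul) /=; ring. Qed.

Lemma nrm_pt (x y p q : R) : nrm (pt x y - pt p q) <= `|x - p| + `|y - q|.
Proof.
have -> : pt x y - pt p q = toC (x - p) + Ci R * toC (y - q).
  by rewrite /pt !toCB; ring.
by apply: le_trans (nrm_triD _ _) _; rewrite nrmM nrm_i mul1r !nrm_toC.
Qed.

Lemma pt_ReIm (z : C) : z = pt (complex.Re z) (complex.Im z).
Proof. exact: ReIm. Qed.

(** An affine function k0 + l (z - z0) has this quadratic primitive; its boundary
    integrals therefore vanish. *)
Lemma quad_lder (k0 l z0 z v : C) :
  lder (fun z => (k0 - l * z0) * z + l * z ^+ 2 / 2) z v (v * (k0 + l * (z - z0))).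
Proof.
move=> e e0; have n0 : 0 < nrm (l * v ^+ 2 / 2) + 1 by rewrite ltr_wpDl// nrm_ge0.
exists (e / (nrm (l * v ^+ 2 / 2) + 1)); first exact: divr_gt0.
move=> t; rewrite ltr_pdivlMr// => td.
have -> : (k0 - l * z0) * (z + t *: v) + l * (z + t *: v) ^+ 2 / 2 -
  ((k0 - l * z0) * z + l * z ^+ 2 / 2) - t *: (v * (k0 + l * (z - z0))) = l * v ^+ 2 / 2 * (t * t).
  by rewrite !scaleC; field.
move: (l * v ^+ 2 / 2) n0 td => A n0 td.
rewrite nrmM nrmM mulrA ler_wpM2r ?nrm_ge0//; apply: le_trans (ltW td).
by rewrite mulrC ler_wpM2l ?nrm_ge0// lerDl.
Qed.

Variable k : C -> C.
Variables a b c d : R.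
Hypotheses (ab : a < b) (cd : c < d).
Hypothesis k_diff : forall x y, a <= x -> x <= b -> c <= y -> y <= d ->
  exists l, lder k (pt x y) 1 l.

Lemma lder_dir (z v l : C) : lder k z 1 l -> lder k z v (v * l).
Proof.
have [-> _|v0 H] := eqVneq v 0.
  by move=> e e0; exists 1 => // t _; rewrite scaler0 addr0 subrr mul0r scaler0 subrr !nrm0 mulr_ge0 ?nrm_ge0 ?ltW.
move=> e e0; have n0 : 0 < nrm v by rewrite nrm_gt0.
have [r r0 Hr] := H _ (divr_gt0 e0 n0).
exists (r / nrm v) => [|t]; first exact: divr_gt0.
rewrite ltr_pdivlMr// -nrmM => /Hr; rewrite [_ *: 1]mulr1.
rewrite nrmM mulrCA divfK ?gt_eqF//.
by rewrite !scaleC mulrA [nrm t * e]mulrC.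
Qed.

Lemma lder_rcont (f : C -> C) z v l (t : R) (g : R -> C) :
  (forall s, g s = f (z + toC s *: v)) -> lder f (z + toC t *: v) v l -> rcont g t.
Proof.
move=> gE /lder_cont H e /H[r r0 Hr]; exists r => // s sr.
by rewrite !gE; have := Hr (toC s); rewrite nrm_toC toCD scalerDl addrA; exact.
Qed.

Section WithPrimitives.
Variables JH JV : R -> R -> C.
Hypothesis JHP : forall x y, a < x -> x < b -> c <= y -> y <= d -> rder (JH y) x (k (pt x y)).
Hypothesis JVP : forall x y, a <= x -> x <= b -> c < y -> y < d -> rder (JV x) y (k (pt x y)).

Let HI y u v := JH y v - JH y u.
Let VI x u v := Ci R * (JV x v - JV x u).
(** The boundary integral of the rectangle [x1, x2] x [y1, y2], counterclockwise. *)
Let box x1 x2 y1 y2 := HI y1 x1 x2 + VI x2 y1 y2 - HI y2 x1 x2 - VI x1 y1 y2.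

Let box_split x1 x x2 y1 y y2 :
  box x1 x2 y1 y2 = box x1 x y1 y + box x x2 y1 y + (box x1 x y y2 + box x x2 y y2).
Proof. rewrite /box /HI /VI; ring. Qed.

(** The affine part of k at (p, q) contributes nothing, and the remainder is
    at most e s on a boundary of length at most 2 s. *)
Let box_local p q l e x1 x2 y1 y2 s : a < x1 -> x1 <= p -> p <= x2 -> x2 < b ->
  c < y1 -> y1 <= q -> q <= y2 -> y2 < d ->
  0 < e -> x2 - x1 + (y2 - y1) <= s ->
  (forall t, nrm t <= s -> nrm (k (pt p q + t) - k (pt p q) - t * l) <= e * nrm t) ->
  nrm (box x1 x2 y1 y2) <= 2 * e * s ^+ 2.
Proof.
move=> ax xp px xb cy yq qy yd e0 sE Hk.
have xx : x1 <= x2 by exact: le_trans px.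
have yy : y1 <= y2 by exact: le_trans qy.
have s0 : 0 <= s by apply: le_trans sE; rewrite addr_ge0// subr_ge0.
pose k0 := k (pt p q); pose z0 := pt p q.
pose A (z : C) := (k0 - l * z0) * z + l * z ^+ 2 / 2.
have near x y : x1 <= x -> x <= x2 -> y1 <= y -> y <= y2 ->
    nrm (k (pt x y) - (k0 + l * (pt x y - z0))) <= e * s.
  move=> x1x xx2 y1y yy2.
  have ns : nrm (pt x y - z0) <= s.
    apply: le_trans (nrm_pt _ _ _ _) _; apply: le_trans sE.
    by apply: lerD; rewrite ler_norml; apply/andP; split; lra.
  have := Hk _ ns; rewrite (addrC (pt p q)) subrK => H.
  rewrite opprD addrA [l * _]mulrC; apply: le_trans H _.
  by rewrite ler_wpM2l// ltW.
have HB y : y1 <= y -> y <= y2 ->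
    nrm (HI y x1 x2 - (A (pt x2 y) - A (pt x1 y))) <= e * s * (x2 - x1).
  move=> y1y yy2.
  have -> : HI y x1 x2 - (A (pt x2 y) - A (pt x1 y)) =
     (JH y x2 - A (pt x2 y)) - (JH y x1 - A (pt x1 y)) by rewrite /HI; ring.
  apply: (@mvi R C (fun x => JH y x - A (pt x y))) => // x x1x xx2.
  exists (k (pt x y) - 1 * (k0 + l * (pt x y - z0))).
    apply: rderB; first by apply: JHP; lra.
    have -> : (fun x => A (pt x y)) = (fun x => A (pt 0 y + toC x *: (1 : C))).
      by apply/funext => t; rewrite -pt_h.
    by apply: lder_rder; rewrite -pt_h; exact: quad_lder.
  by rewrite mul1r; exact: near.
have VB x : x1 <= x -> x <= x2 ->
    nrm (VI x y1 y2 - (A (pt x y2) - A (pt x y1))) <= e * s * (y2 - y1).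
  move=> x1x xx2.
  have -> : VI x y1 y2 - (A (pt x y2) - A (pt x y1)) =
     (Ci R *: (JV x y2) - A (pt x y2)) - (Ci R *: (JV x y1) - A (pt x y1)).
     rewrite /VI !scaleC; ring.
  apply: (@mvi R C (fun y => Ci R *: (JV x y) - A (pt x y))) => // y y1y yy2.
  exists (Ci R *: (k (pt x y)) - Ci R * (k0 + l * (pt x y - z0))).
    apply: rderB; first by apply: rderZ; apply: JVP; lra.
    have -> : (fun y => A (pt x y)) = (fun y => A (pt x 0 + toC y *: Ci R)).
      by apply/funext => t; rewrite -pt_v.
    by apply: lder_rder; rewrite -pt_v; exact: quad_lder.
  rewrite scaleC -mulrBr nrmM nrm_i mul1r; exact: near.
have -> : box x1 x2 y1 y2 = (HI y1 x1 x2 - (A (pt x2 y1) - A (pt x1 y1))) +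
   (VI x2 y1 y2 - (A (pt x2 y2) - A (pt x2 y1))) -
   (HI y2 x1 x2 - (A (pt x2 y2) - A (pt x1 y2))) -
   (VI x1 y1 y2 - (A (pt x1 y2) - A (pt x1 y1))) by rewrite /box; ring.
apply: le_trans (nrm_triB _ _) _.
apply: le_trans (lerD (nrm_triB _ _) (lexx _)) _.
apply: le_trans (lerD (lerD (nrm_triD _ _) (lexx _)) (lexx _)) _.
have H1 := HB y1 (lexx _) yy; have H2 := HB y2 yy (lexx _).
have V1 := VB x1 (lexx _) xx; have V2 := VB x2 xx (lexx _).
apply: le_trans (lerD (lerD (lerD H1 V2) H2) V1) _.
have : e * s * (x2 - x1 + (y2 - y1)) <= e * s * s by rewrite ler_wpM2l// mulr_ge0// ltW.
rewrite expr2; lra.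
Qed.

(** Goursat's argument: four-fold subdivision keeps a definite share of a nonzero
    boundary integral, which differentiability at the limit point forbids. *)
Lemma goursat_box x1 x2 y1 y2 : a < x1 -> x1 <= x2 -> x2 < b ->
  c < y1 -> y1 <= y2 -> y2 < d -> box x1 x2 y1 y2 = 0.
Proof.
move=> ax xx xb cy yy yd; apply/eqP; rewrite -nrm_eq0 eq_le nrm_ge0 andbT.
set eta := nrm _; rewrite leNgt; apply/negP => eta0.
pose w := x2 - x1; pose h := y2 - y1.
have w0 : 0 <= w by rewrite subr_ge0.
have h0 : 0 <= h by rewrite subr_ge0.
pose bad x y n := [/\ x1 <= x, x + w / 2 ^+ n <= x2, y1 <= y, y + h / 2 ^+ n <= y2 &
  eta / 4 ^+ n <= nrm (box x (x + w / 2 ^+ n) y (y + h / 2 ^+ n))].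
have bad0 : bad x1 y1 0%N.
  by rewrite /bad !expr0 !divr1 /w /h !(addrC _ (_ - _)) !subrK.
have p2 n : 0 < 2 ^+ n :> R by rewrite exprn_gt0.
have wn n : 0 <= w / 2 ^+ n by rewrite divr_ge0// ltW.
have hn n : 0 <= h / 2 ^+ n by rewrite divr_ge0// ltW.
have wS n : w / 2 ^+ n = w / 2 ^+ n.+1 + w / 2 ^+ n.+1.
  by rewrite exprS; field; rewrite gt_eqF.
have hS n : h / 2 ^+ n = h / 2 ^+ n.+1 + h / 2 ^+ n.+1.
  by rewrite exprS; field; rewrite gt_eqF.
have step x y n : bad x y n -> exists x' y', [/\ bad x' y' n.+1, x <= x',
      x' + w / 2 ^+ n.+1 <= x + w / 2 ^+ n, y <= y' & y' + h / 2 ^+ n.+1 <= y + h / 2 ^+ n].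
  move=> [b1 b2 b3 b4 b5]; rewrite wS hS in b2 b4 b5 *.
  set w' := w / 2 ^+ n.+1 in b2 b4 b5 *; set h' := h / 2 ^+ n.+1 in b2 b4 b5 *.
  have w'0 : 0 <= w' by exact: wn.
  have h'0 : 0 <= h' by exact: hn.
  have e4 : eta / 4 ^+ n = 4 * (eta / 4 ^+ n.+1).
    by rewrite exprS; field; rewrite gt_eqF// exprn_gt0.
  rewrite e4 in b5; set e' := eta / 4 ^+ n.+1 in b5 *.
  rewrite [x + (w' + w')]addrA [y + (h' + h')]addrA (box_split _ (x + w') _ _ (y + h')) in b5.
  have X1 : x1 <= x + w' by apply: le_trans b1 _; rewrite lerDl.
  have X2 : x + w' <= x2 by apply: le_trans b2; rewrite addrA lerDl.
  have X3 : x + w' + w' <= x2 by rewrite -addrA.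
  have Y1 : y1 <= y + h' by apply: le_trans b3 _; rewrite lerDl.
  have Y2 : y + h' <= y2 by apply: le_trans b4; rewrite addrA lerDl.
  have Y3 : y + h' + h' <= y2 by rewrite -addrA.
  have [x_w y_h] : x + w' <= x + (w' + w') /\ y + h' <= y + (h' + h').
    by rewrite !addrA !lerDl.
  have [x_x y_y] : x <= x + w' /\ y <= y + h' by rewrite !lerDl.
  have [B1|B1] := leP e' (nrm (box x (x + w') y (y + h'))).
    by exists x, y; split=> //; split.
  have [B2|B2] := leP e' (nrm (box (x + w') (x + w' + w') y (y + h'))).
    by exists (x + w'), y; split=> //; rewrite -/w' -/h' -?addrA//; split=> //; rewrite -/w' -/h' ?addrA.
  have [B3|B3] := leP e' (nrm (box x (x + w') (y + h') (y + h' + h'))).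
    by exists x, (y + h'); split=> //; rewrite -/w' -/h' -?addrA//; split=> //; rewrite -/w' -/h' ?addrA.
  have [B4|B4] := leP e' (nrm (box (x + w') (x + w' + w') (y + h') (y + h' + h'))).
    by exists (x + w'), (y + h'); split=> //; rewrite -/w' -/h' -?addrA//; split=> //; rewrite -/w' -/h' ?addrA.
  exfalso; move: b5; rewrite leNgt => /negP; apply.
  move: B1 B2 B3 B4; move: (box _ _ _ _) (box _ _ _ _) (box _ _ _ _) (box _ _ _ _).
  move=> A1 A2 A3 A4 B1 B2 B3 B4.
  apply: le_lt_trans (nrm_triD _ _) _.
  apply: le_lt_trans (lerD (nrm_triD _ _) (nrm_triD _ _)) _.
  lra.
have [p [q Hpq]] := nested_boxes w0 h0 step bad0.
have [x [y [[b1 b2 b3 b4 _] xp px yq qy]]] := Hpq 0%N.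
have [l Hl] : exists l, lder k (pt p q) 1 l.
  apply: k_diff; apply: ltW.
  - exact: lt_le_trans ax (le_trans b1 xp).
  - exact: le_lt_trans (le_trans px b2) xb.
  - exact: lt_le_trans cy (le_trans b3 yq).
  - exact: le_lt_trans (le_trans qy b4) yd.
pose S := w + h + 1; have S0 : 0 < S by rewrite ltr_wpDl// addr_ge0.
pose e := eta / (4 * S ^+ 2).
have e0 : 0 < e by rewrite divr_gt0// mulr_gt0// exprn_gt0.
have [r r0 Hr] := Hl _ e0.
have [n nr] : exists n, (w + h) / 2 ^+ n < r.
  have [n] := ltr_add_invr (divr_gt0 r0 S0); rewrite add0r => Hn.
  exists n; rewrite ltr_pdivrMr//.
  have nn : n.+1%:R <= 2 ^+ n :> R by rewrite -natrX ler_nat ltn_expl.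
  have : S < r * n.+1%:R.
    by move: Hn; rewrite ltr_pdivlMr// mulrC ltr_pdivrMr// ltr0n.
  have : r * n.+1%:R <= r * 2 ^+ n by rewrite ler_wpM2l// ltW.
  rewrite /S; lra.
have [x' [y' [[c1 c2 c3 c4 c5] xp' px' yq' qy']]] := Hpq n.
set wN := w / 2 ^+ n in c2 c5 px'; set hN := h / 2 ^+ n in c4 c5 qy'.
have sE : x' + wN - x' + (y' + hN - y') <= (w + h) / 2 ^+ n.
  by rewrite mulrDl -/wN -/hN; lra.
have Hk t : nrm t <= (w + h) / 2 ^+ n -> nrm (k (pt p q + t) - k (pt p q) - t * l) <= e * nrm t.
  by move=> tn; have := Hr t (le_lt_trans tn nr); rewrite [_ *: 1]mulr1.
have B : nrm (box x' (x' + wN) y' (y' + hN)) <= 2 * e * ((w + h) / 2 ^+ n) ^+ 2.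
  apply: (box_local (p := p) (q := q) (l := l)) => //.
  - exact: lt_le_trans ax c1.
  - exact: le_lt_trans c2 xb.
  - exact: lt_le_trans cy c3.
  - exact: le_lt_trans c4 yd.
have := le_trans c5 B; rewrite leNgt => /negP; apply.
have -> : 4 ^+ n = (2 ^+ n) ^+ 2 :> R.
  have -> : 4 = 2 ^+ 2 :> R by rewrite expr2; lra.
  by rewrite -!exprM mulnC.
rewrite expr_div_n mulrA ltr_pM2r ?invr_gt0 ?exprn_gt0//.
have -> : 2 * e * (w + h) ^+ 2 = eta * (w + h) ^+ 2 / (2 * S ^+ 2).
  by rewrite /e; field; rewrite gt_eqF.
rewrite ltr_pdivrMr ?mulr_gt0 ?exprn_gt0//.
have wS2 : (w + h) ^+ 2 <= S ^+ 2.
  by apply: lerXn2r; [rewrite nnegrE addr_ge0 | rewrite nnegrE ltW | rewrite /S lerDl].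
 have wS3 : eta * (w + h) ^+ 2 <= eta * S ^+ 2 by rewrite ler_wpM2l// ltW.
have : 0 < eta * S ^+ 2 by rewrite mulr_gt0// exprn_gt0.
rewrite [eta * (2 * _)]mulrCA; move: wS3; move: (eta * S ^+ 2) (eta * _) => u v; lra.
Qed.

End WithPrimitives.

(** Cauchy's theorem for a rectangle, from complex differentiability alone. The
    integrals along the sides are increments of primitives. *)
Lemma goursat : exists JH JV : R -> R -> C, [/\
    forall x y, a < x -> x < b -> c <= y -> y <= d -> rder (JH y) x (k (pt x y)),
    forall x y, a <= x -> x <= b -> c < y -> y < d -> rder (JV x) y (k (pt x y)) &
    forall x1 x2 y1 y2, a < x1 -> x1 <= x2 -> x2 < b -> c < y1 -> y1 <= y2 -> y2 < d ->
      JH y1 x2 - JH y1 x1 + Ci R * (JV x2 y2 - JV x2 y1) -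
      (JH y2 x2 - JH y2 x1) - Ci R * (JV x1 y2 - JV x1 y1) = 0].
Proof.
have /choice[JH HH] y : exists G : R -> C, c <= y -> y <= d ->
    forall x, a < x -> x < b -> rder G x (k (pt x y)).
  have [/andP[cy yd]|ny] := boolP ((c <= y) && (y <= d)); last first.
    by exists (fun _ => 0) => cy yd; rewrite cy yd in ny.
  have [x ax xb|G HG] := primitive_ex (g := fun x => k (pt x y)) ab.
    have [l Hl] := k_diff ax xb cy yd.
    apply: (@lder_rcont k (pt 0 y) 1 l) => [s|]; first by rewrite pt_h.
    by rewrite -pt_h.
  by exists G.
have /choice[JV HV] x : exists G : R -> C, a <= x -> x <= b ->
    forall y, c < y -> y < d -> rder G y (k (pt x y)).
  have [/andP[ax xb]|ny] := boolP ((a <= x) && (x <= b)); last first.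
    by exists (fun _ => 0) => ax xb; rewrite ax xb in ny.
  have [y cy yd|G HG] := primitive_ex (g := fun y => k (pt x y)) cd.
    have [l Hl] := k_diff ax xb cy yd.
    apply: (@lder_rcont k (pt x 0) (Ci R) (Ci R * l)) => [s|]; first by rewrite pt_v.
    by rewrite -pt_v; exact: lder_dir.
  by exists G.
exists JH, JV; split.
- by move=> x y ax xb cy yd; exact: HH.
- by move=> x y ax xb cy yd; exact: HV.
- by move=> *; apply: goursat_box => // *; [exact: HH | exact: HV].
Qed.

End Goursat.

(** * Holomorphic functions of one variable *)

Section OneVariable.
Variable R : realType.
Local Notation C := (Cx R).

Lemma lder_scale (V W : normedModType C) (f : V -> W) x v (a : C) l :
  lder f x v l -> lder f x (a *: v) (a *: l).
Proof.
have [-> _|a0 H] := eqVneq a 0.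
  move=> e e0; exists 1 => // t _.
  by rewrite !scale0r !scaler0 addr0 !subrr !nrm0 mulr_ge0 ?nrm_ge0 ?ltW.
move=> e e0; have n0 : 0 < nrm a by rewrite nrm_gt0.
have [r r0 Hr] := H _ (divr_gt0 e0 n0).
exists (r / nrm a) => [|t]; first exact: divr_gt0.
rewrite ltr_pdivlMr// -nrmM => /Hr.
by rewrite nrmM mulrCA divfK ?gt_eqF// !scalerA [nrm t * e]mulrC.
Qed.

Lemma lder_comp (V W : normedModType C) (g : V -> C) (f : C -> W) x v m l :
  lder g x v m -> lder f (g x) 1 l -> lder (fun y => f (g y)) x v (m *: l).
Proof.
move=> Hg Hf e e0.
have nl := nrm_ge0 l; have nm := nrm_ge0 m.
have A0 : 0 < nrm m + 1 by lra.
have B0 : 0 < nrm l + 1 by lra.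
pose e1 := e / 2 / (nrm m + 1); have e10 : 0 < e1 by rewrite !divr_gt0.
pose e2 := Num.min 1 (e / 2 / (nrm l + 1)).
have e20 : 0 < e2 by rewrite lt_min ltr01 !divr_gt0.
have [d1 d10 H1] := Hf _ e10; have [d2 d20 H2] := Hg _ e20.
exists (Num.min d2 (d1 / (nrm m + 1))) => [|t]; first by rewrite lt_min d20 divr_gt0.
rewrite lt_min ltr_pdivlMr// => /andP[/H2 {}H2 td].
set s := g (x + t *: v) - g x in H2.
have sE : g (x + t *: v) = g x + s *: 1 by rewrite [_ *: 1]mulr1 /s subrKC.
have ns : nrm s <= (nrm m + 1) * nrm t.
  rewrite -(subrK (t *: m) s); apply: le_trans (nrm_triD _ _) _; rewrite nrmZ.
  have : e2 <= 1 by rewrite ge_min lexx.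
  move=> e21; have : e2 * nrm t <= 1 * nrm t by rewrite ler_wpM2r ?nrm_ge0.
  lra.
have sd : nrm s < d1 by apply: le_lt_trans ns _; rewrite mulrC.
have F1 := H1 _ sd; rewrite sE.
have -> : f (g x + s *: 1) - f (g x) - t *: (m *: l) =
   (f (g x + s *: 1) - f (g x) - s *: l) + (s - t *: m) *: l.
  by rewrite (scalerBl s) scalerA [t *: m]scaleC subrKA.
apply: le_trans (nrm_triD _ _) _; rewrite nrmZ.
have P1 : e1 * nrm s <= e / 2 * nrm t.
  apply: le_trans (ler_wpM2l (ltW e10) ns) _.
  by rewrite mulrA /e1 divfK// gt_eqF.
have P2 : nrm (s - t *: m) * nrm l <= e / 2 * nrm t.
  apply: le_trans (ler_wpM2r nl H2) _.
  have : e2 * nrm l <= e / 2.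
    apply: (@le_trans _ _ (e2 * (nrm l + 1))); first by rewrite ler_wpM2l ?ltW//; lra.
    by rewrite -ler_pdivlMr// ge_min lexx orbT.
  move=> el; have := ler_wpM2r (nrm_ge0 t) el; rewrite mulrAC; exact.
move: F1 P1 P2; lra.
Qed.

Lemma derivable_mul (f g : C -> C) z : (exists l, lder f z 1 l) ->
  (exists l, lder g z 1 l) -> exists l, lder (fun w => f w * g w) z 1 l.
Proof.
move=> [l /lderP [Hf _]] [m /lderP [Hg _]]; exists ('D_1 (f * g) z).
by have /lderP := derivableP (derivableM Hf Hg).
Qed.

Lemma derivable_inv (c z : C) : z != c -> exists l, lder (fun w => (w - c)^-1) z 1 l.
Proof.
move=> zc; have D : derivable (fun w : C => w - c) z 1.
  by apply: derivableB; [exact: derivable_id | exact: derivable_cst].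
have H (n0 : (fun w : C => w - c) z != 0) := derivableV n0 D.
have zc0 : (fun w : C => w - c) z != 0 by rewrite subr_eq0.
by exists ('D_1 (fun w : C => (w - c)^-1) z); have /lderP := derivableP (H zc0).
Qed.

Section MeanValue.
Variables (f : C -> C) (c : C) (R0 r M : R).
Hypotheses (r0 : 0 < r) (rR : r < R0).
Hypothesis f_cont : forall e, 0 < e -> exists2 d : R, 0 < d &
  forall z, nrm (z - c) < d -> nrm (f z - f c) <= e.
Hypothesis f_diff : forall z, 0 < nrm (z - c) -> nrm (z - c) < R0 ->
  exists l, lder f z 1 l.
Hypothesis f_bound : forall z, nrm (z - c) = r -> nrm (f z) <= M.

(** The substitution z = c + exp w turns the circles about c into vertical
    segments, and Goursat's lemma for the resulting periodic function says that
    the mean of f over a circle does not depend on the radius.  Mere continuity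
    at c identifies the mean over small circles with f c. *)
Lemma center_le_circle : nrm (f c) <= M.
Proof.
apply/ler_addgt0Pr => e e0.
have [d d0 Hd] := f_cont e0.
(* on the circle of radius rho, f is within e of f c *)
pose rho := Num.min d r / 2.
have m0 : 0 < Num.min d r by rewrite lt_min d0.
have rho0 : 0 < rho by rewrite divr_gt0.
have rhom : rho < Num.min d r by rewrite ltr_pdivrMr// ltr_pMr// ltr1n.
have [rhod rhor] : rho < d /\ rho < r by move: rhom; rewrite lt_min => /andP.
pose r' := (r + R0) / 2.
have [rr' r'R] : r < r' /\ r' < R0 by have := rR; rewrite /r'; split; lra.
pose k (w : C) := f (c + cexp w).
pose P : R := pi *+ 2.
have P0 : 0 < P by rewrite pmulrn_lgt0// pi_gt0.
have ab : ln rho - 1 < ln r'.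
  by rewrite ltrBlDr (@lt_trans _ _ (ln r'))// ?ltrDl// ltr_ln// ?posrE ?(lt_trans r0 rr')// (lt_trans rhor).
have cd : -1 < P + 1 by lra.
have nE x y : nrm (c + cexp (pt x y) - c) = expR x.
  by rewrite addrC addKr nrm_cexp /pt ReD Re_iC addr0.
have kd x y : ln rho - 1 <= x -> x <= ln r' -> -1 <= y -> y <= P + 1 ->
    exists l, lder k (pt x y) 1 l.
  move=> _ xb _ _.
  have [l Hl] : exists l, lder f (c + cexp (pt x y)) 1 l.
    apply: f_diff; rewrite nE ?expR_gt0//; apply: le_lt_trans r'R.
    by rewrite -(@lnK _ r') ?posrE ?ler_expR// (lt_trans r0).
  exists (cexp (pt x y) *: l); apply: (@lder_comp _ _ (fun w => c + cexp w)) => //.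
  move=> e' /(cexp_der (pt x y))[d' d'0 Hd']; exists d' => // t /Hd'.
  by rewrite opprD addrACA subrr add0r.
have [JH [JV [HJH HJV Hbox]]] := goursat ab cd kd.
have lr : ln rho < ln r by rewrite ltr_ln ?posrE.
have rl : ln r < ln r' by rewrite ltr_ln ?posrE// (lt_trans r0).
have ax : ln rho - 1 < ln rho by lra.
have := Hbox (ln rho) (ln r) 0 P ax (ltW lr) rl.
have N10 : -1 < 0 :> R by lra.
have PP : P < P + 1 by lra.
move=> /(_ N10 (ltW P0) PP).
set H0 := JH 0 _ - _; set HP := JH P _ - _; set Vr := JV (ln r) P - _.
set Vp := JV (ln rho) P - _ => HB.
have HE : H0 = HP.
  apply/eqP; rewrite -subr_eq0 -nrm_eq0 eq_le nrm_ge0 andbT.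
  have -> : H0 - HP = (JH 0 (ln r) - JH P (ln r)) - (JH 0 (ln rho) - JH P (ln rho)).
    rewrite /H0 /HP; ring.
  rewrite -[leRHS](mul0r (ln r - ln rho)).
  apply: (@mvi R C (fun x => JH 0 x - JH P x)) (ltW lr) _ => x x1 x2.
  exists (k (pt x 0) - k (pt x P)); first by apply: rderB; apply: HJH; lra.
  have -> : pt x P = pt x 0 + Ci R * toC P.
    by rewrite /pt; apply: complex_eq; rewrite !(ReD, ImD, Re_mul, Im_mul) /=; ring.
  by rewrite /k cexpD cexp_2pi mulr1 subrr nrm0.
have VE : Vr = Vp.
  have : Ci R * (Vr - Vp) = 0 by rewrite -HB HE; ring.
  by move=> /eqP; rewrite mulf_eq0 -nrm_eq0 nrm_i oner_eq0 subr_eq0 => /eqP.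
have Br : nrm Vr <= M * P.
  rewrite -[P]subr0; apply: (@mvi R C (JV (ln r))) (ltW P0) _ => y y1 y2.
  exists (k (pt (ln r) y)); first by apply: HJV; lra.
  by apply: f_bound; rewrite nE lnK ?posrE.
have Bp : nrm (Vp - toC P * f c) <= e * P.
  have -> : Vp - toC P * f c = (JV (ln rho) P - toC P *: f c) - (JV (ln rho) 0 - toC 0 *: f c).
    by rewrite scale0r subr0 scaleC /Vp; ring.
  rewrite -[P in leRHS]subr0.
  apply: (@mvi R C (fun y => JV (ln rho) y - toC y *: f c)) (ltW P0) _ => y y1 y2.
  exists (k (pt (ln rho) y) - f c); first by apply: rderB; [apply: HJV; lra | exact: rder_lin].
  by apply: Hd; rewrite nE lnK ?posrE.
rewrite -(ler_pM2r P0); have -> : nrm (f c) * P = nrm (toC P * f c).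
  by rewrite nrmM nrm_toC gtr0_norm// mulrC.
rewrite -(subrK Vp (toC P * f c)); apply: le_trans (nrm_triD _ _) _.
rewrite [nrm (_ - Vp)]nrmB; move: Bp Br; rewrite VE; move: (nrm _) (nrm _) => u v; lra.
Qed.

End MeanValue.

Section Estimates.
Variables (f f' : C -> C) (c : C) (R0 M : R).
Hypothesis R00 : 0 < R0.
Hypothesis f_diff : forall z, nrm (z - c) < R0 -> lder f z 1 (f' z).
Hypothesis f_bound : forall z, nrm (z - c) < R0 -> nrm (f z) <= M.

(** The mean value inequality for the difference quotient, extended by the
    derivative at c. All radii r below R0 are allowed, whence the bound with R0
    itself. *)
Lemma cauchy_estimate : nrm (f' c) <= 2 * M / R0.
Proof.
have cc : nrm (c - c) < R0 by rewrite subrr nrm0.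
suff H r : 0 < r -> r < R0 -> nrm (f' c) <= 2 * M / r.
  have [n0|n0] := leP (nrm (f' c)) 0.
    by apply: le_trans n0 _; rewrite divr_ge0 ?(ltW R00)// mulr_ge0// (le_trans (nrm_ge0 _) (f_bound cc)).
  rewrite ler_pdivlMr//; apply/ler_addgt0Pr => e e0.
  pose r := Num.max (R0 / 2) (R0 - e / nrm (f' c)).
  have r0 : 0 < r by rewrite lt_max divr_gt0.
  have rR : r < R0 by rewrite gt_max ltr_pdivrMr// ltr_pMr// ltr1n/= ltrBlDr ltrDl divr_gt0.
  have := H r r0 rR; rewrite ler_pdivlMr// => H1.
  have : R0 - e / nrm (f' c) <= r by rewrite le_max lexx orbT.
  rewrite -(ler_pM2l n0) mulrBr mulrCA divff ?gt_eqF//; lra.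
move=> r0 rR; pose q z := if z == c then f' c else (z - c)^-1 * (f z - f c).
suff : nrm (q c) <= 2 * M / r by rewrite /q eqxx.
have q_c : forall e, 0 < e -> exists2 d : R, 0 < d &
    forall z, nrm (z - c) < d -> nrm (q z - q c) <= e.
  move=> e e0; have [d d0 Hd] := f_diff cc e0; exists d => // z /Hd; rewrite [_ *: 1]mulr1 subrKC.
  rewrite /q eqxx; case: eqVneq => [->|zc H]; first by move=> _; rewrite subrr nrm0; exact: ltW.
  have z0 : z - c != 0 by rewrite subr_eq0.
  rewrite -(ler_pM2l (_ : 0 < nrm (z - c))) ?nrm_gt0// -nrmM mulrBr mulVKf//.
  by rewrite [nrm (z - c) * e]mulrC; exact: H.
apply: (center_le_circle r0 rR q_c) => [z z0 zR|z zr].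
  have zc : z - c != 0 by rewrite -nrm_gt0.
  have /lderP dz := f_diff zR.
  have [l' D'] : exists l, lder (fun z => (z - c)^-1 * (f z - f c)) z 1 l.
    apply: derivable_mul; first by apply: derivable_inv; rewrite -subr_eq0.
    by exists (f' z - 0); apply/lderP; apply: is_deriveB => //; exact: is_derive_cst.
  exists l'.
  apply: lder_near D'; apply/nearP; exists (nrm (z - c)) => // y yz.
  rewrite /q; case: eqVneq => // yc.
  by move: yz; rewrite yc nrmB ltxx.
rewrite /q; case: eqVneq => [zc|zc].
  by move: r0; rewrite -zr zc subrr nrm0 ltxx.
rewrite nrmM nrmV zr mulrC ler_pM2r ?invr_gt0//.
apply: le_trans (nrm_triB _ _) _; have := f_bound cc; have := @f_bound z; rewrite zr => /(_ rR).
lra.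
Qed.

End Estimates.

Section Estimates2.
Variables (f f' : C -> C) (c : C) (R0 M : R).
Hypothesis R00 : 0 < R0.
Hypothesis f_diff : forall z, nrm (z - c) < R0 -> lder f z 1 (f' z).
Hypothesis f_bound : forall z, nrm (z - c) < R0 -> nrm (f z) <= M.

Lemma segment_bound (z : C) K : nrm (z - c) < R0 ->
  (forall y, nrm (y - c) <= nrm (z - c) -> nrm (f' y) <= K) ->
  nrm (f z - f c) <= K * nrm (z - c).
Proof.
move=> zR HK.
have nt t : 0 <= t -> t <= 1 -> nrm (c + toC t *: (z - c) - c) <= nrm (z - c).
  by move=> t0 t1; rewrite addrC addKr nrmZ nrm_toC ger0_norm// ler_piMl// nrm_ge0.
have := @mvi R C (fun t => f (c + toC t *: (z - c))) 0 1 (nrm (z - c) * K) ler01.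
rewrite scale0r scale1r addr0 subrKC subr0 mulr1 [K * _]mulrC => H; apply: H => t t0 t1.
exists ((z - c) *: f' (c + toC t *: (z - c))).
  apply: (@lder_rder _ _ _ f).
  have := @lder_scale C C f _ 1 (z - c) _ (f_diff (le_lt_trans (nt _ t0 t1) zR)).
  by rewrite [_ *: 1]mulr1.
by rewrite nrmZ ler_wpM2l ?nrm_ge0// HK// nt.
Qed.

Lemma lipschitz_center (z : C) : nrm (z - c) < R0 / 2 ->
  nrm (f z - f c) <= 4 * M / R0 * nrm (z - c).
Proof.
move=> zR; have R00' := R00; apply: segment_bound => [|y yz]; first lra.
have -> : 4 * M / R0 = 2 * M / (R0 / 2) by field; rewrite gt_eqF.
have yin w : nrm (w - y) < R0 / 2 -> nrm (w - c) < R0.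
  by move=> wy; apply: le_lt_trans (nrm_tri y _ _) _; lra.
apply: (@cauchy_estimate f f') => [|w /yin|w /yin]; [by rewrite divr_gt0 | exact: f_diff | exact: f_bound].
Qed.

End Estimates2.

Lemma lder_shift (f : C -> C) x z l : lder f (z + x) 1 l -> lder (fun w => f (w + x)) z 1 l.
Proof. by move=> H e /H[d d0 Hd]; exists d => // t /Hd; rewrite [z + t *: 1 + x]addrAC. Qed.

Section Estimates3.
Variables (f f' : C -> C) (c : C) (R0 M : R).
Hypothesis R00 : 0 < R0.
Hypothesis f_diff : forall z, nrm (z - c) < R0 -> lder f z 1 (f' z).
Hypothesis f_bound : forall z, nrm (z - c) < R0 -> nrm (f z) <= M.

(** Cauchy's estimate for the increments f(z + x) - f(z), which are themselves of
    order |x|: this bounds the second derivative without introducing it. *)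
Lemma derivative_lipschitz (x : C) : nrm x <= R0 / 4 ->
  nrm (f' (c + x) - f' c) <= 64 * M * nrm x / R0 ^+ 2.
Proof.
move=> xR; have R00' := R00.
have M0 : 0 <= M by apply: le_trans (nrm_ge0 (f c)) (f_bound _); rewrite subrr nrm0.
have H z : nrm (z - c) < R0 / 4 -> nrm (f (z + x) - f z) <= 16 / 3 * M / R0 * nrm x.
  move=> zR; have xE : nrm (z + x - z) = nrm x by rewrite addrC addKr.
  have win w : nrm (w - z) < 3 / 4 * R0 -> nrm (w - c) < R0.
    by move=> wz; apply: le_lt_trans (nrm_tri z _ _) _; lra.
  have := @lipschitz_center f f' z (3 / 4 * R0) M.
  move=> /(_ _ (fun w wz => f_diff (win w wz)) (fun w wz => f_bound (win w wz)) (z + x)).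
  rewrite xE => H; have {}H := H (_ : 0 < 3 / 4 * R0).
  have -> : 16 / 3 * M / R0 = 4 * M / (3 / 4 * R0) by field; rewrite gt_eqF.
  by apply: H; lra.
have := @cauchy_estimate (fun z => f (z + x) - f z) (fun z => f' (z + x) - f' z) c (R0 / 4)
  (16 / 3 * M / R0 * nrm x) (divr_gt0 R00 (ltr0n _ 4)).
have R2 : 0 < R0 ^+ 2 by rewrite exprn_gt0.
have n0 := nrm_ge0 x.
move=> /(_ _ H) H2; apply: (@le_trans _ _ (2 * (16 / 3 * M / R0 * nrm x) / (R0 / 4))).
  apply: H2 => z zR.
  apply/lderP; apply: is_deriveB; apply/lderP; last by apply: f_diff; lra.
  apply: lder_shift; apply: f_diff; rewrite addrAC; apply: le_lt_trans (nrm_triD _ _) _; lra.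
have -> : 2 * (16 / 3 * M / R0 * nrm x) / (R0 / 4) = 128 / 3 * (M * nrm x / R0 ^+ 2).
  by field; rewrite gt_eqF.
have -> : 64 * M * nrm x / R0 ^+ 2 = 64 * (M * nrm x / R0 ^+ 2) by field; rewrite gt_eqF.
by rewrite ler_wpM2r ?divr_ge0 ?mulr_ge0// ?ltW//; lra.
Qed.

(** A second order remainder with a constant depending on the bound M and the
    radius only; such uniform remainders survive passage to the limit and sums of
    several increments. *)
Lemma taylor2 (x : C) : nrm x <= R0 / 4 ->
  nrm (f (c + x) - f c - x * f' c) <= 64 * M * nrm x ^+ 2 / R0 ^+ 2.
Proof.
move=> xR; have R00' := R00; pose g z := f z - (z - c) * f' c.
have M0 : 0 <= M by apply: le_trans (nrm_ge0 (f c)) (f_bound _); rewrite subrr nrm0.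
have R2 : 0 < R0 ^+ 2 by rewrite exprn_gt0.
have xE : c + x - c = x by rewrite addrC addKr.
have := @segment_bound g (fun z => f' z - f' c) c R0.
have gd z : nrm (z - c) < R0 -> lder g z 1 (f' z - f' c).
  move=> zR; apply/lderP; apply: is_deriveB; first exact/lderP/f_diff.
  apply/lderP => e e0; exists 1 => // t _.
  have -> : (z + t *: 1 - c) * f' c - (z - c) * f' c - t *: f' c = 0 by rewrite !scaleC; ring.
  by rewrite nrm0 mulr_ge0 ?nrm_ge0// ltW.
move=> /(_ gd (c + x) (64 * M * nrm x / R0 ^+ 2)); rewrite xE => H.
have -> : f (c + x) - f c - x * f' c = g (c + x) - g c by rewrite /g; ring.
have -> : 64 * M * nrm x ^+ 2 / R0 ^+ 2 = 64 * M * nrm x / R0 ^+ 2 * nrm x by field; rewrite gt_eqF.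
apply: H => [|y yx]; first lra.
have -> : y = c + (y - c) by rewrite subrKC.
apply: le_trans (derivative_lipschitz (le_trans yx xR)) _.
by rewrite ler_pM2r ?invr_gt0// ler_wpM2l// mulr_ge0.
Qed.

End Estimates3.

(** A holomorphic function that vanishes near c is divisible by every power of
    z - c; the mean value of the quotient at a nearby point tends to 0. *)
Lemma identity_disc (f : C -> C) (c z0 : C) (R0 M d : R) : 0 < d ->
  (forall z, nrm (z - c) < R0 -> exists l, lder f z 1 l) ->
  (forall z, nrm (z - c) < R0 -> nrm (f z) <= M) ->
  (forall z, nrm (z - c) < d -> f z = 0) ->
  nrm (z0 - c) < R0 / 4 -> f z0 = 0.
Proof.
move=> d0 fd fb fz z0R.
have R00 : 0 < R0 by have := nrm_ge0 (z0 - c); lra.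
have M0 : 0 <= M by apply: le_trans (nrm_ge0 (f c)) (fb _ _); rewrite subrr nrm0.
have [->|z0c] := eqVneq z0 c; first by apply: fz; rewrite subrr nrm0.
(* the circle of radius rho about z0 keeps the distance 1 / q from c, while z0
   is within R0 / 4 of c: each factor z - c gains 2 / 3 *)
pose rho := 5 / 8 * R0; pose q := (3 / 8 * R0)^-1.
have rho0 : 0 < rho by rewrite /rho; lra.
have rhoR : rho < 3 / 4 * R0 by rewrite /rho; lra.
have q0 : 0 < q by rewrite invr_gt0; lra.
have nz : 0 < nrm (z0 - c) by rewrite nrm_gt0 subr_eq0.
have B n : nrm (f z0) <= M * (2 / 3) ^+ n.
  (* divided by (z - c)^n, f stays holomorphic because it vanishes near c *)
  pose g z := (z - c)^-1 ^+ n * f z.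
  have gd z : nrm (z - z0) < 3 / 4 * R0 -> exists l, lder g z 1 l.
    move=> zz; have zR : nrm (z - c) < R0 by apply: le_lt_trans (nrm_tri z0 _ _) _; lra.
    have [l /lderP Hl] := fd z zR.
    have [zc|zc] := eqVneq z c.
      exists 0; apply: (@lder_near _ _ _ (fun=> 0)); last first.
        by apply/lderP; exact: is_derive_cst.
      by apply/nearP; exists d => // y; rewrite zc => /fz; rewrite /g => ->; rewrite mulr0.
    apply: derivable_mul; last by exists l; apply/lderP.
    elim: n {g} => [|n [l' IH]].
      by exists 0; apply/lderP; exact: is_derive_cst.
    have [l2 H2] := derivable_mul (derivable_inv zc) (ex_intro _ l' IH).
    by exists l2; apply: lder_near H2; apply/nearP; exists 1 => // y _; rewrite exprS.
  have gc : forall e, 0 < e -> exists2 d' : R, 0 < d' &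
      forall z, nrm (z - z0) < d' -> nrm (g z - g z0) <= e.
    move=> e e0; have [|l Hl] := gd z0; first by rewrite subrr nrm0; lra.
    have [d' d'0 Hd'] := lder_cont Hl e0; exists d' => // z zd.
    by have := Hd' _ zd; rewrite [_ *: 1]mulr1 subrKC.
  have gb z : nrm (z - z0) = rho -> nrm (g z) <= q ^+ n * M.
    move=> zr; have zR : nrm (z - c) < R0.
      by apply: le_lt_trans (nrm_tri z0 _ _) _; rewrite zr /rho; lra.
    have zl : 3 / 8 * R0 <= nrm (z - c).
      have := nrm_tri c z z0; rewrite zr [nrm (c - z0)]nrmB /rho; lra.
    rewrite /g nrmM nrmX nrmV; apply: ler_pM; rewrite ?nrm_ge0 ?exprn_ge0 ?invr_ge0 ?nrm_ge0//; last exact: fb.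
    have zl0 : 0 < 3 / 8 * R0 by lra.
    have zn : 0 < nrm (z - c) by exact: lt_le_trans zl.
    by apply: lerXn2r; [rewrite nnegrE invr_ge0 ltW | rewrite nnegrE ltW | rewrite /q lef_pV2].
  have := center_le_circle rho0 rhoR gc (fun z _ zR => gd z zR) gb.
  rewrite /g nrmM nrmX nrmV => H.
  have : nrm (z0 - c) ^+ n * ((nrm (z0 - c))^-1 ^+ n * nrm (f z0)) <= (2 / 3 / q) ^+ n * (q ^+ n * M).
    apply: ler_pM => //; rewrite ?exprn_ge0 ?nrm_ge0// ?mulr_ge0 ?exprn_ge0 ?invr_ge0 ?nrm_ge0//.
    have qE : 2 / 3 / q = R0 / 4 by rewrite /q invrK; field.
    by rewrite qE; apply: lerXn2r; rewrite ?nnegrE ?nrm_ge0 ?divr_ge0 ?(ltW R00) ?(ltW z0R).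
  rewrite !mulrA -!exprMn divff ?gt_eqF// divfK ?gt_eqF// expr1n mul1r => H1.
  by rewrite mulrC.
apply/eqP; rewrite -nrm_eq0 eq_le nrm_ge0 andbT; apply/ler_addgt0Pr => e e0; rewrite add0r.
have [ME|Mn] := eqVneq M 0.
  by have := B 0%N; rewrite ME mul0r => /le_trans -> //; exact: ltW.
have Mp : 0 < M by rewrite lt_neqAle eq_sym Mn.
have : (fun n => (2 / 3 : R) ^+ n) @ \oo --> (0 : R).
  by apply: cvg_expr; rewrite ger0_norm; lra.
move=> /cvgrPdist_lt /(_ (e / M)) /(_ (divr_gt0 e0 Mp)) [N _ /(_ N (leqnn _))].
have p0 : 0 <= (2 / 3 : R) ^+ N by rewrite exprn_ge0// divr_ge0.
rewrite /= sub0r normrN ger0_norm//.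
rewrite ltr_pdivlMr// => H; apply: le_trans (B N) _; rewrite mulrC; exact: ltW.
Qed.

End OneVariable.

(** * Holomorphic functions of several variables *)

Section Frechet.
Variable R : realType.
Local Notation C := (Cx R).

(** The bound on L provides the continuity that a differential must have. *)
Lemma diff_of (V W : normedModType C) (f : V -> W) (x : V) (L : {linear V -> W}) (K : R) :
  (forall h, nrm (L h) <= K * nrm h) ->
  (forall e : R, 0 < e -> exists2 d : R, 0 < d &
    forall h, nrm h < d -> nrm (f (x + h) - f x - L h) <= e * nrm h) ->
  differentiable f x.
Proof.
move=> LK Hf.
have Lc : continuous L.
  move=> y; apply/cvgrPdist_le => _/pos_toC[e e0 ->].
  have K0 : 0 < `|K| + 1 by rewrite ltr_wpDl.
  apply/nearP; exists (e / (`|K| + 1)) => [|z]; first exact: divr_gt0.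
  rewrite ltr_pdivlMr// => zy; rewrite -linearB nrmE toC_le nrmB in zy *.
  apply: le_trans (LK _) _; apply: le_trans (ltW zy); rewrite mulrC ler_wpM2l ?nrm_ge0//.
  by rewrite (le_trans (ler_norm _))// lerDl.
have E : f \o shift x = cst (f x) + L +o_ 0 id.
  apply/eqaddoP => _/pos_toC[e e0 ->]; have [d d0 Hd] := Hf e e0.
  apply/nearP; exists d => // h; rewrite subr0 => /Hd H.
  rewrite !nrmE -toCM toC_le; apply: le_trans H.
  by rewrite -[(_ - _) h]/(f (h + x) - (f x + L h)) opprD addrA (addrC h).
have dE := diff_unique Lc E.
by apply/diff_locallyP; rewrite dE; split.
Qed.

Lemma lder_quad (V W : normedModType C) (f : V -> W) (x v : V) l (K d : R) : 0 < d ->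
  (forall t : C, nrm t < d -> nrm (f (x + t *: v) - f x - t *: l) <= K * nrm t ^+ 2) ->
  lder f x v l.
Proof.
move=> d0 H e e0; have K0 : 0 < `|K| + 1 by rewrite ltr_wpDl.
exists (Num.min d (e / (`|K| + 1))) => [|t]; first by rewrite lt_min d0 divr_gt0.
rewrite lt_min ltr_pdivlMr// => /andP[/H {}H te]; apply: le_trans H _.
rewrite expr2 mulrA ler_wpM2r ?nrm_ge0//; apply: le_trans (ltW te).
rewrite mulrC ler_wpM2l ?nrm_ge0//.
by rewrite (le_trans (ler_norm _))// lerDl.
Qed.

Section Gateaux.
Variable V : normedModType C.
Variables (f : V -> C) (D : V -> V -> C) (x0 : V) (r M : R).
Hypothesis r0 : 0 < r.
Hypothesis fD : forall x, nrm (x - x0) < r -> forall v, lder f x v (D x v).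
Hypothesis fb : forall x, nrm (x - x0) < r -> nrm (f x) <= M.

Let M0 : 0 <= M.
Proof. by apply: le_trans (nrm_ge0 (f x0)) (fb _); rewrite subrr nrm0. Qed.

Let in_line (x v : V) (t : C) (s : R) : nrm (x - x0) < s -> nrm t * nrm v <= r - s -> nrm (x + t *: v - x0) < r.
Proof.
move=> xs tv; rewrite addrAC; apply: le_lt_trans (nrm_triD _ _) _; rewrite nrmZ; lra.
Qed.

Let line_lder (x v : V) (t : C) (s : R) : nrm (x - x0) < s -> nrm t * nrm v <= r - s ->
  lder (fun s : C => f (x + s *: v)) t 1 (D (x + t *: v) v).
Proof. by move=> xs tv; apply/lder_line/fD/(in_line xs tv). Qed.

Let in_disc (v : V) (s t : R) : v != 0 -> t < s / nrm v -> t * nrm v <= s.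
Proof. by move=> v0 ts; rewrite -ler_pdivlMr ?nrm_gt0// ltW. Qed.

(** The next estimates are the one-variable ones on the complex line through x in
    the direction v, of which a disc of radius r / (2 |v|) lies in the ball; all
    constants are homogeneous in v. *)
Lemma gateaux_lip x v : nrm (x - x0) < r / 2 -> nrm v < r / 4 ->
  nrm (f (x + v) - f x) <= 8 * M / r * nrm v.
Proof.
move=> xr vr; have [->|v0] := eqVneq v 0.
  by rewrite addr0 subrr !nrm0 mulr0.
have nv : 0 < nrm v by rewrite nrm_gt0.
have rr : r - r / 2 = r / 2 by lra.
have := @lipschitz_center R (fun s : C => f (x + s *: v)) (fun t : C => D (x + t *: v) v) 0 (r / 2 / nrm v) M.
rewrite scale0r addr0 => H; have {}H := H _ _ _ 1.
rewrite subr0 nrm1 scale1r mulr1 in H.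
have -> : 8 * M / r * nrm v = 4 * M / (r / 2 / nrm v) by field; rewrite !gt_eqF.
apply: H; first by rewrite !divr_gt0.
- by move=> z; rewrite subr0 => /(in_disc v0) zv; apply: line_lder xr _; rewrite rr.
- by move=> z; rewrite subr0 => /(in_disc v0) zv; apply: fb; apply: in_line xr _; rewrite rr.
- by rewrite ltr_pdivlMr// mul1r ltr_pdivlMr//; lra.
Qed.

Lemma gateaux_cauchy x v : nrm (x - x0) < r / 2 -> nrm (D x v) <= 4 * M / r * nrm v.
Proof.
move=> xr; have [->|v0] := eqVneq v 0.
  have xr' : nrm (x - x0) < r by have := r0; lra.
  have := fD xr' (0 *: 0); have := @lder_scale R V C f x 0 0 (D x 0) (fD xr' 0) => H1.
  rewrite scaler0 in H1 * => H2; rewrite (lder_uniq H2 H1) scale0r !nrm0 mulr0//.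
have nv : 0 < nrm v by rewrite nrm_gt0.
have rr : r - r / 2 = r / 2 by lra.
have := @cauchy_estimate R (fun s : C => f (x + s *: v)) (fun t : C => D (x + t *: v) v) 0 (r / 2 / nrm v) M.
rewrite scale0r addr0 => H.
have -> : 4 * M / r * nrm v = 2 * M / (r / 2 / nrm v) by field; rewrite !gt_eqF.
apply: H; first by rewrite !divr_gt0.
- by move=> z; rewrite subr0 => /(in_disc v0) zv; apply: line_lder xr _; rewrite rr.
- by move=> z; rewrite subr0 => /(in_disc v0) zv; apply: fb; apply: in_line xr _; rewrite rr.
Qed.

Lemma gateaux_taylor x v : nrm (x - x0) < r / 2 -> nrm v <= r / 8 ->
  nrm (f (x + v) - f x - D x v) <= 256 * M / r ^+ 2 * nrm v ^+ 2.
Proof.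
move=> xr vr; have [v0|v0] := eqVneq v 0.
  have := gateaux_cauchy v xr; rewrite v0 addr0 subrr sub0r nrmN nrm0 mulr0 => H.
  by apply: le_trans H _; rewrite expr0n mulr0.
have nv : 0 < nrm v by rewrite nrm_gt0.
have rr : r - r / 2 = r / 2 by lra.
have := @taylor2 R (fun s : C => f (x + s *: v)) (fun t : C => D (x + t *: v) v) 0 (r / 2 / nrm v) M.
rewrite scale0r addr0 => H; have {}H := H _ _ _ 1.
rewrite add0r nrm1 scale1r mul1r expr1n mulr1 in H.
have -> : 256 * M / r ^+ 2 * nrm v ^+ 2 = 64 * M / (r / 2 / nrm v) ^+ 2 by field; rewrite !gt_eqF.
apply: H; first by rewrite !divr_gt0.
- by move=> z; rewrite subr0 => /(in_disc v0) zv; apply: line_lder xr _; rewrite rr.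
- by move=> z; rewrite subr0 => /(in_disc v0) zv; apply: fb; apply: in_line xr _; rewrite rr.
- by rewrite ler_pdivlMr// mul1r ler_pdivlMr//; lra.
Qed.

(** Cauchy's estimate on the line in the direction w, for the difference of two
    translates of f, which is small by [gateaux_lip]. *)
Lemma gateaux_dlip x y w : nrm (x - x0) < r / 4 -> nrm y < r / 4 ->
  nrm (D (x + y) w - D x w) <= 64 * M / r ^+ 2 * nrm y * nrm w.
Proof.
move=> xr yr; have r0' := r0; have [w0|w0] := eqVneq w 0.
  have xr2 : nrm (x - x0) < r / 2 by lra.
  have xyr2 : nrm (x + y - x0) < r / 2.
    by rewrite addrAC; apply: le_lt_trans (nrm_triD _ _) _; lra.
  have := gateaux_cauchy w xr2; have := gateaux_cauchy w xyr2.
  rewrite w0 nrm0 !mulr0 => H1 H2; apply: le_trans (nrm_triB _ _) _; lra.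
have nw : 0 < nrm w by rewrite nrm_gt0.
have := @cauchy_estimate R (fun s : C => f (x + y + s *: w) - f (x + s *: w))
  (fun t : C => D (x + y + t *: w) w - D (x + t *: w) w) 0 (r / 4 / nrm w) (8 * M / r * nrm y).
rewrite scale0r !addr0 => H.
have -> : 64 * M / r ^+ 2 * nrm y * nrm w = 2 * (8 * M / r * nrm y) / (r / 4 / nrm w).
  by field; rewrite !gt_eqF.
apply: H; first by rewrite !divr_gt0.
- move=> z; rewrite subr0 => /(in_disc w0) zw.
  apply/lderP; apply: is_deriveB; apply/lderP.
    apply: (@line_lder _ _ _ (r / 2)); last lra.
    by rewrite addrAC; apply: le_lt_trans (nrm_triD _ _) _; lra.
  by apply: (@line_lder _ _ _ (r / 4)) => //; lra.
- move=> z; rewrite subr0 => /(in_disc w0) zw.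
  rewrite addrAC; apply: gateaux_lip => //.
  by rewrite addrAC; apply: le_lt_trans (nrm_triD _ _) _; rewrite nrmZ; lra.
Qed.

Lemma gateaux_scale x v (a : C) : nrm (x - x0) < r -> D x (a *: v) = a * D x v.
Proof.
move=> xr; exact: lder_uniq (fD xr (a *: v)) (lder_scale a (fD xr v)).
Qed.

(** Additivity of the derivative in its direction: going along v and then along
    w changes the derivative in the direction w by an amount of first order only,
    so the errors are of second order. *)
Lemma gateaux_add v w : D x0 (v + w) = D x0 v + D x0 w.
Proof.
have xx s : 0 < s -> nrm (x0 - x0) < s by rewrite subrr nrm0.
apply: lder_uniq (fD (xx _ r0) (v + w)) _.
have n0 : 0 < nrm v + nrm w + 1 by rewrite ltr_wpDl// addr_ge0// nrm_ge0.
have r8 : 0 < r / 8 by rewrite divr_gt0.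
pose K := 256 * M / r ^+ 2.
have K0 : 0 <= K by rewrite divr_ge0 ?exprn_ge0 ?mulr_ge0// ltW.
apply: (@lder_quad _ _ _ _ _ _ (K * nrm w ^+ 2 + K * nrm v ^+ 2 + K * nrm v * nrm w)
  (r / 8 / (nrm v + nrm w + 1))); first exact: divr_gt0.
move=> t; rewrite ltr_pdivlMr// => td; have nt := nrm_ge0 t.
have nv := nrm_ge0 v; have nw := nrm_ge0 w.
have [tv tw] : nrm t * nrm v < r / 8 /\ nrm t * nrm w < r / 8.
  have := mulr_ge0 nt nv; have := mulr_ge0 nt nw; split; lra.
have x1 : nrm (x0 + t *: v - x0) < r / 2 by rewrite addrC addKr nrmZ; lra.
have x1' : nrm (x0 + t *: v - x0) < r by lra.
have T1 : nrm (t *: w) <= r / 8 by rewrite nrmZ ltW.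
have T2 : nrm (t *: v) <= r / 8 by rewrite nrmZ ltW.
have T3 : nrm (t *: v) < r / 4 by rewrite nrmZ; lra.
have r2 : 0 < r / 2 by lra.
have r4 : 0 < r / 4 by lra.
have H1 := gateaux_taylor x1 T1.
have H2 := gateaux_taylor (xx _ r2) T2.
have H3 := gateaux_dlip w (xx _ r4) T3.
rewrite !gateaux_scale ?xx// in H1 H2.
rewrite !nrmZ in H1 H2 H3.
have -> : f (x0 + t *: (v + w)) - f x0 - t *: (D x0 v + D x0 w) =
  (f (x0 + t *: v + t *: w) - f (x0 + t *: v) - t * D (x0 + t *: v) w) +
  (f (x0 + t *: v) - f x0 - t * D x0 v) + t * (D (x0 + t *: v) w - D x0 w).
  by rewrite scalerDr addrA !scaleC; ring.
apply: le_trans (nrm_triD _ _) _; apply: le_trans (lerD (nrm_triD _ _) (lexx _)) _.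
rewrite nrmM; have H4 := ler_wpM2l nt H3.
have H5 : 0 <= (K - 64 * M / r ^+ 2) * (nrm t * nrm t * nrm v * nrm w).
  rewrite mulr_ge0// ?mulr_ge0// /K -mulrBl divr_ge0 ?exprn_ge0 ?(ltW r0)//; have := M0; lra.
rewrite -/K !exprMn in H1 H2; rewrite expr2 in H1 H2 *; move: H1 H2 H4 H5.
set a := nrm (_ - _); set b := nrm (_ - _); set c := nrm (_ - _); lra.
Qed.

(** The derivatives form a bounded linear map, and the second order remainder is
    uniform in the direction. *)
Lemma gateaux_frechet : differentiable f x0.
Proof.
have xx s : 0 < s -> nrm (x0 - x0) < s by rewrite subrr nrm0.
have lin : linear (D x0).
  by move=> a v w; rewrite gateaux_add gateaux_scale// xx.
pose L : {linear V -> C} := HB.pack (D x0) (GRing.isLinear.Build _ _ _ _ (D x0) lin).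
have r2 : 0 < r / 2 by rewrite divr_gt0.
apply: (@diff_of _ _ _ _ L (4 * M / r)) => [h|e e0]; first by apply: gateaux_cauchy; exact: xx.
have K0 : 0 <= 256 * M / r ^+ 2 by rewrite divr_ge0 ?exprn_ge0 ?mulr_ge0// ltW.
have K1 : 0 < 256 * M / r ^+ 2 + 1 by rewrite ltr_wpDl.
exists (Num.min (r / 8) (e / (256 * M / r ^+ 2 + 1))) => [|h].
  by rewrite lt_min !divr_gt0.
rewrite lt_min => /andP[h8]; rewrite ltr_pdivlMr// => he.
apply: le_trans (gateaux_taylor (xx _ r2) (ltW h8)) _.
rewrite expr2 mulrA ler_wpM2r ?nrm_ge0//; apply: le_trans (ltW he).
by rewrite mulrC ler_wpM2l ?nrm_ge0// lerDl.
Qed.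

End Gateaux.

(** Derivatives in all complex directions are chosen, and combine into a
    differential by the estimates above. *)
Lemma holomorphic_of_lines (V : normedModType C) (f : V -> C) (x0 : V) (r M : R) : 0 < r ->
  (forall x, nrm (x - x0) < r -> forall v, exists l, lder f x v l) ->
  (forall x, nrm (x - x0) < r -> nrm (f x) <= M) -> differentiable f x0.
Proof.
move=> r0 fd fb.
have /choice[D HD] (xv : V * V) : exists l, nrm (xv.1 - x0) < r -> lder f xv.1 xv.2 l.
  have [xr|nxr] := boolP (nrm (xv.1 - x0) < r); last by exists 0.
  by have [l Hl] := fd _ xr xv.2; exists l.
exact: (@gateaux_frechet _ f (fun x v => D (x, v)) x0 r M r0 (fun x xr v => HD (x, v) xr) fb).
Qed.

(** Completeness of C for sequences that come with a rate. The real and imaginary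
    parts converge to the suprema of their lower bounds. *)
Lemma complex_limit (u : nat -> C) (e : nat -> R) :
  (forall n m, nrm (u n - u m) <= e n + e m) ->
  exists l, forall n, nrm (u n - l) <= 2 * e n.
Proof.
move=> H.
have RL (v : nat -> R) : (forall n m, `|v n - v m| <= e n + e m) ->
    exists l, forall n, `|v n - l| <= e n.
  move=> Hv; have le n m : v n - e n <= v m + e m.
    by have := le_trans (ler_norm _) (Hv n m); lra.
  exists (sup (range (fun n => v n - e n))) => n.
  have ub : has_ubound (range (fun n => v n - e n)) by exists (v 0%N + e 0%N) => _ [m _ <-].
  have A : v n - e n <= sup (range (fun n => v n - e n)) by apply: ub_le_sup => //; exists n.
  have B : sup (range (fun n => v n - e n)) <= v n + e n.
    by apply: ge_sup => [|_ [m _ <-]//]; exists (v 0%N - e 0%N), 0%N.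
  by rewrite ler_norml; apply/andP; split; lra.
have [n m|a Ha] := RL (fun n => complex.Re (u n)).
  by rewrite -ReN -ReD; exact: le_trans (nrm_Re _) (H n m).
have [n m|b Hb] := RL (fun n => complex.Im (u n)).
  by rewrite -ImN -ImD; exact: le_trans (nrm_Im _) (H n m).
exists (pt a b) => n; apply: le_trans (nrm_le_ReIm _) _.
rewrite !(ReD, ImD, ReN, ImN) /pt Re_iC Im_iC /= addr0 add0r.
by have := Ha n; have := Hb n; lra.
Qed.

(** Weierstrass: Cauchy's estimate makes the derivatives converge, and the
    second order Taylor bound passes to the limit. *)
Lemma uniform_limit_lder (V : normedModType C) (F : nat -> V -> C) (f : V -> C) (x0 : V)
    (r M : R) (eps : nat -> R) : 0 < r ->
  (forall n x, nrm (x - x0) < r -> forall v, exists l, lder (F n) x v l) ->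
  (forall n x, nrm (x - x0) < r -> nrm (F n x) <= M) ->
  (forall n x, nrm (x - x0) < r -> nrm (F n x - f x) <= eps n) ->
  (forall e, 0 < e -> exists n, eps n <= e) ->
  forall v, exists l, lder f x0 v l.
Proof.
move=> r0 Fd Fb Ff epsP v.
have [->|v0] := eqVneq v 0.
  exists 0 => e e0; exists 1 => // t _.
  by rewrite !scaler0 addr0 !subrr nrm0 mulr_ge0 ?nrm_ge0// ltW.
have nv : 0 < nrm v by rewrite nrm_gt0.
have R00 : 0 < r / nrm v by rewrite divr_gt0.
have inl (t : C) : nrm (t - 0) < r / nrm v -> nrm (x0 + t *: v - x0) < r.
  by rewrite subr0 ltr_pdivlMr// addrC addKr nrmZ.
have /choice[G HG] (nt : nat * C) : exists l, nrm (nt.2 - 0) < r / nrm v ->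
    lder (fun s : C => F nt.1 (x0 + s *: v)) nt.2 1 l.
  have [tr|ntr] := boolP (nrm (nt.2 - 0) < r / nrm v); last by exists 0.
  by have [l Hl] := Fd nt.1 _ (inl _ tr) v; exists l => _; apply/lder_line.
have CE n m : nrm (G (n, 0) - G (m, 0)) <= 2 * nrm v / r * eps n + 2 * nrm v / r * eps m.
  have := @cauchy_estimate R (fun s : C => F n (x0 + s *: v) - F m (x0 + s *: v))
    (fun t : C => G (n, t) - G (m, t)) 0 (r / nrm v) (eps n + eps m) R00.
  have -> : 2 * (eps n + eps m) / (r / nrm v) = 2 * nrm v / r * eps n + 2 * nrm v / r * eps m.
    by field; rewrite !gt_eqF.
  apply=> z zr; first by apply/lderP; apply: is_deriveB; apply/lderP; [exact: (HG (n, z)) | exact: (HG (m, z))].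
  apply: le_trans (nrm_tri (f (x0 + z *: v)) _ _) _; apply: lerD; first exact: Ff (inl _ zr).
  by rewrite nrmB; exact: Ff (inl _ zr).
have [l Hl] := complex_limit CE.
exists l; pose K := 64 * M / (r / nrm v) ^+ 2.
apply: (@lder_quad _ _ _ _ _ _ K (r / nrm v / 4)); first by rewrite divr_gt0.
move=> t tr; have tr' : nrm (t - 0) < r / nrm v by rewrite subr0; lra.
apply/ler_addgt0Pr => e e0.
have c0 : 0 < 2 + nrm t * (2 * (2 * nrm v / r)).
  by rewrite ltr_wpDr// !mulr_ge0 ?nrm_ge0// invr_ge0 ltW.
have [n Hn] := epsP _ (divr_gt0 e0 c0); move: Hn; rewrite ler_pdivlMr// => Hn.
have T := @taylor2 R (fun s : C => F n (x0 + s *: v)) (fun t : C => G (n, t)) 0 (r / nrm v) M R00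
  (fun z zr => HG (n, z) zr) (fun z zr => Fb n _ (inl _ zr)) t (ltW tr).
rewrite add0r scale0r addr0 in T.
have A1 := Ff n _ (inl _ tr').
have A2 := Ff n x0; rewrite subrr nrm0 in A2; have {}A2 := A2 r0.
have A3 := ler_wpM2l (nrm_ge0 t) (Hl n).
have -> : f (x0 + t *: v) - f x0 - t *: l =
  (F n (x0 + t *: v) - F n x0 - t * G (n, 0)) - (F n (x0 + t *: v) - f (x0 + t *: v)) +
  (F n x0 - f x0) + t * (G (n, 0) - l) by rewrite scaleC; ring.
apply: le_trans (nrm_triD _ _) _; apply: le_trans (lerD (nrm_triD _ _) (lexx _)) _.
apply: le_trans (lerD (lerD (nrm_triB _ _) (lexx _)) (lexx _)) _; rewrite nrmM.
have KE : 64 * M * nrm t ^+ 2 / (r / nrm v) ^+ 2 = K * nrm t ^+ 2 by rewrite /K mulrAC.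
rewrite KE in T; lra.
Qed.

(** Sup-norm limits are holomorphic on lines, and bounded. *)
Lemma uniform_limit_holomorphic (V : normedModType C) (F : nat -> V -> C) (f : V -> C) (x0 : V)
    (r M : R) (eps : nat -> R) : 0 < r ->
  (forall n x, nrm (x - x0) < r -> differentiable (F n) x) ->
  (forall n x, nrm (x - x0) < r -> nrm (F n x) <= M) ->
  (forall n x, nrm (x - x0) < r -> nrm (F n x - f x) <= eps n) ->
  (forall e, 0 < e -> exists n, eps n <= e) ->
  forall x, nrm (x - x0) < r -> differentiable f x.
Proof.
move=> r0 Fd Fb Ff epsP x xr.
pose s := r - nrm (x - x0); have s0 : 0 < s by rewrite subr_gt0.
have ins y z t : nrm (y - x) < t -> nrm (z - y) <= s - t -> nrm (z - x0) < r.
  move=> yx zy; apply: le_lt_trans (nrm_tri y _ _) _.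
  by have := nrm_tri x y x0; rewrite /s in zy *; lra.
have s2 : 0 < s / 2 by rewrite divr_gt0.
apply: (@holomorphic_of_lines _ _ _ (s / 2) (M + eps 0%N) s2).
  move=> y yx v; apply: (@uniform_limit_lder _ F f y (s / 2) M eps s2).
  - move=> n z zy w; exists ('d (F n) z w); apply: diff_lder; apply: Fd.
    by apply: ins yx _; lra.
  - by move=> n z zy; apply: Fb; apply: ins yx _; lra.
  - by move=> n z zy; apply: Ff; apply: ins yx _; lra.
  - exact: epsP.
move=> y yx; have yr : nrm (y - x0) < r by apply: (ins y y (s / 2)) => //; rewrite subrr nrm0; lra.
rewrite -(subrK (F 0%N y) (f y)) addrC; apply: le_trans (nrm_triD _ _) _.
by apply: lerD; [exact: Fb | rewrite nrmB; exact: Ff].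
Qed.

Lemma differentiable_near_bound (V W : normedModType C) (f : V -> W) (x : V) :
  differentiable f x -> exists2 d : R, 0 < d & forall y, nrm (y - x) < d -> nrm (f y) <= nrm (f x) + 1.
Proof.
move=> /differentiable_continuous/cvgrPdist_lt/(_ 1 ltr01) H.
have /nearP[d d0 Hd] : \forall t \near x, `|f x - f t| < 1 by exact: H.
exists d => // y /Hd; rewrite nrmE (_ : 1 = toC 1 :> C)// toC_lt nrmB => H1.
by have := nrm_subl (f y) (f x); lra.
Qed.

(** The one-variable theorem on the complex line through q and x. That the radius
    depends on q only through r makes a connectedness argument possible. *)
Lemma identity_ball (V : normedModType C) (f : V -> C) (q : V) (r M : R) :
  (forall x, nrm (x - q) < r -> differentiable f x) ->
  (forall x, nrm (x - q) < r -> nrm (f x) <= M) ->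
  (\forall x \near q, f x = 0) -> forall x, nrm (x - q) < r / 4 -> f x = 0.
Proof.
move=> fd fb /nearP[d d0 fz] x xr.
have [->|xq] := eqVneq x q; first by apply: fz; rewrite subrr nrm0.
have nv : 0 < nrm (x - q) by rewrite nrm_gt0 subr_eq0.
have inl (s : R) (t : C) : nrm (t - 0) < s / nrm (x - q) -> nrm (q + t *: (x - q) - q) < s.
  by rewrite subr0 ltr_pdivlMr// (addrC q) addrK nrmZ.
have := @identity_disc R (fun t : C => f (q + t *: (x - q))) 0 1 (r / nrm (x - q)) M (d / nrm (x - q)).
rewrite scale1r subrKC; apply.
- by rewrite divr_gt0.
- move=> z /inl/fd D; exists ('d f (q + z *: (x - q)) (x - q)).
  by apply/lder_line; exact: diff_lder.
- by move=> z /inl/fb.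
- by move=> z /inl/fz.
- by rewrite subr0 nrm1 mulrAC ltr_pdivlMr// mul1r.
Qed.

(** The points near which f vanishes form an open set that is closed in U, since
    [identity_ball] applies with a radius that is uniform near a given point. *)
Lemma identity_connected (V : normedModType C) (f : V -> C) (U S : set V) (p q : V) :
  open U -> S `<=` U -> connected S -> (forall x, U x -> differentiable f x) ->
  S p -> S q -> (\forall x \near p, f x = 0) -> \forall x \near q, f x = 0.
Proof.
move=> oU SU cS fd Sp Sq fp.
pose Z := [set x | U x /\ \forall y \near x, f y = 0].
have loc x : U x -> exists2 d : R, 0 < d & forall y, nrm (y - x) < d -> Z y ->
    forall z, nrm (z - x) < d -> Z z.
  move=> Ux; have [d1 d10 H1] := differentiable_near_bound (fd _ Ux).
  have /nearP[d2 d20 H2] : \forall y \near x, U y by apply: open_nbhs_nbhs; split.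
  pose d := Num.min d1 d2; have d0 : 0 < d by rewrite lt_min d10.
  have dd y : nrm (y - x) < d -> nrm (f y) <= nrm (f x) + 1 /\ U y.
    by rewrite lt_min => /andP[/H1 ? /H2 ?].
  exists (d / 32); first by rewrite divr_gt0.
  move=> y yx [Uy fy] z zx; split; first by apply: (dd _ _).2; lra.
  apply/nearP; exists (d / 32); first by rewrite divr_gt0.
  move=> w wz; apply: (@identity_ball _ f y (d / 2) (nrm (f x) + 1)) => //.
  - by move=> u uy; apply: fd; apply: (dd _ _).2; apply: le_lt_trans (nrm_tri y _ _) _; lra.
  - by move=> u uy; apply: (dd _ _).1; apply: le_lt_trans (nrm_tri y _ _) _; lra.
  - apply: le_lt_trans (nrm_tri z _ _) _.
    by have := nrm_tri x z y; rewrite [nrm (x - y)]nrmB; lra.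
have oZ : open Z.
  rewrite openE => x Zx; apply/nearP; have [d d0 Hd] := loc x Zx.1.
  by exists d => // y yx; apply: (Hd x _ Zx y yx); rewrite subrr nrm0.
have oN : open (U `&` ~` Z).
  rewrite openE => x [Ux nZ]; rewrite /interior; have [d d0 Hd] := loc x Ux.
  apply: filterI; first by apply: open_nbhs_nbhs.
  apply/nearP; exists d => // y yx Zy; apply: nZ; apply: (Hd y yx Zy x).
  by rewrite subrr nrm0.
have SZ : S `&` Z = S.
  apply: cS; first by exists p; split=> //; split=> //; exact: SU.
    by exists Z.
  exists (~` (U `&` ~` Z)); first exact: open_closedC.
  rewrite predeqE => x; split=> [[Sx Zx]|[Sx nUZ]]; split=> //; first by case.
  by apply: contrapT => nZ; apply: nUZ; split=> //; exact: SU.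
by move: Sq; rewrite -SZ => -[_ []].
Qed.

End Frechet.

(** * Rows, connectedness and compactness *)

Section Rows.
Variable R : realType.
Local Notation C := (Cx R).

(** The inverse of the sum of the inverses spares minima over finite types,
    which would require a nonempty index set. *)
Lemma finite_lower_bound n (d : 'I_n -> R) : (forall i, 0 < d i) ->
  exists2 e : R, 0 < e & forall i, e <= d i.
Proof.
move=> d0; have s0 : 0 <= \sum_i (d i)^-1 by apply: sumr_ge0 => i _; rewrite invr_ge0 ltW.
have s1 : 0 < 1 + \sum_i (d i)^-1 by rewrite ltr_wpDr.
exists (1 + \sum_i (d i)^-1)^-1 => [|i]; first by rewrite invr_gt0.
rewrite -[leRHS]invrK lef_pV2 ?posrE ?invr_gt0//.
rewrite (bigD1 i)//= addrCA lerDl addr_ge0//.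
by apply: sumr_ge0 => j _; rewrite invr_ge0 ltW.
Qed.

Lemma near_forall n (V : normedModType C) (x : V) (P : 'I_n -> V -> Prop) :
  (forall i, \forall y \near x, P i y) -> \forall y \near x, forall i, P i y.
Proof.
move=> H; have /choice[d Hd] i : exists d : R, 0 < d /\ forall y, nrm (y - x) < d -> P i y.
  by have /nearP[d d0 Hd] := H i; exists d.
have [e e0 He] := finite_lower_bound (fun i => (Hd i).1).
by apply/nearP; exists e => // y ye i; apply: (Hd i).2; exact: lt_le_trans ye (He i).
Qed.

Lemma diff_entry n (V : normedModType C) (f : V -> 'rV[C]_n) x i :
  differentiable f x -> differentiable (fun y => f y 0 i) x.
Proof.
by move=> fd; apply: (@differentiable_comp _ _ _ _ f (fun u : 'rV[C]_n => u 0 i)) => //; exact: differentiable_coord.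
Qed.

Lemma lder_entry n (V : normedModType C) (f : V -> 'rV[C]_n) x v (l : 'rV[C]_n) i :
  lder f x v l -> lder (fun y => f y 0 i) x v (l 0 i).
Proof.
move=> H e /H[d d0 Hd]; exists d => // t /Hd; apply: le_trans.
by have := nrm_coord (f (x + t *: v) - f x - t *: l) 0 i; rewrite !mxE.
Qed.

Lemma lder_row n (V : normedModType C) (f : V -> 'rV[C]_n) x v (l : 'rV[C]_n) :
  (forall i, lder (fun y => f y 0 i) x v (l 0 i)) -> lder f x v l.
Proof.
move=> H e e0; have /choice[d Hd] i : exists d : R, 0 < d /\ forall t : C, nrm t < d ->
    nrm (f (x + t *: v) 0 i - f x 0 i - t *: l 0 i) <= e * nrm t.
  by have [d d0 Hd] := H i e e0; exists d.
have [d' d'0 Hd'] := finite_lower_bound (fun i => (Hd i).1).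
exists d' => // t td; apply: nrm_row_le => [|i]; first by rewrite mulr_ge0 ?nrm_ge0 ?ltW.
by rewrite !mxE; apply: (Hd i).2; exact: lt_le_trans td (Hd' i).
Qed.

Lemma diff_entryE n (V : normedModType C) (f : V -> 'rV[C]_n) x i v :
  differentiable f x -> 'd (fun y => f y 0 i) x v = 'd f x v 0 i.
Proof.
move=> fd; apply: lder_uniq (diff_lder _ (diff_entry i fd)) _.
exact: lder_entry (diff_lder _ fd).
Qed.

Lemma diff_row n (V : normedModType C) (f : V -> 'rV[C]_n) x :
  (forall i, differentiable (fun y => f y 0 i) x) -> differentiable f x.
Proof.
move=> H; have -> : f = (fun y => \sum_(i < n) (f y 0 i) *: (delta_mx 0 i : 'rV[C]_n)).
  by apply/funext => y; rewrite [LHS]row_sum_delta.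
have -> : (fun y => \sum_(i < n) (f y 0 i) *: (delta_mx 0 i : 'rV[C]_n)) =
    \sum_(i < n) (fun y => (f y 0 i) *: (delta_mx 0 i : 'rV[C]_n)).
  by apply/funext => y; rewrite fct_sumE.
by apply: differentiable_sum => i; exact: differentiableZl.
Qed.

Lemma identity_connected_row n (V : normedModType C) (f : V -> 'rV[C]_n) (U S : set V) (p q : V) :
  open U -> S `<=` U -> connected S -> (forall x, U x -> differentiable f x) ->
  S p -> S q -> (\forall x \near p, f x = 0) -> \forall x \near q, f x = 0.
Proof.
move=> oU SU cS fd Sp Sq fp.
have : \forall x \near q, forall i, f x 0 i = 0.
  apply: near_forall => i.
  apply: (@identity_connected _ _ (fun x => f x 0 i) U S p q) => //.
    by move=> x Ux; apply: diff_entry; exact: fd.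
  by move: fp => /nearP[d d0 Hd]; apply/nearP; exists d => // y /Hd ->; rewrite mxE.
move=> /nearP[d d0 Hd]; apply/nearP; exists d => // y /Hd H; apply/rowP => i.
by rewrite H mxE.
Qed.

Lemma continuous_nrmP (V W : normedModType C) (f : V -> W) x :
  {for x, continuous f} <-> (forall e : R, 0 < e -> exists2 d : R, 0 < d &
    forall y, nrm (y - x) < d -> nrm (f y - f x) < e).
Proof.
split.
  move=> /cvgrPdist_lt H e e0.
  have /nearP[d d0 Hd] : \forall t \near x, `|f x - f t| < toC e.
    by apply: H; rewrite (_ : 0 = toC 0)// toC_lt.
  by exists d => // y /Hd; rewrite nrmE toC_lt nrmB.
move=> H; apply/cvgrPdist_lt => _/pos_toC[e e0 ->].
by have [d d0 Hd] := H e e0; apply/nearP; exists d => // y /Hd; rewrite nrmB nrmE toC_lt.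
Qed.

Lemma diff_cont (V W : normedModType C) (f : V -> W) x : differentiable f x ->
  forall e : R, 0 < e -> exists2 d : R, 0 < d &
    forall y, nrm (y - x) < d -> nrm (f y - f x) < e.
Proof. by move=> /differentiable_continuous/continuous_nrmP. Qed.

Lemma open_nrm (V : normedModType C) (A : set V) :
  open A <-> forall x, A x -> exists2 d : R, 0 < d & forall y, nrm (y - x) < d -> A y.
Proof.
split=> [oA x Ax|H]; first by apply/nearP; apply: open_nbhs_nbhs; split.
by rewrite openE => x /H Ax; exact/nearP.
Qed.

(** Connectedness as an induction principle: it suffices that P holds somewhere
    and that both P and its negation are open in A. *)
Lemma connected_clopen (V : normedModType C) (A : set V) (P : V -> Prop) (p : V) :
  connected A -> A p -> P p ->
  (forall x, A x -> P x -> exists2 d : R, 0 < d & forall y, A y -> nrm (y - x) < d -> P y) ->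
  (forall x, A x -> ~ P x -> exists2 d : R, 0 < d & forall y, A y -> nrm (y - x) < d -> ~ P y) ->
  forall x, A x -> P x.
Proof.
move=> cA Ap Pp oP oN.
have opn (Q : V -> Prop) : open [set y | exists x d, [/\ A x, Q x, (0 : R) < d,
    (forall z, A z -> nrm (z - x) < d -> Q z) & nrm (y - x) < d]].
  rewrite openE => y [x [d [Ax Qx d0 Hd yx]]]; apply/nearP.
  exists (d - nrm (y - x)); first by rewrite subr_gt0.
  move=> z zy; exists x, d; split=> //.
  by apply: le_lt_trans (nrm_tri y _ _) _; rewrite -ltrBrDr.
have AQ (Q : V -> Prop) : (forall x, A x -> Q x -> exists2 d : R, 0 < d & forall y, A y -> nrm (y - x) < d -> Q y) ->
    forall y, A y -> (Q y <-> exists x d, [/\ A x, Q x, (0 : R) < d,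
    (forall z, A z -> nrm (z - x) < d -> Q z) & nrm (y - x) < d]).
  move=> oQ y Ay; split=> [Qy|[x [d [_ _ _ H yx]]]]; last exact: H.
  by have [d d0 Hd] := oQ y Ay Qy; exists y, d; split=> //; rewrite subrr nrm0.
have E : A `&` [set x | P x] = A.
  apply: cA; first by exists p.
    apply: (ex_intro2 _ _ _ (opn P)); rewrite predeqE => x.
    by split=> -[Ax Px]; split=> //; have [H1 H2] := AQ P oP x Ax; [exact: H1 | exact: H2].
  exists (~` [set y | exists x d, [/\ A x, ~ P x, (0 : R) < d,
    (forall z, A z -> nrm (z - x) < d -> ~ P z) & nrm (y - x) < d]]).
    by apply: open_closedC; exact: (opn (fun x => ~ P x)).
  rewrite predeqE => x; split=> -[Ax Px]; split=> //.
    by move=> /(AQ (fun x => ~ P x) oN x Ax).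
  by apply: contrapT => nPx; apply: Px; apply/(AQ (fun x => ~ P x) oN x Ax).
by move=> x; rewrite -E => -[].
Qed.

Lemma continuous_RV (V : normedModType C) (f : R -> V) (t : R) :
  (forall e : R, 0 < e -> exists2 d : R, 0 < d & forall s, `|s - t| < d -> nrm (f s - f t) < e) ->
  {for t, continuous f}.
Proof.
move=> H; apply/cvgrPdist_lt => _/pos_toC[e e0 ->]; have [d d0 Hd] := H e e0.
apply/nbhs_normP; exists d => // s /=; rewrite distrC => sd.
by have := Hd _ sd; rewrite nrmB nrmE toC_lt.
Qed.

Lemma continuous_line (V : normedModType C) (x v : V) : continuous (fun t : R => x + toC t *: v).
Proof.
move=> t; apply: continuous_RV => e e0; have n0 : 0 < nrm v + 1 by rewrite ltr_wpDl// nrm_ge0.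
exists (e / (nrm v + 1)) => [|s]; first exact: divr_gt0.
rewrite ltr_pdivlMr// => H.
have -> : x + toC s *: v - (x + toC t *: v) = toC (s - t) *: v.
  by rewrite opprD addrACA subrr add0r -scalerBl toCB.
by rewrite nrmZ nrm_toC (le_lt_trans _ H)// ler_wpM2l// lerDl.
Qed.

Lemma connected_ball (V : normedModType C) (x : V) (d : R) : 0 < d ->
  connected [set y | nrm (y - x) < d].
Proof.
move=> d0; have -> : [set y | nrm (y - x) < d] =
    \bigcup_(y in [set y | nrm (y - x) < d]) ((fun t : R => x + toC t *: (y - x)) @` `[0, 1]).
  rewrite predeqE => z; split=> [zd|[y /= yd [t /= + <-]]].
    by exists z => //; exists 1; rewrite /= ?in_itv /= ?ler01 ?lexx// scale1r subrKC.
  rewrite in_itv /= => /andP[t0 t1]; rewrite (addrC x) addrK nrmZ nrm_toC ger0_norm//.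
  by apply: le_lt_trans yd; rewrite ler_piMl// nrm_ge0.
apply: bigcup_connected.
  exists x => y /= yd; exists 0; first by rewrite /= in_itv /= ler01 lexx.
  by rewrite scale0r addr0.
move=> y _; apply: connected_continuous_connected; first exact: segment_connected.
by apply: continuous_subspaceT; exact: continuous_line.
Qed.

Lemma open_component (V : normedModType C) (A : set V) (p : V) : open A ->
  open (connected_component A p).
Proof.
move=> oA; rewrite openE => x [B [Bp BA cB] Bx].
have /nearP[d d0 Hd] : \forall y \near x, A y by apply: open_nbhs_nbhs; split=> //; exact: BA.
apply/nearP; exists d => // y yd.
exists (B `|` [set y | nrm (y - x) < d]); last by right.
split; [by left | by move=> z [/BA//|/Hd] |].
apply: connectedU => //; last exact: connected_ball.
by exists x; split=> //=; rewrite subrr nrm0.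
Qed.

(** Components of open sets are relatively closed, because a small ball around
    x meets the component and can be added to it. *)
Lemma component_near (V : normedModType C) (A : set V) (p x : V) : open A -> A x ->
  closure (connected_component A p) x -> connected_component A p x.
Proof.
move=> oA Ax clx.
have nA : \forall y \near x, A y by apply: open_nbhs_nbhs; split.
have /nearP[d d0 Hd] := nA.
have nB : \forall y \near x, nrm (y - x) < d by apply/nearP; exists d.
have [y [[B [Bp BA cB] By] yd]] := clx _ nB.
exists (B `|` [set y | nrm (y - x) < d]); last by right; rewrite /= subrr nrm0.
split; [by left | by move=> z [/BA//|/Hd] |].
by apply: connectedU => //; [exists y; split | exact: connected_ball].
Qed.

Lemma closed_nrm (V : normedModType C) (r : R) : closed [set x : V | nrm x <= r].
Proof.
rewrite -[X in closed X]setCK; apply: open_closedC; rewrite openE => x /= /negP.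
rewrite -ltNge => rx; suff : \forall y \near x, ~ (nrm y <= r) by [].
apply/nearP; exists (nrm x - r); first by rewrite subr_gt0.
by move=> y yx /=; apply/negP; rewrite -ltNge; have := nrm_subl x y; rewrite nrmB; lra.
Qed.

Lemma compact_row_ball n (r : R) : compact [set x : 'rV[C]_n | nrm x <= r].
Proof.
have cD : compact [set z : C | exists a b : R, [/\ `|a| <= r, `|b| <= r & z = pt a b]].
  have -> : [set z : C | exists a b : R, [/\ `|a| <= r, `|b| <= r & z = pt a b]] =
      (fun ab : R * R => pt ab.1 ab.2) @` (`[-r, r] `*` `[-r, r]).
    rewrite predeqE => z; split=> [[a [b [ar br ->]]]|[[a b] [/= + +] <-]].
      by exists (a, b) => //; split; rewrite /= in_itv /= -ler_norml.
    by rewrite !in_itv /= -!ler_norml => ar br; exists a, b.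
  apply: continuous_compact; last by apply: compact_setX; exact: segment_compact.
  apply: continuous_subspaceT => -[a b]; apply/cvgrPdist_lt => _/pos_toC[e e0 ->].
  have e2 : 0 < e / 2 by rewrite divr_gt0.
  exists ([set x | `|a - x| < e / 2], [set x | `|b - x| < e / 2]).
    by split; apply/nbhs_normP; exists (e / 2).
  move=> [x y] [/= xa yb]; rewrite nrmE toC_lt; apply: le_lt_trans (nrm_pt _ _ _ _) _; lra.
have := @rV_compact _ n (fun=> [set z : C | exists a b : R, [/\ `|a| <= r, `|b| <= r & z = pt a b]]) (fun=> cD).
move=> cP.
apply: (subclosed_compact _ cP); last first.
  move=> x /= xr i; exists (complex.Re (x 0 i)), (complex.Im (x 0 i)); split; last exact: pt_ReIm.
    exact: le_trans (nrm_Re _) (le_trans (nrm_coord _ _ _) xr).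
  exact: le_trans (nrm_Im _) (le_trans (nrm_coord _ _ _) xr).
exact: closed_nrm.
Qed.

(** Bounded sequences have cluster points, by compactness of closed balls; the
    cluster point is approached along arbitrarily late terms. *)
Lemma bounded_rows_cluster n (r : R) (u : nat -> 'rV[C]_n) : (forall k, nrm (u k) <= r) ->
  exists p, forall (d : R) N, 0 < d -> exists2 k, (N <= k)%N & nrm (u k - p) < d.
Proof.
move=> ur; have F : (u @ \oo) [set x : 'rV[C]_n | nrm x <= r] by exists 0%N => // k _; exact: ur.
have [p [_ cp]] := @compact_row_ball n r (u @ \oo) _ F.
exists p => d N d0.
have FN : (u @ \oo) (u @` [set k | (N <= k)%N]) by exists N => // k Nk; exists k.
have nB : nbhs p [set y | nrm (y - p) < d] by apply/(@nearP R 'rV[C]_n); exists d.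
by have [_ [[k Nk <-] kd]] := cp _ _ FN nB; exists k.
Qed.

(** Countable sets have measure zero and intervals do not. *)
Lemma interval_uncountable (r : R) (T : countType) (F : R -> T) : 0 < r ->
  (forall s t, 0 < s -> s < r -> 0 < t -> t < r -> F s = F t -> s = t) -> False.
Proof.
move=> r0 Finj.
have cI : countable (`]0, r[%classic : set R).
  apply/countable_injP; exists (pickle \o F) => s t; rewrite !inE /= !in_itv /=.
  by move=> /andP[s0 sr] /andP[t0 tr] /(pcan_inj pickleK); exact: Finj.
have := countable_lebesgue_measure0 cI; rewrite lebesgue_measure_itv /= lte_fin r0.
by rewrite -EFinB subr0 => -[] E; rewrite E ltxx in r0.
Qed.

End Rows.

(** * Maps with finite orbits *)

Section Periodicity.
Variables (R : realType) (m : nat).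
Local Notation C := (Cx R).
Local Notation E := 'rV[C]_m.

Section OneMap.
Variables (g : E -> E) (V : set E).
Hypothesis oV : open V.
Hypothesis g_diff : forall x, V x -> differentiable g x.
Hypothesis g_fix : forall N p, (0 < N)%N -> (forall i, (i <= N)%N -> V (iter i g p)) -> iter N g p = p ->
  (\forall x \near p, (forall i, (i <= N)%N -> V (iter i g x)) -> iter N g x = x -> x = p) \/
  \forall x \near p, iter N g x = x.

Definition iter_dom N := [set x | forall i, (i <= N)%N -> V (iter i g x)].

Lemma iter_diff n x : (forall i, (i < n)%N -> V (iter i g x)) -> differentiable (iter n g) x.
Proof.
elim: n => [|n IH] H /=; first exact: ex_diff.
apply: (@differentiable_comp _ _ _ _ (iter n g) g); first by apply: IH => i /ltnW; exact: H.
by apply: g_diff; exact: H.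
Qed.

Lemma open_iter_dom N : open (iter_dom N).
Proof.
apply/open_nrm => x Hx.
have H i : (i <= N)%N -> \forall y \near x, V (iter i g y).
  move=> iN; have c : {for x, continuous (iter i g)}.
    by apply: differentiable_continuous; apply: iter_diff => j ji; apply: Hx; rewrite (leq_trans (ltnW ji)).
  by apply: c; apply: open_nbhs_nbhs; split=> //; exact: Hx.
have : \forall y \near x, forall i : 'I_N.+1, V (iter i g y).
  by apply: near_forall => i; apply: H; rewrite -ltnS.
move=> /nearP[d d0 Hd]; exists d => // y /Hd Hy i iN.
by have := Hy (Ordinal (iN : (i < N.+1)%N)).
Qed.

(** Uncountably many periodic points cannot all be isolated; where one is not,
    an iterate is the identity, and the identity theorem carries this along a
    connected set to the origin. *)
Lemma periodic_of_many (r : R) (xs : R -> E) (N : R -> nat) (S : R -> set E) : 0 < r ->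
  (forall s, 0 < s -> s < r -> [/\ nrm (xs s) = s, (0 < N s)%N, iter (N s) g (xs s) = xs s &
    [/\ connected (S s), S s 0, S s (xs s) & S s `<=` iter_dom (N s)]]) ->
  exists2 n, (0 < n)%N & [/\ \forall x \near (0 : E), iter n g x = x & exists S : set E, [/\ connected S, S 0 & S `<=` iter_dom n]].
Proof.
move=> r0 H; apply: contrapT => no.
have iso s : exists d : R, 0 < s -> s < r -> 0 < d /\ forall x, nrm (x - xs s) < d ->
    iter_dom (N s) x -> iter (N s) g x = x -> x = xs s.
  have [[s0 sr]|ns] := pselect (0 < s /\ s < r); last by exists 0 => s0 sr; exfalso; exact: ns.
  have [xn Np px [cS S0 Sx Sd]] := H s s0 sr.
  have [/nearP[d d0 Hd]|pn] := g_fix Np (Sd _ Sx) px; first by exists d => _ _; split.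
  exfalso; apply: no; exists (N s); first exact: Np.
  split; last by exists (S s); split.
  have : \forall x \near (0 : E), iter (N s) g x - x = 0.
    have fp : \forall x \near xs s, iter (N s) g x - x = 0.
      by move: pn => /nearP[d d0 Hd]; apply/nearP; exists d => // y /Hd ->; rewrite subrr.
    have fd x : iter_dom (N s) x -> differentiable (fun x => iter (N s) g x - x) x.
      move=> Hx; apply: differentiableB; last exact: ex_diff.
      by apply: iter_diff => i /ltnW; exact: Hx.
    exact: (@identity_connected_row R m _ _ (iter_dom (N s)) (S s) (xs s) 0 (@open_iter_dom (N s)) Sd cS fd Sx S0 fp).
  by move=> /nearP[d d0 Hd]; apply/nearP; exists d => // y /Hd/eqP; rewrite subr_eq0 => /eqP.
have {iso}/choice[d Hd] := iso.
have /choice[j Hj] s : exists j : nat, 0 < s -> s < r -> j.+1%:R^-1 < d s.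
  have [[s0 sr]|ns] := pselect (0 < s /\ s < r); last by exists 0%N => s0 sr; exfalso; exact: ns.
  have [j] := ltr_add_invr (Hd s s0 sr).1; rewrite add0r => Hj; by exists j.
(* periodic points with equal codes have the same period and lie in the same
   cell of a grid finer than their isolation radius *)
pose q s (z : R) := Num.floor (z * 2 * (j s).+1%:R).
pose code s := (N s, j s, [ffun i : 'I_m => (q s (complex.Re (xs s 0 i)), q s (complex.Im (xs s 0 i)))]).
apply: (@interval_uncountable R r _ code r0) => s t s0 sr t0 tr [NE jE /ffunP qE].
have [xs_n _ _ _] := H s s0 sr; have [xt_n _ pt' [_ _ St Sd]] := H t t0 tr.
suff E1 : xs t = xs s by rewrite -xs_n -xt_n E1.
have [d0 iso] := Hd s s0 sr.
have fl (a b : R) : q s a = q t b -> `|b - a| < (j s).+1%:R^-1 / 2.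
  rewrite /q -jE; set J : R := (j s).+1%:R => fE.
  have J0 : 0 < J by rewrite ltr0n.
  have A := floor_le (a * 2 * J); have B := floorD1_gt (a * 2 * J).
  have A' := floor_le (b * 2 * J); have B' := floorD1_gt (b * 2 * J).
  have zD (z : int) : (z + 1)%:~R = z%:~R + 1 :> R by rewrite intrD.
  rewrite -fE in A' B'; rewrite !zD in B B'.
  have : `|b * 2 * J - a * 2 * J| < 1 by rewrite ltr_norml; apply/andP; split; lra.
  have -> : b * 2 * J - a * 2 * J = (b - a) * (2 * J) by ring.
  rewrite normrM (gtr0_norm (_ : 0 < 2 * J)) ?mulr_gt0// -ltr_pdivlMr ?mulr_gt0// div1r invfM.
  by rewrite mulrC.
apply: iso; first last.
- by rewrite NE.
- by rewrite NE; exact: Sd.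
apply: lt_trans (Hj s s0 sr); apply: nrm_row_lt => [|i]; first by rewrite invr_gt0.
rewrite !mxE; apply: le_lt_trans (nrm_le_ReIm _) _.
have := qE i; rewrite !ffunE => -[/fl A /fl B].
rewrite ReD ReN ImD ImN; move: A B; set J := _^-1; lra.
Qed.

End OneMap.

Section TwoMaps.
Variables (h k : E -> E) (V : set E).
Hypothesis m0 : (0 < m)%N.
Hypothesis dom : pseudogroup_domain h k V.
Hypothesis fin : finite_orbits_on h k V.
Hypothesis iso : fixed_points_isolated_or_identity_on h k V.

Let gb (b : bool) := if b then h else k.

Lemma word_iter b n x : word_map h k (nseq n b) x = iter n (gb b) x.
Proof.
by rewrite /word_map /gb; case: b; elim: n x => [//|n IH] x; rewrite iterSr -IH.
Qed.

Lemma word_iter_dom b n x : (forall i, (i <= n)%N -> V (iter i (gb b) x)) -> word_dom h k V (nseq n b) x.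
Proof.
move=> H; split=> [|l]; first exact: (H 0%N).
rewrite size_nseq => /andP[_ ln]; rewrite take_nseq ?word_iter; last exact: ltnW.
by apply: H; exact: ltnW.
Qed.

(** The forward iterates lie in one pseudo-orbit, which is finite; a repetition
    among them descends to x because the map is injective. *)
Lemma periodic_point b x : (forall i, V (iter i (gb b) x)) ->
  exists2 N, (0 < N)%N & iter N (gb b) x = x.
Proof.
move=> Vx; have [_ _ _ [hi ki] _] := dom.
have gi : {in V &, injective (gb b)} by rewrite /gb; case: b Vx.
have inO i : pseudo_orbit h k V x (iter i (gb b) x).
  split; first exact: Vx.
  exists (nseq i b); split; last by rewrite word_iter.
  by apply: word_iter_dom.
have [i [j [ij E1]]] : exists i j, (i < j)%N /\ iter i (gb b) x = iter j (gb b) x.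
  apply: contrapT => no.
  have inj : injective (fun i => iter i (gb b) x).
    move=> i j E1; apply: contrapT => /eqP; rewrite neq_ltn => /orP[ij|ji]; apply: no.
      by exists i, j.
    by exists j, i.
  have : finite_set [set: nat].
    have := fin (Vx 0%N) => F.
    apply: (@sub_finite_set _ _ ((fun i => iter i (gb b) x) @^-1` pseudo_orbit h k V x)).
      by move=> i _; exact: inO.
    by apply: finite_preimage => // ? ? _ _; exact: inj.
  exact: infinite_nat.
exists (j - i)%N; first by rewrite subn_gt0.
elim: i j ij E1 => [|i IH] j ij E1; first by rewrite subn0 -E1.
case: j ij E1 => [//|j] ij E1; rewrite subSS; apply: IH => //.
by apply: gi; rewrite ?inE.
Qed.

Let g_fix b N p : (0 < N)%N -> (forall i, (i <= N)%N -> V (iter i (gb b) p)) -> iter N (gb b) p = p ->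
  (\forall x \near p, (forall i, (i <= N)%N -> V (iter i (gb b) x)) -> iter N (gb b) x = x -> x = p) \/
  \forall x \near p, iter N (gb b) x = x.
Proof.
move=> N0 Vp pp; have := iso (word_iter_dom Vp); rewrite word_iter => /(_ pp)[|].
  move=> /nearP[d d0 Hd]; left; apply/nearP; exists d => // x xd Vx px.
  by apply: Hd => //; [exact: word_iter_dom | rewrite word_iter].
move=> /nearP[d d0 Hd]; right; apply/nearP; exists d => // x /Hd.
by rewrite word_iter.
Qed.

Let g_diff b x : V x -> differentiable (gb b) x.
Proof. by have [_ _ [hd kd] _ _] := dom; rewrite /gb; case: b => Vx; [exact: hd | exact: kd]. Qed.

(** Let O n be the component containing 0 of the set of points that stay in a
    small ball for n iterates.

    If every O n meets every small sphere, then cluster points of O n as n grows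
    provide, at every small distance from 0, a point all of whose forward iterates
    stay near 0, and it is connected to 0 through points with the same property
    for any given number of iterates.

    Otherwise some O n avoids a sphere, hence lies inside it. The inverse map then
    sends O n into itself: the image is connected, contains 0, and its points
    stay in the ball for n iterates. All points of the neighbourhood O n of 0
    have backward iterates that stay near 0.

    In both cases there are uncountably many periodic points, and
    [periodic_of_many] applies to the map or to its inverse. *)
Lemma finite_orbits_periodic : exists2 N, (0 < N)%N & \forall x \near (0 : E), iter N h x = x.
Proof.
have [[oV V0] [[_ h0] [_ k0] _ _] _ _ [kh hk]] := dom.
have /nearP[r1 r10 Hr1] : \forall x \near (0 : E), V x by apply: open_nbhs_nbhs; split.
pose r := r1 / 2; have r0 : 0 < r by rewrite divr_gt0.
have rV x : nrm x <= r -> V x by move=> xr; apply: Hr1; rewrite subr0; rewrite /r in xr; lra.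
pose B := [set x : E | nrm (x - 0) < r].
have oB : open B.
  apply/open_nrm => x xB; exists (r - nrm (x - 0)); first by rewrite subr_gt0.
  by move=> y yx; apply: le_lt_trans (nrm_tri x _ _) _; rewrite -ltrBrDr.
have BV : B `<=` V by move=> x; rewrite /B /= subr0 => /ltW/rV.
have oBn n : open (iter_dom h B n).
  by apply: open_iter_dom => // x /BV; exact: (g_diff true).
pose O n := connected_component (iter_dom h B n) 0.
have h0n i : iter i h 0 = 0 by elim: i => //= i ->.
have k0n i : iter i k 0 = 0 by elim: i => //= i ->.
have B0 n : iter_dom h B n 0 by move=> i _; rewrite h0n /B /= subrr nrm0.
have O0 n : O n 0 by exact: connected_component_refl.
have OB n : O n `<=` iter_dom h B n by exact: connected_component_sub.
have cO n : connected (O n) by exact: component_connected.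
have oO n : open (O n) by exact: open_component.
have [A|nA] := pselect (forall s n, 0 < s -> s < r -> exists2 x : E, O n x & nrm x = s).
  have P s : exists xN : E * nat, 0 < s -> s < r -> [/\ nrm xN.1 = s, (0 < xN.2)%N,
      iter xN.2 h xN.1 = xN.1 & forall n, closure (O n) xN.1].
    have [[s0 sr]|ns] := pselect (0 < s /\ s < r); last by exists (0, 0%N) => s0 sr; exfalso; exact: ns.
    have /choice[u Hu] n : exists x : E, O n x /\ nrm x = s by have [x Ox xs] := A s n s0 sr; exists x.
    have us n : nrm (u n) <= s by rewrite (Hu n).2.
      have [p Hp] := @bounded_rows_cluster R m s u us.
    have clp n : closure (O n) p.
      move=> Q /nearP[d d0 Hd]; have [k' nk kd] := Hp d n d0; exists (u k'); split; last exact: Hd.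
      have [[Q' [Q0 QB cQ] Qu] _] := Hu k'; exists Q' => //; split=> // y /QB Hy i i_n.
      by apply: Hy; exact: leq_trans nk.
    have pn : nrm p = s.
      apply/eqP; rewrite -subr_eq0 -normr_le0; apply/ler_addgt0Pr => e e0; rewrite add0r.
      have [k' _ kd] := Hp e 0%N e0; rewrite -(Hu k').2.
      rewrite ler_norml; have := nrm_subl p (u k'); have := nrm_subl (u k') p.
      rewrite [nrm (p - _)]nrmB => A1 A2; apply/andP; split; lra.
    have Vp : forall i, nrm (iter i h p) <= r.
      move=> i; elim/ltn_ind: i => i IH.
      have c : differentiable (iter i h) p.
        by apply: (@iter_diff h V (g_diff true)) => l li; apply: rV; exact: IH.
      apply/ler_addgt0Pr => e e0; have [d d0 Hd] := diff_cont c e0.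
      have [k' ik kd] := Hp d i d0.
      have := OB _ _ (Hu k').1 _ ik; rewrite /B /= subr0 => H1.
      have := Hd _ kd; have := nrm_subl (iter i h p) (iter i h (u k')).
      by rewrite nrmB; lra.
    have [N N0 pN] := @periodic_point true p (fun i => rV _ (Vp i)).
    by exists (p, N).
  have {P}/choice[xN HxN] := P.
  have [] := @periodic_of_many h V oV (g_diff true) (g_fix (b := true)) r (fun s => (xN s).1)
     (fun s => (xN s).2) (fun s => closure (O (xN s).2)) r0.
    move=> s s0 sr; have [xn Np px cl] := HxN s s0 sr; split=> //; split.
    - exact: connected_closure.
    - exact: subset_closure.
    - exact: cl.
    move=> x clx i iN; apply: (rV _); move: iN; elim/ltn_ind: i => i IH iN.
    have c : differentiable (iter i h) x.
      apply: (@iter_diff h V (g_diff true)) => l li; apply: rV; apply: IH => //.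
      exact: leq_trans (ltnW li) iN.
    apply/ler_addgt0Pr => e e0; have [d d0 Hd] := diff_cont c e0.
    have nB : \forall y \near x, nrm (y - x) < d by apply/nearP; exists d.
    have [y [Oy yd]] := clx _ nB.
    have := OB _ _ Oy _ iN; rewrite /B /= subr0 => H1.
    have := Hd _ yd; have := nrm_subl (iter i h x) (iter i h y).
    by rewrite nrmB; lra.
  by move=> n n0 [Hn _]; exists n.
have [s [n [s0 sr ns]]] : exists s n, [/\ 0 < s, s < r & forall x : E, O n x -> nrm x <> s].
  apply: contrapT => no; apply: nA => s n s0 sr; apply: contrapT => nx; apply: no.
  by exists s, n; split=> // x Ox xs; apply: nx; exists x.
have Os x : O n x -> nrm x < s.
  apply: (@connected_clopen _ _ (O n) (fun x => nrm x < s) 0) => //; first by rewrite nrm0.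
    move=> y _ ys; exists (s - nrm y); first by rewrite subr_gt0.
    by move=> z _; have := nrm_subl z y; lra.
  move=> y Oy /negP; rewrite -leNgt le_eqVlt => /orP[/eqP sy|sy]; first by have := ns y Oy; rewrite sy.
  exists (nrm y - s); first by rewrite subr_gt0.
  by move=> z _; have := nrm_subl y z; rewrite nrmB => A1 A2; apply/negP; rewrite -leNgt; lra.
have OV x : O n x -> V x by move=> /Os xs; apply: rV; lra.
have kO x : O n x -> O n (k x).
  have ck : connected (k @` O n).
    apply: connected_continuous_connected => //.
    apply: continuous_in_subspaceT => y; rewrite inE => /OV Vy.
    by apply: differentiable_continuous; exact: (g_diff false).
  have nn (y : E) (P : set E) : open P -> P y -> exists2 d : R, 0 < d & forall z, nrm (z - y) < d -> P z.
    by move=> /open_nrm oP /oP.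
  suff H y : (k @` O n) y -> O n y by move=> Ox; apply: H; exists x.
  apply: (@connected_clopen _ _ _ (O n) 0 ck) => //; first by exists 0.
    by move=> z _ Oz; have [d d0 Hd] := nn _ _ (oO n) Oz; exists d => // w _; exact: Hd.
  move=> z [w Ow kwz] nOz.
  suff ncl : ~ closure (O n) z.
    have [d d0 Hd] := nn z (~` closure (O n)) (closed_openC (@closed_closure _ _)) ncl.
    by exists d => // v _ /Hd ncv Ov; apply: ncv; exact: subset_closure.
  move=> clz; apply: nOz; apply: component_near => //.
  have zs : nrm z <= s.
    apply/ler_addgt0Pr => e e0.
    have nB : \forall y \near z, nrm (y - z) < e by apply/nearP; exists e.
    have [v [/Os vs vz]] := clz _ nB; have := nrm_subl z v; rewrite nrmB; lra.
  have Vz : V z by apply: rV; lra.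
  have hz : h z = w by rewrite -kwz hk//; [exact: OV | rewrite kwz].
  move=> [_|i iN]; first by rewrite /B /= subr0; lra.
  by rewrite iterSr hz; apply: (OB _ _ Ow); exact: ltnW.
have kOi i x : O n x -> O n (iter i k x) by move=> Ox; elim: i => //= i; exact: kO.
have /nearP[r2 r20 Hr2] : \forall x \near (0 : E), O n x by apply: open_nbhs_nbhs; split.
pose xs (t : R) : E := toC t *: const_mx 1.
have xs_n t : 0 < t -> nrm (xs t) = t.
  move=> t0; apply/eqP; rewrite eq_le; apply/andP; split.
    by apply: nrm_row_le => [|i]; rewrite ?(ltW t0)// !mxE mulr1 nrm_toC gtr0_norm.
  by have := nrm_coord (xs t) 0 (Ordinal m0); rewrite !mxE mulr1 nrm_toC gtr0_norm.
have P t : exists N, 0 < t -> t < r2 -> (0 < N)%N /\ iter N k (xs t) = xs t.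
  have [[t0 tr]|nt] := pselect (0 < t /\ t < r2); last by exists 0%N => t0 tr; exfalso; exact: nt.
  have Ot : O n (xs t) by apply: Hr2; rewrite subr0 xs_n.
  by have [N N0 pN] := @periodic_point false (xs t) (fun i => OV _ (kOi i _ Ot)); exists N.
have {P}/choice[N HN] := P.
have [] := @periodic_of_many k V oV (g_diff false) (g_fix (b := false)) r2 xs N (fun=> O n) r20.
  move=> t t0 tr; have [Np pN] := HN t t0 tr; split=> //; first exact: xs_n.
  split=> //; first by apply: Hr2; rewrite subr0 xs_n.
  by move=> x Ox i _; apply: OV; exact: kOi.
move=> M M0 [/nearP[d d0 Hd] _]; exists M => //.
apply/nearP; exists (Num.min d r2) => [|x]; first by rewrite lt_min d0.
rewrite lt_min => /andP[/Hd kx /Hr2 Ox].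
have hkn j y : O n y -> iter j h (iter j k y) = y.
  elim: j y => //= j IH y Oy; rewrite -iterS iterSr.
  have -> : h (k (iter j k y)) = iter j k y by apply: hk; apply: OV; [exact: kOi | exact: (kOi j.+1)].
  exact: IH.
by rewrite -{1}kx hkn.
Qed.

End TwoMaps.
End Periodicity.

(** * Flows in complex time *)

Section Euler.
Variables (R : realType) (n : nat).
Local Notation C := (Cx R).
Local Notation E := 'rV[C]_n.

Definition euler (Y : E -> E) (h : C) (i : nat) (x : E) : E :=
  iter i (fun y => y + h *: Y y) x.

(** The time-nu map of the flow of Y, for complex nu, as the limit of N Euler
    steps of length nu / N along the segment from 0 to nu. A limit with the rate
    1 / N is required, which gives uniqueness at once and convergence that is
    uniform in parameters. *)
Definition flow (Y : E -> E) (nu : C) (x : E) : E :=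
  get [set l | exists (K : R) N0, forall N, (0 < N)%N -> (N0 <= N)%N ->
    nrm (euler Y (nu / N%:R) N x - l) <= K / N%:R].

(** The vector field is controlled on P only, so every estimate must know that
    the polygons stay in P. In [euler_good] this holds for all fine subdivisions;
    a common N0 for nearby times and points gives uniform convergence. *)
Definition euler_in (Y : E -> E) (P : set E) (nu : C) (N : nat) (x : E) :=
  forall i, (i <= N)%N -> P (euler Y (nu / N%:R) i x).

Definition euler_good (Y : E -> E) (P : set E) (N0 : nat) (nu : C) (x : E) :=
  (0 < N0)%N /\ forall N, (N0 <= N)%N -> euler_in Y P nu N x.

Lemma toC_nat k : toC k%:R = k%:R :> C.
Proof. by elim: k => [//|k IH]; rewrite -natr1 toCD IH -[in RHS]natr1. Qed.

(** Inequalities between limits are proved up to an error K / N and then freed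
    from it here. *)
Lemma small_of_rate (K a : R) N0 : (forall N, (0 < N)%N -> (N0 <= N)%N -> a <= K / N%:R) -> a <= 0.
Proof.
move=> H; apply/ler_addgt0Pr => e e0; rewrite add0r.
have K0 : 0 < `|K| + 1 by rewrite ltr_wpDl.
have [k Hk] := ltr_add_invr (divr_gt0 e0 K0); rewrite add0r in Hk.
have := H (maxn N0 k.+1); rewrite leq_maxl leq_max ltn0Sn orbT => /(_ isT isT).
set N := maxn _ _ => aK; apply: le_trans aK _.
have N1 : k.+1%:R <= N%:R :> R by rewrite ler_nat leq_maxr.
have Np : 0 < N%:R :> R by apply: lt_le_trans N1; rewrite ltr0n.
rewrite ler_pdivrMr//; move: Hk; rewrite ltr_pdivlMr// mulrC ltr_pdivrMr ?ltr0n// => Hk.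
apply: le_trans (ler_norm K) _; have : e * k.+1%:R <= e * N%:R by rewrite ler_wpM2l// ltW.
lra.
Qed.

Lemma three_steps (f z w u yz yu : E) (s : C) : f - (z + s *: yz) =
  (f - w) + (w - (u + s *: yu)) + ((u - z) + s *: (yu - yz)).
Proof. by apply/rowP => j; rewrite !mxE; ring. Qed.

Lemma rate_split (a b k s i : R) : (a + k * b) * i + s = a * i + s + k * (b * i).
Proof. ring. Qed.

Lemma quadratic_small (k q e : R) : 0 <= q -> (k + 1) * q <= e / 2 ->
  k * q ^+ 2 + e / 2 * q <= q * e.
Proof.
move=> q0 H; have := ler_wpM2l q0 H; have := mulr_ge0 q0 q0; rewrite expr2.
lra.
Qed.

Lemma scaled_difference (z f l y : E) (s : C) : s *: l - s *: y =
  (f - (z + s *: y)) - (f - z - s *: l).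
Proof. by apply/rowP => j; rewrite !mxE; ring. Qed.

Section Field.
Variables (Y : E -> E) (P : set E) (L B : R).
Hypotheses (L0 : 0 <= L) (B0 : 0 <= B).
Hypothesis YL : forall x y, P x -> P y -> nrm (Y x - Y y) <= L * nrm (x - y).
Hypothesis YB : forall x, P x -> nrm (Y x) <= B.

Lemma eulerS h i x : euler Y h i.+1 x = euler Y h i x + h *: Y (euler Y h i x).
Proof. by []. Qed.

Lemma eulerD h i j x : euler Y h (i + j) x = euler Y h i (euler Y h j x).
Proof. by rewrite /euler iterD. Qed.

(** Discrete Gronwall inequality: an approximate polygon with defect d at each
    step stays close to the Euler polygon with the same origin. *)
Lemma euler_compare (h : C) (N : nat) (v : nat -> E) (d : R) : 0 <= d ->
  (forall i, (i <= N)%N -> P (v i) /\ P (euler Y h i (v 0%N))) ->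
  (forall i, (i < N)%N -> nrm (v i.+1 - (v i + h *: Y (v i))) <= d) ->
  nrm (v N - euler Y h N (v 0%N)) <= N%:R * d * expR (L * nrm h * N%:R).
Proof.
move=> d0 HP Hv.
have c0 : 0 <= L * nrm h by rewrite mulr_ge0 ?nrm_ge0.
suff H i : (i <= N)%N -> nrm (v i - euler Y h i (v 0%N)) <= i%:R * d * expR (L * nrm h * i%:R) by exact: H.
elim: i => [|i IH] iN; first by rewrite /= subrr nrm0 !mul0r.
have [Pv Pe] := HP i (ltnW iN); have {}IH := IH (ltnW iN).
have S1 := Hv i iN; rewrite eulerS.
set e := euler Y h i (v 0%N) in IH Pe *.
have -> : v i.+1 - (e + h *: Y e) =
   (v i.+1 - (v i + h *: Y (v i))) + ((v i - e) + h *: (Y (v i) - Y e)).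
  by apply/rowP => j; rewrite !mxE; ring.
apply: le_trans (nrm_triD _ _) _; apply: le_trans (lerD S1 (nrm_triD _ _)) _.
rewrite nrmZ; have S2 := ler_wpM2l (nrm_ge0 h) (YL Pv Pe).
have D0 : 0 <= nrm (v i - e) by exact: nrm_ge0.
set D := nrm (v i - e) in IH S2 D0 *.
have S3 : D + nrm h * (L * D) <= i%:R * d * expR (L * nrm h * i.+1%:R).
  rewrite (_ : D + _ = (1 + L * nrm h) * D); last by ring.
  rewrite -natr1 mulrDr mulr1 expRD mulrA mulrC; apply: ler_pM => //; first by rewrite addr_ge0.
  exact: expR_ge1Dx.
have S4 : d <= d * expR (L * nrm h * i.+1%:R).
  by rewrite ler_peMr// -expR0 ler_expR mulr_ge0.
rewrite -natr1 !mulrDl mul1r; move: S3 S4; rewrite natr1; move: S2.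
set a := nrm h * nrm _; lra.
Qed.

Lemma euler_dist (h : C) (M i : nat) x : (0 < M)%N -> (i <= M)%N ->
  (forall j, (j < i)%N -> P (euler Y (h / M%:R) j x)) ->
  nrm (euler Y (h / M%:R) i x - x) <= nrm h * B.
Proof.
move=> M0 iM HP.
suff H j : (j <= i)%N -> nrm (euler Y (h / M%:R) j x - x) <= j%:R * (nrm h / M%:R * B).
  apply: le_trans (H i (leqnn i)) _.
  have M0' : 0 < M%:R :> R by rewrite ltr0n.
  rewrite (_ : _ * (_ * B) = i%:R / M%:R * (nrm h * B)); last by rewrite -!mulrA; ring.
  by rewrite ler_piMl ?mulr_ge0 ?nrm_ge0// ler_pdivrMr// mul1r ler_nat.
elim: j => [|j IH] ji; first by rewrite /= subrr nrm0 mul0r.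
rewrite eulerS addrAC; apply: le_trans (nrm_triD _ _) _.
rewrite -natr1 mulrDl mul1r; apply: lerD; first exact: IH (ltnW ji).
rewrite nrmZ nrmM nrmV nrm_nat ler_wpM2l ?mulr_ge0 ?nrm_ge0 ?invr_ge0//.
by apply: YB; exact: HP.
Qed.

(** M small steps differ from a single step of the same total length by a second
    order term, uniformly in M. *)
Lemma euler_one_step (h : C) (M : nat) x : (0 < M)%N ->
  (forall j, (j <= M)%N -> P (euler Y (h / M%:R) j x)) ->
  nrm (euler Y (h / M%:R) M x - (x + h *: Y x)) <= L * B * nrm h ^+ 2.
Proof.
move=> M0 HP; have M0' : 0 < M%:R :> R by rewrite ltr0n.
have Mc : M%:R != 0 :> C by rewrite pnatr_eq0 -lt0n.
suff H j : (j <= M)%N -> nrm (euler Y (h / M%:R) j x - (x + (j%:R * (h / M%:R)) *: Y x)) <=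
     j%:R * (nrm h / M%:R * (L * (nrm h * B))).
  have := H M (leqnn M); rewrite mulrCA divff// mulr1 => H1; apply: le_trans H1 _.
  rewrite le_eqVlt; apply/orP; left; apply/eqP; field; exact: lt0r_neq0.
elim: j => [|j IH] jM; first by rewrite mul0r scale0r addr0 /= subrr nrm0 !mul0r.
rewrite eulerS; set e := euler Y _ j x.
have -> : e + (h / M%:R) *: Y e - (x + (j.+1%:R * (h / M%:R)) *: Y x) =
   (e - (x + (j%:R * (h / M%:R)) *: Y x)) + (h / M%:R) *: (Y e - Y x).
  by rewrite -natr1; apply/rowP => i; rewrite !mxE; ring.
apply: le_trans (nrm_triD _ _) _; rewrite -natr1 [leRHS]mulrDl mul1r; apply: lerD.
  exact: IH (ltnW jM).
rewrite nrmZ nrmM nrmV nrm_nat ler_wpM2l ?mulr_ge0 ?nrm_ge0 ?invr_ge0//.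
apply: le_trans (YL (HP j (ltnW jM)) (HP 0%N (leq0n _))) _; rewrite ler_wpM2l//.
apply: euler_dist => // [|i ij]; first exact: ltnW.
by apply: HP; apply: leq_trans (ltnW ij) (ltnW jM).
Qed.

(** The constant of the global error of the Euler method: N steps, with a defect
    of order (|nu| / N)^2 each, and the amplification of Gronwall. *)
Definition euler_rate (nu : C) : R := L * B * nrm nu ^+ 2 * expR (L * nrm nu).

Lemma euler_rate_ge0 nu : 0 <= euler_rate nu.
Proof. by rewrite mulr_ge0 ?expR_ge0// !mulr_ge0 ?exprn_ge0 ?nrm_ge0. Qed.

(** Both refined polygons and exact solutions satisfy the hypothesis; they
    provide existence and uniqueness respectively. *)
Lemma approx_solution (nu : C) (N : nat) (v : nat -> E) : (0 < N)%N ->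
  (forall i, (i <= N)%N -> P (v i)) -> euler_in Y P nu N (v 0%N) ->
  (forall i, (i < N)%N -> nrm (v i.+1 - (v i + (nu / N%:R) *: Y (v i))) <= L * B * nrm (nu / N%:R) ^+ 2) ->
  nrm (v N - euler Y (nu / N%:R) N (v 0%N)) <= euler_rate nu / N%:R.
Proof.
move=> N0 Pv Pe Hv; have N0' : 0 < N%:R :> R by rewrite ltr0n.
have d0 : 0 <= L * B * nrm (nu / N%:R) ^+ 2 by rewrite !mulr_ge0 ?exprn_ge0 ?nrm_ge0.
apply: le_trans (euler_compare d0 (fun i iN => conj (Pv i iN) (Pe i iN)) Hv) _.
rewrite nrmM nrmV nrm_nat /euler_rate le_eqVlt; apply/orP; left; apply/eqP.
have -> : L * (nrm nu / N%:R) * N%:R = L * nrm nu by field; exact: lt0r_neq0.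
by field; exact: lt0r_neq0.
Qed.

Lemma euler_refine (nu : C) (N M : nat) x : (0 < N)%N -> (0 < M)%N ->
  euler_in Y P nu N x -> euler_in Y P nu (N * M) x ->
  nrm (euler Y (nu / (N * M)%:R) (N * M) x - euler Y (nu / N%:R) N x) <= euler_rate nu / N%:R.
Proof.
move=> N0 M0 HN HNM.
have hE : nu / (N * M)%:R = nu / N%:R / M%:R by rewrite natrM invfM mulrA.
have := @approx_solution nu N (fun i => euler Y (nu / (N * M)%:R) (i * M) x) N0; rewrite mul0n; apply.
- by move=> i iN; apply: HNM; rewrite leq_mul2r iN orbT.
- exact: HN.
move=> i iN; rewrite mulSn eulerD hE; apply: euler_one_step => // j jM.
rewrite -eulerD -hE; apply: HNM; apply: leq_trans (leq_add jM (leqnn _)) _.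
by rewrite -mulSn leq_mul2r iN orbT.
Qed.

Lemma flow_eq nu x l (K : R) N0 : (forall N, (0 < N)%N -> (N0 <= N)%N ->
  nrm (euler Y (nu / N%:R) N x - l) <= K / N%:R) -> flow Y nu x = l.
Proof.
move=> H; have ex : exists l, [set l | exists (K : R) N0, forall N, (0 < N)%N -> (N0 <= N)%N ->
    nrm (euler Y (nu / N%:R) N x - l) <= K / N%:R] l by exists l, K, N0.
have [K' [N0' H']] := getPex ex; rewrite -/(flow Y nu x) in H'.
apply/eqP; rewrite -subr_eq0 -nrm_eq0 eq_le nrm_ge0 andbT.
apply: (@small_of_rate (K' + K) _ (maxn N0 N0')) => N Np; rewrite geq_max => /andP[N1 N2].
apply: le_trans (nrm_tri (euler Y (nu / N%:R) N x) _ _) _.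
by rewrite mulrDl lerD//; [rewrite nrmB; exact: H' | exact: H].
Qed.

Opaque flow.

(** Two subdivisions are compared through their common refinement, so the
    polygons form a Cauchy sequence. *)
Lemma flow_conv nu x N0 : euler_good Y P N0 nu x -> forall N, (N0 <= N)%N ->
  nrm (euler Y (nu / N%:R) N x - flow Y nu x) <= 2 * (euler_rate nu / N%:R).
Proof.
move=> [N00 Hg] N NN.
have cauchy N1 N2 : (N0 <= N1)%N -> (N0 <= N2)%N ->
   nrm (euler Y (nu / N1%:R) N1 x - euler Y (nu / N2%:R) N2 x) <= euler_rate nu / N1%:R + euler_rate nu / N2%:R.
  move=> H1 H2; have p1 := leq_trans N00 H1; have p2 := leq_trans N00 H2.
  have g12 : euler_in Y P nu (N1 * N2) x by apply: Hg; apply: leq_trans H1 _; exact: leq_pmulr.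
  apply: le_trans (nrm_tri (euler Y (nu / (N1 * N2)%:R) (N1 * N2) x) _ _) _; apply: lerD.
    by rewrite nrmB; apply: euler_refine => //; exact: Hg.
  by rewrite mulnC; apply: euler_refine => //; [exact: Hg | rewrite mulnC].
have /choice[l Hl] j : exists l, forall k, nrm (euler Y (nu / (N0 + k)%:R) (N0 + k) x 0 j - l) <= 2 * (euler_rate nu / (N0 + k)%:R).
  apply: (@complex_limit R (fun k => euler Y (nu / (N0 + k)%:R) (N0 + k) x 0 j)) => a b.
  have := cauchy _ _ (leq_addr a N0) (leq_addr b N0); apply: le_trans.
  by have := nrm_coord (euler Y (nu / (N0 + a)%:R) (N0 + a) x - euler Y (nu / (N0 + b)%:R) (N0 + b) x) 0 j; rewrite !mxE.
have Hl' N' : (N0 <= N')%N -> nrm (euler Y (nu / N'%:R) N' x - (\row_j l j)) <= 2 * (euler_rate nu / N'%:R).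
  move=> NN'; apply: nrm_row_le => [|j]; first by rewrite mulr_ge0// divr_ge0// euler_rate_ge0.
  by rewrite !mxE; have := Hl j (N' - N0)%N; rewrite subnKC.
rewrite (@flow_eq nu x (\row_j l j) (2 * euler_rate nu) N0); first exact: Hl'.
by move=> N' _ /Hl'; rewrite mulrA.
Qed.

Lemma flow_first_order nu x N0 : euler_good Y P N0 nu x ->
  nrm (flow Y nu x - (x + nu *: Y x)) <= L * B * nrm nu ^+ 2.
Proof.
move=> Hg; rewrite -subr_le0.
apply: (@small_of_rate (2 * euler_rate nu) _ N0) => N Np NN; rewrite lerBlDr.
apply: le_trans (nrm_tri (euler Y (nu / N%:R) N x) _ _) _; apply: lerD.
  by rewrite nrmB -mulrA; exact: flow_conv Hg _ NN.
by apply: euler_one_step => //; exact: Hg.2.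
Qed.

Lemma flow_dist nu x N0 : euler_good Y P N0 nu x -> nrm (flow Y nu x - x) <= B * nrm nu.
Proof.
move=> Hg; rewrite -subr_le0.
apply: (@small_of_rate (2 * euler_rate nu) _ N0) => N Np NN; rewrite lerBlDr.
apply: le_trans (nrm_tri (euler Y (nu / N%:R) N x) _ _) _; apply: lerD.
  by rewrite nrmB -mulrA; exact: flow_conv Hg _ NN.
by rewrite [leRHS]mulrC; apply: euler_dist; [exact: Np | exact: leqnn | move=> j /ltnW; exact: (Hg.2 N NN)].
Qed.

Lemma flow0 x N0 : euler_good Y P N0 0 x -> flow Y 0 x = x.
Proof.
move=> /flow_dist; rewrite nrm0 mulr0 => H; apply/eqP.
by rewrite -subr_eq0 -nrm_eq0 eq_le nrm_ge0 H.
Qed.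

(** The flow is a limit of polygons whose steps point along nu, so prolonging the
    time by nu / p merely prolongs these polygons by one p-th. *)
Lemma flow_step nu x N0 N1 p : (0 < p)%N -> euler_good Y P N0 nu x ->
  euler_good Y P N1 (nu + nu / p%:R) x -> P (flow Y nu x) ->
  nrm (flow Y (nu + nu / p%:R) x - (flow Y nu x + (nu / p%:R) *: Y (flow Y nu x))) <=
    L * B * nrm (nu / p%:R) ^+ 2.
Proof.
move=> p0 Hg Hg1 Pf; set nu' := nu + nu / p%:R; set z := flow Y nu x.
have pR : 0 < p%:R :> R by rewrite ltr0n.
have pC : p%:R != 0 :> C by rewrite pnatr_eq0 -lt0n.
rewrite -subr_le0.
pose c := nrm (nu / p%:R) * L; have c0 : 0 <= c by rewrite mulr_ge0 ?nrm_ge0.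
apply: (@small_of_rate (2 * euler_rate nu' + (1 + c) * (2 * euler_rate nu)) _ (N0 + N1)) => N Np NN.
rewrite lerBlDr.
have NR : 0 < N%:R :> R by rewrite ltr0n.
have NC : N%:R != 0 :> C by rewrite pnatr_eq0 -lt0n.
have H1 : (N0 <= p * N)%N.
  by apply: leq_trans (leq_addr N1 N0) _; apply: leq_trans NN _; exact: leq_pmull.
have H2 : (N1 <= p.+1 * N)%N.
  by apply: leq_trans (leq_addl N0 N1) _; apply: leq_trans NN _; exact: leq_pmull.
have stepE : nu' / (p.+1 * N)%:R = nu / p%:R / N%:R.
  have p1C : 1 + p%:R != 0 :> C by rewrite nat1r pnatr_eq0.
  by rewrite /nu' natrM -nat1r; field; rewrite NC p1C pC.
have stepE' : nu / (p * N)%:R = nu / p%:R / N%:R by rewrite natrM; field; rewrite NC pC.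
set u := euler Y (nu / (p * N)%:R) (p * N) x.
have Pu : P u by apply: (Hg.2 _ H1).
have E1 : euler Y (nu' / (p.+1 * N)%:R) (p.+1 * N) x = euler Y (nu / p%:R / N%:R) N u.
  by rewrite /u stepE stepE' mulSn eulerD.
have A1 := flow_conv Hg1 H2; have A2 := flow_conv Hg H1; rewrite -/nu' E1 in A1; rewrite -/u -/z in A2.
have A3 : nrm (euler Y (nu / p%:R / N%:R) N u - (u + (nu / p%:R) *: Y u)) <= L * B * nrm (nu / p%:R) ^+ 2.
  apply: euler_one_step => // j jN; rewrite /u stepE' -eulerD -stepE; apply: (Hg1.2 _ H2).
  by rewrite mulSn leq_add2r.
have A4 := YL Pu Pf.
have r0 := euler_rate_ge0 nu; have r1 := euler_rate_ge0 nu'.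
have mono (K : R) q : 0 <= K -> (0 < q)%N -> K / (q * N)%:R <= K / N%:R.
  move=> K0 q0; rewrite ler_wpM2l// lef_pV2 ?posrE ?ltr0n ?muln_gt0 ?q0//.
  by rewrite ler_nat leq_pmull.
have A1' : 2 * (euler_rate nu' / (p.+1 * N)%:R) <= 2 * euler_rate nu' / N%:R.
  by rewrite -mulrA ler_wpM2l// mono.
have A2' : 2 * (euler_rate nu / (p * N)%:R) <= 2 * euler_rate nu / N%:R.
  by rewrite -mulrA ler_wpM2l// mono.
set w := euler Y (nu / p%:R / N%:R) N u in A1 A3.
rewrite (three_steps _ z w u _ (Y u)).
apply: le_trans (nrm_triD _ _) _; apply: le_trans (lerD (nrm_triD _ _) (nrm_triD _ _)) _.
rewrite nrmZ [nrm (_ - w)]nrmB.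
have A5 : nrm (nu / p%:R) * nrm (Y u - Y z) <= c * nrm (u - z).
  by rewrite /c -mulrA ler_wpM2l ?nrm_ge0.
have A6 : (1 + c) * nrm (u - z) <= (1 + c) * (2 * euler_rate nu / N%:R).
  by rewrite ler_wpM2l ?addr_ge0//; exact: le_trans A2 A2'.
have A7 : nrm (u - z) + nrm (nu / p%:R) * nrm (Y u - Y z) <= (1 + c) * (2 * euler_rate nu / N%:R).
  by apply: le_trans A6; rewrite [leRHS]mulrDl mul1r lerD2l.
have -> : (2 * euler_rate nu' + (1 + c) * (2 * euler_rate nu)) / N%:R + L * B * nrm (nu / p%:R) ^+ 2 =
    2 * euler_rate nu' / N%:R + L * B * nrm (nu / p%:R) ^+ 2 + (1 + c) * (2 * euler_rate nu / N%:R).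
  by apply: rate_split.
exact: lerD (lerD (le_trans A1 A1') A3) A7.
Qed.

(** Holomorphy in time is granted by [flow_holo]; a complex derivative may be
    computed along any sequence of increments, and the increments nu / p are those
    of [flow_step]. At nu = 0 the first order expansion is direct. *)
Lemma flow_der nu x N0 r : 0 < r -> (forall s, nrm (s - nu) < r -> euler_good Y P N0 s x) ->
  P (flow Y nu x) -> (forall i, exists l, lder (fun s => flow Y s x 0 i) nu 1 l) ->
  lder (fun s => flow Y s x) nu 1 (Y (flow Y nu x)).
Proof.
move=> r0 Hg Pf fd; have gnu : euler_good Y P N0 nu x by apply: Hg; rewrite subrr nrm0.
have [nu0|nu0] := eqVneq nu 0.
  rewrite nu0 in Hg gnu Pf *; apply: (@lder_quad _ _ _ _ _ _ _ (L * B) r) => // t tr.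
  rewrite add0r [t *: 1]mulr1 (flow0 gnu) -addrA -opprD.
  by apply: (@flow_first_order t x N0); apply: Hg; rewrite subr0.
have {fd}/choice[l Hl] := fd.
have H : lder (fun s => flow Y s x) nu 1 (\row_i l i) by apply: lder_row => i; rewrite mxE.
suff <- : \row_i l i = Y (flow Y nu x) by [].
apply/eqP; rewrite -subr_eq0 -nrm_eq0 eq_le nrm_ge0 andbT.
have n0 : 0 < nrm nu by rewrite nrm_gt0.
apply/ler_addgt0Pr => e e0; rewrite add0r.
have e2 : 0 < e / 2 by rewrite divr_gt0.
have [d d0 Hd] := H _ e2.
pose c := L * B + 1; have c0 : 0 < c by rewrite ltr_wpDl// mulr_ge0.
(* the increment nu / p is small enough for both first order expansions, and so
   small that its quadratic error is below e / 2 per unit *)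
pose q := Num.min (Num.min d r) (e / 2 / c); have q0 : 0 < q by rewrite !lt_min d0 r0 divr_gt0.
have [p Hp] := ltr_add_invr (divr_gt0 q0 n0); rewrite add0r in Hp.
have pq : nrm (nu / p.+1%:R) < q.
  by rewrite nrmM nrmV nrm_nat mulrC -ltr_pdivlMr.
move: pq; rewrite !lt_min => /andP[/andP[pd pr] pc].
have g1 : euler_good Y P N0 (nu + nu / p.+1%:R) x by apply: Hg; rewrite addrC addKr.
have S1 := flow_step (ltn0Sn p) gnu g1 Pf.
have S2 := Hd _ pd; rewrite [_ *: 1]mulr1 in S2.
set s := nu / p.+1%:R in pd pr pc S1 S2 g1.
have s0 : 0 < nrm s by rewrite nrmM nrmV nrm_nat divr_gt0// ltr0n.
rewrite -(ler_pM2l s0) -nrmZ scalerBr.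
rewrite (scaled_difference (flow Y nu x) (flow Y (nu + s) x)).
apply: le_trans (nrm_triB _ _) _; apply: le_trans (lerD S1 S2) _.
have : c * nrm s < e / 2 by rewrite mulrC -ltr_pdivlMr.
move=> /ltW H1; exact: quadratic_small (ltW s0) H1.
Qed.

(** A solution of the differential equation along the segment from 0 to nu is an
    approximate polygon, by the mean value inequality on each subinterval. *)
Lemma flow_uniq (nu : C) (v : R -> E) N0 :
  (forall t, 0 <= t -> t <= 1 -> P (v t) /\ rder v t (nu *: Y (v t))) ->
  euler_good Y P N0 nu (v 0) -> flow Y nu (v 0) = v 1.
Proof.
move=> Hv Hg.
apply: (@flow_eq nu _ _ (euler_rate nu) N0) => N Np NN; rewrite nrmB.
have NR : 0 < N%:R :> R by rewrite ltr0n.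
pose u (i : nat) := v (i%:R / N%:R).
have ut i : (i <= N)%N -> 0 <= i%:R / N%:R :> R /\ i%:R / N%:R <= 1 :> R.
  by move=> iN; rewrite divr_ge0// ler_pdivrMr// mul1r ler_nat.
have := @approx_solution nu N u Np; rewrite /u mul0r divff ?gt_eqF//; apply.
- by move=> i iN; have [t0 t1] := ut i iN; exact: (Hv _ t0 t1).1.
- exact: Hg.2.
move=> i iN; have [t0 t1] := ut i (ltnW iN); have [t0' t1'] := ut i.+1 iN.
set t := i%:R / N%:R in t0 t1 *; have tE : i.+1%:R / N%:R = t + N%:R^-1 by rewrite -natr1 mulrDl mul1r.
rewrite tE in t0' t1' *; set s := N%:R^-1 : R in t0' t1' *.
have s0 : 0 < s by rewrite invr_gt0.
have lip t' : t <= t' -> t' <= t + s -> nrm (v t' - v t) <= nrm nu * B * s.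
  move=> tt ts; apply: (@le_trans _ _ (nrm nu * B * (t' - t))).
    apply: mvi => // t2 t2a t2b.
    have [|| Pt rt] := Hv t2; [exact: le_trans t2a | exact: le_trans t2b (le_trans ts t1') |].
    by exists (nu *: Y (v t2)); rewrite // nrmZ ler_wpM2l ?nrm_ge0// YB.
  by rewrite ler_wpM2l ?mulr_ge0 ?nrm_ge0//; lra.
have [Pt _] := Hv t t0 t1.
have sE : toC s = N%:R^-1 :> C.
  rewrite /s; apply: (@mulfI _ (N%:R)); first by rewrite pnatr_eq0 -lt0n.
  rewrite -toC_nat.
  have tN : toC N%:R != 0 :> C by rewrite toC_nat pnatr_eq0 -lt0n.
  by rewrite -toCM mulfV ?gt_eqF// divff.
have := @mvi R E (fun t' => v t' - toC t' *: (nu *: Y (v t))) t (t + s) (nrm nu * (L * (nrm nu * B * s))).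
have -> : v (t + s) - toC (t + s) *: (nu *: Y (v t)) - (v t - toC t *: (nu *: Y (v t))) =
  v (t + s) - (v t + (nu / N%:R) *: Y (v t)).
  by rewrite toCD sE; apply/rowP => j; rewrite !mxE; ring.
move=> H; apply: le_trans (H _ _) _; first by rewrite lerDl ltW.
  move=> t' tt' ts'.
  have [|| Pt' rt'] := Hv t'; [exact: le_trans tt' | exact: le_trans ts' t1' |].
  exists (nu *: Y (v t') - nu *: Y (v t)); first by apply: rderB; [exact: rt' | exact: rder_lin].
  rewrite -scalerBr nrmZ ler_wpM2l ?nrm_ge0//.
  by apply: le_trans (YL Pt' Pt) _; rewrite ler_wpM2l//; exact: lip.
rewrite nrmM nrmV nrm_nat -/s addrC addKr le_eqVlt; apply/orP; left; apply/eqP; ring.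
Qed.

End Field.

Section Holomorphy.
Variables (Y : E -> E) (P : set E) (L B Bd : R).
Hypotheses (L0 : 0 <= L) (B0 : 0 <= B).
Hypothesis YL : forall x y, P x -> P y -> nrm (Y x - Y y) <= L * nrm (x - y).
Hypothesis YB : forall x, P x -> nrm (Y x) <= B.
Hypothesis YD : forall x, P x -> differentiable Y x.
Hypothesis PB : forall x, P x -> nrm x <= Bd.

Lemma euler_diff (V : normedModType C) (nu : V -> C) (xi : V -> E) (z : V) N i :
  differentiable nu z -> differentiable xi z ->
  (forall j, (j < i)%N -> P (euler Y (nu z / N%:R) j (xi z))) ->
  differentiable (fun z => euler Y (nu z / N%:R) i (xi z)) z.
Proof.
move=> dnu dxi; elim: i => [|i IH] HP; first exact: dxi.
have {}IH := IH (fun j ji => HP j (ltnW ji)).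
have dY : differentiable (fun z => Y (euler Y (nu z / N%:R) i (xi z))) z.
  by apply: (@differentiable_comp _ _ _ _ _ Y) => //; apply: YD; exact: HP.
apply: diff_row => j.
have -> : (fun y => euler Y (nu y / N%:R) i.+1 (xi y) 0 j) =
   (fun y => euler Y (nu y / N%:R) i (xi y) 0 j) +
   (fun y => nu y * N%:R^-1) * (fun y => Y (euler Y (nu y / N%:R) i (xi y)) 0 j).
  by apply/funext => y; rewrite eulerS !mxE.
apply: differentiableD; first exact: diff_entry.
apply: differentiableM; last exact: diff_entry.
by apply: differentiableM.
Qed.

(** The time and the initial point may depend on parameters: Euler polygons are
    holomorphic in them, and converge uniformly. *)
Lemma flow_holo (V : normedModType C) (nu : V -> C) (xi : V -> E) (z0 : V) (r A : R) N0 : 0 < r ->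
  (forall z, nrm (z - z0) < r -> [/\ differentiable nu z, differentiable xi z,
     nrm (nu z) <= A & euler_good Y P N0 (nu z) (xi z)]) ->
  forall z, nrm (z - z0) < r -> differentiable (fun z => flow Y (nu z) (xi z)) z.
Proof.
move=> r0 H.
have H0 : nrm (z0 - z0) < r by rewrite subrr nrm0.
have A0 : 0 <= A by have [_ _ a _] := H _ H0; apply: le_trans a; exact: nrm_ge0.
pose K := 2 * (L * B * A ^+ 2 * expR (L * A)).
have K0 : 0 <= K by rewrite !mulr_ge0// ?exprn_ge0// expR_ge0.
move=> z zr; apply: diff_row => i; move: z zr.
apply: (@uniform_limit_holomorphic R V (fun k z => euler Y (nu z / (N0 + k)%:R) (N0 + k) (xi z) 0 i)
  (fun z => flow Y (nu z) (xi z) 0 i) z0 r Bd (fun k => K / (N0 + k)%:R) r0).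
- move=> k z /H[dnu dxi _ [_ Hg]]; apply: diff_entry; apply: euler_diff => // j jk.
  by apply: Hg; [exact: leq_addr | exact: ltnW].
- move=> k z /H[_ _ _ [_ Hg]]; apply: le_trans (nrm_coord _ _ _) _; apply: PB.
  exact: (Hg _ (leq_addr k N0) _ (leqnn _)).
- move=> k z /H[_ _ nA Hg].
  have := flow_conv L0 B0 YL YB Hg (leq_addr k N0).
  have := nrm_coord (euler Y (nu z / (N0 + k)%:R) (N0 + k) (xi z) - flow Y (nu z) (xi z)) 0 i.
  rewrite !mxE => H1 H2; apply: le_trans H1 (le_trans H2 _).
  rewrite /K -mulrA ler_wpM2l// ler_wpM2r// /euler_rate.
  apply: ler_pM; rewrite ?expR_ge0 ?mulr_ge0 ?exprn_ge0 ?nrm_ge0//.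
    by rewrite ler_wpM2l ?mulr_ge0//; apply: lerXn2r; rewrite ?nnegrE ?nrm_ge0.
  by rewrite ler_expR ler_wpM2l.
move=> e e0; have K1 : 0 < K + 1 by rewrite ltr_wpDl.
have [k] := ltr_add_invr (divr_gt0 e0 K1); rewrite add0r => Hk.
exists k.+1; have kR : 0 < (N0 + k.+1)%:R :> R by rewrite ltr0n addnS.
rewrite ler_pdivrMr//; move: Hk; rewrite ltr_pdivlMr// mulrC ltr_pdivrMr ?ltr0n// => Hk.
have : e * k.+1%:R <= e * (N0 + k.+1)%:R.
  by apply: ler_wpM2l; [exact: ltW | rewrite ler_nat leq_addl].
lra.
Qed.

(** The time is interior to the domain of the flow at x, with a uniform threshold
    for the number of steps. *)
Definition flow_ok (x : E) (s : C) : Prop :=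
  exists (r : R) N0, 0 < r /\ forall s', nrm (s' - s) < r -> euler_good Y P N0 s' x.

Lemma flow_ok_lder x s : flow_ok x s -> P (flow Y s x) ->
  lder (fun s => flow Y s x) s 1 (Y (flow Y s x)).
Proof.
move=> [r [N0 [r0 Hr]]] Ps; apply: (flow_der L0 B0 YL YB r0 Hr Ps) => i.
have D : differentiable (fun s => flow Y s x) s.
  apply: (@flow_holo C id (fun=> x) s r (nrm s + r) N0 r0); last by rewrite subrr nrm0.
  move=> z zs; split; [exact: ex_diff | exact: differentiable_cst | | exact: Hr].
  by have := nrm_subl z s; lra.
exists ('d (fun s => flow Y s x) s 1 0 i); apply: lder_entry; exact: diff_lder.
Qed.

(** The path t |-> flow (nu1 + t nu2) solves the equation with the initial value
    flow nu1, so uniqueness identifies its end point. *)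
Lemma flow_semigroup x nu1 nu2 N0 :
  (forall t : R, 0 <= t -> t <= 1 -> flow_ok x (nu1 + toC t *: nu2) /\ P (flow Y (nu1 + toC t *: nu2) x)) ->
  euler_good Y P N0 nu2 (flow Y nu1 x) -> flow Y nu2 (flow Y nu1 x) = flow Y (nu1 + nu2) x.
Proof.
move=> H Hg; pose v t := flow Y (nu1 + toC t *: nu2) x.
have toC0 : toC 0 = 0 :> C by [].
have toC1 : toC 1 = 1 :> C by [].
have v0 : v 0 = flow Y nu1 x by rewrite /v toC0 scale0r addr0.
have e1 : nu1 + toC 1 *: nu2 = nu1 + nu2 by rewrite toC1 scale1r.
have v1 : v 1 = flow Y (nu1 + nu2) x := congr1 (fun s => flow Y s x) e1.
rewrite -v1 -v0; apply: (@flow_uniq Y P L B L0 B0 YL YB nu2 v N0); last by rewrite v0.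
move=> t t0 t1; have [ok Pt] := H t t0 t1; split; first exact: Pt.
apply: (@lder_rder R C E (fun s => flow Y s x)).
have e2 : nu2 *: (1 : C) = nu2 by rewrite scaleC mulr1.
exact: (eq_rect _ (fun w => lder (fun s => flow Y s x) _ w _) (lder_scale nu2 (flow_ok_lder ok Pt)) _ e2).
Qed.

End Holomorphy.
End Euler.

(** * Logarithms, averages, cones and determinants *)

Opaque cexp flow.

Lemma archimedes (R : realType) (S : R) : exists k : nat, S < k.+1%:R.
Proof.
have p : 0 < (`|S| + 1)^-1 by rewrite invr_gt0 ltr_wpDl.
have [k] := ltr_add_invr p; rewrite add0r ltf_pV2 ?posrE ?ltr0n ?ltr_wpDl// => H.
exists k; apply: le_lt_trans (ler_norm S) (lt_trans _ H).
by rewrite ltrDl.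
Qed.

Lemma toC_natV (R : realType) N : N%:R^-1 = toC (N%:R^-1 : R) :> Cx R.
Proof.
case: N => [|N]; first by rewrite !invr0.
apply: (@mulfI _ (N.+1%:R : Cx R)); first by rewrite pnatr_eq0.
by rewrite -[in RHS]toC_nat -toCM !divff// pnatr_eq0.
Qed.

Lemma Re_divn (R : realType) (z : Cx R) N : complex.Re (z / N%:R) = complex.Re z / N%:R.
Proof.
have -> : z / N%:R = z * toC (N%:R^-1 : R) by rewrite toC_natV.
by apply: (etrans (Re_mul z (toC (N%:R^-1 : R)))); rewrite /= mulr0 subr0.
Qed.

Section Elementary.
Variable R : realType.
Local Notation C := (Cx R).

Lemma expR_mulS (c : R) i : expR (c * i.+1%:R) = expR (c * i%:R) * expR c.
Proof. by rewrite -natr1 mulrDr mulr1 expRD. Qed.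

Lemma expR_half (u : R) : u <= 1 / 2 -> expR u <= 2.
Proof.
move=> u1; have := expR_ge1Dx (- u); rewrite expRN => H.
have p0 := expR_gt0 u; have h : 1 / 2 <= (expR u)^-1 by lra.
have := ler_wpM2l (ltW p0) h; rewrite divff ?gt_eqF//; lra.
Qed.

(** Sharper than the bound by exp |h|: the real part governs the growth of
    (1 + h)^N, which is what the first coordinate of an Euler polygon is. *)
Lemma factor0_le (h : C) : nrm (1 + h) <= expR (complex.Re h + nrm h ^+ 2 / 2).
Proof.
rewrite -ler_sqr ?nnegrE ?nrm_ge0 ?expR_ge0// -expRM_natl.
have -> : nrm (1 + h) ^+ 2 = 1 + 2 * (complex.Re h + nrm h ^+ 2 / 2).
  by rewrite !nrm_sqr ReD ImD /=; field.
exact: expR_ge1Dx.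
Qed.

Lemma pow_diff (u v : C) (c : R) i : 1 <= c -> nrm u <= c -> nrm v <= c ->
  nrm (u ^+ i - v ^+ i) <= i%:R * nrm (u - v) * c ^+ i.
Proof.
move=> c1 uc vc; have c0 : 0 <= c by lra.
elim: i => [|i IH]; first by rewrite !expr0 subrr nrm0 !mul0r.
have -> : u ^+ i.+1 - v ^+ i.+1 = u * (u ^+ i - v ^+ i) + (u - v) * v ^+ i.
  by rewrite !exprS; ring.
apply: le_trans (nrm_triD _ _) _; rewrite !nrmM nrmX -natr1 !mulrDl mul1r; apply: lerD.
  rewrite exprS [i%:R * _ * (c * _)]mulrCA; apply: ler_pM => //; exact: nrm_ge0.
rewrite ler_wpM2l ?nrm_ge0//; apply: (@le_trans _ _ (c ^+ i)).
  by apply: lerXn2r; rewrite ?nnegrE ?nrm_ge0.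
by rewrite exprS ler_peMl// exprn_ge0.
Qed.

Lemma cexpX (z : C) i : cexp (i%:R * z) = cexp z ^+ i :> C.
Proof.
elim: i => [|i IH]; first by rewrite mul0r cexp0.
by rewrite -natr1 mulrDl mul1r cexpD IH exprSr.
Qed.

End Elementary.

Section Logarithm.
Variable R : realType.
Local Notation C := (Cx R).

(** The principal logarithm, used on the half-plane Re z > 0 only. *)
Definition clog (z : C) : C :=
  toC (ln (nrm z)) + Ci R * toC (atan (complex.Im z / complex.Re z)).

Lemma Im_clog (z : C) : complex.Im (clog z) = atan (complex.Im z / complex.Re z).
Proof. by rewrite /clog ImD Im_iC /= add0r. Qed.

Lemma Re_clog (z : C) : complex.Re (clog z) = ln (nrm z).
Proof. by rewrite /clog ReD Re_iC /= addr0. Qed.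

Lemma Re_pos_neq0 (z : C) : 0 < complex.Re z -> z != 0.
Proof. by move=> z0; apply/eqP => zE; move: z0; rewrite zE /= ltxx. Qed.

Lemma clogK (z : C) : 0 < complex.Re z -> cexp (clog z) = z.
Proof.
move=> z0; have n0 : 0 < nrm z by rewrite nrm_gt0 Re_pos_neq0.
have E : Num.sqrt (1 + (complex.Im z / complex.Re z) ^+ 2) = nrm z / complex.Re z.
  have -> : 1 + (complex.Im z / complex.Re z) ^+ 2 = (nrm z / complex.Re z) ^+ 2.
    rewrite [RHS]expr_div_n nrm_sqr; field; exact: lt0r_neq0.
  by rewrite sqrtr_sqr ger0_norm// divr_ge0 ?nrm_ge0// ltW.
have c0 : cos (atan (complex.Im z / complex.Re z)) = complex.Re z / nrm z.
  by rewrite cos_atan E invf_div.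
have s0 : sin (atan (complex.Im z / complex.Re z)) = complex.Im z / nrm z.
  have cN : complex.Re z / nrm z != 0 by rewrite mulf_neq0 ?invr_eq0// lt0r_neq0.
  have := atanK (complex.Im z / complex.Re z); rewrite /tan c0 => H.
  rewrite -[LHS](divfK cN) H; field.
  by rewrite (lt0r_neq0 z0) (lt0r_neq0 n0).
apply: complex_eq; rewrite ?Re_cexp ?Im_cexp Re_clog Im_clog ?c0 ?s0 lnK ?posrE// mulrCA divff ?mulr1 ?lt0r_neq0//.
Qed.

Lemma clog1 : clog 1 = 0.
Proof.
apply: complex_eq; rewrite ?Re_clog ?Im_clog /= ?nrm1 ?ln1// mul0r atan0//.
Qed.

Lemma quotient_cont (x y e : R) : 0 < x -> 0 < e -> exists2 d, 0 < d &
  forall x' y', `|x' - x| < d -> `|y' - y| < d -> `|y' / x' - y / x| < e.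
Proof.
move=> x0 e0; have p : 0 < x + `|y| by rewrite ltr_wpDr.
exists (Num.min (x / 2) (e * x ^+ 2 / 2 / (x + `|y|))).
  by rewrite lt_min !divr_gt0 ?mulr_gt0 ?exprn_gt0.
move=> x' y'; rewrite !lt_min => /andP[X1 X2] /andP[_ Y2].
have x'0 : x / 2 < x' by move: X1; rewrite ltr_norml; lra.
have x'p : 0 < x' by have := x0; lra.
have -> : y' / x' - y / x = ((y' - y) * x - y * (x' - x)) / (x * x').
  by field; rewrite (lt0r_neq0 x0) (lt0r_neq0 x'p).
rewrite normrM normfV (ger0_norm (_ : 0 <= x * x')) ?mulr_ge0 ?(ltW x0) ?(ltW x'p)//.
rewrite ltr_pdivrMr ?mulr_gt0//.
rewrite ltr_pdivlMr// in X2; rewrite ltr_pdivlMr// in Y2.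
apply: (@le_lt_trans _ _ (`|y' - y| * x + `|y| * `|x' - x|)).
  by apply: le_trans (ler_normB _ _) _; rewrite !normrM (gtr0_norm x0).
have : e * (x * (x / 2)) < e * (x * x') by rewrite ltr_pM2l// ltr_pM2l.
have : `|y' - y| * x + `|y| * `|x' - x| <= Num.max `|y' - y| `|x' - x| * (x + `|y|).
  rewrite mulrDr; apply: lerD; first by rewrite ler_wpM2r ?le_max ?lexx// ltW.
  by rewrite mulrC ler_wpM2r ?le_max ?lexx ?orbT.
have : Num.max `|y' - y| `|x' - x| * (x + `|y|) < e * x ^+ 2 / 2.
  by rewrite /Num.max; case: ifP.
rewrite expr2; lra.
Qed.

Lemma clog_cont (z : C) : 0 < complex.Re z -> forall e : R, 0 < e ->
  exists2 d : R, 0 < d & forall w : C, nrm (w - z) < d -> nrm (clog w - clog z) < e.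
Proof.
move=> z0 e e0; have n0 : 0 < nrm z by rewrite nrm_gt0 Re_pos_neq0.
have e3 : 0 < e / 3 by rewrite divr_gt0.
have [d1 d10 H1] := realder_cont (is_derive1_ln n0) e3.
have [d2 d20 H2] := realder_cont (is_derive1_atan (complex.Im z / complex.Re z)) e3.
have [d3 d30 H3] := quotient_cont (complex.Im z) z0 d20.
exists (Num.min d1 d3) => [|w]; first by rewrite lt_min d10.
rewrite lt_min => /andP[wd1 wd3]; apply: le_lt_trans (nrm_le_ReIm _) _.
rewrite ReD ReN ImD ImN !Re_clog !Im_clog.
have A1 : `|ln (nrm w) - ln (nrm z)| <= e / 3.
  have := H1 (nrm w - nrm z); rewrite subrKC; apply; apply: le_lt_trans wd1.
  rewrite ler_norml nrm_subl andbT; have := nrm_subl z w; rewrite nrmB; lra.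
have A2 : `|atan (complex.Im w / complex.Re w) - atan (complex.Im z / complex.Re z)| <= e / 3.
  have := H2 (complex.Im w / complex.Re w - complex.Im z / complex.Re z).
  rewrite subrKC; apply; apply: H3.
    by rewrite -ReN -ReD; apply: le_lt_trans (nrm_Re _) wd3.
  by rewrite -ImN -ImD; apply: le_lt_trans (nrm_Im _) wd3.
lra.
Qed.

(** The derivative of an inverse function: clog is continuous, and a right inverse
    of the exponential, whose derivative is known. *)
Lemma clog_der (z : C) : 0 < complex.Re z -> lder clog z 1 z^-1.
Proof.
move=> z0 e e0; have zN := Re_pos_neq0 z0; have n0 : 0 < nrm z by rewrite nrm_gt0.
pose e' := Num.min (1 / 2) (e * nrm z / 2).
have e'0 : 0 < e' by rewrite lt_min !mulr_gt0.
have [d1 d10 H1] := cexp_der0 e'0.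
have [d2 d20 H2] := clog_cont z0 d10.
have [d3 d30 H3] : exists2 d3 : R, 0 < d3 & forall t : C, nrm t < d3 -> 0 < complex.Re (z + t).
  exists (complex.Re z) => // t tz; rewrite ReD; have := le_lt_trans (nrm_Re t) tz.
  by rewrite ltr_norml; lra.
exists (Num.min d2 d3) => [|t]; first by rewrite lt_min d20.
rewrite lt_min => /andP[td2 td3]; rewrite [t *: 1]mulr1.
set w := clog (z + t) - clog z.
have wd : nrm w < d1 by apply: H2; rewrite addrC addKr.
have zt : z + t = z * cexp w.
  by rewrite -{1}(clogK (H3 t td3)) -[X in X * _](clogK z0) -cexpD /w subrKC.
have tE : t = z * (cexp w - 1) by rewrite mulrBr mulr1 -zt addrC addKr.
have := H1 w wd; have -> : cexp w - 1 - w = t / z - w by rewrite tE; field.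
move=> B; have e'1 : e' <= 1 / 2 by rewrite ge_min lexx.
have e'2 : e' <= e * nrm z / 2 by rewrite ge_min lexx orbT.
have w0 := nrm_ge0 w.
have B2 : nrm (t / z - w) <= nrm w / 2.
  by apply: le_trans B _; rewrite mulrC ler_wpM2l//; lra.
have wt : nrm w <= 2 * nrm (t / z) by have := nrm_subl w (t / z); rewrite nrmB; lra.
have -> : w - t *: z^-1 = - (t / z - w) by rewrite scaleC opprB.
rewrite nrmN; apply: le_trans B _.
apply: (@le_trans _ _ (e' * (2 * nrm (t / z)))); first by rewrite ler_wpM2l// ltW.
apply: (@le_trans _ _ ((e * nrm z / 2) * (2 * nrm (t / z)))).
  by rewrite ler_wpM2r// mulr_ge0// nrm_ge0.
by rewrite nrmM nrmV -[leLHS](_ : e * nrm t = _)//; field; exact: lt0r_neq0.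
Qed.

Lemma clog_diff (z : C) : 0 < complex.Re z -> differentiable clog z.
Proof.
by move=> /clog_der/lderP[dz _]; apply/derivable1_diffP.
Qed.

Lemma Re_near1 (z : C) : nrm (z - 1) < 1 -> 0 < complex.Re z.
Proof.
by move=> /(le_lt_trans (nrm_Re _)); rewrite ReD ReN /= ltr_norml; lra.
Qed.

Lemma clog_ex (z : C) : 0 < complex.Re z -> exists w : C, cexp w = z /\ `|complex.Im w| <= pi.
Proof.
move=> z0; exists (clog z); split; first exact: clogK.
rewrite Im_clog ler_norml; set u := _ / _.
by have := atan_gtNpi2 u; have := atan_ltpi2 u; have := @pi_gt0 R; lra.
Qed.

Lemma cexp_ipi : cexp (Ci R * toC (pi / 2)) = Ci R.
Proof.
by apply: complex_eq; rewrite ?Re_cexp ?Im_cexp Re_iC Im_iC expR0 mul1r ?cos_pihalf ?sin_pihalf.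
Qed.

(** Quarter turns bring z into the half-plane of the principal logarithm. Only the
    existence of some bound on the imaginary part matters. *)
Lemma log_ex (z : C) : z != 0 -> exists w : C, cexp w = z /\ `|complex.Im w| <= 3 * pi.
Proof.
have quarter (k : nat) (v : C) : (k <= 3)%N -> 0 < complex.Re v ->
    exists w : C, cexp w = Ci R ^+ k * v /\ `|complex.Im w| <= 3 * pi.
  move=> k3 /clog_ex[w [<- wpi]]; exists (k%:R * (Ci R * toC (pi / 2)) + w).
  rewrite cexpD cexpX cexp_ipi; split=> //; rewrite ImD.
  apply: le_trans (ler_normD _ _) _.
  have -> : complex.Im (k%:R * (Ci R * toC (pi / 2))) = k%:R * (pi / 2).
    by rewrite mulrCA -toC_nat -toCM Im_iC.
  have kR : k%:R <= 3 :> R by rewrite (ler_nat _ k 3).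
  rewrite ger0_norm ?mulr_ge0 ?pi_ge0//.
  have : k%:R * (pi / 2) <= 3 * (pi / 2) :> R by rewrite ler_wpM2r ?divr_ge0 ?pi_ge0.
  have := @pi_ge0 R; lra.
move=> z0.
have [p|n|e] := ltgtP (complex.Re z) 0.
- have [|w Hw] := quarter 2 (- z) isT; first by rewrite ReN oppr_gt0.
  exists w; have <- : Ci R ^+ 2 * - z = z => //.
  by apply: complex_eq; rewrite expr2 ?Re_mul ?Im_mul ?ReN ?ImN /=; ring.
- have [w Hw] := quarter 0 z isT n.
  by exists w; have <- : Ci R ^+ 0 * z = z by rewrite expr0 mul1r.
have I0 : complex.Im z != 0.
  by apply: contra z0 => /eqP Iz; apply/eqP; apply: complex_eq; rewrite ?e ?Iz.
have [Ip|In|Ie] := ltgtP (complex.Im z) 0; last by rewrite Ie eqxx in I0.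
- have [|w Hw] := quarter 3 (Ci R * z) isT; first by rewrite Re_mul /= mul0r sub0r mul1r oppr_gt0.
  exists w; have <- : Ci R ^+ 3 * (Ci R * z) = z => //.
  by apply: complex_eq; rewrite 2!exprS expr1 !(Re_mul, Im_mul) /=; ring.
have [|w Hw] := quarter 1 (- (Ci R * z)) isT; first by rewrite ReN Re_mul /= mul0r sub0r mul1r opprK.
exists w; have <- : Ci R ^+ 1 * - (Ci R * z) = z => //.
by apply: complex_eq; rewrite expr1 !(ReN, ImN, Re_mul, Im_mul) /=; ring.
Qed.

Lemma cos_eq1 (y : R) : 0 <= y -> y < pi *+ 2 -> cos y = 1 -> sin y = 0 -> y = 0.
Proof.
move=> y0 y2 cy sy; have p0 := @pi_gt0 R.
have [yp|py] := leP y pi.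
  apply: cos_inj; rewrite ?in_itv /= ?y0 ?yp ?lexx ?(ltW p0)//.
  by rewrite cos0.
have : pi *+ 2 - y = 0.
  apply: cos_inj; rewrite ?in_itv /= ?lexx ?(ltW p0) //.
    by move: y2; rewrite mulr2n; lra.
  by rewrite cosB cos2pi sin2pi mul0r addr0 mul1r cos0.
by move=> /eqP; rewrite subr_eq0 => /eqP E; rewrite E ltxx in y2.
Qed.

Lemma cexp_2pin (k : nat) : cexp (Ci R * toC ((pi *+ 2) * k%:R)) = 1.
Proof. by rewrite toCM mulrA mulrC toC_nat cexpX cexp_2pi expr1n. Qed.

Lemma cexp_2pik (k : int) : cexp (Ci R * toC ((pi *+ 2) * k%:~R)) = 1.
Proof.
case: k => k; first exact: cexp_2pin.
rewrite NegzE mulrNz mulrN toCN mulrN; apply: (mulIf (cexp_neq0 (Ci R * toC ((pi *+ 2) * k.+1%:R)))).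
by rewrite -cexpD addNr cexp0 mul1r cexp_2pin.
Qed.

(** The modulus gives Re w = 0, and after subtraction of whole turns the angle
    lies in [0, 2 pi). *)
Lemma cexp_eq1 (w : C) : cexp w = 1 -> exists k : int, w = Ci R * toC ((pi *+ 2) * k%:~R).
Proof.
move=> w1; have R0 : complex.Re w = 0.
  apply: expR_inj; rewrite expR0 -nrm_cexp w1; exact: nrm1.
have p0 : 0 < pi *+ 2 :> R by rewrite mulrn_wgt0// pi_gt0.
pose k := Num.floor (complex.Im w / (pi *+ 2)).
pose y := complex.Im w - (pi *+ 2) * k%:~R.
have y0 : 0 <= y.
  by rewrite subr_ge0 mulrC -ler_pdivlMr//; apply: ge_floor.
have y2 : y < pi *+ 2.
  have := floorD1_gt (complex.Im w / (pi *+ 2)); rewrite ltr_pdivrMr// intrD mulrDl mul1r mulrC.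
  by rewrite /y -/k; lra.
have c1 : cexp (Ci R * toC y) = 1.
  rewrite /y toCB mulrBr cexpD; have := cexp_2pik k => E.
  have E' : cexp (- (Ci R * toC ((pi *+ 2) * k%:~R))) = 1.
    by apply: (mulIf (cexp_neq0 (Ci R * toC ((pi *+ 2) * k%:~R)))); rewrite -cexpD addNr cexp0 E mul1r.
  rewrite E' mulr1 -w1; congr cexp; apply: complex_eq; rewrite ?Re_iC ?Im_iC ?R0//.
have cy : cos y = 1.
  by have := congr1 (@complex.Re R) c1; rewrite Re_cexp Re_iC Im_iC expR0 mul1r.
have sy : sin y = 0.
  by have := congr1 (@complex.Im R) c1; rewrite Im_cexp Re_iC Im_iC expR0 mul1r.
exists k; have := cos_eq1 y0 y2 cy sy; rewrite /y => /eqP; rewrite subr_eq0 => /eqP Iw.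
by apply: complex_eq; rewrite ?Re_iC ?Im_iC ?R0.
Qed.

Lemma within_continuousP (V : normedModType C) (A : set R) (f : R -> V) :
  {within A, continuous f} <-> (forall t, A t -> forall e : R, 0 < e -> exists2 d : R, 0 < d &
    forall s, A s -> `|s - t| < d -> nrm (f s - f t) < e).
Proof.
split.
  move=> /subspace_continuousP H t At e e0.
  have /cvgrPdist_lt/(_ (toC e)) := H t At.
  rewrite (_ : 0 = toC 0)// toC_lt => /(_ e0); rewrite /prop_near1 /within /= => /nbhs_normP[d d0 Hd].
  exists d => // s As st; have := Hd s; rewrite /= distrC => /(_ st As).
  by rewrite nrmE toC_lt nrmB.
move=> H; apply/subspace_continuousP => t At; apply/cvgrPdist_lt => _/pos_toC[e e0 ->].
have [d d0 Hd] := H t At e e0; rewrite /prop_near1 /within /=.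
apply/nbhs_normP; exists d => // s /=; rewrite distrC => st As.
by rewrite nrmE toC_lt nrmB; exact: Hd.
Qed.

(** A continuous logarithm of zeta on [x, y]. Continuity is stated by hand so that
    the concatenation of two lifts is elementary. *)
Definition lift_on (zeta : R -> C) (x y : R) (th : R -> C) : Prop :=
  (forall t, x <= t -> t <= y -> cexp (th t) = zeta t) /\
  (forall t, x <= t -> t <= y -> forall e : R, 0 < e -> exists2 d : R, 0 < d &
     forall s, x <= s -> s <= y -> `|s - t| < d -> nrm (th s - th t) < e).

Lemma lift_cat (zeta : R -> C) (x y z : R) (t1 t2 : R -> C) : x <= y -> y <= z ->
  lift_on zeta x y t1 -> lift_on zeta y z t2 -> t2 y = t1 y ->
  lift_on zeta x z (fun t => if t <= y then t1 t else t2 t).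
Proof.
move=> xy yz [E1 C1] [E2 C2] t12; split.
  by move=> t xt tz; case: leP => ty; [apply: E1 | apply: E2 => //; exact: ltW].
move=> t xt tz e e0; have [ty|yt|tE] := ltgtP t y.
- have [d d0 Hd] := C1 t xt (ltW ty) e e0.
  exists (Num.min d (y - t)) => [|s xs sz]; first by rewrite lt_min d0 subr_gt0.
  rewrite lt_min => /andP[sd]; rewrite ltr_norml => /andP[_ sy].
  have sy' : s <= y by lra.
  by rewrite sy'; exact: Hd.
- have [d d0 Hd] := C2 t (ltW yt) tz e e0.
  exists (Num.min d (t - y)) => [|s xs sz]; first by rewrite lt_min d0 subr_gt0.
  rewrite lt_min => /andP[sd]; rewrite ltr_norml => /andP[sy _].
  have sy' : y < s by lra.
  by rewrite leNgt sy' /=; apply: Hd => //; exact: ltW.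
subst t; have [d1 d10 H1] := C1 y xt (lexx _) e e0; have [d2 d20 H2] := C2 y (lexx _) tz e e0.
exists (Num.min d1 d2) => [|s xs sz]; first by rewrite lt_min d10.
rewrite lt_min => /andP[s1 s2]; have [sy|sy] := leP s y; first exact: H1.
by rewrite -t12; apply: H2 => //; exact: ltW.
Qed.

(** On short intervals zeta is close to a nonzero constant and has a principal
    logarithm up to an additive constant. Lifts with a prescribed initial value
    can be concatenated, so the induction on intervals applies. *)
Lemma path_log (zeta : R -> C) (w0 : C) : {within `[0, 1], continuous zeta} ->
  (forall t : R, t \in `[0, 1] -> zeta t != 0) -> cexp w0 = zeta 0 ->
  exists th : R -> C, [/\ {within `[0, 1], continuous th}, th 0 = w0
    & forall t : R, t \in `[0, 1] -> cexp (th t) = zeta t].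
Proof.
move=> /within_continuousP zc z0 e0.
have inI (t : R) : 0 <= t -> t <= 1 -> `[0, 1]%classic t by move=> a b; rewrite /= in_itv /= a b.
suff : forall w, cexp w = zeta 0 -> exists2 th, lift_on zeta 0 1 th & th 0 = w.
  move=> /(_ w0 e0)[th [E Cn] th0]; exists th; split=> //.
    apply/within_continuousP => t; rewrite /= in_itv /= => /andP[t0 t1] e e00.
    have [d d0 Hd] := Cn t t0 t1 e e00; exists d => // s.
    by rewrite /= in_itv /= => /andP[s0 s1]; exact: Hd.
  by move=> t; rewrite in_itv /= => /andP[t0 t1]; exact: E.
pose P x y := forall w, cexp w = zeta x -> exists2 th, lift_on zeta x y th & th x = w.
apply: (@cousin R P 0 1) => //.
  move=> x y z ax xy yz zb Pxy Pyz w wE.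
  have [t1 L1 t1x] := Pxy w wE; have [t2 L2 t2y] := Pyz (t1 y) (L1.1 y xy (lexx _)).
  by exists (fun t => if t <= y then t1 t else t2 t); [exact: (@lift_cat zeta x y z t1 t2) | rewrite xy].
move=> t t0 t1; have zt : zeta t != 0 by apply: z0; rewrite in_itv /= t0 t1.
have n0 : 0 < nrm (zeta t) by rewrite nrm_gt0.
have [d d0 Hd] := zc t (inI t t0 t1) _ n0.
exists d => // u v u0 ut tv v1 utd tvd w wE.
have B s : u <= s -> s <= v -> 0 < complex.Re (zeta s / zeta t).
  move=> us sv; apply: Re_near1.
  have -> : zeta s / zeta t - 1 = (zeta s - zeta t) / zeta t by field.
  rewrite nrmM nrmV ltr_pdivrMr// mul1r; apply: Hd.
    by apply: inI; [exact: le_trans us | exact: le_trans sv v1].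
  by rewrite ltr_norml; lra.
exists (fun s => w + clog (zeta s / zeta t) - clog (zeta u / zeta t)); last by rewrite addrK.
split.
  move=> s us sv; have uv := le_trans us sv.
  have Bu := clogK (B u (lexx _) uv); have Bs := clogK (B s us sv).
  apply: (mulIf (cexp_neq0 (clog (zeta u / zeta t)))).
  rewrite -cexpD subrK cexpD Bu Bs wE; field; exact: zt.
move=> s us sv e e00.
have [d1 d10 H1] := clog_cont (B s us sv) e00.
have sI := inI s (le_trans u0 us) (le_trans sv v1).
have [d2 d20 H2] := zc s sI _ (mulr_gt0 d10 n0).
exists d2 => // s' us' sv' ss'.
have -> : w + clog (zeta s' / zeta t) - clog (zeta u / zeta t) -
  (w + clog (zeta s / zeta t) - clog (zeta u / zeta t)) =
  clog (zeta s' / zeta t) - clog (zeta s / zeta t) by ring.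
apply: H1; rewrite -mulrBl nrmM nrmV ltr_pdivrMr//.
by apply: H2 => //; apply: inI; [exact: le_trans us' | exact: le_trans sv' v1].
Qed.

End Logarithm.

Section Turn.
Variable R : realType.
Local Notation C := (Cx R).

(** The time 2 pi i, after which the exponential returns to its value. *)
Definition turn : C := Ci R * toC (pi *+ 2).

Lemma nrm_turn : nrm turn = 2 * pi.
Proof.
have p := @pi_ge0 R; rewrite nrmM nrm_i nrm_toC mul1r (mulr2n pi) ger0_norm; last exact: addr_ge0.
by rewrite mulr_natl mulr2n.
Qed.

Lemma pi4_gt0 : 0 < 4 * pi :> R. Proof. by rewrite mulr_gt0 ?pi_gt0. Qed.

End Turn.

Section ConsRow.
Variables (R : realType) (m : nat).
Local Notation C := (Cx R).
Local Notation E := 'rV[C]_m.+1.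

(** Points of C^(m+1) are split into the coordinate of index 0, along the
    separatrix, and the transverse coordinates. *)
Definition cons_row (c : C) (z : 'rV[C]_m) : E :=
  \row_j (if unlift ord0 j is Some k then z 0 k else c).

Definition rest (x : E) : 'rV[C]_m := \row_k x 0 (lift ord0 k).

Lemma cons_row0 c z : cons_row c z 0 ord0 = c.
Proof. by rewrite mxE unlift_none. Qed.

Lemma cons_rowS c z k : cons_row c z 0 (lift ord0 k) = z 0 k.
Proof. by rewrite mxE liftK. Qed.

Lemma restE x k : rest x 0 k = x 0 (lift ord0 k).
Proof. by rewrite mxE. Qed.

Lemma rowE0 (x y : E) : x 0 ord0 = y 0 ord0 -> rest x = rest y -> x = y.
Proof.
move=> H0 Hr; apply/rowP => j; have [k ->|->//] := unliftP ord0 j.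
by rewrite -!restE Hr.
Qed.

Lemma rest_cons_row c z : rest (cons_row c z) = z.
Proof. by apply/rowP => k; rewrite restE cons_rowS. Qed.

Lemma cons_row_rest (x : E) : cons_row (x 0 ord0) (rest x) = x.
Proof. by apply: rowE0; rewrite ?cons_row0 ?rest_cons_row. Qed.

Lemma cons_rowD c d z w : cons_row c z + cons_row d w = cons_row (c + d) (z + w).
Proof. by apply: rowE0; [rewrite mxE !cons_row0 | apply/rowP => k; rewrite !(restE, cons_rowS, mxE) ?liftK]. Qed.

Lemma cons_rowZ (t : C) c z : t *: cons_row c z = cons_row (t * c) (t *: z).
Proof. by apply: rowE0; [rewrite mxE !cons_row0 | apply/rowP => k; rewrite !(restE, cons_rowS, mxE) ?liftK]. Qed.

Lemma cons_row00 : cons_row 0 0 = 0.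
Proof. by apply: rowE0; [rewrite cons_row0 mxE | apply/rowP => k; rewrite !(restE, cons_rowS, mxE)]. Qed.

Lemma nrm_rest x : nrm (rest x) <= nrm x.
Proof. by apply: nrm_row_le => [|k]; rewrite ?nrm_ge0// restE nrm_coord. Qed.

Lemma nrm_cons_row_le c z (e : R) : nrm c <= e -> nrm z <= e -> nrm (cons_row c z) <= e.
Proof.
move=> ce ze; apply: nrm_row_le => [|j]; first exact: le_trans (nrm_ge0 c) ce.
have [k ->|->] := unliftP ord0 j; rewrite ?cons_row0 ?cons_rowS//.
exact: le_trans (nrm_coord _ _ _) ze.
Qed.

Lemma nrm_cons_row_lt c z (e : R) : nrm c < e -> nrm z < e -> nrm (cons_row c z) < e.
Proof.
move=> ce ze; apply: nrm_row_lt => [|j]; first exact: le_lt_trans (nrm_ge0 c) ce.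
have [k ->|->] := unliftP ord0 j; rewrite ?cons_row0 ?cons_rowS//.
exact: le_lt_trans (nrm_coord _ _ _) ze.
Qed.

Lemma diff_rest (V : normedModType C) (f : V -> E) v : differentiable f v ->
  differentiable (fun v => rest (f v)) v.
Proof.
move=> df; apply: diff_row => k.
have -> : (fun v => rest (f v) 0 k) = (fun v => f v 0 (lift ord0 k)).
  by apply/funext => w; rewrite restE.
exact: diff_entry.
Qed.

Lemma diff_cons_row (V : normedModType C) (c : V -> C) (f : V -> 'rV[C]_m) v :
  differentiable c v -> differentiable f v -> differentiable (fun v => cons_row (c v) (f v)) v.
Proof.
move=> dc df; apply: diff_row => j; have [k ->|->] := unliftP ord0 j.
  have -> : (fun v => cons_row (c v) (f v) 0 (lift ord0 k)) = (fun v => f v 0 k).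
    by apply/funext => w; rewrite cons_rowS.
  exact: diff_entry.
have -> // : (fun v => cons_row (c v) (f v) 0 ord0) = c.
by apply/funext => w; rewrite cons_row0.
Qed.

End ConsRow.

(** The differential vanishes on the hyperplane, being computed there along lines
    on which q is zero. *)
Lemma diff_hyperplane (R : realType) m (q : 'rV[Cx R]_m -> Cx R) (k : 'I_m) (d : R) : 0 < d ->
  differentiable q 0 -> (forall y : 'rV[Cx R]_m, nrm y < d -> y 0 k = 0 -> q y = 0) ->
  forall v : 'rV[Cx R]_m, 'd q 0 v = v 0 k * 'd q 0 (delta_mx 0 k).
Proof.
move=> d0 dq H.
have Z (v : 'rV[Cx R]_m) : v 0 k = 0 -> 'd q 0 v = 0.
  move=> vk; apply: (lder_uniq (diff_lder v dq)) => e e0.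
  have n1 : 0 < nrm v + 1 by rewrite ltr_wpDl ?nrm_ge0.
  exists (d / (nrm v + 1)) => [|t]; first exact: divr_gt0.
  rewrite ltr_pdivlMr// => td.
  have n2 : nrm t * nrm v <= nrm t * (nrm v + 1) by rewrite ler_wpM2l ?nrm_ge0// lerDl.
  rewrite add0r scaler0 subr0 !H ?subrr ?nrm0 ?mulr_ge0 ?nrm_ge0 ?(ltW e0)//.
  - by rewrite mxE.
  - by rewrite nrmZ; exact: le_lt_trans n2 td.
  - by rewrite mxE vk mulr0.
move=> v; have {1}-> : v = (v - v 0 k *: delta_mx 0 k) + v 0 k *: delta_mx 0 k by rewrite subrK.
rewrite linearD [X in X + _]Z ?add0r; first exact: linearZ.
by rewrite !mxE !eqxx mulr1 subrr.
Qed.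

Section Frechet.
Variables (R : realType).
Local Notation C := (Cx R).
Variables (V W : normedModType C).

Lemma diff_bound (f : V -> W) x : differentiable f x ->
  exists2 K : R, 0 < K & forall h, nrm ('d f x h) <= K * nrm h.
Proof.
move=> /diff_locallyP[/(_ 0)/continuous_nrmP/(_ 1 ltr01)[d d0 Hd] _].
exists (2 / d) => [|h]; first exact: divr_gt0.
have [->|h0] := eqVneq h 0; first by rewrite linear0 !nrm0 mulr0.
have n0 : 0 < nrm h by rewrite nrm_gt0.
have c0 : 0 < d / 2 / nrm h by rewrite !divr_gt0.
have := Hd (toC (d / 2 / nrm h) *: h).
rewrite (linear0 ('d f x)) !subr0 nrmZ nrm_toC gtr0_norm// divfK ?gt_eqF// linearZ /= nrmZ nrm_toC gtr0_norm//.
move=> H; have {}H : d / 2 / nrm h * nrm ('d f x h) < 1 by apply: H; have := d0; lra.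
rewrite -(ler_pM2l c0); apply: le_trans (ltW H) _.
by rewrite le_eqVlt; apply/orP; left; apply/eqP; field; rewrite !gt_eqF.
Qed.

Lemma diff_frechet (f : V -> W) x : differentiable f x -> forall e : R, 0 < e ->
  exists2 d : R, 0 < d & forall h, nrm h < d -> nrm (f (x + h) - f x - 'd f x h) <= e * nrm h.
Proof.
move=> /diff_locallyP[_ /eqaddoP H] e e0.
have /H/nearP[d d0 Hd] : 0 < toC e :> C by rewrite (_ : 0 = toC 0)// toC_lt.
exists d => // h hd; have := Hd h; rewrite subr0 => /(_ hd).
rewrite !nrmE -toCM toC_le; congr (nrm _ <= _).
by rewrite -[(_ - _) h]/(f (h + x) - (f x + 'd f x h)) opprD addrA (addrC h).
Qed.

Lemma diff_near (f k : V -> W) x : (\forall y \near x, f y = k y) ->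
  differentiable f x -> differentiable k x.
Proof.
move=> /nearP[d1 d10 fk] df; have [K K0 HK] := diff_bound df.
apply: (diff_of HK) => e e0; have [d d0 Hd] := diff_frechet df e0.
exists (Num.min d d1) => [|h]; first by rewrite lt_min d0.
rewrite lt_min => /andP[hd hd1]; rewrite -!fk ?subrr ?nrm0//; first exact: Hd.
by rewrite addrC addKr.
Qed.

(** Also yields differentiability, which is how a function defined separately on
    a hypersurface is seen to be holomorphic across it. *)
Lemma diff_zero (f : V -> W) x (K d : R) : 0 < d ->
  (forall h, nrm h < d -> nrm (f (x + h)) <= K * nrm h ^+ 2) ->
  differentiable f x /\ forall v, 'd f x v = 0.
Proof.
move=> d0 H; have f0 : f x = 0.
  apply/eqP; rewrite -nrm_eq0 eq_le nrm_ge0 andbT.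
  by have := H 0; rewrite addr0 nrm0 expr0n mulr0 => ->.
have df : differentiable f x.
  apply: (@diff_of R V W f x \0 0) => [h|e e0]; first by rewrite nrm0 mul0r.
  have K1 : 0 < `|K| + 1 by rewrite ltr_wpDl.
  exists (Num.min d (e / (`|K| + 1))) => [|h]; first by rewrite lt_min d0 divr_gt0.
  rewrite lt_min ltr_pdivlMr// => /andP[hd he]; rewrite f0 !subr0.
  apply: le_trans (H h hd) _; rewrite expr2 mulrA ler_wpM2r ?nrm_ge0//.
  have := ler_norm K; have := nrm_ge0 h => h0 k0.
  have : K * nrm h <= `|K| * nrm h by rewrite ler_wpM2r.
  lra.
split=> // v; apply: (lder_uniq (diff_lder v df)).
apply: (@lder_quad R V W f x v 0 (`|K| * nrm v ^+ 2) (d / (nrm v + 1))) => [|t].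
  by rewrite divr_gt0// ltr_wpDl ?nrm_ge0.
rewrite ltr_pdivlMr ?ltr_wpDl ?nrm_ge0// => td; rewrite f0 scaler0 !subr0.
apply: le_trans (H _ _) _.
  by rewrite nrmZ; apply: le_lt_trans td; rewrite ler_wpM2l ?nrm_ge0// lerDl.
have -> : `|K| * nrm v ^+ 2 * nrm t ^+ 2 = `|K| * nrm (t *: v) ^+ 2 by rewrite nrmZ exprMn; ring.
by rewrite ler_wpM2r ?exprn_ge0 ?nrm_ge0 ?ler_norm.
Qed.

End Frechet.

Section Average.
Variables (R : realType) (m : nat).
Local Notation C := (Cx R).
Local Notation T := 'rV[C]_m.
Variables (h : T -> T) (N : nat) (d K : R).
Hypothesis N0 : (0 < N)%N.
Hypothesis d0 : 0 < d.
Hypothesis h_diff : forall i z, (i <= N)%N -> nrm z < d -> differentiable (iter i h) z.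
Hypothesis h_entry : forall i (z : T) k, (i <= N)%N -> nrm z < d ->
  nrm (iter i h z 0 k) <= K * nrm (z 0 k).
Hypothesis h_per : forall z, nrm z < d -> iter N h z = z.

(** Since h preserves the coordinate hyperplanes, its differential at 0 is
    diagonal, with these entries; periodicity makes them roots of unity. *)
Definition multiplier k : C := 'd h 0 (delta_mx 0 k) 0 k.

(** Projection of the k-th coordinate onto the eigenspace of the multiplier in
    the finite cyclic group of maps generated by h. It has the same differential
    at 0 as the coordinate, and is an eigenfunction of composition with h
    ([average_mult]); together these averages linearize h. *)
Definition average k (z : T) : C :=
  N%:R^-1 * \sum_(i < N) (multiplier k ^- i * iter i h z 0 k).

Let z0d : nrm (0 : T) < d. Proof. by rewrite nrm0. Qed.

Let NC : N%:R != 0 :> C. Proof. by rewrite pnatr_eq0 -lt0n. Qed.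

Lemma iter_axis i (z : T) k : (i <= N)%N -> nrm z < d -> z 0 k = 0 -> iter i h z 0 k = 0.
Proof.
move=> iN zd zk; have := h_entry k iN zd; rewrite zk nrm0 mulr0 => H.
by apply/eqP; rewrite -nrm_eq0 eq_le H nrm_ge0.
Qed.

Lemma iter_zero i : (i <= N)%N -> iter i h 0 = 0.
Proof. by move=> iN; apply/rowP => k; rewrite iter_axis ?mxE. Qed.

Lemma iter_der i k (v : T) : (i <= N)%N -> 'd (iter i h) 0 v 0 k = v 0 k * multiplier k ^+ i.
Proof.
have diag j (w : T) : (j <= N)%N -> 'd (iter j h) 0 w 0 k = w 0 k * 'd (iter j h) 0 (delta_mx 0 k) 0 k.
  move=> jN; rewrite -!diff_entryE; try by apply: h_diff.
  apply: (diff_hyperplane d0); first by apply: diff_entry; apply: h_diff.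
  by move=> y yd yk; exact: iter_axis.
move=> iN; rewrite diag//; congr (_ * _); elim: i iN => [|i IH] iN.
  have E : iter 0 h = idfun by [].
  rewrite E expr0 (lder_uniq (diff_lder _ _) (_ : lder idfun 0 _ (delta_mx 0 k))) ?mxE ?eqxx//.
  by move=> e e0; exists 1 => // t _; rewrite add0r subr0 subrr nrm0 mulr_ge0 ?nrm_ge0// ltW.
have h1 : differentiable h 0 by have := h_diff (i := 1) (leq_trans (ltn0Sn i) iN) z0d.
have h00 : h 0 = 0 := iter_zero (i := 1) (leq_trans (ltn0Sn i) iN).
have E : iter i.+1 h = iter i h \o h by apply/funext => z; rewrite iterSr.
have hi : differentiable (iter i h) (h 0) by rewrite h00; apply: (h_diff (ltnW iN)).
rewrite E (congr1 (fun f : T -> T => f (delta_mx 0 k) 0 k) (diff_comp h1 hi)) /= h00 (diag i _ (ltnW iN)).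
rewrite exprS; exact: (congr1 (fun c : C => multiplier k * c) (IH (ltnW iN))).
Qed.

Lemma multiplierN k : multiplier k ^+ N = 1.
Proof.
have := iter_der k (delta_mx 0 k) (leqnn N); rewrite mxE !eqxx mul1r => <-.
rewrite (lder_uniq (diff_lder _ _) (_ : lder (iter N h) 0 _ (delta_mx 0 k))) ?mxE ?eqxx//.
  exact: h_diff.
apply: (@lder_near R _ _ idfun).
  by apply/nearP; exists d => // y; rewrite subr0 => /h_per.
by move=> e e0; exists 1 => // t _; rewrite add0r subr0 subrr nrm0 mulr_ge0 ?nrm_ge0// ltW.
Qed.

Lemma multiplier_neq0 k : multiplier k != 0.
Proof.
apply/eqP => m0; have := multiplierN k; rewrite m0 expr0n gtn_eqF//= => /eqP.
by rewrite eq_sym oner_eq0.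
Qed.

Lemma nrm_multiplier k : nrm (multiplier k) = 1.
Proof.
apply/eqP; rewrite -(@eqrXn2 _ N) ?nrm_ge0 ?ler01//.
by rewrite -nrmX multiplierN nrm1 expr1n.
Qed.

(** The sum over i < N is cyclic, because both h and the multiplier have a period
    dividing N. *)
Lemma average_mult k z : nrm z < d -> average k (h z) = multiplier k * average k z.
Proof.
move=> zd; rewrite /average mulrCA; congr (_ * _); rewrite big_distrr /=.
pose F i : C := multiplier k * (multiplier k ^- i * iter i h z 0 k).
have E (i : 'I_N) : multiplier k ^- i * iter i h (h z) 0 k = F i.+1.
  by rewrite /F -iterSr exprS; field; rewrite ?expf_neq0 ?multiplier_neq0.
rewrite (eq_bigr _ (fun i _ => E i)).
have FN : F N = F 0%N by rewrite /F multiplierN h_per// expr0.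
apply: (addIr (F 0%N)).
have -> : \sum_(i < N) F i.+1 + F 0%N = \sum_(i < N.+1) F i by rewrite big_ord_recl addrC.
by rewrite big_ord_recr /= FN.
Qed.

Lemma average_diff k z : nrm z < d -> differentiable (average k) z.
Proof.
move=> zd; have -> : average k = N%:R^-1 *: (\sum_(i < N) (multiplier k ^- i *: (fun z => iter i h z 0 k))).
  by apply/funext => y; rewrite /average /= fct_sumE.
apply: differentiableZ; apply: differentiable_sum => i; apply: differentiableZ.
by apply: diff_entry; apply: h_diff => //; exact: ltnW.
Qed.

Lemma average_der k (v : T) : 'd (average k) 0 v = v 0 k.
Proof.
have D (i : 'I_N) : is_derive (0 : T) v (multiplier k ^- i \*: (fun z => iter i h z 0 k) : T -> C) (v 0 k).
  have Hd : differentiable (iter i h) 0 by apply: h_diff => //; exact: ltnW.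
  have := lder_entry k (diff_lder v Hd); rewrite iter_der ?(ltnW (ltn_ord i))// => /lderP H.
  have E : multiplier k ^- i *: (v 0 k * multiplier k ^+ i) = v 0 k.
    by rewrite scaleC; field; rewrite ?expf_neq0 ?multiplier_neq0.
  exact: (eq_rect _ (fun w => is_derive _ _ _ w) (is_deriveZ (multiplier k ^- i) H) _ E).
have /lderP S := is_deriveZ N%:R^-1 (is_derive_sum D).
apply: (lder_uniq (diff_lder v (average_diff k z0d))).
have E : N%:R^-1 *: \sum_(i < N) v 0 k = v 0 k.
  by rewrite sumr_const card_ord -[v 0 k *+ N]mulr_natl scaleC mulKf.
rewrite E in S; apply: lder_near S; apply/nearP; exists 1 => // y _.
by rewrite /average /= fct_sumE.
Qed.

Lemma average_bound k (z : T) : nrm z < d -> nrm (average k z) <= K * nrm (z 0 k).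
Proof.
move=> zd; have NR : 0 < N%:R :> R by rewrite ltr0n.
rewrite /average nrmM nrmV nrm_nat ler_pdivrMl//.
apply: le_trans (nrm_sum _ _ _) _.
apply: (@le_trans _ _ (\sum_(i < N) (K * nrm (z 0 k)))).
  apply: ler_sum => i _; rewrite nrmM nrmV nrmX nrm_multiplier expr1n invr1 mul1r.
  by apply: h_entry => //; exact: ltnW.
by rewrite sumr_const card_ord mulr_natl.
Qed.

End Average.

Lemma convex_step (R : realType) (s t : R) : 0 <= s -> s <= 1 -> 0 < t -> t < 1 ->
  0 < t + s * (1 - t) /\ t + s * (1 - t) <= 1.
Proof.
move=> s0 s1 t0 t1; have t1' : 0 <= 1 - t by rewrite subr_ge0 ltW.
have h : s * (1 - t) <= 1 * (1 - t) by rewrite ler_wpM2r.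
have h2 : 0 <= s * (1 - t) by rewrite mulr_ge0.
by split; lra.
Qed.

Section ConeGeometry.
Variables (R : realType) (m : nat) (a : 'I_m.+1 -> Cx R) (del : R).
Local Notation C := (Cx R).

(** Times along which the linear flow expands the coordinate of index 0, whose
    eigenvalue is 1, and contracts the others at the rate del. It is a convex open
    cone. *)
Definition cone (nu : C) : Prop :=
  0 < complex.Re nu /\ forall j, j != ord0 -> complex.Re (nu * a j) < - (del * nrm nu).

Lemma Re_toCM (t : R) (z : C) : complex.Re (toC t * z) = t * complex.Re z.
Proof. by rewrite Re_mul /= mul0r subr0. Qed.

Hypothesis del0 : 0 < del.

Lemma toC_split (t : R) (z : C) : toC t * z + toC (1 - t) * z = z.
Proof. by rewrite toCB (_ : toC 1 = 1)//; ring. Qed.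

Lemma toC_split2 (s t : R) (z : C) : toC t * z + toC s * (toC (1 - t) * z) = toC (t + s * (1 - t)) * z.
Proof. by rewrite toCD toCM; ring. Qed.

Lemma cone_scale (t : R) (nu : C) : 0 < t -> cone nu -> cone (toC t * nu).
Proof.
move=> t0 [H0 Hj]; split=> [|j /Hj H]; first by rewrite Re_toCM mulr_gt0.
by rewrite -mulrA Re_toCM nrmM nrm_toC gtr0_norm// mulrCA -mulrN ltr_pM2l.
Qed.

Lemma cone_add (nu nu' : C) : cone nu -> cone nu' -> cone (nu + nu').
Proof.
move=> [H0 Hj] [H0' Hj']; split=> [|j j0]; first by rewrite ReD addr_gt0.
rewrite mulrDl ReD; have := Hj j j0; have := Hj' j j0.
have : del * nrm (nu + nu') <= del * (nrm nu + nrm nu') by rewrite ler_wpM2l ?nrm_triD// ltW.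
lra.
Qed.

Lemma cone_convex (nu nu' : C) (t : R) : cone nu -> cone nu' -> 0 <= t -> t <= 1 ->
  cone (nu + toC t * (nu' - nu)).
Proof.
move=> c c' t0 t1; have -> : nu + toC t * (nu' - nu) = toC (1 - t) * nu + toC t * nu'.
  by rewrite toCB (_ : toC 1 = 1)//; ring.
have [->|tn] := eqVneq t 0; first by rewrite subr0 (_ : toC 0 = 0)// mul0r addr0 (_ : toC 1 = 1)// mul1r.
have [->|tn1] := eqVneq t 1; first by rewrite subrr (_ : toC 0 = 0)// mul0r add0r (_ : toC 1 = 1)// mul1r.
apply: cone_add; apply: cone_scale => //; first by rewrite subr_gt0 lt_neqAle tn1.
by rewrite lt_neqAle eq_sym tn.
Qed.

Lemma cone_open (nu : C) : cone nu ->
  exists2 e : R, 0 < e & forall nu', nrm (nu' - nu) < e -> cone nu'.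
Proof.
move=> [H0 Hj].
pose d (j : 'I_m.+1) := if j == ord0 then complex.Re nu else
  (- (del * nrm nu) - complex.Re (nu * a j)) / (nrm (a j) + del).
have dp j : 0 < d j.
  rewrite /d; case: eqVneq => // j0; apply: divr_gt0; last by rewrite ltr_wpDl ?nrm_ge0.
  by rewrite subr_gt0; exact: Hj.
have [e e0 He] := finite_lower_bound dp.
exists e => // nu' nn; split.
  have := He ord0; rewrite /d eqxx => le; have := le_lt_trans (nrm_Re (nu' - nu)) (lt_le_trans nn le).
  by rewrite ReD ReN ltr_norml; lra.
move=> j j0; have := lt_le_trans nn (He j); rewrite /d (negbTE j0).
have ap : 0 < nrm (a j) + del by rewrite ltr_wpDl ?nrm_ge0.
rewrite (ltr_pdivlMr _ _ ap) => H.
have := le_trans (ler_norm _) (nrm_Re ((nu' - nu) * a j)).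
rewrite mulrBl ReD ReN -mulrBl nrmM => H1.
have : del * nrm nu' <= del * (nrm nu + nrm (nu' - nu)).
  by rewrite ler_wpM2l ?(ltW del0)//; have := nrm_subl nu' nu; lra.
lra.
Qed.

End ConeGeometry.

Lemma half_lt (R : realType) (x : R) : 0 < x -> x / 2 < x.
Proof. lra. Qed.

Section Determinant.
Variables (R : realType) (m : nat).
Local Notation C := (Cx R).
Local Notation T := 'rV[C]_m.

(** In a nonzero kernel vector, the equation for the largest entry contradicts
    the smallness of the off-diagonal part. *)
Lemma diagonal_dominant (B : 'M[C]_m) (c : 'I_m -> C) (e : R) : 0 < e ->
  (forall i, e <= nrm (c i)) ->
  (forall i j, nrm (B i j - (if i == j then c i else 0)) <= e / (2 * m.+1%:R)) ->
  \det B != 0.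
Proof.
move=> e0 ce Be; apply/negP => /det0P[v v0 vB].
have n0 := nrm_ge0 v; have mR : 0 < m.+1%:R :> R by rewrite ltr0n.
suff : nrm v <= nrm v / 2.
  move=> h; have : nrm v == 0 by rewrite eq_le n0 andbT; move: h; lra.
  by rewrite nrm_eq0 (negbTE v0).
apply: nrm_row_le => [|j]; first by rewrite divr_ge0.
rewrite -(ler_pM2r e0); apply: (@le_trans _ _ (nrm (v 0 j * c j))).
  by rewrite nrmM ler_wpM2l ?nrm_ge0.
have E : v 0 j * c j = - \sum_i v 0 i * (B i j - (if i == j then c i else 0)).
  have S : \sum_i v 0 i * B i j = 0 by have := congr1 (fun w : 'rV[C]_m => w 0 j) vB; rewrite !mxE.
  have S2 : \sum_i v 0 i * (if i == j then c i else 0) = v 0 j * c j.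
    rewrite (bigD1 j)//= eqxx big1 ?addr0// => i ij; by rewrite (negbTE ij) mulr0.
  have -> : \sum_i v 0 i * (B i j - (if i == j then c i else 0)) =
      \sum_i v 0 i * B i j - \sum_i v 0 i * (if i == j then c i else 0).
    by rewrite -sumrB; apply: eq_bigr => i _; rewrite mulrBr.
  by rewrite S S2 sub0r opprK.
rewrite E nrmN; apply: le_trans (nrm_sum _ _ _) _.
apply: (@le_trans _ _ (\sum_(i < m) (nrm v * (e / (2 * m.+1%:R))))).
  by apply: ler_sum => i _; rewrite nrmM ler_pM ?nrm_ge0 ?nrm_coord.
rewrite sumr_const card_ord -[_ *+ m]mulr_natl.
apply: (@le_trans _ _ (m.+1%:R * (nrm v * (e / (2 * m.+1%:R))))).
  by rewrite ler_wpM2r ?ler_nat// mulr_ge0// divr_ge0 ?mulr_ge0 ?(ltW e0)// ltW.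
by rewrite le_eqVlt; apply/orP; left; apply/eqP; field; rewrite gt_eqF.
Qed.

Lemma det_scaled_rows (B B' : 'M[C]_m) (w : 'I_m -> C) :
  (forall i j, B i j = w i * B' i j) -> \det B = \prod_i w i * \det B'.
Proof.
move=> BE; have -> : B = diag_mx (\row_i w i) *m B'.
  by apply/matrixP => i j; rewrite mul_diag_mx !mxE.
by rewrite det_mulmx det_diag; congr (_ * _); apply: eq_bigr => i _; rewrite mxE.
Qed.

Variables (Th : 'I_m -> T -> C) (c : 'I_m -> C) (d : R) (M : nat).
Hypothesis d0 : 0 < d.
Hypothesis Th_diff : forall k y, nrm y < d -> differentiable (Th k) y.
Hypothesis Th0 : forall k, Th k 0 = 0.
Hypothesis Th_der : forall k (v : T), 'd (Th k) 0 v = v 0 k * c k.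
Hypothesis c0 : forall k, c k != 0.

(** The differential is Lipschitz near 0, by the second order estimates for
    holomorphic functions. *)
Lemma Th_near k (eta : R) : 0 < eta -> exists2 s : R, 0 < s & forall y, nrm y < s -> forall j,
  nrm ('d (Th k) y (delta_mx 0 j) - (if k == j then c k else 0)) <= eta.
Proof.
move=> eta0; have z0 : nrm (0 : T) < d by rewrite nrm0.
have [d1 d10 H1] := differentiable_near_bound (Th_diff k z0).
rewrite Th0 nrm0 add0r in H1; pose r := Num.min d d1.
have r0 : 0 < r by rewrite lt_min d0.
exists (Num.min (r / 4) (eta / (64 / r ^+ 2))) => [|y].
  by rewrite lt_min !divr_gt0 ?exprn_gt0.
have q0 : 0 < 64 / r ^+ 2 by rewrite divr_gt0 ?exprn_gt0.
rewrite lt_min (ltr_pdivlMr _ _ q0) => /andP[yr ye] j.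
have D1 (x : T) : nrm (x - 0) < r -> forall v : T, lder (Th k) x v ('d (Th k) x v).
  by rewrite subr0 lt_min => /andP[xd _] v; exact: diff_lder (Th_diff k xd).
have B1 (x : T) : nrm (x - 0) < r -> nrm (Th k x) <= 1.
  by move=> xr; apply: H1; move: xr; rewrite lt_min => /andP[].
have z1 : nrm ((0 : T) - 0) < r / 4 by rewrite subr0 nrm0 divr_gt0.
have H := gateaux_dlip r0 D1 B1 (delta_mx 0 j) z1 yr.
have H' x' : 0 + y = x' -> nrm ('d (Th k) x' (delta_mx 0 j) - 'd (Th k) 0 (delta_mx 0 j)) <=
    64 * 1 / r ^+ 2 * nrm y * nrm (delta_mx 0 j : T) by move=> <-.
have e2 : (if k == j then c k else 0) = 'd (Th k) 0 (delta_mx 0 j).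
  apply: esym; apply: (etrans (Th_der k _)); rewrite mxE eqxx /=.
  by case: eqP; rewrite ?mul1r ?mul0r.
rewrite e2; apply: (le_trans (H' y (add0r y))).
have n1 : nrm (delta_mx 0 j : T) <= 1.
  apply: nrm_row_le => // i; rewrite !mxE eqxx /=.
  by case: eqP; rewrite ?nrm1 ?nrm0.
rewrite mulr1; apply: (@le_trans _ _ (64 / r ^+ 2 * nrm y)); last by rewrite mulrC ltW.
by rewrite ler_piMr// mulr_ge0 ?nrm_ge0// divr_ge0// exprn_ge0// ltW.
Qed.

Lemma Th_nonzero k : exists2 s : R, 0 < s & forall t : R, 0 < t -> t < s ->
  Th k (const_mx (toC t)) != 0.
Proof.
have z0 : nrm (0 : T) < d by rewrite nrm0.
have n0 : 0 < nrm (c k) by rewrite nrm_gt0.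
have n2 : 0 < nrm (c k) / 2 by rewrite divr_gt0.
have [s s0 Hs] := diff_frechet (Th_diff k z0) n2.
exists s => // t t0 ts; set y : T := const_mx _.
have yt : nrm y <= t.
  by apply: nrm_row_le => [|i]; [exact: ltW | rewrite mxE nrm_toC gtr0_norm].
have := Hs y (le_lt_trans yt ts); rewrite add0r Th0 subr0 Th_der mxE => H.
apply/eqP => T0; rewrite T0 sub0r nrmN nrmM nrm_toC gtr0_norm// in H.
have : nrm (c k) / 2 * nrm y <= nrm (c k) / 2 * t by rewrite ler_wpM2l// ltW.
have : 0 < t * nrm (c k) by rewrite mulr_gt0.
lra.
Qed.

(** The differentials of powers may vanish at 0. At a nearby point with all Th k
    nonzero, row i of the matrix is a nonzero multiple of the differential of
    Th i, and these are almost diagonal. *)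
Lemma diagonal_independent : exists2 y, nrm y < d &
  \det (\matrix_(i, j) 'd ((Th i) ^+ M.+1) y (delta_mx 0 j)) != 0.
Proof.
have cp k : 0 < nrm (c k) by rewrite nrm_gt0.
have [e e0 He] := finite_lower_bound cp.
have mR : 0 < m.+1%:R :> R by rewrite ltr0n.
have eta0 : 0 < e / (2 * m.+1%:R) by rewrite divr_gt0// mulr_gt0.
have /choice[s1 Hs1] : forall k, exists s : R, 0 < s /\ forall y, nrm y < s -> forall j,
  nrm ('d (Th k) y (delta_mx 0 j) - (if k == j then c k else 0)) <= e / (2 * m.+1%:R).
  by move=> k; have [s s0 H] := Th_near k eta0; exists s.
have /choice[s2 Hs2] : forall k, exists s : R, 0 < s /\ forall t : R, 0 < t -> t < s ->
  Th k (const_mx (toC t)) != 0.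
  by move=> k; have [s s0 H] := Th_nonzero k; exists s.
have [u u0 Hu] := finite_lower_bound (fun k => (Hs1 k).1).
have [w w0 Hw] := finite_lower_bound (fun k => (Hs2 k).1).
pose t := Num.min d (Num.min u w) / 2.
have p0 : 0 < Num.min d (Num.min u w) by rewrite !lt_min d0 u0.
have t0 : 0 < t by rewrite divr_gt0.
have tm : t < Num.min d (Num.min u w) := half_lt p0.
have [td tu tw] : [/\ t < d, t < u & t < w] by move: tm; rewrite !lt_min => /andP[-> /andP[-> ->]].
pose y : T := const_mx (toC t).
have yt : nrm y <= t.
  by apply: nrm_row_le => [|i]; [exact: ltW | rewrite mxE nrm_toC gtr0_norm].
have yd : nrm y < d := le_lt_trans yt td.
exists y => //.
have DE i j : (\matrix_(i, j) 'd ((Th i) ^+ M.+1) y (delta_mx 0 j)) i j =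
    (M.+1%:R * Th i y ^+ M) * (\matrix_(i, j) 'd (Th i) y (delta_mx 0 j)) i j.
  apply: (etrans (mxE _ _ _ _)).
  apply: etrans (congr1 (fun u : C => M.+1%:R * Th i y ^+ M * u) (esym (mxE _ _ i j))).
  exact: (congr1 (fun f : T -> C => f (delta_mx 0 j)) (diffX M (Th_diff i yd))).
rewrite (det_scaled_rows DE); apply: mulf_neq0.
  apply/prodf_neq0 => i _; apply: mulf_neq0; first by rewrite pnatr_eq0.
  by rewrite expf_neq0//; apply: (Hs2 i).2 => //; exact: lt_le_trans (Hw i).
apply: (@diagonal_dominant _ c e e0 He) => i j; apply: (eq_rect _ (fun u : C => nrm (u - _) <= _) _ _ (esym (mxE _ _ i j))).
by apply: (Hs1 i).2; apply: le_lt_trans yt (lt_le_trans tu (Hu i)).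
Qed.

End Determinant.

(** * Trajectories, and the axis as a separatrix *)

Section Calculus.
Variable R : realType.
Local Notation C := (Cx R).

Lemma rder_near_cont (V : normedModType C) (g : R -> V) t l : rder g t l ->
  forall e : R, 0 < e -> exists2 d : R, 0 < d & forall s : R, `|s| < d -> nrm (g (t + s) - g t) <= e.
Proof.
move=> H e e0; have [d d0 Hd] := H 1 ltr01.
have n1 : 0 < 1 + nrm l by rewrite ltr_wpDr ?nrm_ge0.
exists (Num.min d (e / (1 + nrm l))) => [|s]; first by rewrite lt_min d0 divr_gt0.
rewrite lt_min (ltr_pdivlMr _ _ n1) => /andP[/Hd H1 H2].
rewrite -(subrK (toC s *: l) (g (t + s) - g t)); apply: le_trans (nrm_triD _ _) _.
by rewrite nrmZ nrm_toC; move: H1 H2; lra.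
Qed.

Lemma chain_split (V : normedModType C) (x l : V) (s del k : C) :
  x - s *: (k *: l) = x - del *: l + (del - s *: k) *: l.
Proof. by rewrite scalerBl addrA subrK scalerA. Qed.

Lemma rder_comp (V : normedModType C) (F : C -> V) (tau : R -> C) (t : R) (k : C) (l : V) :
  lder F (tau t) (1 : C) l -> rder tau t k -> rder (fun s => F (tau s)) t (k *: l).
Proof.
move=> HF Ht e e0.
have nk : 0 < nrm k + 1 by rewrite ltr_wpDl ?nrm_ge0.
have nl : 0 < nrm l + 1 by rewrite ltr_wpDl ?nrm_ge0.
have a1 : 0 < e / 2 / (nrm k + 1) by rewrite !divr_gt0.
have a2 : 0 < Num.min 1 (e / 2 / (nrm l + 1)) by rewrite lt_min ltr01 !divr_gt0.
have [d1 d10 H1] := HF _ a1; have [d2 d20 H2] := Ht _ a2.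
have h : 0 < d1 / 2 by rewrite divr_gt0.
have [d3 d30 H3] := rder_near_cont Ht h.
exists (Num.min d2 d3) => [|s]; first by rewrite lt_min d20.
rewrite lt_min => /andP[s2 s3]; have {}H2 := H2 s s2; have {}H3 := H3 s s3.
set del := tau (t + s) - tau t in H2 H3.
have D1 : nrm del < d1 by move: H3 d10; lra.
have := H1 del D1; have -> : tau t + del *: (1 : C) = tau (t + s) by rewrite [_ *: _]mulr1 subrKC.
move=> {}H1.
have m1 : Num.min 1 (e / 2 / (nrm l + 1)) <= 1 by rewrite ge_min lexx.
have m2 : Num.min 1 (e / 2 / (nrm l + 1)) <= e / 2 / (nrm l + 1) by rewrite ge_min lexx orbT.
have s0 : 0 <= `|s| by [].
have D2 : nrm del <= (nrm k + 1) * `|s|.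
  have := nrm_subl del (toC s *: k); rewrite nrmZ nrm_toC.
  have : Num.min 1 (e / 2 / (nrm l + 1)) * `|s| <= 1 * `|s| by rewrite ler_wpM2r.
  by move: H2; lra.
have -> : F (tau (t + s)) - F (tau t) - toC s *: (k *: l) =
   (F (tau (t + s)) - F (tau t) - del *: l) + (del - toC s *: k) *: l.
  exact: chain_split.
apply: le_trans (nrm_triD _ _) _.
have B1 : nrm (F (tau (t + s)) - F (tau t) - del *: l) <= e / 2 * `|s|.
  apply: le_trans H1 _; apply: (@le_trans _ _ (e / 2 / (nrm k + 1) * ((nrm k + 1) * `|s|))).
    by rewrite ler_wpM2l// ltW.
  by rewrite mulrA divfK// gt_eqF.
have B2 : nrm ((del - toC s *: k) *: l) <= e / 2 * `|s|.
  rewrite nrmZ; apply: (@le_trans _ _ (e / 2 / (nrm l + 1) * `|s| * (nrm l + 1))).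
    apply: ler_pM; rewrite ?nrm_ge0 ?lerDl//.
    by apply: le_trans H2 _; rewrite ler_wpM2r.
  by rewrite mulrAC divfK// gt_eqF.
by move: B1 B2; lra.
Qed.

(** Gronwall's argument on an interval so short that each use of the mean value
    inequality halves the bound. *)
Lemma short_gronwall (V : normedModType C) (w : R -> V) (t0 e K M : R) : 0 <= K -> K * e <= 1 / 2 ->
  w t0 = 0 ->
  (forall t, `|t - t0| < e -> nrm (w t) <= M /\ exists2 l, rder w t l & nrm l <= K * nrm (w t)) ->
  forall t, `|t - t0| < e -> w t = 0.
Proof.
move=> K0 Ke w0 H.
have main n t : `|t - t0| < e -> nrm (w t) <= M / 2 ^+ n.
  elim: n t => [|n IH] t te; first by rewrite expr0 divr1; exact: (H t te).1.
  have q0 : 0 <= M / 2 ^+ n by exact: le_trans (nrm_ge0 _) (IH t te).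
  have step a b : a <= b -> b - a < e -> `|a - t0| < e -> `|b - t0| < e ->
      nrm (w b - w a) <= M / 2 ^+ n.+1.
    move=> ab be ae bbe; apply: (@le_trans _ _ (K * (M / 2 ^+ n) * (b - a))).
      apply: mvi => // u au ub.
      have ue : `|u - t0| < e by move: ae bbe; rewrite !ltr_norml; lra.
      have [l lw lK] := (H u ue).2; exists l => //; apply: le_trans lK _.
      by rewrite ler_wpM2l// IH.
    apply: (@le_trans _ _ (K * (M / 2 ^+ n) * e)); first by apply: ler_wpM2l; [exact: mulr_ge0 | exact: ltW].
    have : K * e * (M / 2 ^+ n) <= 1 / 2 * (M / 2 ^+ n) by rewrite ler_wpM2r.
    by rewrite exprS invfM; move: (_ ^- _) => ?; lra.
  have t00 : `|t0 - t0| < e by rewrite subrr normr0; exact: le_lt_trans (normr_ge0 _) te.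
  have [tt|tt] := leP t0 t.
    have := step _ _ tt _ t00 te; rewrite w0 subr0; apply.
    by move: te; rewrite ger0_norm// subr_ge0.
  have := step _ _ (ltW tt) _ te t00; rewrite w0 sub0r nrmN; apply.
  by move: te; rewrite ltr0_norm ?subr_lt0// opprB.
move=> t te; apply/eqP; rewrite -nrm_eq0 eq_le nrm_ge0 andbT.
have M0 : 0 <= M := le_trans (nrm_ge0 _) (H t te).1.
apply: (@small_of_rate R M _ 0) => N N0 _; apply: le_trans (main N t te) _.
rewrite ler_wpM2l// lef_pV2 ?posrE ?exprn_gt0 ?ltr0n//.
by rewrite -natrX ler_nat ltnW// ltn_expl.
Qed.

Lemma lipschitz_inner n (Z : 'rV[C]_n -> 'rV[C]_n) (r B : R) : 0 < r -> 0 <= B ->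
  (forall x, nrm x < r -> differentiable Z x) -> (forall x, nrm x < r -> nrm (Z x) <= B) ->
  forall x y, nrm x < r / 8 -> nrm y < r / 8 -> nrm (Z x - Z y) <= 8 * B / r * nrm (x - y).
Proof.
move=> r0 B0 ZD ZB x y xr yr.
have c0 : 0 <= 8 * B / r by rewrite divr_ge0 ?mulr_ge0// ltW.
apply: nrm_row_le => [|j]; first by rewrite mulr_ge0 ?nrm_ge0.
have D1 z : nrm (z - 0) < r -> forall v, lder (fun z => Z z 0 j) z v ('d (fun z => Z z 0 j) z v).
  by rewrite subr0 => zr v; apply: diff_lder; apply: diff_entry; exact: ZD.
have B1 z : nrm (z - 0) < r -> nrm (Z z 0 j) <= B.
  by rewrite subr0 => zr; apply: le_trans (nrm_coord _ _ _) _; exact: ZB.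
have y2 : nrm (y - 0) < r / 2 by rewrite subr0; move: yr r0; lra.
have xy : nrm (x - y) < r / 4.
  by apply: le_lt_trans (nrm_triB _ _) _; move: xr yr; lra.
have := gateaux_lip r0 D1 B1 y2 xy; rewrite subrKC; apply: le_trans.
by rewrite !mxE.
Qed.

(** A polygon cannot leave the ball before the time needed to reach the boundary
    at maximal speed. *)
Lemma bounded_good n (Z : 'rV[C]_n -> 'rV[C]_n) (r B : R) (nu : C) p : 0 <= B ->
  (forall x, nrm x < r -> nrm (Z x) <= B) -> nrm p + B * nrm nu < r ->
  euler_good Z [set x | nrm x < r] 1 nu p.
Proof.
move=> B0 ZB pr; split=> // N N0.
have NR : 0 < N%:R :> R by rewrite ltr0n.
have b0 : 0 <= B * nrm nu by rewrite mulr_ge0 ?nrm_ge0.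
have hE : nrm (nu / N%:R) = nrm nu / N%:R by rewrite nrmM nrmV nrm_nat.
suff main i : (i <= N)%N -> nrm (euler Z (nu / N%:R) i p) <= nrm p + B * nrm nu / N%:R * i%:R.
  move=> i iN; apply: le_lt_trans (main i iN) (le_lt_trans _ pr).
  rewrite lerD2l mulrAC ler_pdivrMr// ler_wpM2l// ler_nat//.
elim: i => [|i IH] iN; first by rewrite mulr0 addr0.
have {}IH := IH (ltnW iN); rewrite eulerS; apply: le_trans (nrm_triD _ _) _.
have ir : nrm (euler Z (nu / N%:R) i p) < r.
  apply: le_lt_trans IH (le_lt_trans _ pr).
  by rewrite lerD2l mulrAC ler_pdivrMr// ler_wpM2l// ler_nat ltnW.
rewrite nrmZ hE -natr1 mulrDr mulr1 addrA; apply: lerD => //.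
rewrite mulrC mulrA ler_wpM2r ?invr_ge0 ?(ltW NR)// ler_wpM2r ?nrm_ge0//; exact: ZB.
Qed.

End Calculus.

Section Reparametrization.
Variables (R : realType) (n : nat).
Local Notation C := (Cx R).
Local Notation E := 'rV[C]_n.
Variables (Z : E -> E) (r L B : R).
Local Notation P := [set x : E | nrm x < r].
Hypotheses (L0 : 0 <= L) (B0 : 0 <= B).
Hypothesis ZL : forall x y, nrm x < r -> nrm y < r -> nrm (Z x - Z y) <= L * nrm (x - y).
Hypothesis ZB : forall x, nrm x < r -> nrm (Z x) <= B.
Hypothesis ZD : forall x, nrm x < r -> differentiable Z x.

Lemma short_time (p : E) (s : C) : nrm p + B * nrm s < r ->
  [/\ flow_ok Z P p s, P (flow Z s p) & lder (fun s => flow Z s p) s 1 (Z (flow Z s p))].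
Proof.
move=> ps; have ok : flow_ok Z P p s.
  have b1 : 0 < B + 1 by rewrite ltr_wpDl.
  exists ((r - (nrm p + B * nrm s)) / (B + 1)), 1%N; split=> [|s' ss].
    by rewrite divr_gt0// subr_gt0.
  apply: (bounded_good B0 ZB); rewrite ltr_pdivlMr// in ss.
  have h : nrm s' <= nrm s + nrm (s' - s) by have := nrm_subl s' s; lra.
  have h2 : B * nrm s' <= B * (nrm s + nrm (s' - s)) by rewrite ler_wpM2l.
  have := nrm_ge0 (s' - s); move: ss h2; lra.
have Pf : P (flow Z s p).
  have h := flow_dist L0 B0 ZL ZB (bounded_good B0 ZB ps).
  by rewrite /=; have := nrm_subl (flow Z s p) p; move: h ps; lra.
split=> //; apply: (flow_ok_lder L0 B0 ZL ZB ZD (Bd := r) _ ok Pf).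
by move=> x /ltW.
Qed.

Variables (gam : R -> E) (beta : R -> C) (t0 e0 K : R).
Hypothesis e00 : 0 < e0.
Hypothesis K0 : 0 <= K.
Hypothesis gamP : forall t, `|t - t0| < e0 -> nrm (gam t) < r.
Hypothesis gam_der : forall t, `|t - t0| < e0 -> rder gam t (beta t *: Z (gam t)).
Hypothesis beta_cont : forall t, `|t - t0| < e0 -> rcont beta t.
Hypothesis beta_bound : forall t, `|t - t0| < e0 -> nrm (beta t) <= K.

(** Take a primitive tau of the complex speed beta: the trajectory of Z at the
    complex time tau(t) satisfies the same equation as gam, and Gronwall applies to
    the difference. *)
Lemma complex_clock : exists (rT e : R) (tau : R -> C), [/\ 0 < rT, 0 < e /\ tau t0 = 0,
  nrm (gam t0) + B * rT < r,
  forall t, `|t - t0| < e -> exists l, rder tau t l &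
  forall t, `|t - t0| < e -> nrm (tau t) < rT /\ gam t = flow Z (tau t) (gam t0)].
Proof.
set p := gam t0.
have t00 : `|t0 - t0| < e0 by rewrite subrr normr0.
have pr : nrm p < r := gamP t00.
have b1 : 0 < 2 * (B + 1) by rewrite mulr_gt0// ltr_wpDl.
pose rT := (r - nrm p) / (2 * (B + 1)).
have rT0 : 0 < rT by rewrite divr_gt0// subr_gt0.
have rTE : rT * (2 * (B + 1)) = r - nrm p by rewrite /rT divfK// gt_eqF.
have rTr : nrm p + B * rT < r by move: rTE rT0; lra.
have h2 : 0 < e0 / 2 by rewrite divr_gt0.
have ab : t0 - e0 / 2 < t0 + e0 / 2 by move: h2; lra.
have inI t : t0 - e0 / 2 <= t -> t <= t0 + e0 / 2 -> `|t - t0| < e0.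
  by rewrite ltr_norml; have := e00; lra.
have [G HG] := primitive_ex ab (fun t ta tb => beta_cont (inI t ta tb)).
pose tau t := G t - G t0.
have tau_der t : `|t - t0| < e0 / 2 -> rder tau t (beta t).
  rewrite ltr_norml => /andP[ta tb]; rewrite -[beta t]subr0; apply: rderB; last exact: rder_cst.
  by apply: HG; lra.
have K1 : 0 < K + 1 by rewrite ltr_wpDl.
have KL1 : 0 < 2 * (K * L + 1) by rewrite mulr_gt0// ltr_wpDl// mulr_ge0.
(* tau stays below rT, and the interval is short enough for [short_gronwall]
   with the constant K L *)
pose e := Num.min (e0 / 2) (Num.min (rT / (K + 1)) (1 / (2 * (K * L + 1)))).
have e1 : 0 < e by rewrite !lt_min h2 (divr_gt0 rT0 K1) (divr_gt0 ltr01 KL1).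
have ee : e <= e0 / 2 by rewrite ge_min lexx.
have eT : e <= rT / (K + 1) by rewrite !ge_min lexx orbT.
have eL : e <= 1 / (2 * (K * L + 1)) by rewrite !ge_min lexx !orbT.
have e_e0 t : `|t - t0| < e -> `|t - t0| < e0 / 2 by move=> te; exact: lt_le_trans ee.
have e_e1 t : `|t - t0| < e -> `|t - t0| < e0 by move=> /e_e0 te; apply: lt_trans te _; move: h2; lra.
have tau0 : tau t0 = 0 by rewrite /tau subrr.
have step a b : a <= b -> `|a - t0| < e -> `|b - t0| < e -> nrm (tau b - tau a) <= K * (b - a).
  move=> ab' ae be; apply: mvi => // u au ub.
  have ue : `|u - t0| < e by move: ae be; rewrite !ltr_norml; lra.
  by exists (beta u); [exact: tau_der (e_e0 _ ue) | exact: beta_bound (e_e1 _ ue)].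
have tau_lt t : `|t - t0| < e -> nrm (tau t) < rT.
  move=> te; have t0e : `|t0 - t0| < e by rewrite subrr normr0.
  have H : nrm (tau t) <= K * `|t - t0|.
    have [tt|tt] := leP t0 t.
      by have := step _ _ tt t0e te; rewrite tau0 subr0 ger0_norm// subr_ge0.
    have := step _ _ (ltW tt) te t0e; rewrite tau0 sub0r nrmN.
    by rewrite ltr0_norm ?subr_lt0// opprB.
  apply: le_lt_trans H _; apply: (@le_lt_trans _ _ (K * (rT / (K + 1)))).
    by rewrite ler_wpM2l// (le_trans (ltW te)).
  rewrite mulrA ltr_pdivrMr// mulrC ltr_pM2l//; lra.
exists rT, e, tau; split=> //.
  by move=> t te; exists (beta t); exact: tau_der (e_e0 _ te).
have ok t : `|t - t0| < e -> nrm p + B * nrm (tau t) < r.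
  move=> te; apply: le_lt_trans rTr; rewrite lerD2l ler_wpM2l// ltW//; exact: tau_lt.
pose w t := flow Z (tau t) p - gam t.
suff wz t : `|t - t0| < e -> w t = 0.
  move=> t te; split; first exact: tau_lt.
  by apply: esym; apply/eqP; rewrite -subr_eq0; apply/eqP; exact: wz.
apply: (@short_gronwall R E w t0 e (K * L) (2 * r)); first exact: mulr_ge0.
- apply: (@le_trans _ _ (K * L * (1 / (2 * (K * L + 1))))); first by rewrite ler_wpM2l ?mulr_ge0.
  rewrite mulrA mulr1 ler_pdivrMr//; have := mulr_ge0 K0 L0; lra.
- have f0 : flow Z 0 p = p.
    apply: (flow0 L0 B0 ZL ZB (N0 := 1)); apply: (bounded_good B0 ZB).
    by rewrite nrm0 mulr0 addr0.
  by rewrite /w tau0 f0 subrr.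
move=> {}t te; have [_ Pf lf] := short_time (ok t te).
have Pg := gamP (e_e1 t te).
split; first by apply: le_trans (nrm_triB _ _) _; move: Pf Pg => /=; lra.
have H := rderB (rder_comp lf (tau_der _ (e_e0 t te))) (gam_der (e_e1 t te)).
rewrite -scalerBr in H; exists (beta t *: (Z (flow Z (tau t) p) - Z (gam t))); first exact: H.
rewrite nrmZ -mulrA; apply: ler_pM; rewrite ?nrm_ge0//; first exact: beta_bound (e_e1 t te).
exact: ZL.
Qed.

End Reparametrization.

Section Within.
Variables (R : realType).
Local Notation C := (Cx R).

Lemma ball0P (r : R) (z : C) : ball (0 : C) (toC r) z <-> nrm z < r.
Proof. by rewrite -ball_normE /= sub0r normrN nrmE toC_lt. Qed.

Lemma within_comp (S T U : topologicalType) (A : set S) (f : S -> T) (k : T -> U) :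
  {within A, continuous f} -> (forall x, A x -> {for f x, continuous k}) ->
  {within A, continuous (k \o f)}.
Proof.
move=> /subspace_continuousP fc kc; apply/subspace_continuousP => x Ax.
exact: cvg_comp (fc x Ax) (kc x Ax).
Qed.

Lemma within_for (S T : topologicalType) (A : set S) (f : S -> T) :
  (forall x, A x -> {for x, continuous f}) -> {within A, continuous f}.
Proof.
move=> fc; apply/subspace_continuousP => x Ax; apply: cvg_within_filter; exact: fc.
Qed.

End Within.

Lemma lder_id (R : realType) (V : normedModType (Cx R)) (x v : V) : lder idfun x v v.
Proof.
by move=> e e0; exists 1 => // t _; rewrite /= (addrC x) addrK subrr nrm0 mulr_ge0 ?nrm_ge0// ltW.
Qed.

Lemma open_ball_nrm (R : realType) (V : normedModType (Cx R)) (x : V) (d : R) : open [set y | nrm (y - x) < d].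
Proof.
apply/open_nrm => y /= yd; exists (d - nrm (y - x)); first by rewrite subr_gt0.
by move=> z zy; have := nrm_tri y z x; move: zy; lra.
Qed.

Section Separatrix.
Variables (R : realType) (m : nat).
Local Notation C := (Cx R).
Local Notation E := 'rV[C]_m.+1.
Variables (X Xt Phi Psi : E -> E) (r r1 : R).
Hypothesis r0 : 0 < r.
Hypothesis Phi_diff : forall x, nrm x < r1 -> differentiable Phi x.
Hypothesis PsiK : forall x, nrm x < r1 -> Psi (Phi x) = x.
Hypothesis X_diff : forall x, nrm x < r1 -> differentiable X x.
Hypothesis X_neq0 : forall x, nrm x < r1 -> x != 0 -> X x != 0.
Hypothesis X_Phi : forall x, nrm x < r1 -> 'd Phi x (X x) = Xt (Phi x).
Hypothesis Psi_diff : forall y, nrm y < r -> differentiable Psi y.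
Hypothesis PhiK : forall y, nrm y < r -> Phi (Psi y) = y.
Hypothesis Psi_lt : forall y, nrm y < r -> nrm (Psi y) < r1.
Hypothesis Phi0 : Phi 0 = 0.
Hypothesis Xt_axis : forall y, nrm y < r -> rest y = 0 -> rest (Xt y) = 0.

(** The margin r / 8 leaves room for the estimates of the field, which hold on
    the ball of radius r. *)
Definition nbhd : set E := [set x | nrm x < r1 /\ nrm (Phi x) < r / 8].
Definition axis_curve : set E := [set x | nbhd x /\ rest (Phi x) = 0].
Definition axis (z : C) : E := Psi (cons_row z 0).

Lemma r8r : r / 8 < r. Proof. by have := r0; lra. Qed.

Lemma r8_gt0 : 0 < r / 8. Proof. by have := r0; lra. Qed.

Lemma zero_r1 : nrm (0 : E) < r1.
Proof. by rewrite nrm0; apply: le_lt_trans (nrm_ge0 (Psi 0)) (Psi_lt _); rewrite nrm0. Qed.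

Lemma Psi0 : Psi 0 = 0. Proof. by rewrite -[in LHS]Phi0 PsiK//; exact: zero_r1. Qed.

Lemma nbhd_Psi y : nrm y < r / 8 -> nbhd (Psi y).
Proof. by move=> yr; have y1 := lt_trans yr r8r; split; rewrite ?PhiK//; exact: Psi_lt. Qed.

Lemma open_nbhd : open nbhd.
Proof.
apply/open_nrm => x [xr Px].
have e0 : 0 < r / 8 - nrm (Phi x) by rewrite subr_gt0.
have [d d0 Hd] := diff_cont (Phi_diff xr) e0.
exists (Num.min d (r1 - nrm x)) => [|y]; first by rewrite lt_min d0 subr_gt0.
rewrite lt_min => /andP[/Hd H1 H2]; split.
  by have := nrm_subl y x; move: H2; lra.
by have := nrm_subl (Phi y) (Phi x); move: H1; lra.
Qed.

Lemma nrm_axis (z : C) (e : R) : 0 < e -> nrm z < e -> nrm (cons_row z 0 : E) < e.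
Proof. by move=> e0 ze; apply: nrm_cons_row_lt; rewrite ?nrm0. Qed.

Lemma axis_curve_axis z : nrm z < r / 8 -> axis_curve (axis z).
Proof.
move=> zr; have h := nrm_axis r8_gt0 zr; split; first exact: nbhd_Psi.
by rewrite /axis PhiK ?rest_cons_row//; exact: lt_trans h r8r.
Qed.

Lemma axis_curveE x : axis_curve x -> x = axis (Phi x 0 ord0) /\ nrm (Phi x 0 ord0) < r / 8.
Proof.
move=> [[xr Px] Rx]; split; last exact: le_lt_trans (nrm_coord _ _ _) Px.
by rewrite /axis -Rx cons_row_rest PsiK.
Qed.

Lemma Phi_axis z : nrm z < r -> Phi (axis z) = cons_row z 0.
Proof. by move=> zr; rewrite PhiK//; exact: nrm_axis. Qed.

Lemma axis0 : axis 0 = 0. Proof. by rewrite /axis cons_row00 Psi0. Qed.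

Lemma axis_diff z : nrm z < r -> differentiable axis z.
Proof.
move=> zr; have dc : differentiable (fun z : C => cons_row z 0 : E) z.
  by apply: diff_cons_row; [exact: ex_diff | exact: differentiable_cst].
by apply: (@differentiable_comp _ _ _ _ (fun z : C => cons_row z 0 : E) Psi); last exact: Psi_diff (nrm_axis r0 zr).
Qed.

Lemma dPsi_dPhi y v : nrm y < r -> 'd Psi y ('d Phi (Psi y) v) = v.
Proof.
move=> yr; have xr := Psi_lt yr.
have dP : differentiable Psi (Phi (Psi y)) by rewrite PhiK//; exact: Psi_diff.
have h := congr1 (fun f : E -> E => f v) (diff_comp (Phi_diff xr) dP).
rewrite /= PhiK// in h; rewrite -h.
apply: (lder_uniq (diff_lder v (differentiable_comp (Phi_diff xr) dP))).
apply: (@lder_near R _ _ idfun).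
  apply/(@nearP R E); exists (r1 - nrm (Psi y)); first by rewrite subr_gt0.
  by move=> x xy /=; rewrite PsiK//; have := nrm_subl x (Psi y); move: xy; lra.
exact: lder_id.
Qed.

Lemma dPhi_dPsi y v : nrm y < r -> 'd Phi (Psi y) ('d Psi y v) = v.
Proof.
move=> yr; have dP := Psi_diff yr; have dF := Phi_diff (Psi_lt yr).
have h := congr1 (fun f : E -> E => f v) (diff_comp dP dF); rewrite /= in h; rewrite -h.
apply: (lder_uniq (diff_lder v (differentiable_comp dP dF))).
apply: (@lder_near R _ _ idfun).
  apply/(@nearP R E); exists (r - nrm y); first by rewrite subr_gt0.
  by move=> x xy /=; rewrite PhiK//; have := nrm_subl x y; move: xy; lra.
exact: lder_id.
Qed.

Lemma dPsi_Xt y : nrm y < r -> 'd Psi y (Xt y) = X (Psi y).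
Proof. by move=> yr; rewrite -[in Xt y](PhiK yr) -X_Phi ?dPsi_dPhi//; exact: Psi_lt. Qed.

Definition curve_eq (x : E) : 'rV[C]_m := rest (Phi x).

Lemma curve_eq_diff x : nrm x < r1 -> differentiable curve_eq x.
Proof. by move=> xr; apply: diff_rest; exact: Phi_diff. Qed.

Lemma curve_eq_holo x : nrm x < r1 -> holomorphic_at curve_eq x.
Proof.
move=> xr; apply/(@nearP R E); exists (r1 - nrm x); first by rewrite subr_gt0.
by move=> y yx; apply: curve_eq_diff; have := nrm_subl y x; move: yx; lra.
Qed.

Lemma near_nbhd x : nbhd x -> \forall y \near x, nbhd y.
Proof. by move=> Ux; apply: open_nbhs_nbhs; split; [exact: open_nbhd | exact: Ux]. Qed.

Lemma curve_eq_zero x : nbhd x -> \forall y \near x, axis_curve y <-> curve_eq y = 0.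
Proof.
move=> /near_nbhd/(@nearP R E)[d d0 Hd]; apply/(@nearP R E); exists d => // y /Hd Uy.
by split=> [[]|].
Qed.

Lemma curve_analytic x : nbhd x -> analytic_at axis_curve x.
Proof.
move=> Ux; exists m, curve_eq; split; first exact: curve_eq_holo Ux.1.
exact: curve_eq_zero.
Qed.

Lemma Phi_cont0 (e : R) : 0 < e -> exists2 d : R, 0 < d & forall x, nrm x < d -> nbhd x /\ nrm (Phi x) < e.
Proof.
move=> e0; have [d d0 Hd] := diff_cont (Phi_diff zero_r1) e0.
have U0 : nbhd 0 by split; [exact: zero_r1 | rewrite Phi0 nrm0; exact: r8_gt0].
have /(@nearP R E)[d' d'0 Hd'] := near_nbhd U0.
exists (Num.min d d') => [|x]; first by rewrite lt_min d0.
rewrite lt_min => /andP[xd xd']; split; first by apply: Hd'; rewrite subr0.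
by have := Hd x; rewrite subr0 Phi0 subr0; exact.
Qed.

Lemma axis_cont0 (e : R) : 0 < e -> exists2 d : R, 0 < d & forall z : C, nrm z < d -> nrm z < r / 8 /\ nrm (axis z) < e.
Proof.
move=> e0; have z0 : nrm (0 : C) < r by rewrite nrm0.
have [d d0 Hd] := diff_cont (axis_diff z0) e0.
exists (Num.min d (r / 8)) => [|z]; first by rewrite lt_min d0 r8_gt0.
rewrite lt_min => /andP[zd zr]; split=> //.
by have := Hd z; rewrite subr0 axis0 subr0; exact.
Qed.

(** The curve is a disc, parametrized by its first coordinate. Near a point of it
    where the equations of A do not all vanish those of B do, and then they vanish
    on the disc by the identity theorem. *)
Lemma curve_irreducible : irreducible_at axis_curve 0.
Proof.
move=> A B [ka [ga [/(@nearP R E)[da da0 Ha] /(@nearP R E)[da' da'0 Ha']]]]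
  [kb [gb [/(@nearP R E)[db db0 Hb] /(@nearP R E)[db' db'0 Hb']]]] /(@nearP R E)[dc dc0 Hc].
pose e := Num.min (Num.min da da') (Num.min (Num.min db db') dc).
have e0 : 0 < e by rewrite !lt_min da0 da'0 db0 db'0.
have [d d0 Hd] := axis_cont0 e0.
have small (x : E) : nrm x < e -> [/\ differentiable ga x, differentiable gb x,
    A x <-> ga x = 0, B x <-> gb x = 0 & axis_curve x <-> A x \/ B x].
  rewrite !lt_min => /andP[/andP[h1 h2] /andP[/andP[h3 h4] h5]].
  by split; [apply: Ha | apply: Hb | apply: Ha' | apply: Hb' | apply: Hc]; rewrite subr0.
have conv D : (forall z, nrm z < d -> D (axis z)) -> (forall x, nrm x < e -> D x -> axis_curve x) ->
    same_germ axis_curve D 0.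
  move=> HD HS; have [d' d'0 Hd'] := Phi_cont0 d0.
  apply/(@nearP R E); exists (Num.min d' e) => [|x]; first by rewrite lt_min d'0.
  rewrite subr0 lt_min => /andP[/Hd'[Ux Px] xe]; split; last exact: HS.
  move=> /axis_curveE[-> _]; apply: HD; exact: le_lt_trans (nrm_coord _ _ _) Px.
have [allA|] := pselect (forall z : C, nrm z < d -> ga (axis z) = 0).
  left; apply: conv => [z zd|x xe Ax].
    by have [_ ze] := Hd z zd; have [_ _ [_ h] _ _] := small _ ze; apply: h; exact: allA.
  by have [_ _ _ _ [_ h]] := small x xe; apply: h; left.
move=> /existsNP[z1 /not_implyP[z1d /eqP g1]]; right.
have dcomp k (gg : E -> 'rV[C]_k) (z : C) : nrm z < d -> differentiable gg (axis z) -> differentiable (gg \o axis) z.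
  move=> /Hd[zr _] dg; apply: differentiable_comp dg; apply: axis_diff; exact: lt_trans zr r8r.
have dga (z : C) : nrm z < d -> differentiable (ga \o axis) z.
  by move=> zd; apply: dcomp => //; have [h _ _ _ _] := small _ (Hd z zd).2.
have dgb (z : C) : nrm z < d -> differentiable (gb \o axis) z.
  by move=> zd; apply: dcomp => //; have [_ h _ _ _] := small _ (Hd z zd).2.
have n1 : 0 < nrm (ga (axis z1)) by rewrite nrm_gt0.
have [d1 d10 H1] := diff_cont (dga z1 z1d) n1.
have near1 : \forall z \near z1, (gb \o axis) z = 0.
  apply/(@nearP R C); exists (Num.min d1 (d - nrm z1)) => [|z]; first by rewrite lt_min d10 subr_gt0.
  rewrite lt_min => /andP[zd1 zd2].
  have zd : nrm z < d by have := nrm_subl z z1; move: zd2; lra.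
  have [zr ze] := Hd z zd; have [_ _ [h1 _] [h2 _] [h3 _]] := small _ ze.
  have [/h1 ga0|/h2//] := h3 (axis_curve_axis zr).
  by have := H1 z zd1; rewrite /= ga0 sub0r nrmN ltxx.
pose D : set C := [set z | nrm (z - 0) < d].
have Dd z : D z -> differentiable (gb \o axis) z by rewrite /D /= subr0 => /dgb.
have oD : open D by exact: open_ball_nrm.
have Dz1 : D z1 by rewrite /D /= subr0.
apply: conv => [z zd|x xe Bx]; last by have [_ _ _ _ [_ h]] := small x xe; apply: h; right.
have Dz : D z by rewrite /D /= subr0.
have nz := @identity_connected_row R kb C (gb \o axis) D D z1 z oD (fun _ h => h)
  (@connected_ball R C 0 d d0) Dd Dz1 Dz near1.
have [_ ze] := Hd z zd; have [_ _ _ [_ h] _] := small _ ze; apply: h.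
exact: (nbhs_singleton nz).
Qed.

Lemma curve_limit : limit_point axis_curve 0.
Proof.
move=> W /(@nearP R E)[e e0 HW]; have [d d0 Hd] := axis_cont0 e0.
have d2 : 0 < d / 2 by rewrite divr_gt0.
have nz : nrm (toC (d / 2) : C) = d / 2 by rewrite nrm_toC gtr0_norm.
have [zr ze] : nrm (toC (d / 2) : C) < r / 8 /\ nrm (axis (toC (d / 2))) < e.
  by apply: Hd; rewrite nz; move: d0; lra.
exists (axis (toC (d / 2))); split; last by apply: HW; rewrite subr0.
  apply/eqP => a0; have := Phi_axis (lt_trans zr r8r); rewrite a0 Phi0 => h.
  have := congr1 (fun x : E => x 0 ord0) h; rewrite mxE cons_row0 => h2.
  by move: nz; rewrite -h2 nrm0 => h3; move: d2; rewrite -h3 ltxx.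
exact: axis_curve_axis.
Qed.

Lemma curve_smooth p : axis_curve p -> smooth_curve_equation axis_curve p curve_eq.
Proof.
move=> Sp; have Up := Sp.1; split; first exact: curve_eq_holo Up.1.
  apply/eqP; change (row_full ('J curve_eq p)); rewrite -sub1mx; apply/row_subP => i.
  set w := row i _; have yr : nrm (Phi p) < r := lt_trans Up.2 r8r.
  have -> : w = 'd Psi (Phi p) (cons_row 0 w) *m 'J curve_eq p; last exact: submxMl.
  rewrite mul_rV_lin1 /=; set v := 'd Psi _ _.
  have dv : 'd Phi p v = cons_row 0 w by have := dPhi_dPsi (cons_row 0 w) yr; rewrite PsiK//; exact: Up.1.
  have l := diff_lder v (Phi_diff Up.1); rewrite dv in l.
  apply: (lder_uniq _ (diff_lder v (curve_eq_diff Up.1))).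
  apply: lder_row => k; have := lder_entry (lift ord0 k) l; rewrite cons_rowS => l2.
  apply: lder_near l2; apply/(@nearP R E); exists 1 => // y _; by rewrite /curve_eq restE.
exact: curve_eq_zero.
Qed.

(** Any equation k of the curve vanishes along the parametrization by the first
    coordinate, and the field is a multiple of the velocity of the latter. *)
Lemma curve_tangent p (k : E -> 'rV[C]_m) : axis_curve p -> smooth_curve_equation axis_curve p k -> 'd k p (X p) = 0.
Proof.
move=> Sp [hk _ /(@nearP R E)[d d0 Hd]]; have [pE zr] := axis_curveE Sp.
have dk : differentiable k p by exact: nbhs_singleton hk.
set z := Phi p 0 ord0 in pE zr; have zr' := lt_trans zr r8r.
have da := axis_diff zr'; rewrite pE in dk Hd *.
have dcomp := differentiable_comp da dk.
have [d1 d10 H1] := diff_cont da d0.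
have Z : 'd (k \o axis) z (1 : C) = 0.
  apply: (lder_uniq (diff_lder (1 : C) dcomp)); apply: (@lder_near R C _ (fun=> 0)).
    apply/(@nearP R C); exists (Num.min d1 (r / 8 - nrm z)) => [|y].
      by rewrite lt_min d10 subr_gt0.
    rewrite lt_min => /andP[/H1 y1 y2]; apply: esym; apply: (Hd _ y1).1; apply: axis_curve_axis.
    by have := nrm_subl y z; move: y2; lra.
  by move=> e e0; exists 1 => // t _; rewrite scaler0 !subr0 nrm0 mulr_ge0 ?nrm_ge0// ltW.
have yr : nrm (cons_row z 0 : E) < r := nrm_axis r0 zr'.
have dP := Psi_diff yr.
have da1 : 'd axis z (1 : C) = 'd Psi (cons_row z 0) (cons_row 1 0).
  apply: (lder_uniq (diff_lder (1 : C) da)) => e e0.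
  have [d2 d20 H2] := diff_lder (cons_row 1 0) dP e0; exists d2 => // t /H2.
  by rewrite cons_rowZ scaler0 cons_rowD addr0 mulr1 /axis [t *: 1]mulr1.
have Xe : Xt (cons_row z 0) = Xt (cons_row z 0) 0 ord0 *: cons_row 1 0.
  by rewrite -[LHS]cons_row_rest Xt_axis ?rest_cons_row// cons_rowZ scaler0 mulr1.
rewrite /axis -(dPsi_Xt yr) Xe linearZ /= -da1 linearZ /=.
have h := congr1 (fun f : C -> 'rV[C]_m => f 1) (diff_comp da dk).
have {}h : 'd k (axis z) ('d axis z (1 : C)) = 0 by apply: etrans Z; rewrite h.
by apply: (etrans (congr1 (fun u => _ *: u) h)); rewrite scaler0.
Qed.

Lemma curve_separatrix : separatrix X nbhd axis_curve.
Proof.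
split.
- split; first exact: open_nbhd.
  + by split; [exact: zero_r1 | rewrite Phi0 nrm0; exact: r8_gt0].
  + by move=> x [xr _]; exact: X_diff.
  + by move=> x [xr _]; exact: X_neq0.
- split; first by move=> x [].
    by have := axis_curve_axis (_ : nrm (0 : C) < r / 8); rewrite axis0; apply; rewrite nrm0 r8_gt0.
  by move=> p Up; exact: curve_analytic.
- by split; [exact: curve_irreducible | exact: curve_limit].
- by move=> p Sp _; exists curve_eq; exact: curve_smooth.
- by move=> p k Sp _; exact: curve_tangent.
Qed.

End Separatrix.

Lemma toC_cont (R : realType) (t : R) : {for t, continuous (@toC R : R -> Cx R)}.
Proof.
apply: continuous_RV => e e0; exists e => // s st.
by rewrite -toCB nrm_toC.
Qed.

Lemma cexp_diff (R : realType) (z : Cx R) : differentiable (@cexp R) z.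
Proof. by apply/derivable1_diffP; have /lderP[] := cexp_der z. Qed.

Lemma within_square_snd (R : realType) (A : set R) (T : topologicalType) (f : R -> T) :
  {within A, continuous f} ->
  {within A `*` A, continuous (fun p : R * R => f p.2)}.
Proof.
move=> /subspace_continuousP fc; apply/subspace_continuousP => -[s t] [/= As At].
apply: (@cvg_comp _ _ _ snd f _ (within A (nbhs t))); last exact: fc.
move=> Q HQ; change (nbhs (s, t) (fun p : R * R => (A `*` A) p -> Q p.2)).
have HQ2 := @cvg_snd R R (nbhs s) (nbhs t) _ _ HQ.
apply: (@filterS _ (nbhs (s, t)) (nbhs_filter _) (fun p => A p.2 -> Q p.2)) => [p Hp [_ Ap]|]; first exact: Hp.
exact: (HQ2 (nbhs_filter s)).
Qed.

Section Loops.
Variables (R : realType) (m : nat).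
Local Notation C := (Cx R).
Local Notation E := 'rV[C]_m.+1.
Variables (Phi Psi : E -> E) (r r1 rho : R).
Hypothesis r0 : 0 < r.
Hypothesis Phi_diff : forall x, nrm x < r1 -> differentiable Phi x.
Hypothesis PsiK : forall x, nrm x < r1 -> Psi (Phi x) = x.
Hypothesis Psi_diff : forall y, nrm y < r -> differentiable Psi y.
Hypothesis PhiK : forall y, nrm y < r -> Phi (Psi y) = y.
Hypothesis Psi_lt : forall y, nrm y < r -> nrm (Psi y) < r1.
Hypothesis Phi0 : Phi 0 = 0.
Hypothesis rho0 : 0 < rho.
Hypothesis rho_r : rho < r / 8.

Local Notation axis := (axis Psi).
Local Notation S := (axis_curve Phi r r1).

Let axis_curve_axis z : nrm z < r / 8 -> S (axis z).
Proof. exact: axis_curve_axis. Qed.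
Let axis_curveE x : S x -> x = axis (Phi x 0 ord0) /\ nrm (Phi x 0 ord0) < r / 8.
Proof. exact: axis_curveE. Qed.
Let Phi_axis z : nrm z < r -> Phi (axis z) = cons_row z 0.
Proof. by apply: Phi_axis. Qed.
Let axis0 : axis 0 = 0. Proof. by apply: (@axis0 R m Phi Psi r r1). Qed.
Let axis_diff z : nrm z < r -> differentiable axis z.
Proof. by apply: axis_diff. Qed.
Let r8r : r / 8 < r. Proof. exact: r8r. Qed.
Let r8_gt0 : 0 < r / 8. Proof. exact: r8_gt0. Qed.

Lemma axis_neq0 z : nrm z < r -> z != 0 -> axis z != 0.
Proof.
move=> zr; apply: contra => /eqP a0; have := Phi_axis zr; rewrite a0 Phi0 => h.
by have := congr1 (fun x : E => x 0 ord0) h; rewrite mxE cons_row0 => <-.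
Qed.

Lemma curve_disc : disc_representative S.
Proof.
have n8 : nrm (toC (r / 8) : C) = r / 8 by rewrite nrm_toC gtr0_norm.
have t8 : toC (r / 8) != 0 :> C by rewrite -nrm_gt0 n8.
have in8 (z : C) : ball (0 : C) 1 z -> nrm (toC (r / 8) * z) < r / 8.
  by move=> /(ball0P 1) z1; rewrite nrmM n8 gtr_pMr.
exists (fun z => axis (toC (r / 8) * z)), (fun x => Phi x 0 ord0 / toC (r / 8)); split.
- apply: within_for => z zb; apply: differentiable_continuous.
  apply: (@differentiable_comp _ _ _ _ (fun z : C => toC (r / 8) * z) axis).
    by apply: differentiableM; [exact: differentiable_cst | exact: ex_diff].
  by apply: axis_diff; exact: lt_trans (in8 z zb) r8r.
- apply: within_for => x Sx; apply: differentiable_continuous; apply: differentiableM; last exact: differentiable_cst.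
  by apply: diff_entry; apply: Phi_diff; exact: Sx.1.1.
- by rewrite mulr0 axis0.
- move=> z /in8 zb; split; first exact: axis_curve_axis.
  rewrite Phi_axis; last exact: lt_trans zb r8r.
  by rewrite cons_row0 mulrC mulKf.
move=> x Sx; have [xE xr] := axis_curveE Sx; split.
  by apply/(ball0P 1); rewrite nrmM nrmV n8 ltr_pdivrMr// mul1r.
by rewrite mulrC divfK.
Qed.

Definition base_loop (t : R) : E := axis (toC rho * cexp (toC t * turn R)).

Lemma nrm_circle (w : C) : nrm (toC rho * cexp w) = rho * expR (complex.Re w).
Proof. by rewrite nrmM nrm_toC gtr0_norm// nrm_cexp. Qed.

Lemma circle_neq0 (w : C) : toC rho * cexp w != 0.
Proof. by rewrite mulf_neq0 ?cexp_neq0// -nrm_gt0 nrm_toC gtr0_norm. Qed.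

Lemma circle_continuous (w : C) : rho * expR (complex.Re w) < r ->
  {for w, continuous (fun w => axis (toC rho * cexp w))}.
Proof.
move=> wr; apply: differentiable_continuous.
apply: (@differentiable_comp _ _ _ _ (fun w : C => toC rho * cexp w) axis).
  by apply: differentiableM; [exact: differentiable_cst | exact: cexp_diff].
by apply: axis_diff; rewrite nrm_circle.
Qed.

Lemma Re_turns (t : R) : complex.Re (toC t * turn R) = 0.
Proof. by rewrite Re_mul [complex.Re (turn R)]Re_iC mulr0 /= mul0r subr0. Qed.

Lemma curve_circle (w : C) : rho * expR (complex.Re w) < r / 8 ->
  (S `\ 0) (axis (toC rho * cexp w)).
Proof.
move=> wr; split; first by apply: axis_curve_axis; rewrite nrm_circle.
by apply/eqP; apply: axis_neq0; rewrite ?circle_neq0// nrm_circle; exact: lt_trans wr r8r.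
Qed.

Lemma cexp_turnz (k : int) : cexp (toC (k%:~R : R) * turn R) = 1.
Proof. by have := cexp_2pik R k; rewrite toCM mulrA mulrC. Qed.

Lemma base_loop_circle t : rho * expR (complex.Re (toC t * turn R)) < r / 8.
Proof. by rewrite Re_turns expR0 mulr1. Qed.

Lemma base_is_loop : is_loop (S `\ 0) base_loop.
Proof.
split.
- apply: within_for => t _; apply: (@continuous_comp _ _ _ (fun t : R => toC t * turn R) (fun w => axis (toC rho * cexp w))).
    by apply: cvgMl; exact: toC_cont.
  by apply: circle_continuous; exact: lt_trans (base_loop_circle t) r8r.
- have := cexp_turnz 1; have := cexp_turnz 0; rewrite /base_loop.
  by move=> -> ->.
by move=> t _; apply: curve_circle; exact: base_loop_circle.
Qed.

(** The first coordinate of a loop of S \ 0 has a continuous logarithm, whose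
    increment is k turns. The segment that joins this logarithm to the linear path
    with the same ends is a homotopy; it stays in S because the modulus is an
    interpolation between that of the loop and rho. *)
Lemma base_generates : generating_loop (S `\ 0) base_loop.
Proof.
split; first exact: base_is_loop.
move=> d [dc d01 dS] d0; pose zeta t := Phi (d t) 0 ord0.
have inI (t : R) : (`[0, 1]%classic t) -> t \in `[0, 1] by rewrite /= => ?.
have z0I : (0 : R) \in `[0, 1] by rewrite in_itv /= lexx ler01.
have z1I : (1 : R) \in `[0, 1] by rewrite in_itv /= lexx ler01.
have dE t : t \in `[0, 1] -> d t = axis (zeta t) /\ nrm (zeta t) < r / 8.
  by move=> /dS[Sd _]; exact: axis_curveE.
have zn t : t \in `[0, 1] -> zeta t != 0.
  move=> tI; have [Sd dn] := dS t tI; have [e _] := dE t tI.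
  by apply/eqP => z; apply: dn; rewrite e z axis0.
have rN : toC rho != 0 :> C by rewrite -nrm_gt0 nrm_toC gtr0_norm.
have zc : {within `[0, 1], continuous (fun t => zeta t / toC rho)}.
  apply: (@within_comp _ _ _ _ d (fun x : E => Phi x 0 ord0 / toC rho)) => // t tI.
  apply: differentiable_continuous; apply: differentiableM; last exact: differentiable_cst.
  by apply: diff_entry; apply: Phi_diff; have [[[]]] := dS t (inI t tI).
have c0E : cexp (toC 0 * turn R) = 1 by have := cexp_turnz 0.
have zeta0 : zeta 0 = toC rho.
  rewrite /zeta d0 /base_loop c0E mulr1 Phi_axis ?cons_row0//.
  by rewrite nrm_toC gtr0_norm//; exact: lt_trans rho_r r8r.
have zeta1 : zeta 1 = toC rho by rewrite -zeta0 /zeta d01.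
have w0 : cexp (0 : C) = zeta 0 / toC rho by rewrite cexp0 zeta0 divff.
have zn' t : t \in `[0, 1] -> zeta t / toC rho != 0.
  by move=> tI; rewrite mulf_neq0 ?invr_eq0// zn.
have [th [thc th0 thE]] := path_log zc zn' w0.
have th1 : cexp (th 1) = 1 by rewrite thE// zeta1 divff.
have [k kE] := cexp_eq1 th1.
have {}kE : th 1 = toC k%:~R * turn R by rewrite kE toCM mulrA mulrC.
exists k.
(* from the logarithm of the loop at time 0 of the homotopy to k turns at
   constant speed at time 1 *)
pose I (p : R * R) : C := toC (1 - p.1) * th p.2 + toC (p.1 * (k%:~R * p.2)) * turn R.
pose H (p : R * R) : E := axis (toC rho * cexp (I p)).
have ReI s t : complex.Re (I (s, t)) = (1 - s) * complex.Re (th t).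
  by rewrite /I /= ReD Re_turns addr0 Re_mul /= mul0r subr0.
have Hr s t : s \in `[0, 1] -> t \in `[0, 1] -> rho * expR (complex.Re (I (s, t))) < r / 8.
  move=> sI tI; rewrite ReI; have [_ zt] := dE t tI.
  have e1 : rho * expR (complex.Re (th t)) < r / 8.
    by rewrite -nrm_circle thE// mulrC divfK.
  move: sI; rewrite in_itv /= => /andP[s0 s1].
  have [p|n] := leP 0 (complex.Re (th t)).
    apply: le_lt_trans e1; rewrite ler_wpM2l ?(ltW rho0)// ler_expR.
    by rewrite ler_piMl// lerBlDr lerDl.
  apply: le_lt_trans rho_r; rewrite ler_piMr ?(ltW rho0)// -[X in _ <= X]expR0 ler_expR.
  by rewrite mulr_ge0_le0 ?(ltW n)// subr_ge0.
exists H; split.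
- apply: (@within_comp _ _ _ _ I (fun w => axis (toC rho * cexp w))).
    have thc2 := within_square_snd thc; move/subspace_continuousP: thc2 => thc2.
    apply/subspace_continuousP => p Ap; apply: cvgD; apply: cvgM.
    + apply: cvg_within_filter.
      apply: (@continuous_comp _ _ _ (fun p : R * R => 1 - p.1) (@toC R)); last exact: toC_cont.
      by apply: cvgB; [exact: cvg_cst | exact: cvg_fst].
    + exact: thc2.
    + apply: cvg_within_filter.
      apply: (@continuous_comp _ _ _ (fun p : R * R => p.1 * (k%:~R * p.2)) (@toC R)); last exact: toC_cont.
      apply: cvgM; first exact: cvg_fst.
      by apply: cvgM; [exact: cvg_cst | exact: cvg_snd].
    + exact: cvg_cst.
  move=> [s t] [/= sI tI]; apply: circle_continuous; exact: lt_trans (Hr s t sI tI) r8r.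
- by move=> s t sI tI; apply: curve_circle; exact: Hr.
- move=> t tI; split.
    have e : I (0, t) = th t by rewrite /I /= subr0 mul0r (_ : toC 1 = 1)// (_ : toC 0 = 0)// mul1r mul0r addr0.
    by rewrite /H e thE// mulrC divfK//; rewrite -(dE t tI).1.
  have e : I (1, t) = toC (k%:~R * t) * turn R.
    by rewrite /I /= subrr mul1r (_ : toC 0 = 0)// mul0r add0r.
  rewrite /H e /loop_power /base_loop toCB mulrBl; congr (axis (_ * _)).
  set w := toC (k%:~R * t) * _; set f := Num.floor _.
  have E1 := cexp_turnz f; have : cexp (w - toC f%:~R * turn R) * cexp (toC f%:~R * turn R) = cexp w.
    by rewrite -cexpD subrK.
  by rewrite E1 mulr1 => ->.
move=> s sI; have dz := (dE 0 z0I).1; split.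
  have e : I (s, 0) = 0 by rewrite /I /= th0 !mulr0 (_ : toC 0 = 0)// mul0r add0r.
  by rewrite /H e cexp0 mulr1 dz zeta0.
have e : I (s, 1) = toC k%:~R * turn R.
  rewrite /I /= kE mulr1 mulrA -mulrDl -toCM -toCD; congr (toC _ * _); ring.
by rewrite /H e cexp_turnz mulr1 dz zeta0.
Qed.

End Loops.

(** * Flow, holonomy and integrals of the normal form *)

Section NormalForm.
Variables (R : realType) (m : nat).
Local Notation C := (Cx R).
Local Notation E := 'rV[C]_m.+1.
Variables (a : 'I_m.+1 -> C) (g : 'I_m.+1 -> E -> C) (r eta A del : R).

(** The field of the normal form divided by the factor of its component of index
    0. This changes the parametrization of the leaves only, and makes the flow act
    on the coordinate of index 0 by the exponential of time, since then a 0 = 1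
    and g 0 = 0. *)
Definition nfield (x : E) : E := \row_j (a j * x 0 j * (1 + g j x)).

Hypothesis r0 : 0 < r.
Hypothesis a0 : a ord0 = 1.
Hypothesis g0 : forall x, nrm x < r -> g ord0 x = 0.
Hypothesis g_diff : forall j x, nrm x < r -> differentiable (g j) x.
Hypothesis g_small : forall j x, nrm x < r -> nrm (g j x) <= eta.
Hypothesis eta1 : eta <= 1.
Hypothesis aA : forall j, 2 * nrm (a j) <= A.
Hypothesis del0 : 0 < del.
Hypothesis a_eta : forall j, nrm (a j) * eta <= del / 2.

Local Notation Y := nfield.
Local Notation cone := (cone a del).

(** The field is bounded on the ball of radius r; the Lipschitz
    estimate that follows from this bound only holds on an eighth of the radius. *)
Definition dom : set E := [set x | nrm x < r / 8].

Let A2 : 2 <= A.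
Proof. by have := aA ord0; rewrite a0 nrm1 mulr1. Qed.

Let A0 : 0 <= A. Proof. by have := A2; lra. Qed.

Lemma factor_bound j (x : E) : nrm x < r -> nrm (a j * (1 + g j x)) <= A.
Proof.
move=> xr; rewrite nrmM; apply: le_trans (aA j); rewrite mulrC.
rewrite ler_wpM2r ?nrm_ge0//; apply: le_trans (nrm_triD _ _) _; rewrite nrm1.
by have := g_small j xr; have := eta1; lra.
Qed.

Lemma nfieldE x j : nfield x 0 j = a j * x 0 j * (1 + g j x).
Proof. by rewrite mxE. Qed.

Lemma nfield_entry_bound j (x : E) : nrm x < r -> nrm (nfield x 0 j) <= A * r.
Proof.
move=> xr; rewrite nfieldE mulrAC nrmM; apply: ler_pM; rewrite ?nrm_ge0 ?factor_bound//.
exact: le_trans (nrm_coord _ _ _) (ltW xr).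
Qed.

Lemma nfield_entry_diff j (x : E) : nrm x < r -> differentiable (fun y => nfield y 0 j) x.
Proof.
move=> xr; have -> : (fun y : E => nfield y 0 j) = (fun y : E => a j * y 0 j) * (fun y : E => 1 + g j y).
  by apply/funext => y; rewrite nfieldE.
apply: differentiableM; first by apply: differentiableM => //; exact: differentiable_coord.
by apply: differentiableD => //; exact: g_diff.
Qed.

Lemma nfield_diff (x : E) : nrm x < r -> differentiable nfield x.
Proof. by move=> xr; apply: diff_row => j; exact: nfield_entry_diff. Qed.

Lemma nfield_lip (x y : E) : dom x -> dom y -> nrm (nfield x - nfield y) <= 8 * A * nrm (x - y).
Proof.
rewrite /dom /= => xr yr; apply: nrm_row_le => [|j]; first by rewrite !mulr_ge0 ?nrm_ge0.
have := @gateaux_lip R E (fun z => nfield z 0 j) (fun z v => 'd (fun z => nfield z 0 j) z v) 0 r (A * r) r0.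
have r0' := r0.
move=> /(_ _ _ y (x - y)) H; rewrite subrKC subr0 in H.
have -> : 8 * A = 8 * (A * r) / r by field; exact: lt0r_neq0.
rewrite !mxE -!nfieldE in H *; apply: H.
- by move=> z; rewrite subr0 => zr v; apply: diff_lder; exact: nfield_entry_diff.
- by move=> z; rewrite subr0; exact: nfield_entry_bound.
- lra.
- by apply: le_lt_trans (nrm_triB _ _) _; lra.
Qed.

Lemma dom_r (x : E) : dom x -> nrm x < r.
Proof. by rewrite /dom /=; have := r0; lra. Qed.

Lemma nfield_bound (x : E) : dom x -> nrm (nfield x) <= A * r.
Proof.
move=> /dom_r xr; apply: nrm_row_le => [|j]; last exact: nfield_entry_bound.
by rewrite mulr_ge0// ltW.
Qed.

Let L0 : 0 <= 8 * A. Proof. by rewrite mulr_ge0. Qed.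
Let B0 : 0 <= A * r. Proof. by rewrite mulr_ge0// ltW. Qed.
Let YD x : dom x -> differentiable nfield x. Proof. by move=> /dom_r; exact: nfield_diff. Qed.
Let PB x : dom x -> nrm x <= r. Proof. by move=> /dom_r/ltW. Qed.

Local Notation eul := (euler nfield).
Local Notation good := (euler_good nfield dom).
Local Notation phi := (flow nfield).

(** Each coordinate of a polygon is multiplied at each step by a factor close to
    1; all estimates of the flow come from bounds on this factor. *)
Lemma euler_entry (h : C) i (x : E) j : eul h i.+1 x 0 j =
  eul h i x 0 j * (1 + h * (a j * (1 + g j (eul h i x)))).
Proof. by rewrite eulerS mxE [X in _ + X]mxE nfieldE; ring. Qed.

Lemma euler_entry_le (h : C) i (x : E) j c :
  (forall k, (k < i)%N -> nrm (1 + h * (a j * (1 + g j (eul h k x)))) <= expR c) ->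
  nrm (eul h i x 0 j) <= nrm (x 0 j) * expR (c * i%:R).
Proof.
elim: i => [|i IH] H; first by rewrite mulr0 expR0 mulr1.
rewrite euler_entry nrmM expR_mulS [leRHS]mulrA; apply: ler_pM; rewrite ?nrm_ge0//.
  by apply: IH => k ki; apply: H; exact: ltnW.
exact: H.
Qed.

Lemma euler_entry_ge (h : C) i (x : E) j c :
  (forall k, (k < i)%N -> expR c <= nrm (1 + h * (a j * (1 + g j (eul h k x))))) ->
  nrm (x 0 j) * expR (c * i%:R) <= nrm (eul h i x 0 j).
Proof.
elim: i => [|i IH] H; first by rewrite mulr0 expR0 mulr1.
rewrite euler_entry nrmM expR_mulS [leLHS]mulrA; apply: ler_pM; rewrite ?mulr_ge0 ?nrm_ge0 ?expR_ge0//.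
  by apply: IH => k ki; apply: H; exact: ltnW.
exact: H.
Qed.

Lemma factor_le (h : C) (x : E) j : nrm x < r -> nrm (1 + h * (a j * (1 + g j x))) <= expR (A * nrm h).
Proof.
move=> xr; apply: le_trans (nrm_triD _ _) _; rewrite nrm1 nrmM.
apply: le_trans (expR_ge1Dx _); rewrite lerD2l mulrC ler_wpM2r ?nrm_ge0//.
exact: factor_bound.
Qed.

Lemma factor_ge (h : C) (x : E) j : nrm x < r -> A * nrm h <= 1 / 2 ->
  expR (- (2 * A * nrm h)) <= nrm (1 + h * (a j * (1 + g j x))).
Proof.
move=> xr hA; set z := h * _.
have zA : nrm z <= A * nrm h by rewrite /z nrmM mulrC ler_wpM2r ?nrm_ge0 ?factor_bound.
have z1 : 1 - nrm z <= nrm (1 + z) by have := nrm_subl (1 : C) (- z); rewrite opprK nrm1 nrmN.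
apply: le_trans z1; set u := A * nrm h in hA zA *.
have u0 : 0 <= u by rewrite mulr_ge0// nrm_ge0.
have E1 : 1 + 2 * u <= expR (2 * u) by exact: expR_ge1Dx.
have p0 : 0 < expR (2 * u) by exact: expR_gt0.
rewrite -mulrA -/u expRN; apply: (@le_trans _ _ (1 - u)); last by rewrite lerD2l lerN2.
rewrite -(ler_pM2r p0) mulVf ?gt_eqF//.
have : (1 - u) * (1 + 2 * u) <= (1 - u) * expR (2 * u) by rewrite ler_wpM2l//; lra.
have : 0 <= u * (1 - 2 * u) by rewrite mulr_ge0//; lra.
lra.
Qed.

(** For steps in the cone the linear part of the factor contracts at the rate del.
    Half of it is spent on the perturbation g and a quarter on the second order
    term, which needs small steps. *)
Lemma cone_factor (h : C) (x : E) j : nrm x < r -> j != ord0 ->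
  complex.Re (h * a j) <= - (del * nrm h) -> A ^+ 2 * nrm h <= del / 2 -> del * nrm h <= 1 ->
  nrm (1 + h * (a j * (1 + g j x))) <= expR (- (del / 4 * nrm h)).
Proof.
move=> xr j0 Hc HA Hd; set z := h * _; set u := nrm h in Hc HA Hd *.
have u0 : 0 <= u by exact: nrm_ge0.
have zA : nrm z <= A * u by rewrite /z nrmM mulrC ler_wpM2r ?nrm_ge0 ?factor_bound.
have Rz : complex.Re z <= - (del / 2 * u).
  have -> : z = h * a j + h * a j * g j x by rewrite /z; ring.
  rewrite ReD; have := nrm_Re (h * a j * g j x); rewrite !nrmM -/u => H1.
  have H2 := le_trans (ler_norm _) H1.
  have H3 : u * nrm (a j) * nrm (g j x) <= u * (del / 2).
    rewrite -mulrA ler_wpM2l//; apply: le_trans (a_eta j).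
    by rewrite ler_wpM2l ?nrm_ge0 ?g_small.
  lra.
apply: le_trans (expR_ge1Dx _); set w := del / 4 * u.
have w1 : 0 <= 1 + - w by rewrite /w; lra.
rewrite -ler_sqr ?nnegrE ?nrm_ge0//.
have -> : nrm (1 + z) ^+ 2 = 1 + 2 * complex.Re z + nrm z ^+ 2.
  rewrite !nrm_sqr ReD ImD /=; ring.
have H4 : nrm z ^+ 2 <= (A * u) ^+ 2 by apply: lerXn2r; rewrite ?nnegrE ?nrm_ge0 ?mulr_ge0.
have H5 : A ^+ 2 * u * u <= del / 2 * u by rewrite ler_wpM2r.
rewrite !expr2 in H4 H5 *; have := sqr_ge0 w; rewrite expr2 /w; lra.
Qed.

(** The bound by exp (A |nu|) is available a priori for the points of the polygon
    as long as they stay in the domain, and then keeps them there. *)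
Lemma good_small (nu : C) (x : E) : nrm x * expR (A * nrm nu) < r / 8 -> good 1 nu x.
Proof.
move=> Hx; split=> // N N0.
have NR : 0 < N%:R :> R by rewrite ltr0n.
have hE : nrm (nu / N%:R) = nrm nu / N%:R by rewrite nrmM nrmV nrm_nat.
move=> i; elim/ltn_ind: i => i IH iN; apply: le_lt_trans Hx.
have H j : nrm (eul (nu / N%:R) i x 0 j) <= nrm (x 0 j) * expR (A * nrm (nu / N%:R) * i%:R).
  by apply: euler_entry_le => k ki; apply: factor_le; apply: dom_r; apply: IH => //; exact: leq_trans (ltnW ki) iN.
apply: nrm_row_le => [|j]; first by rewrite mulr_ge0 ?nrm_ge0 ?expR_ge0.
apply: le_trans (H j) _; apply: ler_pM; rewrite ?nrm_ge0 ?expR_ge0 ?nrm_coord//.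
rewrite ler_expR hE -mulrA ler_wpM2l// -mulrA ler_piMr ?nrm_ge0// mulrC ler_pdivrMr// mul1r.
by rewrite ler_nat.
Qed.

(** Within the cone the transverse coordinates decrease, and the coordinate of
    index 0 has its largest modulus at the end of the trajectory. So long
    trajectories stay in the domain, although the exponential bound for arbitrary
    times is useless for them. The factor 2 absorbs the discretization error of
    the coordinate of index 0. *)
Lemma good_cone (Lam : R) : exists N0, forall (nu : C) (x : E), cone nu -> nrm nu <= Lam ->
  (forall j, j != ord0 -> nrm (x 0 j) < r / 8) ->
  2 * (nrm (x 0 ord0) * expR (complex.Re nu)) < r / 8 ->
  good N0 nu x /\ forall N, (N0 <= N)%N -> forall j, j != ord0 ->
    nrm (eul (nu / N%:R) N x 0 j) <= nrm (x 0 j) * expR (- (del / 4 * nrm nu)).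
Proof.
(* S is the sum of what the three smallness conditions C1, C2, C3 on the step
   require *)
have [k] := archimedes (1 + `|Lam| + Lam ^+ 2 + 2 * A ^+ 2 * `|Lam| / del + del * `|Lam|).
set S := 1 + _ + _ + _ + _ => Sk.
exists k.+1 => nu x [Rnu Hc] nL xj x0.
suff main N : (k.+1 <= N)%N -> euler_in nfield dom nu N x /\ forall j, j != ord0 ->
    nrm (eul (nu / N%:R) N x 0 j) <= nrm (x 0 j) * expR (- (del / 4 * nrm nu)).
  by split=> [|N /main[]//]; split=> // N /main[].
move=> kN; have NR : 0 < N%:R :> R by rewrite ltr0n (leq_trans _ kN).
have SN : S <= N%:R by apply: le_trans (ltW Sk) _; rewrite ler_nat.
have hE : nrm (nu / N%:R) = nrm nu / N%:R by rewrite nrmM nrmV nrm_nat.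
set h := nu / N%:R in hE *.
have n0 := nrm_ge0 nu; have L0' : 0 <= Lam by exact: le_trans nL.
have LamE : `|Lam| = Lam by rewrite ger0_norm.
have p1 : 0 <= Lam ^+ 2 by exact: sqr_ge0.
have p2 : 0 <= 2 * A ^+ 2 * Lam / del by rewrite divr_ge0 ?mulr_ge0 ?exprn_ge0// ltW.
have p3 : 0 <= del * Lam by rewrite mulr_ge0// ltW.
rewrite /S LamE in SN.
have C1 : A ^+ 2 * nrm h <= del / 2.
  rewrite hE mulrA ler_pdivrMr//; apply: (@le_trans _ _ (del / 2 * (2 * A ^+ 2 * Lam / del))).
    have -> : del / 2 * (2 * A ^+ 2 * Lam / del) = A ^+ 2 * Lam by field; exact: lt0r_neq0.
    by rewrite ler_wpM2l// sqr_ge0.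
  by rewrite ler_wpM2l ?divr_ge0 ?(ltW del0)//; lra.
have C2 : del * nrm h <= 1.
  rewrite hE mulrA ler_pdivrMr// mul1r; apply: (@le_trans _ _ (del * Lam)); last lra.
  by rewrite ler_wpM2l// ltW.
have C3 : nrm h ^+ 2 / 2 * N%:R <= 1 / 2.
  rewrite hE; have -> : (nrm nu / N%:R) ^+ 2 / 2 * N%:R = nrm nu ^+ 2 / N%:R / 2.
    by field; exact: lt0r_neq0.
  rewrite ler_pM2r// ler_pdivrMr// mul1r; apply: (@le_trans _ _ (Lam ^+ 2)); last lra.
  by apply: lerXn2r; rewrite ?nnegrE.
have ReV (z : C) : complex.Re (z / N%:R) = complex.Re z / N%:R by exact: Re_divn.
have Rh : complex.Re h = complex.Re nu / N%:R by exact: ReV.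
have Rh0 : 0 <= complex.Re h by rewrite Rh divr_ge0// ltW.
have Hj j : j != ord0 -> complex.Re (h * a j) <= - (del * nrm h).
  move=> j0; rewrite /h mulrAC ReV hE mulrA -mulNr ler_pM2r ?invr_gt0//.
  exact: ltW (Hc j j0).
have D i : (i <= N)%N -> dom (eul h i x).
  elim/ltn_ind: i => i IH iN.
  have inr k' : (k' < i)%N -> nrm (eul h k' x) < r.
    by move=> ki; apply: dom_r; apply: IH => //; exact: leq_trans (ltnW ki) iN.
  apply: nrm_row_lt => [|j]; first by have := r0; lra.
  have [->|j0] := eqVneq j ord0.
    have : nrm (eul h i x 0 ord0) <= nrm (x 0 ord0) * expR ((complex.Re h + nrm h ^+ 2 / 2) * i%:R).
      apply: euler_entry_le => k' /inr kr; rewrite a0 g0// addr0 mulr1 mulr1.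
      exact: factor0_le.
    move=> H; apply: le_lt_trans H _; apply: le_lt_trans x0; rewrite mulrCA ler_wpM2l ?nrm_ge0//.
    have : (complex.Re h + nrm h ^+ 2 / 2) * i%:R <= complex.Re nu + nrm h ^+ 2 / 2 * N%:R.
      have -> : complex.Re nu = complex.Re h * N%:R by rewrite Rh divfK// gt_eqF.
      rewrite -mulrDl ler_wpM2l ?addr_ge0 ?divr_ge0 ?exprn_ge0 ?nrm_ge0// ler_nat//.
    rewrite -ler_expR => /le_trans -> //; rewrite expRD mulrC ler_wpM2r ?expR_ge0//.
    exact: expR_half.
  apply: le_lt_trans (xj j j0).
  have : nrm (eul h i x 0 j) <= nrm (x 0 j) * expR (- (del / 4 * nrm h) * i%:R).
    by apply: euler_entry_le => k' /inr kr; apply: cone_factor => //; exact: Hj.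
  move=> /le_trans -> //; rewrite ler_piMr ?nrm_ge0// -expR0 ler_expR mulNr oppr_le0.
  by rewrite !mulr_ge0 ?nrm_ge0// ?(ltW del0).
split=> // j j0.
have : nrm (eul h N x 0 j) <= nrm (x 0 j) * expR (- (del / 4 * nrm h) * N%:R).
  apply: euler_entry_le => k' kN'; apply: cone_factor => //; last exact: Hj.
  by apply: dom_r; apply: D; exact: ltnW.
move=> /le_trans -> //; rewrite ler_wpM2l ?nrm_ge0// ler_expR hE.
by rewrite -[X in X <= _](_ : - (del / 4 * nrm nu) = _)//; field; exact: lt0r_neq0.
Qed.

Lemma flow_entry_le (nu : C) (x : E) N0 j c : good N0 nu x ->
  (forall N, (N0 <= N)%N -> nrm (eul (nu / N%:R) N x 0 j) <= c) -> nrm (phi nu x 0 j) <= c.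
Proof.
move=> Hg H; rewrite -subr_le0.
apply: (@small_of_rate R (2 * euler_rate (8 * A) (A * r) nu) _ N0) => N Np NN; rewrite lerBlDr.
have := flow_conv L0 B0 nfield_lip nfield_bound Hg NN; rewrite mulrA => H1.
have := nrm_coord (eul (nu / N%:R) N x - phi nu x) 0 j; rewrite !mxE => H2.
have := H N NN; have := nrm_subl (phi nu x 0 j) (eul (nu / N%:R) N x 0 j); rewrite nrmB.
by move: (le_trans H2 H1); lra.
Qed.

Lemma flow_entry_ge (nu : C) (x : E) N0 j c : good N0 nu x ->
  (forall N, (N0 <= N)%N -> c <= nrm (eul (nu / N%:R) N x 0 j)) -> c <= nrm (phi nu x 0 j).
Proof.
move=> Hg H; rewrite -subr_le0.
apply: (@small_of_rate R (2 * euler_rate (8 * A) (A * r) nu) _ N0) => N Np NN; rewrite lerBlDr.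
have := flow_conv L0 B0 nfield_lip nfield_bound Hg NN; rewrite mulrA => H1.
have := nrm_coord (eul (nu / N%:R) N x - phi nu x) 0 j; rewrite !mxE => H2.
have := H N NN; have := nrm_subl (eul (nu / N%:R) N x 0 j) (phi nu x 0 j).
by move: (le_trans H2 H1); lra.
Qed.

(** No coordinate shrinks faster than exponentially, so the flow maps cannot
    degenerate. *)
Lemma flow_lower (nu : C) (x : E) N0 j : good N0 nu x ->
  nrm (x 0 j) * expR (- (2 * A * nrm nu)) <= nrm (phi nu x 0 j).
Proof.
move=> Hg; have [k Hk] := archimedes (2 * A * nrm nu + 1).
have Hg' : good (maxn N0 k.+1) nu x.
  split=> [|N]; first by rewrite leq_max Hg.1.
  by rewrite geq_max => /andP[NN _]; exact: Hg.2.
apply: (flow_entry_ge Hg') => N; rewrite geq_max => /andP[NN kN].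
have NR : 0 < N%:R :> R by rewrite ltr0n (leq_trans _ kN).
have kNR : k.+1%:R <= N%:R :> R by rewrite ler_nat.
have hE : nrm (nu / N%:R) = nrm nu / N%:R by rewrite nrmM nrmV nrm_nat.
apply: (@le_trans _ _ (nrm (x 0 j) * expR (- (2 * A * nrm (nu / N%:R)) * N%:R))).
  rewrite hE (_ : - _ * N%:R = - (2 * A * nrm nu))//; field; exact: lt0r_neq0.
apply: euler_entry_ge => i iN; apply: factor_ge.
  by apply: dom_r; apply: (Hg.2 N NN); exact: ltnW.
rewrite hE mulrA ler_pdivrMr//; lra.
Qed.

Lemma flow_upper (nu : C) (x : E) N0 j : good N0 nu x ->
  nrm (phi nu x 0 j) <= nrm (x 0 j) * expR (A * nrm nu).
Proof.
move=> Hg; apply: (flow_entry_le Hg) => N NN.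
have N0' : (0 < N)%N by exact: leq_trans Hg.1 NN.
have NR : 0 < N%:R :> R by rewrite ltr0n.
have hE : nrm (nu / N%:R) = nrm nu / N%:R by rewrite nrmM nrmV nrm_nat.
have -> : A * nrm nu = A * nrm (nu / N%:R) * N%:R.
  by rewrite hE; field; exact: lt0r_neq0.
apply: euler_entry_le => i iN; apply: factor_le.
by apply: dom_r; apply: (Hg.2 N NN); exact: ltnW.
Qed.

Lemma flow_cone (Lam : R) : exists N0, forall (nu : C) (x : E), cone nu -> nrm nu <= Lam ->
  (forall j, j != ord0 -> nrm (x 0 j) < r / 8) ->
  2 * (nrm (x 0 ord0) * expR (complex.Re nu)) < r / 8 ->
  good N0 nu x /\ forall j, j != ord0 ->
    nrm (phi nu x 0 j) <= nrm (x 0 j) * expR (- (del / 4 * nrm nu)).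
Proof.
have [N0 H] := good_cone Lam; exists N0 => nu x nuc nL xj x0.
have [Hg Hj] := H nu x nuc nL xj x0; split=> // j j0.
by apply: (flow_entry_le Hg) => N NN; exact: Hj.
Qed.

(** This is the classical limit of (1 + nu / N)^N. *)
Lemma flow_first (nu : C) (x : E) N0 : good N0 nu x -> phi nu x 0 ord0 = x 0 ord0 * cexp nu.
Proof.
move=> Hg; apply/eqP; rewrite -subr_eq0 -nrm_eq0 eq_le nrm_ge0 andbT.
apply/ler_addgt0Pr => e e0; rewrite add0r.
have K0 : 0 <= euler_rate (8 * A) (A * r) nu by exact: euler_rate_ge0.
pose S := 1 + nrm (x 0 ord0) * nrm nu * expR (nrm nu).
have S0 : 0 < S by rewrite ltr_wpDr// !mulr_ge0 ?nrm_ge0 ?expR_ge0.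
have e2 : 0 < e / 2 by rewrite divr_gt0.
have [d d0 Hd] := cexp_der0 (divr_gt0 e2 S0).
pose T := nrm nu / d + 2 * (2 * euler_rate (8 * A) (A * r) nu) / e.
have [k Hk] := archimedes (T + 1).
set N := maxn N0 k.+1; have NN : (N0 <= N)%N by exact: leq_maxl.
have NR : 0 < N%:R :> R by rewrite ltr0n (leq_trans _ (leq_maxr _ _)).
have kN : k.+1%:R <= N%:R :> R by rewrite ler_nat leq_maxr.
have hE : nrm (nu / N%:R) = nrm nu / N%:R by rewrite nrmM nrmV nrm_nat.
have T1 : nrm nu / d <= T.
  by rewrite /T lerDl; apply: divr_ge0; [| exact: ltW]; apply: mulr_ge0 => //; exact: mulr_ge0.
have T2 : 2 * (2 * euler_rate (8 * A) (A * r) nu) / e <= T.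
  by rewrite /T lerDr; apply: divr_ge0; [exact: nrm_ge0 | exact: ltW].
have hd : nrm (nu / N%:R) < d.
  rewrite hE ltr_pdivrMr// mulrC -ltr_pdivrMr//; lra.
have EN i : (i <= N)%N -> eul (nu / N%:R) i x 0 ord0 = x 0 ord0 * (1 + nu / N%:R) ^+ i.
  elim: i => [|i IH] iN; first by rewrite expr0 mulr1.
  rewrite euler_entry IH; last exact: ltnW.
  rewrite a0 g0 ?addr0 ?mulr1 ?exprSr ?mulrA//.
  by apply: dom_r; apply: (Hg.2 N NN); exact: ltnW.
have H1 := flow_conv L0 B0 nfield_lip nfield_bound Hg NN.
have H2 := nrm_coord (eul (nu / N%:R) N x - phi nu x) 0 ord0; rewrite !mxE (EN N (leqnn N)) in H2.
have H3 : nrm (cexp (nu / N%:R) ^+ N - (1 + nu / N%:R) ^+ N) <=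
    N%:R * (e / 2 / S * nrm (nu / N%:R)) * expR (nrm (nu / N%:R)) ^+ N.
  have c1 : 1 <= expR (nrm (nu / N%:R)) by rewrite -expR0 ler_expR nrm_ge0.
  have b1 : nrm (cexp (nu / N%:R)) <= expR (nrm (nu / N%:R)).
    by rewrite nrm_cexp ler_expR; exact: le_trans (ler_norm _) (nrm_Re _).
  have b2 : nrm (1 + nu / N%:R) <= expR (nrm (nu / N%:R)).
    by apply: le_trans (nrm_triD _ _) _; rewrite nrm1; exact: expR_ge1Dx.
  apply: le_trans (pow_diff N c1 b1 b2) _; rewrite ler_wpM2r ?exprn_ge0 ?expR_ge0//.
  rewrite ler_wpM2l//; have := Hd _ hd; by rewrite -addrA -opprD.
have eX : expR (nrm (nu / N%:R)) ^+ N = expR (nrm nu).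
  by rewrite -expRM_natl hE mulrC divfK// gt_eqF.
have cX : cexp (nu / N%:R) ^+ N = cexp nu.
  rewrite -cexpX mulrC divfK// pnatr_eq0 -lt0n; exact: leq_trans (leq_maxr N0 k.+1).
rewrite eX cX hE in H3.
have -> : phi nu x 0 ord0 - x 0 ord0 * cexp nu =
  - (x 0 ord0 * (1 + nu / N%:R) ^+ N - phi nu x 0 ord0) - x 0 ord0 * (cexp nu - (1 + nu / N%:R) ^+ N) by ring.
apply: le_trans (nrm_triB _ _) _; rewrite nrmN nrmM.
have H4 : nrm (x 0 ord0 * (1 + nu / N%:R) ^+ N - phi nu x 0 ord0) <= e / 2.
  apply: le_trans (le_trans H2 H1) _; rewrite mulrA ler_pdivrMr//.
  have : 2 * (2 * euler_rate (8 * A) (A * r) nu) / e <= N%:R by lra.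
  rewrite ler_pdivrMr//; lra.
have H5 : nrm (x 0 ord0) * nrm (cexp nu - (1 + nu / N%:R) ^+ N) <= e / 2.
  apply: le_trans (ler_wpM2l (nrm_ge0 _) H3) _.
  have -> : nrm (x 0 ord0) * (N%:R * (e / 2 / S * (nrm nu / N%:R)) * expR (nrm nu)) =
     e / 2 / S * (nrm (x 0 ord0) * nrm nu * expR (nrm nu)).
    by field; rewrite (gt_eqF S0) (gt_eqF NR).
  rewrite -mulrA ler_piMr ?(ltW e2)// ler_pdivrMl// mulr1 /S lerDr//.
lra.
Qed.

Variable rho : R.
Hypothesis rho0 : 0 < rho.
Hypothesis rho_small : rho * expR (A * (4 * pi)) < r / 8.
Local Notation ok := (flow_ok nfield dom).

Lemma small_good (nu : C) (x : E) : nrm x <= rho -> nrm nu <= 4 * pi -> good 1 nu x.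
Proof.
move=> xr nW; apply: good_small => //.
apply: le_lt_trans rho_small; apply: ler_pM; rewrite ?nrm_ge0 ?expR_ge0//.
by rewrite ler_expR ler_wpM2l.
Qed.

Lemma small_ok (nu : C) (x : E) : nrm x <= rho -> nrm nu < 4 * pi -> ok x nu.
Proof.
move=> xr nW; exists (4 * pi - nrm nu), 1%N; rewrite subr_gt0; split=> // s sn.
apply: small_good => //; have := nrm_subl s nu; lra.
Qed.

Lemma small_dom (nu : C) (x : E) : nrm x <= rho -> nrm nu <= 4 * pi -> dom (phi nu x).
Proof.
move=> xr nW; apply: nrm_row_lt => [|j]; first by have := r0; lra.
apply: le_lt_trans (flow_upper j (small_good xr nW)) _.
apply: le_lt_trans rho_small; apply: ler_pM; rewrite ?nrm_ge0 ?expR_ge0//.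
  exact: le_trans (nrm_coord _ _ _) xr.
by rewrite ler_expR ler_wpM2l.
Qed.

Lemma small_semigroup (nu1 nu2 : C) (x : E) : nrm x <= rho -> nrm nu1 < 4 * pi ->
  nrm (nu1 + nu2) < 4 * pi -> nrm nu2 <= 4 * pi -> nrm (phi nu1 x) <= rho ->
  phi nu2 (phi nu1 x) = phi (nu1 + nu2) x.
Proof.
move=> xr n1 n12 n2 pr; apply: (flow_semigroup L0 B0 nfield_lip nfield_bound YD PB (N0 := 1)); last exact: small_good.
move=> t t0 t1; have nt : nrm (nu1 + toC t *: nu2) < 4 * pi.
  have -> : nu1 + toC t *: nu2 = toC (1 - t) * nu1 + toC t * (nu1 + nu2).
    by rewrite scaleC toCB (_ : toC 1 = 1)//; ring.
  apply: le_lt_trans (nrm_triD _ _) _; rewrite !nrmM !nrm_toC !ger0_norm ?subr_ge0//.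
  have [->|tn] := eqVneq t 0; first by rewrite subr0 mul0r mul1r addr0.
  have tp : 0 < t by rewrite lt_neqAle eq_sym tn.
  have : t * nrm (nu1 + nu2) < t * (4 * pi) by rewrite ltr_pM2l.
  have : (1 - t) * nrm nu1 <= (1 - t) * (4 * pi) by rewrite ler_wpM2l ?subr_ge0// ltW.
  lra.
by split; [exact: small_ok | apply: small_dom => //; exact: ltW].
Qed.

(** For nu a multiple of 2 pi i this is a return map to the section x_0 = rho. *)
Definition hol_of (nu : C) (z : 'rV[C]_m) : 'rV[C]_m := rest (phi nu (cons_row (toC rho) z)).

Lemma nrm_rho : nrm (toC rho) = rho. Proof. by rewrite nrm_toC gtr0_norm. Qed.

Lemma cons_row_small (z : 'rV[C]_m) : nrm z <= rho -> nrm (cons_row (toC rho) z) <= rho.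
Proof. by move=> zr; apply: nrm_cons_row_le; rewrite ?nrm_rho. Qed.

Lemma hol_flow nu (z : 'rV[C]_m) : nrm z <= rho -> nrm nu <= 4 * pi -> cexp nu = 1 ->
  phi nu (cons_row (toC rho) z) = cons_row (toC rho) (hol_of nu z).
Proof.
move=> /cons_row_small zr nW n1; have Hg := small_good zr nW.
by apply: rowE0; rewrite ?rest_cons_row// (flow_first Hg) n1 mulr1 !cons_row0.
Qed.

Lemma hol_diff nu (z : 'rV[C]_m) : nrm nu <= 4 * pi -> nrm z < rho -> differentiable (hol_of nu) z.
Proof.
move=> nW zr; apply: diff_rest.
apply: (flow_holo L0 B0 nfield_lip nfield_bound YD PB (nu := fun=> nu) (z0 := 0) (r := rho) (A := 4 * pi) (N0 := 1) rho0); last by rewrite subr0.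
move=> w; rewrite subr0 => wr; split=> //.
  apply: diff_cons_row; first exact: differentiable_cst.
  exact: ex_diff.
by apply: small_good => //; apply: cons_row_small; exact: ltW.
Qed.

Lemma hol_entry nu (z : 'rV[C]_m) k : nrm nu <= 4 * pi -> nrm z <= rho ->
  nrm (hol_of nu z 0 k) <= nrm (z 0 k) * expR (A * nrm nu).
Proof.
move=> nW /cons_row_small zr; rewrite restE; apply: le_trans (flow_upper _ (small_good zr nW)) _.
by rewrite cons_rowS.
Qed.

Lemma hol_growth nu (z : 'rV[C]_m) : nrm nu <= 4 * pi -> nrm z <= rho ->
  nrm (hol_of nu z) <= nrm z * expR (A * nrm nu).
Proof.
move=> nW zr; apply: nrm_row_le => [|k]; first by rewrite mulr_ge0 ?nrm_ge0 ?expR_ge0.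
by apply: le_trans (hol_entry k nW zr) _; rewrite ler_wpM2r ?expR_ge0 ?nrm_coord.
Qed.

Lemma hol_axis nu (z : 'rV[C]_m) k : nrm nu <= 4 * pi -> nrm z <= rho -> z 0 k = 0 -> hol_of nu z 0 k = 0.
Proof.
move=> nW zr zk; have := hol_entry k nW zr; rewrite zk nrm0 mul0r => H.
by apply/eqP; rewrite -nrm_eq0 eq_le H nrm_ge0.
Qed.

Lemma hol_of0 nu : nrm nu <= 4 * pi -> hol_of nu 0 = 0.
Proof.
by move=> nW; apply/rowP => k; rewrite hol_axis ?mxE ?nrm0 ?(ltW rho0).
Qed.

(** The semigroup property: turning back undoes the turn, as long as the first
    return stays in the section. *)
Lemma hol_inverse nu (z : 'rV[C]_m) : nrm nu <= 2 * pi -> cexp nu = 1 -> nrm z * expR (A * nrm nu) <= rho ->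
  hol_of (- nu) (hol_of nu z) = z.
Proof.
move=> n2 n1 zr; have p0 := @pi_gt0 R.
have z1 : nrm z <= rho.
  apply: le_trans zr; rewrite -[leLHS]mulr1 ler_wpM2l ?nrm_ge0// -expR0 ler_expR.
  by rewrite mulr_ge0 ?nrm_ge0.
have n4 : nrm nu <= 4 * pi by lra.
have n4' : nrm nu < 4 * pi by lra.
rewrite {1}/hol_of -hol_flow// small_semigroup ?subrr ?nrm0 ?nrmN//.
- by rewrite (flow0 L0 B0 nfield_lip nfield_bound (N0 := 1)) ?rest_cons_row//; apply: small_good; rewrite ?nrm0 ?cons_row_small// ltW ?pi4_gt0.
- exact: cons_row_small.
- exact: pi4_gt0.
by rewrite hol_flow//; apply: cons_row_small; exact: le_trans (hol_growth n4 z1) zr.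
Qed.

Local Notation hol := (hol_of (turn R)).

Section FirstIntegrals.
Variables (d : R).
Hypothesis d0 : 0 < d.
Hypothesis d_rho : d <= rho.

(** Points with small transverse coordinates and times that may be applied to
    them: trajectories in the cone that do not go far beyond the section
    x_0 = rho. A time is valid when it leads exactly to the section. *)
Definition tame (x : E) := forall j, j != ord0 -> nrm (x 0 j) < d.
Definition adm (nu : C) (x : E) :=
  cone nu /\ 2 * (nrm (x 0 ord0) * expR (complex.Re nu)) < r / 8.
Definition valid (nu : C) (x : E) := cone nu /\ x 0 ord0 * cexp nu = toC rho.

Lemma rho_r : 2 * rho < r / 8.
Proof.
apply: le_lt_trans rho_small; rewrite mulrC ler_wpM2l ?(ltW rho0)//.
apply: le_trans (expR_ge1Dx _); have : 2 * 8 <= A * (4 * pi).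
  by apply: ler_pM => //; have := @pi_ge2 R; lra.
lra.
Qed.

Lemma tame_r (x : E) : tame x -> forall j, j != ord0 -> nrm (x 0 j) < r / 8.
Proof.
move=> tx j j0; have := tx j j0; have := rho_r; have := rho0; have := d_rho; lra.
Qed.

Lemma tame_rest (x : E) : tame x -> nrm (rest x) < d.
Proof. by move=> tx; apply: nrm_row_lt => // k; rewrite restE; exact: tx. Qed.

Lemma tame_ball (x : E) : nrm x < d -> tame x.
Proof. by move=> xd j _; exact: le_lt_trans (nrm_coord _ _ _) xd. Qed.

Lemma adm_good (Lam : R) : exists N0, forall nu (x : E), tame x -> adm nu x -> nrm nu <= Lam ->
  good N0 nu x /\ forall j, j != ord0 ->
    nrm (phi nu x 0 j) <= nrm (x 0 j) * expR (- (del / 4 * nrm nu)).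
Proof.
have [N0 H] := flow_cone Lam; exists N0 => nu x tx [cn xn] nL.
by apply: H => //; exact: tame_r.
Qed.

Lemma adm_open nu (x : E) : adm nu x -> exists2 e : R, 0 < e & forall nu', nrm (nu' - nu) < e -> adm nu' x.
Proof.
move=> [cn xn]; have [e e0 He] := cone_open del0 cn.
have n0 := nrm_ge0 (x 0 ord0).
have k0 : 0 < (r / 8 - 2 * (nrm (x 0 ord0) * expR (complex.Re nu))) / (2 * (nrm (x 0 ord0) + 1)).
  by rewrite divr_gt0 ?subr_gt0// mulr_gt0// ltr_wpDl.
have k1 := divr_gt0 k0 (ltr0Sn R 1).
have [d1 d10 H1] := realder_cont (is_derive_expR (complex.Re nu)) k1.
exists (Num.min e d1) => [|nu']; first by rewrite lt_min e0.
rewrite lt_min => /andP[ne nd]; split; first exact: He.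
have := H1 (complex.Re nu' - complex.Re nu); rewrite subrKC => H2.
have nR : `|complex.Re nu' - complex.Re nu| < d1.
  by apply: le_lt_trans nd; rewrite -ReN -ReD; exact: nrm_Re.
have {}H2 := H2 nR.
have {}H2 := le_trans (ler_norm _) H2.
set K := (_ / _) in k0 k1 H2.
have H3 : nrm (x 0 ord0) * (expR (complex.Re nu') - expR (complex.Re nu)) <= nrm (x 0 ord0) * (K / 2).
  by rewrite ler_wpM2l.
have H4 : (r / 8 - 2 * (nrm (x 0 ord0) * expR (complex.Re nu))) = K * (2 * (nrm (x 0 ord0) + 1)).
  by rewrite /K divfK// mulf_neq0 ?gt_eqF// ltr_wpDl.
have H5 : 0 <= nrm (x 0 ord0) * K by rewrite mulr_ge0// ltW.
lra.
Qed.

Lemma adm_ok nu (x : E) : tame x -> adm nu x -> ok x nu.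
Proof.
move=> tx /adm_open[e e0 He]; have [N0 H] := adm_good (nrm nu + e).
exists e, N0; split=> // s sn; apply: (H s x tx (He s sn) _).1.
have := nrm_subl s nu; lra.
Qed.

Lemma adm_bound nu (x : E) : tame x -> adm nu x ->
  (forall j, j != ord0 -> nrm (phi nu x 0 j) <= nrm (x 0 j) * expR (- (del / 4 * nrm nu))) /\
  phi nu x 0 ord0 = x 0 ord0 * cexp nu.
Proof.
move=> tx an; have [N0 H] := adm_good (nrm nu); have [Hg Hb] := H nu x tx an (lexx _).
by split=> //; exact: flow_first Hg.
Qed.

Lemma adm_tame nu (x : E) : tame x -> adm nu x -> tame (phi nu x).
Proof.
move=> tx an j j0; apply: le_lt_trans ((adm_bound tx an).1 j j0) (le_lt_trans _ (tx j j0)).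
rewrite ler_piMr ?nrm_ge0// -expR0 ler_expR oppr_le0 mulr_ge0 ?nrm_ge0//.
by rewrite divr_ge0// ltW.
Qed.

Lemma adm_dom nu (x : E) : tame x -> adm nu x -> dom (phi nu x).
Proof.
move=> tx an; apply: nrm_row_lt => [|j]; first by have := r0; lra.
have [->|j0] := eqVneq j ord0; last exact: tame_r (adm_tame tx an) j j0.
rewrite (adm_bound tx an).2 nrmM nrm_cexp; have := an.2.
have : 0 <= nrm (x 0 ord0) * expR (complex.Re nu) by rewrite mulr_ge0 ?nrm_ge0 ?expR_ge0.
lra.
Qed.

(** The times along the segment from nu1 to nu1 + nu2 must be admissible, which is
    where the convexity of the cone enters. *)
Lemma adm_semigroup nu1 nu2 (x : E) N0 : tame x ->
  (forall t : R, 0 <= t -> t <= 1 -> adm (nu1 + toC t * nu2) x) -> good N0 nu2 (phi nu1 x) ->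
  phi nu2 (phi nu1 x) = phi (nu1 + nu2) x.
Proof.
move=> tx H Hg; apply: (flow_semigroup L0 B0 nfield_lip nfield_bound YD PB _ Hg) => t t0 t1; rewrite scaleC.
by have := H t t0 t1 => h; split; [exact: adm_ok | exact: adm_dom].
Qed.

Lemma valid_mod nu (x : E) : valid nu x -> nrm (x 0 ord0) * expR (complex.Re nu) = rho.
Proof. by move=> [_ H]; rewrite -nrm_cexp -nrmM H nrm_rho. Qed.

Lemma valid_adm nu (x : E) : valid nu x -> adm nu x.
Proof. by move=> vn; split; [exact: vn.1 | rewrite (valid_mod vn); exact: rho_r]. Qed.

Lemma valid_neq0 nu (x : E) : valid nu x -> x 0 ord0 != 0.
Proof.
move=> vn; apply/eqP => x0; have := valid_mod vn; rewrite x0 nrm0 mul0r => e.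
by have := rho0; rewrite -e ltxx.
Qed.

Lemma valid_flow nu (x : E) : tame x -> valid nu x ->
  phi nu x = cons_row (toC rho) (rest (phi nu x)).
Proof.
move=> tx vn; rewrite -[LHS]cons_row_rest (adm_bound tx (valid_adm vn)).2.
by rewrite vn.2.
Qed.

Lemma Re_turn : complex.Re (turn R) = 0. Proof. exact: Re_iC. Qed.

(** Arriving one turn later changes the point of arrival by the holonomy. *)
Lemma valid_step nu (x : E) : tame x -> valid nu x -> cone (nu + turn R) ->
  rest (phi (nu + turn R) x) = hol (rest (phi nu x)).
Proof.
move=> tx vn cn; rewrite /hol_of -(valid_flow tx vn).
have p0 := @pi_gt0 R.
rewrite (@adm_semigroup nu (turn R) x 1)//.
  move=> t t0 t1; split.
    have -> : nu + toC t * turn R = nu + toC t * (nu + turn R - nu) by rewrite addrAC subrr add0r.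
    exact: cone_convex vn.1 cn t0 t1.
  by rewrite ReD Re_toCM Re_turn mulr0 addr0; exact: (valid_adm vn).2.
rewrite (valid_flow tx vn); apply: small_good; last by rewrite nrm_turn; lra.
apply: cons_row_small => //; apply: le_trans (ltW (tame_rest _)) d_rho.
exact: adm_tame (valid_adm vn).
Qed.

Lemma cone_between nu n i : cone nu -> cone (nu + n%:R * turn R) -> (i <= n)%N ->
  cone (nu + i%:R * turn R).
Proof.
move=> cn cn' iN; case: n cn' iN => [|n] cn' iN; first by move: iN cn'; rewrite leqn0 => /eqP->.
have nR : 0 < n.+1%:R :> R by rewrite ltr0n.
have -> : nu + i%:R * turn R = nu + toC (i%:R / n.+1%:R) * (nu + n.+1%:R * turn R - nu).
  rewrite addrAC subrr add0r mulrA; congr (_ + _ * _).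
  by rewrite -(toC_nat R n.+1) -toCM divfK ?gt_eqF// toC_nat.
apply: (cone_convex del0 cn cn'); first by apply: divr_ge0; [exact: ler0n | exact: ltW].
by rewrite ler_pdivrMr// mul1r ler_nat.
Qed.

Variable G : 'rV[C]_m -> C.
Hypothesis G_hol : forall z, nrm z < d -> G (hol z) = G z.

Lemma cexp_turn n : cexp (n%:R * turn R) = 1 :> C.
Proof. by rewrite cexpX cexp_2pi expr1n. Qed.

Lemma valid_turns nu n (x : E) : tame x -> valid nu x -> cone (nu + n%:R * turn R) ->
  G (rest (phi (nu + n%:R * turn R) x)) = G (rest (phi nu x)).
Proof.
move=> tx vn cn; suff : forall i, (i <= n)%N -> G (rest (phi (nu + i%:R * turn R) x)) = G (rest (phi nu x)).
  by move=> H; exact: (H n (leqnn n)).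
elim=> [|i IH] iN; first by have -> : nu + 0%:R * turn R = nu by rewrite mul0r addr0.
have ci := cone_between vn.1 cn (ltnW iN); have ci' := cone_between vn.1 cn iN.
have vi : valid (nu + i%:R * turn R) x.
  split; first exact: ci.
  rewrite cexpD cexp_turn mulr1; exact: vn.2.
have e : nu + i.+1%:R * turn R = nu + i%:R * turn R + turn R by rewrite -natr1; ring.
have ci2 : cone (nu + i%:R * turn R + turn R) := eq_rect _ cone ci' _ e.
apply: (etrans (congr1 (fun s => G (rest (phi s x))) e)).
apply: (etrans (congr1 G (valid_step tx vi ci2))).
apply: etrans (IH (ltnW iN)); apply: G_hol.
apply: tame_rest; exact: adm_tame tx (valid_adm vi).
Qed.

Lemma whole_turns (s s' : C) : cexp (s' - s) = 1 ->
  exists n, s' = s + n%:R * turn R \/ s = s' + n%:R * turn R.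
Proof.
move=> /cexp_eq1[k kE].
have E : Ci R * toC (pi *+ 2 * k%:~R) = toC k%:~R * turn R by rewrite /turn toCM; ring.
rewrite {}E in kE; case: k kE => n nE; [exists n; left | exists n.+1; right].
  have e : toC (n%:~R : R) = n%:R := toC_nat R n.
  by rewrite -e -nE subrKC.
have e : toC ((Negz n)%:~R : R) = - n.+1%:R.
  by rewrite NegzE mulrNz toCN; congr (- _); exact: toC_nat.
by rewrite e mulNr in nE; rewrite -[n.+1%:R * _]opprK -nE opprB subrKC.
Qed.

(** Two valid times differ by whole turns, because the coordinate of index 0 is
    multiplied by the exponential. The intermediate times are valid by convexity
    of the cone, and G is invariant under the holonomy. *)
Lemma valid_indep nu nu' (x : E) : tame x -> valid nu x -> valid nu' x ->
  G (rest (phi nu x)) = G (rest (phi nu' x)).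
Proof.
move=> tx vn vn'; have x0 := valid_neq0 vn.
have e : cexp (nu' - nu) = 1.
  apply: (mulIf (cexp_neq0 nu)); rewrite -cexpD subrK mul1r.
  by apply: (mulfI x0); rewrite vn.2 vn'.2.
have [n [E|E]] := whole_turns e.
  have c : cone (nu + n%:R * turn R) := eq_rect _ cone vn'.1 _ E.
  apply: esym; apply: (etrans (congr1 (fun s => G (rest (phi s x))) E)); exact: (valid_turns tx vn c).
have c : cone (nu' + n%:R * turn R) := eq_rect _ cone vn.1 _ E.
apply: (etrans (congr1 (fun s => G (rest (phi s x))) E)); exact: (valid_turns tx vn' c).
Qed.

(** Follow the flow to the section x_0 = rho, and evaluate G there. The
    hyperplane x_0 = 0 is never led to the section. *)
Definition integral_of (x : E) : C :=
  if x 0 ord0 == 0 then 0 else get [set v | exists nu, valid nu x /\ v = G (rest (phi nu x))].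

Local Notation FI := integral_of.

Lemma integral_valid nu (x : E) : tame x -> valid nu x -> FI x = G (rest (phi nu x)).
Proof.
move=> tx vn; rewrite /integral_of (negbTE (valid_neq0 vn)).
have ex : exists v, [set v | exists nu, valid nu x /\ v = G (rest (phi nu x))] v.
  by exists (G (rest (phi nu x))), nu; split.
have [nu' [vn' E]] := getPex ex; apply: (etrans E); exact: valid_indep tx vn' vn.
Qed.

Variable nu0 : C.
Hypothesis nu0_Re : 0 < complex.Re nu0.
Hypothesis nu0_cone : forall j, j != ord0 -> complex.Re (nu0 * a j) <= - (2 * del * nrm nu0).

(** How small x_0 must be for the cone to contain a valid time; see
    [valid_ex]. *)
Definition reach : R := rho * expR (- (3 * pi * (A + del) / del)).

Lemma reach_gt0 : 0 < reach. Proof. by rewrite mulr_gt0 ?expR_gt0. Qed.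

(** Logarithms of rho / x_0 form a translate of 2 pi i Z, so one of them lies at a
    bounded distance, here 3 pi, of the ray directed by nu0. The ray is interior
    to the cone, with twice the opening margin, so far enough from 0 the cone
    contains the ball of this radius around its points; and log (rho / |x_0|)
    is large when x_0 is small. *)
Lemma valid_ex (x : E) : x 0 ord0 != 0 -> nrm (x 0 ord0) < reach -> exists nu, valid nu x.
Proof.
move=> x0 xr; have n0 : 0 < nrm (x 0 ord0) by rewrite nrm_gt0.
pose c := ln (rho / nrm (x 0 ord0)).
have ec : expR c = rho / nrm (x 0 ord0) by rewrite lnK// posrE divr_gt0.
have cL : 3 * pi * (A + del) / del < c.
  rewrite -ltr_expR ec ltr_pdivlMr// mulrC -ltr_pdivlMr ?expR_gt0// -expRN; exact: xr.
pose t := c / complex.Re nu0.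
have L0' : 0 <= 3 * pi * (A + del) / del.
  by rewrite divr_ge0 ?(ltW del0)// mulr_ge0 ?addr_ge0 ?(ltW del0)// mulr_ge0 ?pi_ge0.
have c0 : 0 < c by exact: le_lt_trans cL.
have t0 : 0 < t by rewrite divr_gt0.
have tc : t * complex.Re nu0 = c by rewrite /t divfK ?gt_eqF.
have zN : toC rho / x 0 ord0 * cexp (- (toC t * nu0)) != 0.
  apply: mulf_neq0; last exact: cexp_neq0.
  by apply: mulf_neq0; rewrite ?invr_eq0// -nrm_gt0 nrm_rho.
have [w [wE wpi]] := log_ex zN.
have Rw : complex.Re w = 0.
  apply: expR_inj; rewrite expR0 -nrm_cexp wE (nrmM _ (cexp _)) nrm_cexp (nrmM (toC rho)) nrmV nrm_rho ReN Re_toCM tc expRN ec.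
  by field; rewrite (gt_eqF n0) (gt_eqF rho0).
have nw : nrm w <= 3 * pi.
  by apply: le_trans (nrm_le_ReIm w) _; rewrite Rw normr0 add0r.
exists (toC t * nu0 + w); split; last first.
  have k1 : cexp (toC t * nu0) * cexp (- (toC t * nu0)) = 1 by rewrite -cexpD subrr cexp0.
  rewrite cexpD wE.
  by rewrite -[RHS]mulr1 -k1; field; exact: x0.
split=> [|j j0]; first by rewrite ReD Rw addr0 Re_toCM tc.
rewrite mulrDl ReD -mulrA Re_toCM.
have H1 := le_trans (ler_norm _) (nrm_Re (w * a j)); rewrite nrmM in H1.
have aj : nrm (a j) <= A by have := aA j; have := nrm_ge0 (a j); lra.
have H2 : nrm w * nrm (a j) <= 3 * pi * A by apply: ler_pM; rewrite ?nrm_ge0.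
have H3 : t * complex.Re (nu0 * a j) <= t * - (2 * del * nrm nu0).
  by rewrite ler_wpM2l ?(ltW t0)// nu0_cone.
have H4 : del * nrm (toC t * nu0 + w) <= del * (t * nrm nu0 + 3 * pi).
  rewrite ler_wpM2l ?(ltW del0)//; apply: le_trans (nrm_triD _ _) _.
  by rewrite nrmM nrm_toC (gtr0_norm t0) lerD2l.
have H5 : c <= t * nrm nu0.
  by rewrite -tc ler_wpM2l ?(ltW t0)//; exact: le_trans (ler_norm _) (nrm_Re _).
have H6 : 3 * pi * (A + del) < del * (t * nrm nu0).
  by have := lt_le_trans cL H5; rewrite ltr_pdivrMr// (mulrC _ del).
move: H1 H2 H3 H4 H6; lra.
Qed.

Variables (M : nat) (KG : R).
Hypothesis KG0 : 0 <= KG.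
Hypothesis M_large : 2 <= M%:R * (del / 4).
Hypothesis G_diff : forall z, nrm z < d -> differentiable G z.
Hypothesis G_bound : forall z, nrm z < d -> nrm (G z) <= KG * nrm z ^+ M.

(** The transverse coordinates contract by exp (- del / 4 |nu|) while x_0 expands
    by exp (Re nu) to rho. A zero of G of high order M turns the contraction into
    a power of |x_0| at least two. *)
Lemma integral_bound nu (x : E) : tame x -> valid nu x ->
  nrm (FI x) <= KG * d ^+ M / rho ^+ 2 * nrm (x 0 ord0) ^+ 2.
Proof.
move=> tx vn; have an := valid_adm vn; have vm := valid_mod vn.
rewrite (integral_valid tx vn); apply: le_trans (G_bound (tame_rest (adm_tame tx an))) _.
rewrite -!mulrA ler_wpM2l//.
have H1 : nrm (rest (phi nu x)) <= d * expR (- (del / 4 * nrm nu)).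
  apply: nrm_row_le => [|k]; first by rewrite mulr_ge0 ?expR_ge0// ltW.
  rewrite restE; apply: le_trans ((adm_bound tx an).1 _ _) _; first by [].
  by rewrite ler_wpM2r ?expR_ge0// ltW//; exact: tx.
have H2 : nrm (rest (phi nu x)) ^+ M <= (d * expR (- (del / 4 * nrm nu))) ^+ M.
  by apply: lerXn2r; rewrite ?nnegrE ?nrm_ge0// mulr_ge0 ?expR_ge0// ltW.
apply: le_trans H2 _; rewrite exprMn ler_wpM2l ?exprn_ge0 ?(ltW d0)//.
have x0n : 0 < nrm (x 0 ord0) by rewrite nrm_gt0; exact: valid_neq0 vn.
have e1 : nrm (x 0 ord0) = rho * expR (- complex.Re nu).
  by rewrite -vm expRN mulfK// gt_eqF ?expR_gt0.
have -> : (rho ^+ 2)^-1 * nrm (x 0 ord0) ^+ 2 = expR (- (2 * complex.Re nu)).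
  by rewrite e1 exprMn mulKf ?expf_neq0 ?gt_eqF// -expRM_natl mulrN.
rewrite -expRM_natl ler_expR mulrN lerN2.
have h : complex.Re nu <= nrm nu := le_trans (ler_norm _) (nrm_Re _).
have h2 : 2 * nrm nu <= M%:R * (del / 4) * nrm nu by rewrite ler_wpM2r ?nrm_ge0.
by move: h h2; lra.
Qed.

(** A function that is of second order along a hypersurface is differentiable
    there, whatever it is elsewhere. *)
Lemma integral_zero (x : E) : x 0 ord0 = 0 -> nrm x < d -> nrm x < reach ->
  differentiable FI x /\ forall v, 'd FI x v = 0.
Proof.
move=> x0 xd xr.
apply: (@diff_zero R _ _ FI x (KG * d ^+ M / rho ^+ 2) (Num.min d reach - nrm x)).
  by rewrite subr_gt0 lt_min xd.
move=> h hd; have n1 := nrm_triD x h.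
have K0 : 0 <= KG * d ^+ M / rho ^+ 2.
  by rewrite divr_ge0 ?exprn_ge0 ?mulr_ge0 ?exprn_ge0 ?(ltW d0) ?(ltW rho0).
have m1 : Num.min d reach <= d by rewrite ge_min lexx.
have m2 : Num.min d reach <= reach by rewrite ge_min lexx orbT.
have h1 : nrm (x + h) < d by move: n1 hd m1; lra.
have h2 : nrm (x + h) < reach by move: n1 hd m2; lra.
have xh : (x + h) 0 ord0 = h 0 ord0 by rewrite mxE x0 add0r.
have [z|nz] := eqVneq ((x + h) 0 ord0) 0.
  by rewrite /integral_of z eqxx nrm0 mulr_ge0 ?exprn_ge0 ?nrm_ge0.
have [nu vn] := valid_ex nz (le_lt_trans (nrm_coord _ _ _) h2).
apply: le_trans (integral_bound (tame_ball h1) vn) _; rewrite xh ler_wpM2l//.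
by apply: lerXn2r; rewrite ?nnegrE ?nrm_ge0 ?nrm_coord.
Qed.

(** Near x the valid time nu extends to a holomorphic function of the point, by a
    branch of the logarithm; the flow is holomorphic in time and point together. *)
Lemma integral_regular nu (x : E) : nrm x < d -> valid nu x -> differentiable FI x.
Proof.
move=> xd vn; have x0 := valid_neq0 vn; have n0 : 0 < nrm (x 0 ord0) by rewrite nrm_gt0.
pose nuf (y : E) : C := nu + clog (x 0 ord0 / y 0 ord0).
have B1 (y : E) : nrm (y - x) < nrm (x 0 ord0) / 2 ->
    y 0 ord0 != 0 /\ 0 < complex.Re (x 0 ord0 / y 0 ord0).
  move=> yx; have := nrm_coord (y - x) 0 ord0; rewrite !mxE => h.
  have h1 : nrm (x 0 ord0) / 2 < nrm (y 0 ord0).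
    have := nrm_subl (x 0 ord0) (y 0 ord0); rewrite nrmB; lra.
  have yn : 0 < nrm (y 0 ord0) by lra.
  have y0 : y 0 ord0 != 0 by rewrite -nrm_gt0.
  split=> //; apply: Re_near1.
  have -> : x 0 ord0 / y 0 ord0 - 1 = (x 0 ord0 - y 0 ord0) / y 0 ord0 by field.
  by rewrite nrmM nrmV ltr_pdivrMr// mul1r nrmB; lra.
have Dn (y : E) : nrm (y - x) < nrm (x 0 ord0) / 2 -> differentiable nuf y.
  move=> /B1[y0 yR]; apply: differentiableD; first exact: differentiable_cst.
  apply: (@differentiable_comp _ _ _ _ (fun y : E => x 0 ord0 / y 0 ord0) (@clog R)).
    apply: differentiableM; first exact: differentiable_cst.
    by apply: differentiableV => //; exact: differentiable_coord.
  exact: clog_diff.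
have nux : nuf x = nu by rewrite /nuf divff// clog1 addr0.
have hx : nrm (x - x) < nrm (x 0 ord0) / 2 by rewrite subrr nrm0 divr_gt0.
have [e1 e10 H1] := cone_open del0 vn.1.
have e1' : 0 < Num.min e1 1 by rewrite lt_min e10 ltr01.
have [e2 e20 H2] := diff_cont (Dn x hx) e1'; rewrite nux in H2.
pose e := Num.min (nrm (x 0 ord0) / 2) (Num.min e2 (d - nrm x)).
have e0 : 0 < e by rewrite !lt_min divr_gt0//= e20 subr_gt0.
have V (y : E) : nrm (y - x) < e -> [/\ differentiable nuf y, nrm y < d, valid (nuf y) y & nrm (nuf y) <= nrm nu + 1].
  rewrite !lt_min => /andP[h1 /andP[/H2 h2 h3]].
  move: h2; rewrite lt_min => /andP[h2 h4].
  have [y0 yR] := B1 y h1; split; first exact: Dn.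
  - by have := nrm_subl y x; move: h3; lra.
  - split; first exact: H1.
    rewrite cexpD clogK//; apply: etrans vn.2; field; exact: y0.
  by have := nrm_subl (nuf y) nu; move: h4; lra.
have [N0 HN] := adm_good (nrm nu + 1).
have D : differentiable (fun y => phi (nuf y) y) x.
  apply: (flow_holo L0 B0 nfield_lip nfield_bound YD PB (nu := nuf) (xi := id) (z0 := x) (A := nrm nu + 1) (N0 := N0) e0); last by rewrite subrr nrm0.
  move=> y /V[dn yd vy ny]; split=> //; exact: (HN _ _ (tame_ball yd) (valid_adm vy) ny).1.
apply: (@diff_near R _ _ (fun y => G (rest (phi (nuf y) y)))).
  apply/(@nearP R E); exists e => // y /V[_ yd vy _]; apply: esym.
  exact: integral_valid (tame_ball yd) vy.
apply: (@differentiable_comp _ _ _ _ (fun y => rest (phi (nuf y) y)) G); first exact: diff_rest.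
rewrite nux; apply: G_diff; apply: tame_rest; exact: adm_tame (tame_ball xd) (valid_adm vn).
Qed.

(** The point reached at the time t nu arrives at the section after the remaining
    time (1 - t) nu, at the same place. *)
Lemma integral_ray nu (x : E) (t : R) : tame x -> valid nu x -> 0 < t -> t < 1 ->
  FI (phi (toC t * nu) x) = FI x.
Proof.
move=> tx vn t0 t1; have an := valid_adm vn.
have sc (s : R) : 0 < s -> s <= 1 -> adm (toC s * nu) x.
  move=> s0 s1; split; first exact: (cone_scale s0 vn.1).
  apply: le_lt_trans an.2; rewrite ler_wpM2l// ler_wpM2l ?nrm_ge0// ler_expR Re_toCM.
  by rewrite ler_piMl// ltW//; exact: vn.1.1.
have at1 := sc t t0 (ltW t1); have tt := adm_tame tx at1.
have vt : valid (toC (1 - t) * nu) (phi (toC t * nu) x).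
  split; first by apply: cone_scale vn.1; rewrite subr_gt0.
  rewrite (adm_bound tx at1).2 -mulrA -cexpD -mulrDl -toCD subrKC (_ : toC 1 = 1)// mul1r.
  exact: vn.2.
have [N0 HN] := adm_good (nrm (toC (1 - t) * nu)).
have Hg := (HN _ _ tt (valid_adm vt) (lexx _)).1.
have S := @adm_semigroup (toC t * nu) (toC (1 - t) * nu) x N0 tx _ Hg.
apply: (etrans (integral_valid tt vt)); apply: etrans (esym (integral_valid tx vn)).
have e : toC t * nu + toC (1 - t) * nu = nu.
  exact: toC_split.
apply: (congr1 (fun y => G (rest y))); apply: (etrans (S _)); last exact: (congr1 (fun s => phi s x) e).
move=> s s0 s1.
have e2 : toC t * nu + toC s * (toC (1 - t) * nu) = toC (t + s * (1 - t)) * nu.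
  exact: toC_split2.
have [p0 p1] := convex_step s0 s1 t0 t1.
exact: (eq_rect _ (fun w => adm w x) (sc _ p0 p1) _ (esym e2)).
Qed.

(** The integral is constant along the real ray directed by nu, so its derivative
    in the direction nu Y vanishes; complex linearity removes the factor nu, which
    is not 0. *)
Lemma integral_field nu (x : E) : nrm x < d -> valid nu x -> 'd FI x (Y x) = 0.
Proof.
move=> xd vn; have tx := tame_ball xd.
have xr : nrm x <= rho by exact: le_trans (ltW xd) d_rho.
have p4 := pi4_gt0 R.
have z4 : nrm (0 : C) < 4 * pi by rewrite nrm0.
have f0 : phi 0 x = x by apply: (flow0 L0 B0 nfield_lip nfield_bound (N0 := 1)); apply: small_good xr (ltW z4).
have dx : dom (phi 0 x) by exact: small_dom xr (ltW z4).
have := flow_ok_lder L0 B0 nfield_lip nfield_bound YD PB (small_ok xr z4) dx; rewrite f0 => ld.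
have dc : differentiable (fun s : C => phi s x) 0.
  by apply/derivable1_diffP; have /lderP[] := ld.
have dF := integral_regular xd vn.
have dF0 : differentiable FI (phi 0 x) by rewrite f0.
have dcomp := differentiable_comp dc dF0.
have e1 : 'd (fun s : C => phi s x) 0 (1 : C) = Y x := lder_uniq (diff_lder (1 : C) dc) ld.
have e2 : 'd (FI \o (fun s : C => phi s x)) 0 (1 : C) = 'd FI x (Y x).
  have h := congr1 (fun f : C -> C => f 1) (diff_comp dc dF0).
  by apply: (etrans h); rewrite /= e1 f0.
have := lder_scale nu (diff_lder (1 : C) dcomp); rewrite e2 => l2.
have nu0' : nu != 0.
  by apply/eqP => n0; have := vn.1.1; rewrite n0 /= ltxx.
have l3 : lder (FI \o (fun s : C => phi s x)) 0 (nu *: (1 : C)) (nu *: 'd FI x (Y x)) := l2.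
suff z : nrm (nu *: 'd FI x (Y x)) <= 0.
  have : nu *: 'd FI x (Y x) == 0 by rewrite -nrm_eq0 eq_le z nrm_ge0.
  by rewrite scaler_eq0 (negbTE nu0') => /eqP.
apply/ler_addgt0Pr => e e0; rewrite add0r.
have [dd dd0 Hd] := l3 e e0.
pose t := Num.min (dd / 2) (1 / 2).
have t0 : 0 < t by rewrite lt_min !divr_gt0.
have t1 : t < 1 by rewrite gt_min; apply/orP; right; lra.
have td : t < dd by rewrite gt_min; apply/orP; left; move: dd0; lra.
have ht := Hd (toC t); rewrite nrm_toC (gtr0_norm t0) in ht; have {}ht := ht td.
have E1 : (FI \o (fun s : C => phi s x)) (0 + toC t *: (nu *: (1 : C))) = FI x.
  have es : 0 + toC t *: (nu *: (1 : C)) = toC t * nu by rewrite add0r !scaleC mulr1.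
  apply: (etrans (congr1 (fun s : C => FI (phi s x)) es)); exact: integral_ray tx vn t0 t1.
have E0 : (FI \o (fun s : C => phi s x)) 0 = FI x := congr1 FI f0.
rewrite E1 E0 subrr sub0r nrmN nrmZ nrm_toC (gtr0_norm t0) mulrC in ht.
by move: ht; rewrite ler_pM2r.
Qed.

Lemma integral_holomorphic (x : E) : nrm x < Num.min d reach -> differentiable FI x /\ 'd FI x (Y x) = 0.
Proof.
rewrite lt_min => /andP[xd xr]; have [x0|x0] := eqVneq (x 0 ord0) 0.
  by have [D Z] := integral_zero x0 xd xr.
have [nu vn] := valid_ex x0 (le_lt_trans (nrm_coord _ _ _) xr).
split; [exact: integral_regular vn | exact: integral_field vn].
Qed.

Variables (nu : C) (eps : C).
Hypothesis nu_valid : valid nu (cons_row eps 0).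

Definition transport (y : 'rV[C]_m) : 'rV[C]_m := rest (phi nu (cons_row eps y)).

Lemma tame_cons_row (y : 'rV[C]_m) : nrm y < d -> tame (cons_row eps y).
Proof.
move=> yd j; have [k -> _|->] := unliftP ord0 j; last by rewrite eqxx.
by rewrite cons_rowS; exact: le_lt_trans (nrm_coord _ _ _) yd.
Qed.

Lemma transport_valid (y : 'rV[C]_m) : valid nu (cons_row eps y).
Proof. by split; [exact: nu_valid.1 | have := nu_valid.2; rewrite !cons_row0]. Qed.

Lemma transport_adm (y : 'rV[C]_m) : adm nu (cons_row eps y).
Proof. exact: valid_adm (transport_valid y). Qed.

Lemma transport_lt (y : 'rV[C]_m) : nrm y < d -> nrm (transport y) < d.
Proof. by move=> yd; apply: tame_rest; exact: adm_tame (tame_cons_row yd) (transport_adm y). Qed.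

Lemma transport_diff (y : 'rV[C]_m) : nrm y < d -> differentiable transport y.
Proof.
move=> yd; apply: diff_rest; have [N0 HN] := adm_good (nrm nu).
apply: (flow_holo L0 B0 nfield_lip nfield_bound YD PB (nu := fun=> nu) (xi := cons_row eps) (z0 := 0) (A := nrm nu) (N0 := N0) d0); last by rewrite subr0.
move=> w; rewrite subr0 => wd; split.
- exact: differentiable_cst.
- by apply: diff_cons_row; [exact: differentiable_cst | exact: ex_diff].
- exact: lexx.
exact: (HN _ _ (tame_cons_row wd) (transport_adm w) (lexx _)).1.
Qed.

Lemma transport_axis (y : 'rV[C]_m) k : nrm y < d -> y 0 k = 0 -> transport y 0 k = 0.
Proof.
move=> yd yk; have := (adm_bound (tame_cons_row yd) (transport_adm y)).1 (lift ord0 k) isT.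
rewrite cons_rowS yk nrm0 mul0r => H.
by apply/eqP; rewrite -nrm_eq0 eq_le nrm_ge0 restE H.
Qed.

(** Shows that the diagonal differential of the transport at 0 is invertible. *)
Lemma transport_lower (y : 'rV[C]_m) k : nrm y < d ->
  nrm (y 0 k) * expR (- (2 * A * nrm nu)) <= nrm (transport y 0 k).
Proof.
move=> yd; have [N0 HN] := adm_good (nrm nu).
have Hg := (HN _ _ (tame_cons_row yd) (transport_adm y) (lexx _)).1.
by have := flow_lower (lift ord0 k) Hg; rewrite cons_rowS restE.
Qed.

Lemma integral_slice (y : 'rV[C]_m) (v : 'rV[C]_m) : nrm y < d -> differentiable FI (cons_row eps y) ->
  'd FI (cons_row eps y) (cons_row 0 v) = 'd (G \o transport) y v.
Proof.
move=> yd dF.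
have dG : differentiable (G \o transport) y.
  by apply: differentiable_comp; [exact: transport_diff | apply: G_diff; exact: transport_lt].
have l := diff_lder (cons_row 0 v) dF.
apply: esym; apply: (lder_uniq (diff_lder v dG)) => e e0; have [d1 d10 H1] := l e e0.
have n0 : 0 < nrm v + 1 by rewrite ltr_wpDl ?nrm_ge0.
exists (Num.min d1 ((d - nrm y) / (nrm v + 1))) => [|t].
  by rewrite lt_min d10 divr_gt0// subr_gt0.
rewrite lt_min ltr_pdivlMr// => /andP[td td2]; have := H1 t td.
have E1 : cons_row eps y + t *: cons_row 0 v = cons_row eps (y + t *: v).
  by rewrite cons_rowZ mulr0 cons_rowD addr0.
have yt : nrm (y + t *: v) < d.
  apply: le_lt_trans (nrm_triD _ _) _; rewrite nrmZ.
  have : nrm t * nrm v <= nrm t * (nrm v + 1) by rewrite ler_wpM2l ?nrm_ge0// lerDl.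
  by move: td2; lra.
have E2 := integral_valid (tame_cons_row yd) (transport_valid y).
have E3 := integral_valid (tame_cons_row yt) (transport_valid (y + t *: v)).
by rewrite E1 E2 E3.
Qed.

End FirstIntegrals.

Section Combine.
Variable nu0 : C.
Hypothesis nu0_Re : 0 < complex.Re nu0.
Hypothesis nu0_cone : forall j, j != ord0 -> complex.Re (nu0 * a j) <= - (2 * del * nrm nu0).

Let hol_entry (z : 'rV[C]_m) k : nrm z <= rho -> nrm (hol z 0 k) <= nrm (z 0 k) * expR (A * nrm (turn R)).
Proof.
by apply: hol_entry => //; rewrite nrm_turn; have := @pi_gt0 R; lra.
Qed.
Let hol_diff (z : 'rV[C]_m) : nrm z < rho -> differentiable hol z.
Proof.
by apply: hol_diff => //; rewrite nrm_turn; have := @pi_gt0 R; lra.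
Qed.

(** Each return multiplies a coordinate by a bounded factor, so the first N
    returns are defined on a ball smaller by the N-th power of this factor. *)
Lemma hol_iter N (z : 'rV[C]_m) : nrm z < rho / expR (A * nrm (turn R)) ^+ N ->
  forall i, (i <= N)%N -> [/\ differentiable (iter i hol) z,
    forall k, nrm (iter i hol z 0 k) <= expR (A * nrm (turn R)) ^+ N * nrm (z 0 k)
    & nrm (iter i hol z) < rho].
Proof.
set K := expR _; have K1 : 1 <= K by rewrite /K -expR0 ler_expR mulr_ge0 ?nrm_ge0.
have Kp i : 0 < K ^+ i by rewrite exprn_gt0// expR_gt0.
rewrite ltr_pdivlMr// => zr.
have Kmono i : (i <= N)%N -> K ^+ i <= K ^+ N by move=> iN; exact: ler_weXn2l.
suff main i : (i <= N)%N -> differentiable (iter i hol) z /\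
    forall k, nrm (iter i hol z 0 k) <= K ^+ i * nrm (z 0 k).
  have lt i : (i <= N)%N -> nrm (iter i hol z) < rho.
    move=> iN; apply: le_lt_trans zr; apply: nrm_row_le => [|k].
      by rewrite mulr_ge0 ?nrm_ge0// ltW.
    apply: le_trans ((main i iN).2 k) _; rewrite mulrC; apply: ler_pM; rewrite ?nrm_ge0 ?nrm_coord ?Kmono//.
    exact: ltW.
  move=> i iN; have [D B] := main i iN; split=> //; last exact: lt.
  by move=> k; apply: le_trans (B k) _; rewrite ler_wpM2r ?nrm_ge0 ?Kmono.
elim: i => [|i IH] iN.
  split=> [|k]; first by have -> : iter 0 hol = idfun by []; exact: ex_diff.
  by rewrite expr0 mul1r.
have [D B] := IH (ltnW iN).
have ir : nrm (iter i hol z) < rho.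
  apply: le_lt_trans zr; apply: nrm_row_le => [|k]; first by rewrite mulr_ge0 ?nrm_ge0// ltW.
  apply: le_trans (B k) _; rewrite mulrC; apply: ler_pM; rewrite ?nrm_ge0 ?nrm_coord ?Kmono//.
    exact: ltW.
  exact: ltnW.
have Dc : differentiable (hol \o iter i hol) z := differentiable_comp D (hol_diff ir).
split; first exact: Dc.
move=> k; apply: le_trans (hol_entry k (ltW ir)) _.
by rewrite exprSr mulrAC ler_wpM2r ?expR_ge0// (le_trans (B k)).
Qed.

(** The eigenfunctions psi k of the holonomy have powers that are invariant under
    it, and the exponent may be taken large enough for the integrals to be
    holomorphic across x_0 = 0. On a slice x_0 = q these integrals are the powers of
    psi k composed with the transport to the section; the coordinate hyperplanes
    are preserved, so the differentials at 0 of these compositions are diagonal,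
    and [diagonal_independent] takes care of the powers. *)
Lemma coordinate_integrals N : (0 < N)%N -> (\forall z \near (0 : 'rV[C]_m), iter N hol z = z) ->
  exists (F : 'I_m -> E -> C) (b : R), [/\ 0 < b,
    forall i x, nrm x < b -> differentiable (F i) x /\ 'd (F i) x (Y x) = 0
  & forall e : R, 0 < e -> exists2 x, nrm x < e &
      \det (\matrix_(i, j) 'd (F i) x (cons_row 0 (delta_mx 0 j))) != 0].
Proof.
move=> N0 /nearP[d1 d10 per].
set K := expR (A * nrm (turn R)).
have K1 : 1 <= K ^+ N by rewrite exprn_ege1// /K -expR0 ler_expR mulr_ge0 ?nrm_ge0.
have KN0 : 0 < K ^+ N by rewrite exprn_gt0// expR_gt0.
pose d := Num.min d1 (rho / K ^+ N).
have d0 : 0 < d by rewrite lt_min d10 divr_gt0.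
have dr : d <= rho.
  by rewrite ge_min; apply/orP; right; rewrite ler_pdivrMr// ler_peMr// ltW.
have dK z : nrm z < d -> nrm z < rho / K ^+ N by rewrite lt_min => /andP[].
have h_diff i (z : 'rV[C]_m) : (i <= N)%N -> nrm z < d -> differentiable (iter i hol) z.
  by move=> iN /dK zd; have [] := hol_iter zd iN.
have h_entry i (z : 'rV[C]_m) k : (i <= N)%N -> nrm z < d -> nrm (iter i hol z 0 k) <= K ^+ N * nrm (z 0 k).
  by move=> iN /dK zd; have [_ h _] := hol_iter zd iN; exact: h.
have h_per (z : 'rV[C]_m) : nrm z < d -> iter N hol z = z.
  by rewrite lt_min => /andP[zd _]; apply: per; rewrite subr0.
have [p Hp] := archimedes (8 / del).
(* the exponent M.+1 = N p.+1 is a multiple of N, hence kills the multipliers,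
   and is larger than 8 / del, hence satisfies [M_large] *)
pose M := (N * p.+1).-1.
have ME : M.+1 = (N * p.+1)%N by rewrite prednK// muln_gt0 N0.
pose psi := average hol N.
pose G k : 'rV[C]_m -> C := psi k ^+ M.+1.
have GE k z : G k z = psi k z ^+ M.+1 by rewrite /G fctE.
have M_large : 2 <= M.+1%:R * (del / 4).
  have : 8 / del < M.+1%:R.
    by apply: lt_le_trans Hp _; rewrite ME ler_nat leq_pmull.
  rewrite ltr_pdivrMr//; lra.
have G_hol k z : nrm z < d -> G k (hol z) = G k z.
  move=> zd; have Pm : psi k (hol z) = multiplier hol k * psi k z.
    exact: (average_mult N0 d0 h_diff h_entry h_per k zd).
  have Pn : multiplier hol k ^+ N = 1 := multiplierN d0 h_diff h_entry h_per k.
  rewrite (GE k (hol z)) (GE k z) Pm exprMn.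
  by rewrite [X in X * _](_ : _ = 1) ?mul1r// ME exprM Pn expr1n.
have psi_diff k z : nrm z < d -> differentiable (psi k) z.
  exact: (average_diff h_diff).
have G_diff k z : nrm z < d -> differentiable (G k) z.
  by move=> zd; apply: differentiableX; exact: psi_diff.
have G_bound k z : nrm z < d -> nrm (G k z) <= (K ^+ N) ^+ M.+1 * nrm z ^+ M.+1.
  move=> zd; rewrite GE nrmX -exprMn; apply: lerXn2r; rewrite ?nnegrE ?nrm_ge0 ?mulr_ge0 ?nrm_ge0 ?(ltW KN0)//.
  apply: le_trans (average_bound N0 d0 h_diff h_entry h_per k zd) _.
  by rewrite ler_wpM2l ?nrm_coord// ltW.
have KG0 : 0 <= (K ^+ N) ^+ M.+1 by rewrite exprn_ge0// ltW.
pose F k := integral_of (G k).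
pose b := Num.min d (reach).
have b0 : 0 < b by rewrite lt_min d0 reach_gt0.
have Fh k (x : E) : nrm x < b -> differentiable (F k) x /\ 'd (F k) x (Y x) = 0.
  move=> xb; exact: (integral_holomorphic d0 dr (G_hol k) nu0_Re nu0_cone KG0 M_large (G_diff k) (G_bound k) xb).
exists F, b; split=> // e e0.
pose q := Num.min e b / 2.
have m0 : 0 < Num.min e b by rewrite lt_min e0.
have q0 : 0 < q by rewrite divr_gt0.
have qm : q < Num.min e b := half_lt m0.
have [qe qb] : q < e /\ q < b by move: qm; rewrite lt_min => /andP[].
have nq : nrm (toC q : C) = q by rewrite nrm_toC gtr0_norm.
have xq : (cons_row (toC q) 0 : E) 0 ord0 != 0 by rewrite cons_row0 -nrm_gt0 nq.
have xr : nrm ((cons_row (toC q) 0 : E) 0 ord0) < reach.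
  by rewrite cons_row0 nq; move: qb; rewrite lt_min => /andP[].
have [nu vn] := valid_ex nu0_Re nu0_cone xq xr.
pose S := transport nu (toC q).
have S_lt y : nrm y < d -> nrm (S y) < d.
  exact: (transport_lt d0 dr vn).
have S_diff y : nrm y < d -> differentiable S y.
  exact: (transport_diff d0 dr vn).
have S_axis (y : 'rV[C]_m) k : nrm y < d -> y 0 k = 0 -> S y 0 k = 0.
  exact: (transport_axis dr vn).
have S_lower (y : 'rV[C]_m) k : nrm y < d -> nrm (y 0 k) * expR (- (2 * A * nrm nu)) <= nrm (S y 0 k).
  exact: (transport_lower dr vn).
have z0 : nrm (0 : 'rV[C]_m) < d by rewrite nrm0.
have S0 : S 0 = 0 by apply/rowP => k; rewrite S_axis ?mxE.
pose Th k : 'rV[C]_m -> C := psi k \o S.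
have dS0 : differentiable S 0 := S_diff 0 z0.
have Th_diff k y : nrm y < d -> differentiable (Th k) y.
  move=> yd; apply: differentiable_comp; first exact: S_diff.
  by apply: psi_diff; exact: S_lt.
have psi0 k : psi k 0 = 0.
  apply/eqP; rewrite -nrm_eq0 eq_le nrm_ge0 andbT.
  by have := average_bound N0 d0 h_diff h_entry h_per k z0; rewrite mxE nrm0 mulr0.
have Th0 k : Th k 0 = 0 by rewrite /Th /= S0.
pose c k := 'd S 0 (delta_mx 0 k) 0 k.
have S_der k (v : 'rV[C]_m) : 'd S 0 v 0 k = v 0 k * c k.
  rewrite /c -!diff_entryE//.
  by apply: (diff_hyperplane d0) => [|y yd yk]; [exact: diff_entry | exact: S_axis].
have Th_der k (v : 'rV[C]_m) : 'd (Th k) 0 v = v 0 k * c k.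
  have dp : differentiable (psi k) (S 0) by rewrite S0; exact: psi_diff.
  apply: (etrans (congr1 (fun f : 'rV[C]_m -> C => f v) (diff_comp dS0 dp))) => /=.
  by rewrite S0 (average_der N0 d0 h_diff h_entry h_per) S_der.
have c0 k : c k != 0.
  apply/eqP => ck; have w0 : 0 < expR (- (2 * A * nrm nu)) by exact: expR_gt0.
  have l := lder_entry k (diff_lder (delta_mx 0 k) dS0); rewrite -/(c k) ck in l.
  have w2 : 0 < expR (- (2 * A * nrm nu)) / 2 by rewrite divr_gt0.
  have [d2 d20 H2] := l _ w2.
  pose t := Num.min d d2 / 2.
  have t0 : 0 < t by rewrite divr_gt0// lt_min d0.
  have tm : t < Num.min d d2 by apply: half_lt; rewrite lt_min d0.
  have [td td2] : t < d /\ t < d2 by move: tm; rewrite lt_min => /andP[].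
  have nt : nrm (toC t : C) = t by rewrite nrm_toC gtr0_norm.
  have yd : nrm (toC t *: delta_mx 0 k : 'rV[C]_m) < d.
    apply: nrm_row_lt => // i; rewrite !mxE eqxx /= nrmM nt.
    by case: eqP; rewrite ?nrm1 ?nrm0 ?mulr1 ?mulr0.
  have L1 := S_lower _ k yd.
  have E1 : (toC t *: delta_mx 0 k : 'rV[C]_m) 0 k = toC t by rewrite !mxE !eqxx mulr1.
  rewrite E1 nt in L1.
  have := H2 (toC t); rewrite nt => /(_ td2); rewrite add0r S0 scaler0 !subr0 [(0 : 'rV[C]_m) 0 k]mxE subr0.
  have : 0 < t * expR (- (2 * A * nrm nu)) by rewrite mulr_gt0.
  by move: L1; lra.
have [s s0 Hs] : exists2 y, nrm y < Num.min d q & \det (\matrix_(i, j) 'd (Th i ^+ M.+1) y (delta_mx 0 j)) != 0.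
  have dq0 : 0 < Num.min d q by rewrite lt_min d0.
  have Th_diff' k z : nrm z < Num.min d q -> differentiable (Th k) z.
    by rewrite lt_min => /andP[zd _]; exact: Th_diff.
  exact: (diagonal_independent M dq0 Th_diff' Th0 Th_der c0).
move: s0; rewrite lt_min => /andP[sd sq].
have xs (w : R) : q < w -> nrm (cons_row (toC q) s : E) < w.
  by move=> qw; apply: nrm_cons_row_lt; [rewrite nq | exact: lt_trans qw].
exists (cons_row (toC q) s); first exact: xs.
have -> // : (\matrix_(i, j) 'd (F i) (cons_row (toC q) s) (cons_row 0 (delta_mx 0 j))) =
   (\matrix_(i, j) 'd (Th i ^+ M.+1) s (delta_mx 0 j)).
apply/matrixP => i j; apply: (etrans (mxE _ _ i j)); apply: etrans (esym (mxE _ _ i j)).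
have dF := (Fh i _ (xs b qb)).1.
apply: (etrans (integral_slice d0 dr
  (G_hol i) (G_diff i) vn (delta_mx 0 j) sd dF)).
have FE : G i \o S = Th i ^+ M.+1.
  by apply/funext => z; apply: (etrans (GE i (S z))); rewrite fctE.
exact: (congr1 (fun f : 'rV[C]_m -> C => 'd f s (delta_mx 0 j)) FE).
Qed.

End Combine.

Section Realization.
Variables (b : E -> C) (bmin bmax : R) (X Phi Psi : E -> E) (r1 : R).
Hypothesis bmin0 : 0 < bmin.
Hypothesis b_diff : forall y, nrm y < r -> differentiable b y.
Hypothesis b_lower : forall y, nrm y < r -> bmin <= nrm (b y).
Hypothesis b_upper : forall y, nrm y < r -> nrm (b y) <= bmax.
(** The field of the normal form itself; b is the factor that was divided out. *)
Definition field (y : E) : E := b y *: Y y.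
Hypothesis Phi_diff : forall x, nrm x < r1 -> differentiable Phi x.
Hypothesis PsiK : forall x, nrm x < r1 -> Psi (Phi x) = x.
Hypothesis X_diff : forall x, nrm x < r1 -> differentiable X x.
Hypothesis X_neq0 : forall x, nrm x < r1 -> x != 0 -> X x != 0.
Hypothesis X_Phi : forall x, nrm x < r1 -> 'd Phi x (X x) = field (Phi x).
Hypothesis Psi_diff : forall y, nrm y < r -> differentiable Psi y.
Hypothesis PhiK : forall y, nrm y < r -> Phi (Psi y) = y.
Hypothesis Psi_lt : forall y, nrm y < r -> nrm (Psi y) < r1.
Hypothesis Phi0 : Phi 0 = 0.

Local Notation U := (nbhd Phi r r1).
Local Notation S := (axis_curve Phi r r1).

Let bmax0 : 0 <= bmax.
Proof. by apply: le_trans (nrm_ge0 (b 0)) (b_upper _); rewrite nrm0. Qed.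

Lemma b_neq0 y : nrm y < r -> b y != 0.
Proof. by move=> yr; rewrite -nrm_gt0; exact: lt_le_trans bmin0 (b_lower yr). Qed.

Lemma field_diff y : nrm y < r -> differentiable field y.
Proof.
move=> yr; apply: diff_row => j.
have -> : (fun y => field y 0 j) = b * (fun y => Y y 0 j) by apply/funext => z; rewrite /field [LHS]mxE.
by apply: differentiableM; [exact: b_diff | apply: nfield_entry_diff].
Qed.

Lemma field_bound y : nrm y < r -> nrm (field y) <= bmax * (A * r).
Proof.
move=> yr; rewrite nrmZ; apply: ler_pM; rewrite ?nrm_ge0 ?b_upper//.
by apply: nrm_row_le => [|j]; [exact: B0 | apply: nfield_entry_bound].
Qed.

Lemma field_axis (y : E) : nrm y < r -> rest y = 0 -> rest (field y) = 0.
Proof.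
move=> yr y0; apply/rowP => k; rewrite restE [LHS]mxE nfieldE -restE y0.
by rewrite [in LHS]mxE mulr0 mul0r mulr0 mxE.
Qed.

Lemma field_first (y : E) : nrm y < r -> y 0 ord0 != 0 -> field y 0 ord0 != 0.
Proof.
by move=> yr y0; rewrite [field y 0 ord0]mxE nfieldE a0 g0// addr0 mulr1 mul1r mulf_neq0// b_neq0.
Qed.

Lemma rho_r8 : rho < r / 8.
Proof.
apply: le_lt_trans rho_small; rewrite ler_peMr ?(ltW rho0)// -expR0 ler_expR.
by rewrite mulr_ge0// mulr_ge0// pi_ge0.
Qed.

Definition section (z : 'rV[C]_m) : E := Psi (cons_row (toC rho) z).

Let nrm_toCrho : nrm (toC rho : C) = rho. Proof. by rewrite nrm_toC gtr0_norm. Qed.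

Let rhor : rho < r. Proof. exact: lt_trans rho_r8 (r8r r0). Qed.

Lemma section_in z : nrm z < rho -> nrm (cons_row (toC rho) z : E) < r.
Proof. by move=> zr; apply: nrm_cons_row_lt; rewrite ?nrm_toCrho//; exact: lt_trans zr rhor. Qed.

Lemma section_diff z : nrm z < rho -> differentiable section z.
Proof.
move=> zr; have dc : differentiable (fun z => cons_row (toC rho) z : E) z.
  by apply: diff_cons_row; [exact: differentiable_cst | exact: ex_diff].
by apply: (@differentiable_comp _ _ _ _ (fun z => cons_row (toC rho) z : E) Psi) => //; exact: Psi_diff (section_in zr).
Qed.

Lemma section_der (v : 'rV[C]_m) : 'd section 0 v = 'd Psi (cons_row (toC rho) 0) (cons_row 0 v).
Proof.
have z0 : nrm (0 : 'rV[C]_m) < rho by rewrite nrm0.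
apply: (lder_uniq (diff_lder v (section_diff z0))) => e e0.
have [d d0 Hd] := diff_lder (cons_row 0 v) (Psi_diff (section_in z0)) e0.
by exists d => // t /Hd; rewrite cons_rowZ mulr0 cons_rowD addr0.
Qed.

Lemma base_loop0 : base_loop Psi rho 0 = section 0.
Proof. by rewrite /base_loop (_ : toC 0 = 0)// mul0r cexp0 mulr1. Qed.

Lemma section_transverse : transverse_section X (base_loop Psi rho 0) section.
Proof.
have z0 : nrm (0 : 'rV[C]_m) < rho by rewrite nrm0.
have yr := section_in z0.
have inj (v : 'rV[C]_m) : 'd Phi (section 0) ('d section 0 v) = cons_row 0 v.
  rewrite section_der; exact: (@dPhi_dPsi R m Phi Psi r r1).
rewrite base_loop0; split=> //.
- apply/(@nearP R 'rV[C]_m); exists rho => // z; rewrite subr0; exact: section_diff.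
- move=> v w vw; have := inj v; rewrite vw inj => h.
  by have := congr1 (@rest R m) h; rewrite !rest_cons_row => ->.
move=> [v _ vX].
have h := @dPsi_Xt R m X field Phi Psi r r1 Phi_diff PsiK X_Phi Psi_diff PhiK Psi_lt (cons_row (toC rho) 0) yr.
have h2 : 'd Phi (section 0) (X (section 0)) = field (cons_row (toC rho) 0).
  rewrite /section -h; exact: (@dPhi_dPsi R m Phi Psi r r1).
rewrite -vX inj in h2.
have c0 : (cons_row (toC rho) 0 : E) 0 ord0 != 0 by rewrite cons_row0 -nrm_gt0 nrm_toCrho.
by have := field_first yr c0; rewrite -h2 cons_row0 eqxx.
Qed.

(** The inverse is the return map for the opposite turn. *)
Lemma hol_germ : diffeo_germ hol.
Proof.
have p0 := @pi_gt0 R.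
have n4 : nrm (turn R) <= 4 * pi by rewrite nrm_turn; lra.
have n4' : nrm (- turn R) <= 4 * pi by rewrite nrmN.
have c1 : cexp (turn R) = 1 := cexp_2pi R.
have c1' : cexp (- turn R) = 1.
  by apply: (mulIf (cexp_neq0 (turn R))); rewrite -cexpD addNr cexp0 mul1r c1.
have n2 : nrm (turn R) <= 2 * pi by rewrite nrm_turn.
have n2' : nrm (- turn R) <= 2 * pi by rewrite nrmN nrm_turn.
have H0 nu : nrm nu <= 4 * pi -> holomorphic_at (hol_of nu) 0.
  move=> nn; apply/(@nearP R 'rV[C]_m); exists rho => // z; rewrite subr0 => zr.
  exact: hol_diff.
have H1 nu : nrm nu <= 4 * pi -> hol_of nu 0 = 0.
  by move=> nn; exact: hol_of0.
have H2 nu : nrm nu <= 2 * pi -> cexp nu = 1 -> \forall z \near (0 : 'rV[C]_m), hol_of (- nu) (hol_of nu z) = z.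
  move=> nn cn; apply/(@nearP R 'rV[C]_m); exists (rho / expR (A * nrm nu)); first by rewrite divr_gt0 ?expR_gt0.
  move=> z; rewrite subr0 ltr_pdivlMr ?expR_gt0// => zr.
  by apply: hol_inverse => //; exact: ltW.
exists (hol_of (- turn R)); split; first by split; [exact: H0 | exact: H1].
- by split; [exact: H0 | exact: H1].
- exact: H2.
by have := H2 _ n2' c1'; rewrite opprK.
Qed.

(** The leaves through the section, followed along the times from 0 to 2 pi i;
    above the axis this is the base loop. *)
Definition lifted (p : R * 'rV[C]_m) : E := Psi (phi (toC p.1 * turn R) (cons_row (toC rho) p.2)).

Let q_small (z : 'rV[C]_m) : nrm z <= rho -> nrm (cons_row (toC rho) z : E) <= rho.
Proof. by move=> zr; apply: nrm_cons_row_le; rewrite ?nrm_toCrho. Qed.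

Let turn_small (t : R) : `|t| < 2 -> nrm (toC t * turn R) < 4 * pi.
Proof.
move=> t2; rewrite nrmM nrm_toC nrm_turn; have := @pi_gt0 R => p0.
have : `|t| * (2 * pi) < 2 * (2 * pi) by rewrite ltr_pM2r// mulr_gt0.
lra.
Qed.

Lemma lifted_continuous (t : R) (z : 'rV[C]_m) : `|t| < 2 -> nrm z < rho -> {for (t, z), continuous lifted}.
Proof.
move=> t2 zr; pose J (p : R * 'rV[C]_m) : E := (0 + toC p.1 *: cons_row (turn R) 0) + cons_row 0 p.2.
have JE p : J p = cons_row (toC p.1 * turn R) p.2.
  by rewrite /J add0r cons_rowZ scaler0 cons_rowD addr0 add0r.
pose K (w : E) : E := Psi (phi (w 0 ord0) (cons_row (toC rho) (rest w))).
have -> : lifted = K \o J by apply/funext => p; rewrite /K /= JE cons_row0 rest_cons_row.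
have Jc : {for (t, z), continuous J}.
  apply: cvgD.
    apply: (@continuous_comp _ _ _ fst (fun s : R => 0 + toC s *: cons_row (turn R) 0 : E)); first exact: cvg_fst.
    exact: continuous_line.
  apply: (@continuous_comp _ _ _ snd (fun z => cons_row 0 z : E)); first exact: cvg_snd.
  apply: differentiable_continuous.
  by apply: diff_cons_row; [exact: differentiable_cst | exact: ex_diff].
apply: continuous_comp; first exact: Jc.
apply: differentiable_continuous; rewrite JE /=; set w0 := cons_row _ z.
have e0 : 0 < Num.min (4 * pi - nrm (toC t * turn R)) (rho - nrm z).
  by rewrite lt_min !subr_gt0 turn_small.
have B (w : E) : nrm (w - w0) < Num.min (4 * pi - nrm (toC t * turn R)) (rho - nrm z) ->
    nrm (w 0 ord0) <= 4 * pi /\ nrm (rest w) < rho.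
  rewrite lt_min => /andP[h1 h2]; split.
    have := nrm_coord (w - w0) 0 ord0; rewrite [(w - w0) 0 ord0]mxE [(- w0) 0 ord0]mxE cons_row0 => h.
    by have := nrm_subl (w 0 ord0) (toC t * turn R); move: h h1; lra.
  have E1 : rest w - z = rest (w - w0).
    by apply/rowP => k; rewrite !restE [LHS]mxE [RHS]mxE [X in _ = _ + X]mxE [X in _ + X = _]mxE cons_rowS restE.
  have := nrm_rest (w - w0); rewrite -E1; have := nrm_subl (rest w) z; move: h2; lra.
have D : differentiable (fun w : E => phi (w 0 ord0) (cons_row (toC rho) (rest w))) w0.
  apply: (flow_holo L0 B0 nfield_lip nfield_bound YD PB (nu := fun w : E => w 0 ord0) (z0 := w0) (A := 4 * pi) (N0 := 1) e0); last by rewrite subrr nrm0.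
  move=> w /B[w1 w2]; split.
  - exact: differentiable_coord.
  - by apply: diff_cons_row; [exact: differentiable_cst | apply: diff_rest; exact: ex_diff].
  - exact: w1.
  by apply: small_good w1; apply: q_small; exact: ltW.
apply: (@differentiable_comp _ _ _ _ (fun w : E => phi (w 0 ord0) (cons_row (toC rho) (rest w))) Psi); first exact: D.
apply: Psi_diff; apply: lt_trans (r8r r0); apply: small_dom.
  by apply: q_small; rewrite rest_cons_row ltW.
by rewrite cons_row0 ltW// turn_small.
Qed.

(** In the flow of [nfield] the path runs along the segment of complex time from 0
    to 2 pi i. Leafwise paths are however parametrized by trajectories of X
    itself, whose clock is obtained from [complex_clock], b being the ratio of
    the two fields. *)
Lemma lifted_leafwise (z : 'rV[C]_m) : nrm z < rho -> leafwise_path X U (fun t => lifted (t, z)).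
Proof.
move=> zr t0; rewrite in_itv /= => /andP[t00 t01].
have qr := q_small (ltW zr); set q := cons_row (toC rho) z in qr.
pose gam t := phi (toC t * turn R) q.
have t2 t : `|t - t0| < 1 -> `|t| < 2 by rewrite !ltr_norml; lra.
have gamP t : `|t - t0| < 1 -> nrm (gam t) < r / 8.
  by move=> /t2/turn_small tt; exact: small_dom qr (ltW tt).
have gamr t : `|t - t0| < 1 -> nrm (gam t) < r by move=> /gamP h; exact: lt_trans h (r8r r0).
have gam_der0 t : `|t - t0| < 1 -> rder gam t (turn R *: Y (gam t)).
  move=> tt; have ts := turn_small (t2 t tt).
  have l := flow_ok_lder L0 B0 nfield_lip nfield_bound YD PB (small_ok qr ts) (small_dom qr (ltW ts)).
  have l2 := lder_scale (turn R) l.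
  have e1 : turn R *: (1 : C) = turn R by rewrite scaleC mulr1.
  have e2 s : 0 + toC s *: turn R = toC s * turn R by rewrite add0r scaleC.
  have gE : gam = (fun s => phi (0 + toC s *: turn R) q).
    by apply/funext => s; exact: (congr1 (fun u => phi u q) (esym (e2 s))).
  have l3 := eq_rect _ (fun w => lder (fun s => phi s q) _ w (turn R *: Y (gam t))) l2 _ e1.
  have l4 := eq_rect _ (fun w => lder (fun s => phi s q) w (turn R) (turn R *: Y (gam t))) l3 _ (esym (e2 t)).
  exact: (eq_rect _ (fun f => rder f t (turn R *: Y (gam t))) (lder_rder l4) _ (esym gE)).
pose beta t := turn R / b (gam t).
have gam_der t : `|t - t0| < 1 -> rder gam t (beta t *: field (gam t)).
  move=> tt; have bn := b_neq0 (gamr t tt).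
  have -> : beta t *: field (gam t) = turn R *: Y (gam t); last exact: gam_der0.
  by rewrite /field scalerA /beta divfK.
have beta_cont t : `|t - t0| < 1 -> rcont beta t.
  move=> tt e e0; have bn := b_neq0 (gamr t tt).
  have dB : differentiable (fun y : E => turn R / b y) (gam t).
    apply: differentiableM; first exact: differentiable_cst.
    by apply: differentiableV => //; exact: b_diff (gamr t tt).
  have [d d0 Hd] := diff_cont dB e0.
  have d2 : 0 < d / 2 by rewrite divr_gt0.
  have [d' d'0 Hd'] := rder_near_cont (gam_der t tt) d2.
  exists d' => // s /Hd' h; apply: ltW; apply: Hd; move: h d0; lra.
have K0 : 0 <= 2 * pi / bmin by rewrite divr_ge0 ?mulr_ge0 ?pi_ge0// ltW.
have beta_bound t : `|t - t0| < 1 -> nrm (beta t) <= 2 * pi / bmin.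
  move=> tt; rewrite /beta nrmM nrmV nrm_turn ler_wpM2l ?mulr_ge0 ?pi_ge0//.
  by rewrite lef_pV2 ?posrE ?b_lower ?gamr//; exact: lt_le_trans bmin0 (b_lower (gamr t tt)).
have BZ0 : 0 <= bmax * (A * r) by rewrite mulr_ge0.
have LZ0 : 0 <= 8 * (bmax * (A * r)) / r by rewrite divr_ge0 ?mulr_ge0// ltW.
have ZL := lipschitz_inner r0 BZ0 field_diff field_bound.
have ZB (x : E) : nrm x < r / 8 -> nrm (field x) <= bmax * (A * r).
  by move=> xr; apply: field_bound; exact: lt_trans xr (r8r r0).
have ZD (x : E) : nrm x < r / 8 -> differentiable field x.
  by move=> xr; apply: field_diff; exact: lt_trans xr (r8r r0).
have [rT [e [tau [rT0 [e0 tau0] prT tau_der clock]]]] :=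
  complex_clock LZ0 BZ0 ZL ZB ZD ltr01 K0 gamP gam_der beta_cont beta_bound.
set p := gam t0 in prT clock.
have st (s : C) : nrm s < rT -> nrm p + bmax * (A * r) * nrm s < r / 8.
  by move=> sr; apply: le_lt_trans prT; rewrite lerD2l ler_wpM2l// ltW.
exists (toC rT), (fun s => Psi (flow field s p)), e, tau; split.
- by split=> //; rewrite (_ : 0 = toC 0)// toC_lt.
- have f0 : flow field 0 p = p.
    apply: (flow0 LZ0 BZ0 ZL ZB (N0 := 1)); apply: (bounded_good BZ0 ZB).
    by apply: st; rewrite nrm0.
  exact: (congr1 Psi f0).
- move=> s0 /ball0P/st/(short_time LZ0 BZ0 ZL ZB ZD); move: (s0 : C) => s [_ Ps ls].
  split; first by apply: (@nbhd_Psi R m Phi Psi r r1).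
  have Pr : nrm (flow field s p) < r := lt_trans Ps (r8r r0).
  apply/lderP.
  have dc : differentiable (fun s : C => flow field s p) s by apply/derivable1_diffP; have /lderP[] := ls.
  have dP := Psi_diff Pr.
  have e1 := lder_uniq (diff_lder (1 : C) dc) ls.
  have h := congr1 (fun f : C -> E => f 1) (diff_comp dc dP).
  have h2 := @dPsi_Xt R m X field Phi Psi r r1 Phi_diff PsiK X_Phi Psi_diff PhiK Psi_lt _ Pr.
  have h3 : 'd (Psi \o (fun s : C => flow field s p)) s (1 : C) = X (Psi (flow field s p)).
    by apply: (etrans h); apply: etrans h2; exact: (congr1 ('d Psi (flow field s p)) e1).
  exact: (eq_rect _ (fun l => lder (Psi \o (fun s : C => flow field s p)) s (1 : C) l)
    (diff_lder (1 : C) (differentiable_comp dc dP)) _ h3).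
- split=> //; apply: within_for => t [_]; rewrite -ball_normE /= distrC => te.
  have [l tl] := tau_der t te.
  apply: continuous_RV => d d0; have d2 : 0 < d / 2 by rewrite divr_gt0.
  have [d' d'0 Hd'] := rder_near_cont tl d2; exists d' => // s sd.
  have := Hd' (s - t) sd; rewrite subrKC; move: d0; lra.
move=> t _; rewrite -ball_normE /= distrC => te; have [c1 c2] := clock t te.
split; first exact/ball0P.
exact: (congr1 Psi c2).
Qed.

Lemma lifted_holonomy : holonomy_along X U (base_loop Psi rho) section hol.
Proof.
have p0 := @pi_gt0 R.
split; first exact: hol_germ.
have z0 : nrm (0 : 'rV[C]_m) < rho by rewrite nrm0.
have n4 : nrm (turn R) <= 4 * pi by rewrite nrm_turn; lra.
exists [set z | nrm (z - 0) < rho], lifted; split.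
- by split; [exact: open_ball_nrm | rewrite /= subrr nrm0].
- apply: within_for => -[t z] [/= tI]; rewrite subr0 => zr; apply: lifted_continuous => //.
  by move: tI; rewrite in_itv /= ltr_norml; lra.
- move=> t; rewrite in_itv /= => /andP[t0 t1].
  have tt : nrm (toC t * turn R) <= 4 * pi by apply: ltW; apply: turn_small; rewrite ltr_norml; lra.
  have Hg := small_good (q_small (ltW z0)) tt.
  apply: (congr1 Psi); apply: rowE0.
    by rewrite (flow_first Hg) !cons_row0.
  apply/rowP => k; rewrite rest_cons_row restE; have := flow_upper (lift ord0 k) Hg.
  rewrite cons_rowS [X in nrm X * _]mxE nrm0 mul0r => h.
  by rewrite [RHS]mxE; apply/eqP; rewrite -nrm_eq0 eq_le h nrm_ge0.
- move=> z; rewrite /= subr0 => zr; split.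
    have e : toC 0 * turn R = 0 by rewrite (_ : toC 0 = 0)// mul0r.
    have f0 : phi 0 (cons_row (toC rho) z) = cons_row (toC rho) z.
      apply: (flow0 L0 B0 nfield_lip nfield_bound (N0 := 1)); apply: small_good; first exact: q_small (ltW zr).
      by rewrite nrm0 mulr_ge0// ltW.
    by apply: (congr1 Psi); apply: etrans f0; exact: (congr1 (fun u => phi u (cons_row (toC rho) z)) e).
  have e : toC 1 * turn R = turn R by rewrite (_ : toC 1 = 1)// mul1r.
  have f1 := hol_flow (ltW zr) n4 (cexp_2pi R).
  by apply: (congr1 Psi); apply: etrans f1; exact: (congr1 (fun u => phi u (cons_row (toC rho) z)) e).
by move=> z; rewrite /= subr0 => zr; exact: lifted_leafwise.
Qed.

Theorem holonomy_realized : separatrix_holonomy X U S hol.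
Proof.
split.
- exact: (curve_separatrix r0 Phi_diff PsiK X_diff X_neq0 X_Phi Psi_diff PhiK Psi_lt Phi0 field_axis).
- exact: (curve_disc r0 Phi_diff PsiK Psi_diff PhiK Psi_lt Phi0).
exists (base_loop Psi rho), section; split.
- exact: (base_generates r0 Phi_diff PsiK Psi_diff PhiK Psi_lt Phi0 rho0 rho_r8).
- exact: section_transverse.
exact: lifted_holonomy.
Qed.

End Realization.

End NormalForm.

(** * The foliation in the original coordinates *)

Section Assembly.
Variables (R : realType) (m : nat).
Local Notation C := (Cx R).
Local Notation E := 'rV[C]_m.+1.

(** A direction of complex time in which the eigenvalue of index 0 expands and
    all others contract: rotate the separating line to the imaginary axis. *)
Lemma separating_direction (lambda : 'I_m.+1 -> C) : (forall i, lambda i != 0) ->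
  line_separates_first lambda -> exists (nu0 : C) (del : R), [/\ 0 < del, 0 < complex.Re nu0
  & forall j, j != ord0 -> complex.Re (nu0 * (lambda j / lambda ord0)) <= - (2 * del * nrm nu0)].
Proof.
move=> l0 [w [w0 W0 Wj]]; pose kap : C := - Ci R * w^*.
have Rk j : complex.Re (kap * lambda j) = complex.Im (lambda j * w^* : C).
  have -> : kap * lambda j = - Ci R * (lambda j * w^*) by rewrite /kap; ring.
  by rewrite Re_mul ReN ImN /= oppr0 mul0r sub0r mulN1r opprK.
have P0 : 0 < complex.Im (lambda ord0 * w^* : C) by rewrite -toC_lt; move: W0; rewrite -complexIm.
have Pj j : j != ord0 -> complex.Im (lambda j * w^* : C) < 0.
  by move=> j0; rewrite -toC_lt; move: (Wj j j0); rewrite -complexIm.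
pose nu0 := kap * lambda ord0.
have nE j : nu0 * (lambda j / lambda ord0) = kap * lambda j by rewrite /nu0; field; exact: l0.
have n1 : 0 < 2 * nrm nu0 + 1 by rewrite ltr_wpDl// mulr_ge0 ?nrm_ge0.
pose d (j : 'I_m.+1) : R := if j == ord0 then 1 else - complex.Im (lambda j * w^* : C) / (2 * nrm nu0 + 1).
have dp j : 0 < d j by rewrite /d; case: eqVneq => // j0; rewrite divr_gt0// oppr_gt0 Pj.
have [e e0 He] := finite_lower_bound dp.
exists nu0, e; split=> //; first by rewrite Rk.
move=> j j0; rewrite nE Rk; have := He j; rewrite /d (negbTE j0) ler_pdivlMr//.
have := nrm_ge0 nu0; lra.
Qed.

Lemma near0I (P Q : E -> Prop) : (\forall x \near (0 : E), P x) -> (\forall x \near (0 : E), Q x) ->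
  \forall x \near (0 : E), P x /\ Q x.
Proof. by move=> HP HQ; exact: filterI HP HQ. Qed.

Lemma near_small (q : E -> C) (e : R) : 0 < e -> differentiable q 0 -> q 0 = 0 ->
  \forall y \near (0 : E), nrm (q y) <= e.
Proof.
move=> e0 dq q0; have [d d0 Hd] := diff_cont dq e0; apply/(@nearP R E); exists d => // y /Hd.
by rewrite q0 subr0 => /ltW.
Qed.

(** In dimension one no integral is asked for, and the empty determinant is 1. *)
Lemma no_integral_needed (X : E -> E) : m = 0%N -> exists f : 'I_m -> E -> C, independent_first_integrals X f.
Proof.
move=> m0; exists (fun _ _ => 0); split; first by move=> [i im]; exfalso; move: im; rewrite m0.
move=> /nbhs_singleton/(_ (fun=> 0)); rewrite /wedge_differentials.
move: (\matrix_(_, _) _); rewrite m0 => B; rewrite det_mx00 => /eqP; by rewrite oner_eq0.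
Qed.

Lemma section_radius (A r : R) : 0 < r -> exists rho : R, 0 < rho /\ rho * expR (A * (4 * pi)) < r / 8.
Proof.
move=> r0; exists (r / 16 / expR (A * (4 * pi))); rewrite divfK ?gt_eqF ?expR_gt0//.
by split; [rewrite !divr_gt0 ?expR_gt0 | lra].
Qed.

(** The hypotheses hold on various neighbourhoods of the origin. Once a common
    radius is found, the hypothesis on separatrices is applied to the axis of the
    normal form, and the integrals found there are composed with the change of
    coordinates. *)
Theorem siegel_first_integrals (X : E -> E) (lambda : 'I_m.+1 -> C) : (0 < m)%N ->
  holomorphic_at X 0 -> isolated_singularity X ->
  (forall i, lambda i != 0) -> line_separates_first lambda ->
  normal_form_up_to_coordinates X lambda ->
  (forall (U S : set E) (h : 'rV[C]_m -> 'rV[C]_m),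
      separatrix_holonomy X U S h -> finite_orbits_and_isolated_fixed_points h) ->
  exists f : 'I_m -> E -> C, independent_first_integrals X f.
Proof.
move=> m0 hX [X0 iX] l0 sep [Phi [f [[Psi [[hPhi Phi0] [hPsi Psi00] PsiPhi PhiPsi]] hf hXt]]] hol_fin.
have [nu0 [del [del0 nu0_Re nu0_cone]]] := separating_direction l0 sep.
pose a j := lambda j / lambda ord0.
have a0 : a ord0 = 1 by rewrite /a divff.
pose A : R := \sum_j 2 * nrm (a j).
have aA j : 2 * nrm (a j) <= A.
  rewrite /A (bigD1 j)//= lerDl; apply: sumr_ge0 => i _; exact: mulr_ge0 (nrm_ge0 _).
have A0 : 0 <= A by apply: le_trans (aA ord0); rewrite mulr_ge0 ?nrm_ge0.
have A1 : 0 < A + 1 by rewrite ltr_wpDl.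
(* the perturbations g may consume half of the contraction rate del *)
pose eta : R := Num.min 1 (del / (A + 1)).
have eta0 : 0 < eta by rewrite lt_min ltr01 divr_gt0.
have eta1 : eta <= 1 by rewrite ge_min lexx.
have a_eta j : nrm (a j) * eta <= del / 2.
  have h : eta <= del / (A + 1) by rewrite ge_min lexx orbT.
  rewrite ler_pdivlMr// in h.
  have := aA j; have := nrm_ge0 (a j) => h1 h2.
  have : 2 * nrm (a j) * eta <= A * eta by rewrite ler_wpM2r// ltW.
  by move: h eta0; lra.
pose g j y : C := (1 + f j y) / (1 + f ord0 y) - 1.
pose b y : C := lambda ord0 * (1 + f ord0 y).
have f_diff : \forall y \near (0 : E), forall j, differentiable (f j) y.
  by apply: near_forall => j; exact: (hf j).1.
have f0 j : f j 0 = 0 := (hf j).2.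
have f_small : \forall y \near (0 : E), nrm (f ord0 y) <= 1 / 2.
  apply: near_small; [lra | exact: (nbhs_singleton f_diff) | exact: f0].
have half_neq0 (u : C) : nrm u <= 1 / 2 -> 1 + u != 0.
  move=> u1; rewrite -nrm_gt0; have := nrm_subl (1 : C) (- u); rewrite opprK nrmN nrm1; lra.
have g_diff0 (y : E) j : (forall j, differentiable (f j) y) -> nrm (f ord0 y) <= 1 / 2 -> differentiable (g j) y.
  move=> fd fy; apply: differentiableD; last exact: differentiable_cst.
  apply: differentiableM; first by apply: differentiableD; [exact: differentiable_cst | exact: fd].
  apply: differentiableV; last exact: half_neq0.
  by apply: differentiableD; [exact: differentiable_cst | exact: fd].
have g_small : \forall y \near (0 : E), forall j, nrm (g j y) <= eta.
  apply: near_forall => j; apply: (near_small eta0).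
    by apply: g_diff0; [exact: (nbhs_singleton f_diff) | exact: (nbhs_singleton f_small)].
  by rewrite /g !f0 addr0 divff ?oner_eq0// subrr.
have /(@nearP R E)[rf rf0 Hf] := near0I (near0I f_diff f_small) g_small.
have sub0 (y : E) (e : R) : nrm y < e -> nrm (y - 0) < e by rewrite subr0.
have fs (y : E) : nrm y < rf -> nrm (f ord0 y) <= 1 / 2 by move=> /sub0/Hf[[]].
have fd (y : E) : nrm y < rf -> forall j, differentiable (f j) y by move=> /sub0/Hf[[]].
have Phi_small : \forall x \near (0 : E), nrm (Phi x) < rf.
  have [d d0 Hd] := diff_cont (nbhs_singleton hPhi) rf0; apply/(@nearP R E); exists d => // x /Hd.
  by rewrite Phi0 subr0.
have Xn : \forall x \near (0 : E), x != 0 -> X x != 0 := iX.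
have /(@nearP R E)[rx rx0 Hx] := near0I (near0I (near0I hPhi PsiPhi) (near0I hX hXt)) (near0I Phi_small Xn).
have Psi_small : \forall y \near (0 : E), nrm (Psi y) < rx.
  have [d d0 Hd] := diff_cont (nbhs_singleton hPsi) rx0; apply/(@nearP R E); exists d => // y /Hd.
  by rewrite Psi00 subr0.
have /(@nearP R E)[ry ry0 Hy] := near0I (near0I hPsi PhiPsi) Psi_small.
pose r := Num.min rf ry; have r0 : 0 < r by rewrite lt_min rf0.
have rrf (y : E) : nrm y < r -> nrm y < rf by rewrite lt_min => /andP[].
have rry (y : E) : nrm y < r -> nrm (y - 0) < ry by rewrite subr0 lt_min => /andP[].
have Phi_diff (x : E) : nrm x < rx -> differentiable Phi x by move=> /sub0/Hx[[[]]].
have PsiK (x : E) : nrm x < rx -> Psi (Phi x) = x by move=> /sub0/Hx[[[]]].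
have X_diff (x : E) : nrm x < rx -> differentiable X x by move=> /sub0/Hx[[_ []]].
have X_neq0 (x : E) : nrm x < rx -> x != 0 -> X x != 0 by move=> /sub0/Hx[_ []].
have Psi_diff (y : E) : nrm y < r -> differentiable Psi y by move=> /rry/Hy[[]].
have PhiK (y : E) : nrm y < r -> Phi (Psi y) = y by move=> /rry/Hy[[]].
have Psi_lt (y : E) : nrm y < r -> nrm (Psi y) < rx by move=> /rry/Hy[_].
have gs j (y : E) : nrm y < r -> nrm (g j y) <= eta by move=> /rrf/sub0/Hf[_]; exact.
have gd j (y : E) : nrm y < r -> differentiable (g j) y.
  by move=> /rrf yr; apply: g_diff0; [exact: fd | exact: fs].
have g0 (y : E) : nrm y < r -> g ord0 y = 0.
  by move=> /rrf yr; rewrite /g divff ?subrr// half_neq0// fs.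
have ln : 0 < nrm (lambda ord0) by rewrite nrm_gt0.
have b_diff (y : E) : nrm y < r -> differentiable b y.
  move=> /rrf yr; apply: differentiableM; first exact: differentiable_cst.
  by apply: differentiableD; [exact: differentiable_cst | exact: fd].
have bmin0 : 0 < nrm (lambda ord0) / 2 by rewrite divr_gt0.
have half_lower (u : C) : nrm u <= 1 / 2 -> 2^-1 <= nrm (1 + u).
  by have := nrm_subl (1 : C) (- u); rewrite opprK nrmN nrm1; lra.
have half_upper (u : C) : nrm u <= 1 / 2 -> nrm (1 + u) <= 2.
  by have := nrm_triD (1 : C) u; rewrite nrm1; lra.
have b_lower (y : E) : nrm y < r -> nrm (lambda ord0) / 2 <= nrm (b y).
  by move=> /rrf/fs/half_lower fy; rewrite nrmM ler_pM2l.
have b_upper (y : E) : nrm y < r -> nrm (b y) <= nrm (lambda ord0) * 2.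
  by move=> /rrf/fs/half_upper fy; rewrite nrmM ler_pM2l.
have fieldE (y : E) : nrm y < rf -> field a g b y = \row_i (lambda i * y 0 i * (1 + f i y)).
  move=> yr; apply/rowP => i; rewrite [LHS]mxE nfieldE [RHS]mxE /a /b /g.
  by field; rewrite l0 half_neq0 ?fs.
have X_Phi (x : E) : nrm x < rx -> 'd Phi x (X x) = field a g b (Phi x).
  by move=> /sub0/Hx[[_ [_ E1]] [Pr _]]; rewrite E1 fieldE.
have [rho [rho0 rho_small]] := section_radius A r0.
have SH := holonomy_realized r0 a0 g0 gd gs eta1 aA rho0 rho_small bmin0 b_diff b_lower b_upper
  Phi_diff PsiK X_diff X_neq0 X_Phi Psi_diff PhiK Psi_lt Phi0.
have [k [V [dom fin iso]]] := hol_fin _ _ _ SH.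
have [N N0 per] := finite_orbits_periodic m0 dom fin iso.
have [F [q [q0 Fq indep]]] := coordinate_integrals r0 a0 g0 gd gs eta1 aA del0 a_eta rho0 rho_small
  nu0_Re nu0_cone N0 per.
have Fx i (x : E) : nrm x < rx -> nrm (Phi x) < q ->
    differentiable (F i \o Phi) x /\ forall v, 'd (F i \o Phi) x v = 'd (F i) (Phi x) ('d Phi x v).
  move=> xr Pq; have dF := (Fq i _ Pq).1; have dP := Phi_diff x xr.
  split=> [|v]; first exact: (differentiable_comp dP dF).
  exact: (congr1 (fun f : E -> C => f v) (diff_comp dP dF)).
have Phi_q : \forall x \near (0 : E), nrm (Phi x) < q.
  have [d d0 Hd] := diff_cont (nbhs_singleton hPhi) q0; apply/(@nearP R E); exists d => // x /Hd.
  by rewrite Phi0 subr0.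
have /(@nearP R E)[rq rq0 Hq] := Phi_q.
have small (x : E) : nrm (x - 0) < Num.min rx rq -> nrm x < rx /\ nrm (Phi x) < q.
  by rewrite lt_min => /andP[h1 h2]; split; [rewrite -[x]subr0 | exact: Hq].
have rm : 0 < Num.min rx rq by rewrite lt_min rx0.
exists (fun i => F i \o Phi); split.
  move=> i; split; apply/(@nearP R E); exists (Num.min rx rq) => // x /small[xr Pq].
    exact: (Fx i x xr Pq).1.
  rewrite (Fx i x xr Pq).2 X_Phi// /field linearZ /=.
  by apply: (etrans (congr1 (fun u : C => _ *: u) (Fq i _ Pq).2)); rewrite scaler0.
move=> /(@nearP R E)[d d0 Hd].
have Psi_d : \forall y \near (0 : E), nrm (Psi y) < d.
  have [d' d'0 Hd'] := diff_cont (nbhs_singleton hPsi) d0; apply/(@nearP R E); exists d' => // y /Hd'.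
  by rewrite Psi00 subr0.
have /(@nearP R E)[rd rd0 Hrd] := Psi_d.
have e1 : 0 < Num.min r q by rewrite lt_min r0.
have e0 : 0 < Num.min rd (Num.min r q) by rewrite lt_min rd0 e1.
have [y ye /negP[]] := indep _ e0; apply/eqP.
move: ye; rewrite lt_min => /andP[yd]; rewrite lt_min => /andP[yr yq].
have Px : nrm (Psi y - 0) < d by rewrite subr0; apply: Hrd; rewrite subr0.
apply: etrans (Hd (Psi y) Px (fun j => 'd Psi y (cons_row 0 (delta_mx 0 j)))).
rewrite /wedge_differentials; congr (\det _); apply/matrixP => i j.
apply: (etrans (mxE _ _ i j)); apply: etrans (esym (mxE _ _ i j)); apply: esym.
have Pq : nrm (Phi (Psi y)) < q by rewrite PhiK.
apply: (etrans ((Fx i (Psi y) (Psi_lt y yr) Pq).2 _)).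
have h := dPhi_dPsi Phi_diff Psi_diff PhiK Psi_lt (cons_row 0 (delta_mx 0 j)) yr.
apply: (etrans (congr1 ('d (F i) (Phi (Psi y))) h)).
exact: (congr1 (fun u : E => 'd (F i) u (cons_row 0 (delta_mx 0 j))) (PhiK y yr)).
Qed.

End Assembly.

Unset Implicit Arguments.
Set Strict Implicit.
Set Printing Implicit Defensive.

Theorem theoremB (R : realType) (m : nat)
    (X : 'rV[Cx R]_m.+1 -> 'rV[Cx R]_m.+1) (lambda : 'I_m.+1 -> Cx R)
    (X_holomorphic : holomorphic_at X 0)
    (X_isolated : isolated_singularity X)
    (lambda_eigenvalues :
      char_poly ('J X 0) = \prod_(i < m.+1) ('X - (lambda i)%:P))
    (hyp_i : \det ('J X 0) != 0 /\ in_Siegel_domain lambda)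
    (hyp_ii : (forall i, lambda i != 0) /\ line_separates_first lambda)
    (hyp_iii : normal_form_up_to_coordinates X lambda)
    (hyp_iv : forall (U S : set 'rV[Cx R]_m.+1) (h : 'rV[Cx R]_m -> 'rV[Cx R]_m),
      separatrix_holonomy X U S h -> finite_orbits_and_isolated_fixed_points h) :
  exists f : 'I_m -> 'rV[Cx R]_m.+1 -> Cx R, independent_first_integrals X f.
Proof.
have [l0 sep] := hyp_ii.
have [m0|m0] := posnP m; first exact: (@no_integral_needed R m X m0).
exact: (siegel_first_integrals m0 X_holomorphic X_isolated l0 sep hyp_iii hyp_iv).
Qed.
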